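(* Let $d\in\mathbb N$, $m>0$, $p>d$ and $M>0$. Then $$(\Omega_p,\Lambda,\mathcal M,\Xi)\in\Delta_2^{A},\qquad (\Omega_{p,M},\Lambda,\mathcal M,\Xi)\in\Pi_1^{A}.$$
   Context: **The problems.** $\Omega_{p,M}$ is the set of real-valued $V\in W^{1,p}(\mathbb R^d)$ with $\|V\|_{W^{1,p}(\mathbb R^d)}\le M$ and $|V(x)|\le M(1+|x|^2)^{-1/2}$ for all $x\in\mathbb R^d$; $\Omega_p:=\bigcup_{M>0}\Omega_{p,M}$; $\Lambda:=\{V\mapsto V(x)\,|\,x\in\mathbb Q^d\}$ (continuous representatives); $\mathcal M:=(\mathrm{cl}(\mathbb C),d_{\mathrm H})$ is the set of closed subsets of $\mathbb C$ with the Hausdorff distance $d_{\mathrm H}$; $\Xi(V):=\sigma(T_V)$ (restricted to $\Omega_{p,M}$ in the second problem). Here $T_V(\lambda):=H_0-(V-\lambda)^2$, $\operatorname{dom}T_V(\lambda)=\operatorname{dom}H_0$, $H_0:=-\Delta+m^2$ in $L^2(\mathbb R^d)$ with domain $H^2(\mathbb R^d)$, and $\sigma(T_V)$ is the set of $\lambda\in\mathbb C$ for which $T_V(\lambda)$ is not boundedly invertible. **Algorithms.** A computational problem $(\Omega,\Lambda,\mathcal M,\Xi)$ consists of a set $\Omega$, a set $\Lambda$ of complex-valued functions on $\Omega$, a metric space $\mathcal M$ and a map $\Xi:\Omega\to\mathcal M$. A general algorithm is a map $\Gamma:\Omega\to\mathcal M$ such that for each $T\in\Omega$ there is a finite non-empty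 $\Lambda_\Gamma(T)\subset\Lambda$ such that $\Gamma(T)$ depends only on $\{f(T)\}_{f\in\Lambda_\Gamma(T)}$, and for every $S\in\Omega$ with $f(S)=f(T)$ for all $f\in\Lambda_\Gamma(T)$ one has $\Lambda_\Gamma(S)=\Lambda_\Gamma(T)$. An arithmetic tower of height $1$ (with $\Lambda$ countable) is a sequence of general algorithms $(\Gamma_n)_{n\in\mathbb N}$ with $\lim_{n\to\infty}\Gamma_n(T)=\Xi(T)$ in $\mathcal M$ for all $T\in\Omega$, such that for each $T$ the map $n\mapsto\Gamma_n(\{f(T)\}_{f\in\Lambda_{\Gamma_n}(T)})$ can be executed by a Blum-Shub-Smale machine with input $n$ and an oracle that can access $f(T)$ for any $f\in\Lambda$, and $\Gamma_n(T)$ is a finite string of complex numbers that can be identified with an element of $\mathcal M$. **Classes.** $(\Omega,\Lambda,\mathcal M,\Xi)\in\Delta_2^A$ means that its Solvability Complexity Index with respect to arithmetic towers is at most $1$, i.e. there is an arithmetic tower of height $1$ for it. $(\Omega,\Lambda,\mathcal M,\Xi)\in\Pi_1^A$ means that it is in $\Delta_2^A$ and there is an arithmetic tower $(\Gamma_n)$ of height $1$ such that for every $T\in\Omega$ there are $X_n(T)\in\mathcal M$, $n\in\mathbb N$, with $\Xi(T)\subset X_n(T)$ and $d_{\mathrm H}(X_n(T),\Gamma_n(T))\le n^{-1}$ for all $n\in\mathbb N$. *)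

(* Defs.v *)
From HB Require Import structures.
From mathcomp Require Import all_boot all_order all_algebra.
From mathcomp Require Import all_classical all_reals all_analysis.
From mathcomp Require Import complex.
Import Order.TTheory GRing.Theory Num.Theory numFieldNormedType.Exports.
Set Implicit Arguments.
Unset Strict Implicit.
Unset Printing Implicit Defensive.
Local Open Scope classical_set_scope.
Local Open Scope ring_scope.

(* The Borel sigma-algebra of R^n, generated by the coordinates. *)
Section borel_rV.
Context {R : realType} (n : nat).

Let coords (i : 'I_n) (x : 'rV[R]_n) : measurableTypeR R := x ord0 i.

Let rV_set0 : g_sigma_preimage coords set0.
Proof. exact: sigma_algebra0. Qed.

Let rV_setC A : g_sigma_preimage coords A -> g_sigma_preimage coords (~` A).
Proof. exact: sigma_algebraC. Qed.

Let rV_bigcup (F : _^nat) : (forall i, g_sigma_preimage coords (F i)) ->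
  g_sigma_preimage coords (\bigcup_i (F i)).
Proof. exact: sigma_algebra_bigcup. Qed.

HB.instance Definition _ := @isMeasurable.Build default_measure_display
  'rV[R]_n (g_sigma_preimage coords) rV_set0 rV_setC rV_bigcup.

Lemma measurable_fun_rVP d (T : measurableType d) (f : T -> 'rV[R]_n) :
  (forall i, measurable_fun [set: T]
    (fun x => f x ord0 i : measurableTypeR R)) ->
  measurable_fun [set: T] f.
Proof.
move=> mf.
have : g_sigma_preimage (fun i => coords i \o f) `<=` measurable.
  apply: smallest_sub; first exact: sigma_algebra_measurable.
  by rewrite -bigcup_seq; apply: bigcup_sub => i _ A [B mB <-]; exact: mf.
by rewrite g_sigma_preimage_comp => H _ A mA; apply: H; exists A.
Qed.

Lemma measurable_coord (i : 'I_n) : measurable_fun [set: 'rV[R]_n]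
  (fun x : 'rV[R]_n => x ord0 i : measurableTypeR R).
Proof.
move=> _ Y mY; rewrite setTI; apply: sub_sigma_algebra => /=.
rewrite -bigcup_seq/=; exists i => /=; first by rewrite mem_index_enum.
by exists Y => //; rewrite setTI.
Qed.
End borel_rV.

Lemma product_sigma_finite d1 d2 (T1 : measurableType d1)
    (T2 : measurableType d2) (R : realType)
    (m1 : {sigma_finite_measure set T1 -> \bar R})
    (m2 : {sigma_finite_measure set T2 -> \bar R}) :
  sigma_finite setT (m1 \x m2)%E.
Proof.
have /sigma_finiteP[F [TF ndF Foo]] := sigma_finiteT m1.
have /sigma_finiteP[G [TG ndG Goo]] := sigma_finiteT m2.
exists (fun k => F k `*` G k).
  rewrite -setXTT TF TG predeqE => -[x y]; split.
    move=> [/= [k _ Fkx] [l _ Gly]]; exists (maxn k l) => //; split.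
    - by move: x Fkx; exact/subsetPset/ndF/leq_maxl.
    - by move: y Gly; exact/subsetPset/ndG/leq_maxr.
  by move=> [k _ []/= ? ?]; split; exists k.
move=> k; have [? ?] := Foo k; have [? ?] := Goo k.
split; first exact: measurableX.
by rewrite product_measure1E// lte_mul_pinfty// ge0_fin_numE.
Qed.


Section lebesgue_step.
Context {R : realType} (n : nat).
Variable mu : {sigma_finite_measure set 'rV[R]_n -> \bar R}.
Local Open Scope ereal_scope.

Definition cons_rV (p : measurableTypeR R * 'rV[R]_n) : 'rV[R]_n.+1 :=
  row_mx (\row_(_ < 1) p.1) p.2.

Lemma measurable_cons_rV : measurable_fun setT cons_rV.
Proof.
apply: measurable_fun_rVP => i.
have [j ->|j ->] := @split_ordP 1 n i.
- rewrite [X in measurable_fun _ X](_ : _ = fst) //.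
  by apply/funext => p; rewrite (row_mxEl (n1:=1)) mxE.
- rewrite [X in measurable_fun _ X](_ : _ =
      (fun x : 'rV[R]_n => x ord0 j : measurableTypeR R) \o snd).
    exact: (measurableT_comp (measurable_coord j)).
  by apply/funext => p; rewrite (row_mxEr (n1:=1)).
Qed.



Let lam : {sigma_finite_measure set (measurableTypeR R) -> \bar R} :=
  @lebesgue_measure R.
Let nu : {measure set (measurableTypeR R * 'rV[R]_n)%type -> \bar R} :=
  lam \x mu.
Definition lebesgue_step := pushforward nu cons_rV.

Let lebesgue_step0 : lebesgue_step set0 = 0.
Proof. by rewrite /lebesgue_step /pushforward preimage_set0 measure0. Qed.

Let lebesgue_step_ge0 A : 0 <= lebesgue_step A.
Proof. by rewrite /lebesgue_step /pushforward measure_ge0. Qed.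

Let lebesgue_step_sigma_additive : semi_sigma_additive lebesgue_step.
Proof.
exact: (@measure_semi_sigma_additive _ _ _
  (measure_function_pushforward__canonical__measure_function_Measure
     nu measurable_cons_rV)).
Qed.

HB.instance Definition _ := isMeasure.Build _ _ _ lebesgue_step
  lebesgue_step0 lebesgue_step_ge0 lebesgue_step_sigma_additive.

Let lebesgue_step_sigma_finite : sigma_finite [set: 'rV[R]_n.+1] lebesgue_step.
Proof.
have [F FT Foo] := product_sigma_finite lam mu.
pose g (x : 'rV[R]_n.+1) : measurableTypeR R * 'rV[R]_n :=
  (x ord0 ord0, \row_j x ord0 (lift ord0 j)).
have mg : measurable_fun setT g.
  apply/measurable_fun_pairP; split => /=; first exact: measurable_coord.
  apply: measurable_fun_rVP => j.
  rewrite [X in measurable_fun _ X](_ : _ =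
      fun x : 'rV[R]_n.+1 => x ord0 (lift ord0 j)).
    exact: measurable_coord.
  by apply/funext => x; rewrite mxE.
have cons_rVK : cancel cons_rV g.
  move=> [a v]; congr pair.
    have -> : ord0 = lshift n (ord0 : 'I_1) by exact/val_inj.
    by rewrite (row_mxEl (n1:=1)) mxE.
  apply/rowP => j; rewrite mxE.
  have -> : lift ord0 j = rshift 1 j by exact/val_inj.
  by rewrite (row_mxEr (n1:=1)).
exists (fun k => g @^-1` F k).
  by rewrite -preimage_bigcup -FT preimage_setT.
move=> k; have [mFk Fkoo] := Foo k; split.
  by rewrite -[X in measurable X]setTI; exact: mg.
rewrite /lebesgue_step /pushforward -comp_preimage.
rewrite (_ : g \o cons_rV = id) ?preimage_id //.
by apply/funext => p; exact: cons_rVK.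
Qed.

HB.instance Definition _ := Measure_isSigmaFinite.Build _ _ _ lebesgue_step
  lebesgue_step_sigma_finite.

End lebesgue_step.


Fixpoint lebesgue_rV (R : realType) (n : nat) :
    {sigma_finite_measure set 'rV[R]_n -> \bar R} :=
  match n with
  | 0%N => \d_(0 : 'rV[R]_0)
  | k.+1 => lebesgue_step (lebesgue_rV R k)
  end.

Section sobolev.
Context {R : realType} {d : nat}.
Local Notation mu := (lebesgue_rV R d).
Implicit Types (f phi : 'rV[R]_d -> R) (u v g h : 'rV[R]_d -> R[i]).

Definition partial (i : 'I_d) f : 'rV[R]_d -> R := 'D_(delta_mx ord0 i) f.

Definition iter_partial (s : seq 'I_d) f : 'rV[R]_d -> R := foldr partial f s.

Definition test_function phi : Prop :=
  [/\ forall s, continuous (iter_partial s phi),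
      forall s i x, derivable (iter_partial s phi) x (delta_mx ord0 i)
    & compact (closure [set x | phi x != 0])].

(* [weak_partial i f f'] is meant for locally integrable [f] and [f']; in all
   uses below they are moreover in some L^p with 1 <= p. *)
Definition weak_partial (i : 'I_d) f f' : Prop :=
  forall phi, test_function phi ->
    \int[mu]_(x in setT) (f x * partial i phi x) =
    - \int[mu]_(x in setT) (f' x * phi x).

Definition sqnorm2 (x : 'rV[R]_d) : R := \sum_i x ord0 i ^+ 2.

Definition W1p_norm (p : R) f (Df : 'I_d -> 'rV[R]_d -> R) : \bar R :=
  ((Lnorm mu p%:E (EFin \o f) `^ p +
    \sum_i Lnorm mu p%:E (EFin \o Df i) `^ p) `^ p^-1)%E.

(* For d < p every class in W^{1,p}(R^d) has exactly one continuous
   representative; potentials are identified with it. *)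
Definition Omega_pM (p M : R) : set ('rV[R]_d -> R) :=
  [set V | [/\ continuous V,
    exists DV : 'I_d -> 'rV[R]_d -> R,
      (forall i, measurable_fun setT (DV i) /\ weak_partial i V (DV i)) /\
      (W1p_norm p V DV <= M%:E)%E
    & forall x, `|V x| <= M * (1 + sqnorm2 x) `^ (- 2^-1)]].

Definition Omega_p (p : R) : set ('rV[R]_d -> R) :=
  \bigcup_(M in [set M | 0 < M]) Omega_pM p M.

Definition L2norm u : \bar R :=
  Lnorm mu 2%:E (fun x => (Normc.normc (u x))%:E).

(* Elements of L^2(R^d; C) are represented by functions; equality in L^2 is
   equality almost everywhere. *)
Definition L2 u : Prop :=
  [/\ measurable_fun setT (fun x => complex.Re (u x)),
      measurable_fun setT (fun x => complex.Im (u x))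
    & (L2norm u < +oo)%E].

Definition weak_partialC (i : 'I_d) u v : Prop :=
  weak_partial i (fun x => complex.Re (u x)) (fun x => complex.Re (v x)) /\
  weak_partial i (fun x => complex.Im (u x)) (fun x => complex.Im (v x)).

Definition H2_derivatives u (Du : 'I_d -> 'rV[R]_d -> R[i])
    (D2u : 'I_d -> 'I_d -> 'rV[R]_d -> R[i]) : Prop :=
  [/\ L2 u,
      forall i, L2 (Du i) /\ weak_partialC i u (Du i)
    & forall i j, L2 (D2u i j) /\ weak_partialC j (Du i) (D2u i j)].

(* The graph of H_0 = - Laplacian + m^2, with domain H^2(R^d). *)
Definition H0_graph (m : R) u h : Prop :=
  exists Du D2u, H2_derivatives u Du D2u /\
    {ae mu, forall x, h x = - (\sum_i D2u i i x) + (m ^+ 2)%:C%C * u x}.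

(* The graph of T_V(lambda) = H_0 - (V - lambda)^2. *)
Definition TV_graph (m : R) (V : 'rV[R]_d -> R) (lambda : R[i]) u g : Prop :=
  exists h, H0_graph m u h /\
    {ae mu, forall x, g x = h x - ((V x)%:C%C - lambda) ^+ 2 * u x}.

Definition boundedly_invertible
    (T : ('rV[R]_d -> R[i]) -> ('rV[R]_d -> R[i]) -> Prop) : Prop :=
  exists C : R, forall g, L2 g ->
    exists u, [/\ T u g, (L2norm u <= C%:E * L2norm g)%E
      & forall v, T v g -> {ae mu, forall x, v x = u x}].

Definition spectrum (m : R) (V : 'rV[R]_d -> R) : set R[i] :=
  [set lambda | ~ boundedly_invertible (TV_graph m V lambda)].

Definition point_evaluations : set (('rV[R]_d -> R) -> R[i]) :=
  [set f | exists q : 'rV[rat]_d, f = fun V => (V (map_mx ratr q))%:C%C].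

End sobolev.

Section hausdorff.
Context {R : realType}.

Definition closedC (A : set R[i]) : Prop := closed (A : set (R[i])^o).

Definition dist_to (A : set R[i]) (z : R[i]) : \bar R :=
  ereal_inf [set (Normc.normc (z - a))%:E | a in A].

(* Takes the value +oo, e.g. between a bounded and an unbounded set. *)
Definition dH (A B : set R[i]) : \bar R :=
  ereal_sup ([set 0%E] `|` [set dist_to B a | a in A]
                       `|` [set dist_to A b | b in B]).

End hausdorff.

(* Blum-Shub-Smale machines over R: flowcharts acting on bi-infinite tapes.
   Rational maps are compositions of the arithmetic instructions. *)
Section bss.
Context {R : realType}.

Inductive arith := Add | Sub | Mul | Div.

Inductive instr :=
  | Const of int & R                (* x_i := c *)
  | Op of arith & int & int & int   (* x_i := x_j op x_k *)
  | Branch of int & nat             (* if 0 <= x_i go to l *)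
  | ShiftL
  | ShiftR
  | Query of int & int              (* (x_j, x_(j+1)) := oracle (x_i) *)
  | Halt.

Definition tape := int -> R.
Definition config := (nat * tape)%type.

Definition set_cell (x : tape) (i : int) (c : R) : tape :=
  fun j => if j == i then c else x j.

(* A division by 0 or a query whose argument is not a natural number blocks the
   machine; blocked runs produce no output. *)
Definition step (oracle : nat -> R[i]) (prog : seq instr) (c : config) :
    option config :=
  let: (pc, x) := c in
  match nth Halt prog pc with
  | Const i a => Some (pc.+1, set_cell x i a)
  | Op Add i j k => Some (pc.+1, set_cell x i (x j + x k))
  | Op Sub i j k => Some (pc.+1, set_cell x i (x j - x k))
  | Op Mul i j k => Some (pc.+1, set_cell x i (x j * x k))
  | Op Div i j k =>
      if x k == 0 then None else Some (pc.+1, set_cell x i (x j / x k))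
  | Branch i l => Some (if 0 <= x i then l else pc.+1, x)
  | ShiftL => Some (pc.+1, fun j => x (j + 1))
  | ShiftR => Some (pc.+1, fun j => x (j - 1))
  | Query i j =>
      if x i \is a Num.nat then
        let z := oracle (Num.truncn (x i)) in
        Some (pc.+1,
              set_cell (set_cell x j (complex.Re z)) (j + 1) (complex.Im z))
      else None
  | Halt => None
  end.

(* The input n is placed in cell 0. *)
Definition init (n : nat) : config := (0%N, fun j => if j == 0 then n%:R else 0).

(* A string of k complex numbers is output by writing k in cell 0 and the real
   and imaginary parts of its entries in cells 1, ..., 2k. *)
Definition encodes (x : tape) (s : seq R[i]) : Prop :=
  x 0 = (size s)%:R /\
  forall k, (k < size s)%N -> nth 0 s k = (x k.*2.+1%:Z +i* x k.*2.+2%:Z)%C.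

Definition bss_outputs (prog : seq instr) (oracle : nat -> R[i]) (n : nat)
    (s : seq R[i]) : Prop :=
  exists t pc x,
    [/\ iter t (obind (step oracle prog)) (Some (init n)) = Some (pc, x),
        nth Halt prog pc = Halt & encodes x s].

End bss.

Section sci.
Context {R : realType}.

Record problem := Problem {
  instance : Type ;
  Omega : set instance ;
  Lambda : set (instance -> R[i]) ;
  Xi : instance -> set R[i] }.
Arguments Omega : clear implicits.
Arguments Lambda : clear implicits.
Arguments Xi : clear implicits.

Definition problem_wf (P : problem) : Prop :=
  forall T, Omega P T -> closedC (Xi P T).

Definition general_algorithm (P : problem) (G : instance P -> set R[i]) : Prop :=
  exists LG : instance P -> set (instance P -> R[i]),
    forall T, Omega P T ->
      [/\ closedC (G T), finite_set (LG T), LG T !=set0, LG T `<=` Lambda P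
        & forall S, Omega P S -> (forall f, LG T f -> f S = f T) ->
            G S = G T /\ LG S = LG T].

(* Finite strings of complex numbers are identified with finite unions of points
   and closed half-lines: the pair (a, v) stands for the half-line issued from a
   with direction v, and for the point a if v = 0. Finite sets alone would be at
   infinite Hausdorff distance from any unbounded set. *)
Fixpoint closed_set_of (s : seq R[i]) : set R[i] :=
  match s with
  | a :: v :: s' =>
      [set z | exists2 t : R, 0 <= t & z = a + t%:C%C * v] `|` closed_set_of s'
  | _ => set0
  end.

(* The oracle gives access to Lambda through an enumeration e. The choice of e is
   immaterial: the translation between two enumerations, a map from nat to nat,
   can be stored in one real constant of the machine. The machine depends neither
   on n nor on the instance. *)
Definition arithmetic_tower1 (P : problem) (G : nat -> instance P -> set R[i]) :
    Prop :=
  [/\ forall n, (0 < n)%N -> general_algorithm (G n),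
      forall T, Omega P T -> (fun n => dH (G n T) (Xi P T)) @ \oo --> 0%E
    & exists2 e : nat -> instance P -> R[i], range e = Lambda P &
      exists prog : seq instr, forall T, Omega P T -> forall n, (0 < n)%N ->
        exists2 s, bss_outputs prog (fun k => e k T) n s &
          G n T = closed_set_of s].

Definition Delta2A (P : problem) : Prop :=
  problem_wf P /\ exists G, @arithmetic_tower1 P G.

Definition Pi1A (P : problem) : Prop :=
  Delta2A P /\
  exists2 G, @arithmetic_tower1 P G &
    forall T, Omega P T -> exists X : nat -> set R[i],
      forall n, (0 < n)%N ->
        [/\ closedC (X n), Xi P T `<=` X n & (dH (X n) (G n T) <= (n%:R^-1)%:E)%E].

End sci.

Definition KG_problem (R : realType) (d : nat) (m : R)
    (O : set ('rV[R]_d -> R)) : problem :=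
  {| instance := 'rV[R]_d -> R ;
     Omega := O ;
     Lambda := point_evaluations ;
     Xi := spectrum m |}.

(* Main.v *)
Require Import Defs.
From HB Require Import structures.
From mathcomp Require Import all_boot all_order all_algebra.
From mathcomp Require Import all_classical all_reals all_analysis.
From mathcomp Require Import measurable_realfun complex ring lra zify.
Import Order.TTheory GRing.Theory Num.Theory numFieldNormedType.Exports.
Set Implicit Arguments.
Unset Strict Implicit.
Unset Printing Implicit Defensive.
Local Open Scope classical_set_scope.
Local Open Scope ring_scope.

Local Notation Re := complex.Re.
Local Notation Im := complex.Im.
Local Notation normc := Normc.normc.

(* A machine may store one real constant, and the digits of this constant can list
   the outputs to be given for all finite strings of rounded samples. It therefore
   suffices to approximate the spectrum from finitely many rounded samples of V.

   By Morrey's estimate the potentials of norm at most M have a common modulus of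
   continuity and a common decay; in such a class K, agreement of the first n rounded
   samples forces uniform closeness as n grows. A number lambda is outside sigma(V)
   iff - Laplacian u + q u = g with q = m^2 - (V - lambda)^2 is uniquely solvable with
   an L^2 bound, which is stable under uniformly small changes of q. Hence sigma is
   upper semicontinuous on K, and the closed union X_n of the spectra of all members
   of K sharing the rounded samples of V contains sigma(V) and shrinks to it.

   Outside a disc sigma(V) is the union of two real half-lines. Weyl sequences put
   every real lambda with lambda^2 >= m^2 into the spectrum. For lambda not real of
   large modulus, q stays in a disc of radius smaller than |z| around some z with
   Re z >= 0; for q = z constant the equation is solved by letting the mesh of a
   lattice Laplacian tend to 0, and q is a small perturbation of z. So X_n is, up to
   1/n, a finite set of grid points together with two half-lines.

   If M is unknown, the first class containing a potential with the observed samples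
   is used; classes that do not contain V are eventually refuted by density of the
   sample points. *)

(** * Square-integrable complex functions *)

(** No Fourier transform is used. For Re z >= 0 the vectors z phi and - Laplacian phi enclose an
    angle of at most 90 degrees, so neither is longer than their sum; this bounds phi and its
    Laplacian by (z - Laplacian) phi, and integration by parts bounds all second derivatives by the
    Laplacian. The same argument holds on the lattice uniformly in the mesh, where the equation is
    solved by a Neumann series whose partial sums are finite combinations of translates and so
    remain test functions: the range on test functions is dense. Density gives existence by
    completeness and uniqueness by duality. The machine computes nothing about spectra; the obstacle
    is that its table must be indexed by finitely many natural numbers. Hence samples are rounded,
    and the enclosure, the class used for it and the output string depend on the rounded samples
    only. With M known, V belongs to the class in use, so sigma(V) lies in X_n; with M unknown, a
    smaller class may be in use for finitely many n, and X_n may then miss a part of sigma(V). *)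

Lemma addfE (T : Type) (M : nmodType) (f g : T -> M) x : (f + g) x = f x + g x.
Proof. by []. Qed.
Lemma oppfE (T : Type) (M : zmodType) (f : T -> M) x : (- f) x = - f x.
Proof. by []. Qed.

Section complex_parts.
Context {R : realType}.
Implicit Types z w : R[i].

Lemma complex_ext z w : Re z = Re w -> Im z = Im w -> z = w.
Proof. by case: z w => a b [c d] /= -> ->. Qed.
Lemma cReD z w : Re (z + w) = Re z + Re w. Proof. by case: z w => a b []. Qed.
Lemma cImD z w : Im (z + w) = Im z + Im w. Proof. by case: z w => a b []. Qed.
Lemma cReN z : Re (- z) = - Re z. Proof. by case: z. Qed.
Lemma cImN z : Im (- z) = - Im z. Proof. by case: z. Qed.
Lemma cReB z w : Re (z - w) = Re z - Re w. Proof. by case: z w => a b []. Qed.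
Lemma cImB z w : Im (z - w) = Im z - Im w. Proof. by case: z w => a b []. Qed.
Lemma cReM z w : Re (z * w) = Re z * Re w - Im z * Im w.
Proof. by case: z w => a b []. Qed.
Lemma cImM z w : Im (z * w) = Re z * Im w + Im z * Re w.
Proof. by case: z w => a b []. Qed.
Lemma cRe0 : Re (0 : R[i]) = 0. Proof. by []. Qed.
Lemma cIm0 : Im (0 : R[i]) = 0. Proof. by []. Qed.
Lemma cRe_conj z : Re (conjc z) = Re z. Proof. by case: z. Qed.
Lemma cIm_conj z : Im (conjc z) = - Im z. Proof. by case: z. Qed.

(** The real inner product Re (z conj(w)): all integrals stay real-valued, and the adjoint of
    multiplication by c is multiplication by [conjc c]. *)
Definition dotc z w : R := Re z * Re w + Im z * Im w.

Lemma normcE z : normc z = Num.sqrt (dotc z z).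
Proof. by case: z => a b; rewrite /dotc -!expr2. Qed.

Lemma dotcc_ge0 z : 0 <= dotc z z.
Proof. by rewrite /dotc -!expr2 addr_ge0 ?sqr_ge0. Qed.

Lemma normc_ge0 z : 0 <= normc z.
Proof. by rewrite normcE sqrtr_ge0. Qed.

Lemma normc_sqr z : normc z ^+ 2 = dotc z z.
Proof. by rewrite normcE sqr_sqrtr ?dotcc_ge0. Qed.

Lemma normc_triangle z w : normc (z + w) <= normc z + normc w.
Proof.
have := ler_normD z w.
by case: z w => a b [a' b']; rewrite lecE => /andP[_] /=.
Qed.

Lemma normcN z : normc (- z) = normc z.
Proof. by case: z => a b /=; rewrite !sqrrN. Qed.

Lemma normc_distC z w : normc (z - w) = normc (w - z).
Proof. by rewrite -normcN opprB. Qed.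

Lemma normc_tri_dist z w y : normc (z - y) <= normc (z - w) + normc (w - y).
Proof.
have -> : z - y = (z - w) + (w - y) by rewrite addrA subrK.
exact: normc_triangle.
Qed.

Lemma normcR (a : R) : normc (a%:C)%C = `|a|.
Proof. by rewrite /= expr0n addr0 sqrtr_sqr. Qed.

Lemma ler_Re_normc z : `|Re z| <= normc z.
Proof.
rewrite -(@ler_pXn2r _ 2) ?nnegrE ?normc_ge0// normc_sqr real_normK ?num_real//.
by rewrite /dotc -!expr2 lerDl sqr_ge0.
Qed.

Lemma ler_Im_normc z : `|Im z| <= normc z.
Proof.
rewrite -(@ler_pXn2r _ 2) ?nnegrE ?normc_ge0// normc_sqr real_normK ?num_real//.
by rewrite /dotc -!expr2 lerDr sqr_ge0.
Qed.

Lemma normc_le_ReIm z : normc z <= `|Re z| + `|Im z|.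
Proof.
case: z => a b; have -> : (a +i* b)%C = (a%:C + 0 +i* b)%C.
  by apply: complex_ext; rewrite /= ?addr0 ?add0r.
apply: le_trans (normc_triangle _ _) _.
by rewrite normcR /= expr0n add0r sqrtr_sqr addr0 add0r.
Qed.

Lemma ler_dotc z w : `|dotc z w| <= normc z * normc w.
Proof.
rewrite -(@ler_pXn2r _ 2) ?nnegrE ?mulr_ge0 ?normc_ge0//.
rewrite exprMn !normc_sqr real_normK ?num_real// /dotc.
have := sqr_ge0 (Re z * Im w - Im z * Re w).
move: (Re z) (Im z) (Re w) (Im w) => a b a' b'; nra.
Qed.

Lemma dotc_le z w : `|dotc z w| <= dotc z z + dotc w w.
Proof.
apply: le_trans (ler_dotc _ _) _; rewrite -!normc_sqr.
have := sqr_ge0 (normc z - normc w).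
move: (normc_ge0 z) (normc_ge0 w); move: (normc z) (normc w) => a b; nra.
Qed.

Lemma dotcC z w : dotc z w = dotc w z.
Proof. by rewrite /dotc mulrC [X in _ + X]mulrC. Qed.

Lemma dotcDl z w y : dotc (z + w) y = dotc z y + dotc w y.
Proof. rewrite /dotc cReD cImD; ring. Qed.

Lemma dotcNl z w : dotc (- z) w = - dotc z w.
Proof. rewrite /dotc cReN cImN; ring. Qed.

Lemma dotcM c z w : dotc (c * z) w = dotc z (conjc c * w).
Proof. rewrite /dotc !cReM !cImM cRe_conj cIm_conj; ring. Qed.

Lemma normcM_dot c z : dotc (c * z) (c * z) = normc c ^+ 2 * dotc z z.
Proof. rewrite normc_sqr /dotc !cReM !cImM; ring. Qed.

End complex_parts.

Section L2.
Context {d} {T : measurableType d} {R : realType}.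
Variable mu : {measure set T -> \bar R}.
Implicit Types u v w : T -> R[i].

Definition meas_c u := measurable_fun setT (fun x => Re (u x)) /\
  measurable_fun setT (fun x => Im (u x)).

Lemma meas_c0 : meas_c 0.
Proof. by split; apply: measurable_cst. Qed.

Lemma meas_c_cst (c : R[i]) : meas_c (cst c).
Proof. by split; apply: measurable_cst. Qed.

Lemma meas_cD u v : meas_c u -> meas_c v -> meas_c (u + v).
Proof.
move=> [a b] [a' b']; split.
  under eq_fun do rewrite [(u + v) _]/(_ + _) cReD; exact: measurable_funD.
under eq_fun do rewrite [(u + v) _]/(_ + _) cImD; exact: measurable_funD.
Qed.

Lemma meas_cN u : meas_c u -> meas_c (- u).
Proof.
move=> [a b]; split.
  under eq_fun do rewrite [(- u) _]/(- _) cReN; exact: measurableT_comp.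
under eq_fun do rewrite [(- u) _]/(- _) cImN; exact: measurableT_comp.
Qed.

Lemma meas_cB u v : meas_c u -> meas_c v -> meas_c (u - v).
Proof. by move=> mu1 mv; apply: meas_cD => //; apply: meas_cN. Qed.

Lemma meas_cM u v : meas_c u -> meas_c v -> meas_c (u \* v).
Proof.
move=> [a b] [a' b']; split => /=.
  under eq_fun do rewrite cReM.
  by apply: measurable_funB; apply: measurable_funM.
under eq_fun do rewrite cImM.
by apply: measurable_funD; apply: measurable_funM.
Qed.

Lemma meas_dot u v : meas_c u -> meas_c v ->
  measurable_fun setT (fun x => dotc (u x) (v x)).
Proof.
by move=> [a b] [a' b']; apply: measurable_funD; apply: measurable_funM.
Qed.

Definition sq_integrable u := meas_c u /\
  mu.-integrable setT (EFin \o (fun x => dotc (u x) (u x))).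

Lemma integrable_dom (f g : T -> R) : measurable_fun setT f ->
  mu.-integrable setT (EFin \o g) -> (forall x, `|f x| <= g x) ->
  mu.-integrable setT (EFin \o f).
Proof.
move=> mf ig fg; apply: le_integrable ig => //; first exact/measurable_EFinP.
move=> x _ /=; rewrite lee_fin; apply: le_trans (fg x) _; exact: ler_norm.
Qed.

Lemma integrable_Radd (f g : T -> R) : mu.-integrable setT (EFin \o f) ->
  mu.-integrable setT (EFin \o g) ->
  mu.-integrable setT (EFin \o (fun x => f x + g x)).
Proof.
move=> i1 i2; rewrite (_ : EFin \o _ = (EFin \o f) \+ (EFin \o g))%E//.
exact: integrableD.
Qed.

Lemma integrable_Rscale (k : R) (f : T -> R) : mu.-integrable setT (EFin \o f) ->
  mu.-integrable setT (EFin \o (fun x => k * f x)).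
Proof.
move=> i1; rewrite (_ : EFin \o _ = fun x => k%:E * (EFin \o f) x)%E//.
exact: integrableZl.
Qed.

Lemma integrable_dot u v : sq_integrable u -> sq_integrable v ->
  mu.-integrable setT (EFin \o (fun x => dotc (u x) (v x))).
Proof.
move=> [mu1 iu] [mv iv].
apply: (@integrable_dom _ (fun x => dotc (u x) (u x) + dotc (v x) (v x))).
- exact: meas_dot.
- exact: integrable_Radd.
- by move=> x; exact: dotc_le.
Qed.

Lemma L2c_dom u v (B : R) : meas_c v -> sq_integrable u ->
  (forall x, dotc (v x) (v x) <= B * dotc (u x) (u x)) -> sq_integrable v.
Proof.
move=> mv [mu1 iu] h; split=> //.
apply: (@integrable_dom _ (fun x => B * dotc (u x) (u x))).
- exact: meas_dot.
- exact: integrable_Rscale.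
- by move=> x; rewrite ger0_norm ?dotcc_ge0.
Qed.

Lemma L2c0 : sq_integrable 0.
Proof.
split; first exact: meas_c0.
rewrite (_ : _ \o _ = cst 0%E); first exact: integrable0.
by apply/funext => x /=; rewrite /dotc !mul0r addr0.
Qed.

Lemma L2cM (q : T -> R[i]) B u : meas_c q -> (forall x, normc (q x) <= B) ->
  sq_integrable u -> sq_integrable (q \* u).
Proof.
move=> mq qB Lu; have [mu1 _] := Lu.
apply: (L2c_dom (u := u) (B := B ^+ 2)) => //; first exact: meas_cM.
move=> x /=; rewrite normcM_dot ler_wpM2r ?dotcc_ge0//.
by rewrite lerXn2r ?nnegrE ?normc_ge0// (le_trans (normc_ge0 (q x))).
Qed.

Lemma L2cZ (c : R[i]) u : sq_integrable u -> sq_integrable (cst c \* u).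
Proof. exact: (L2cM (B := normc c) (meas_c_cst c)). Qed.

Lemma L2cD u v : sq_integrable u -> sq_integrable v -> sq_integrable (u + v).
Proof.
move=> [mu1 iu] [mv iv]; split; first exact: meas_cD.
apply: (@integrable_dom _
  (fun x => 2 * (dotc (u x) (u x) + dotc (v x) (v x)))).
- by apply: meas_dot; apply: meas_cD.
- by apply: integrable_Rscale; apply: integrable_Radd.
move=> x; rewrite ger0_norm ?dotcc_ge0// [(u + v) x]/(u x + v x).
rewrite /dotc cReD cImD; move: (Re _) (Im _) (Re _) (Im _) => a b a' b'.
have := sqr_ge0 (a - a'); have := sqr_ge0 (b - b'); nra.
Qed.

Lemma L2cN u : sq_integrable u -> sq_integrable (- u).
Proof.
move=> Lu; rewrite (_ : - u = cst (-1) \* u); first exact: L2cZ.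
by apply/funext => x /=; rewrite mulN1r.
Qed.

Lemma L2cB u v : sq_integrable u -> sq_integrable v -> sq_integrable (u - v).
Proof. by move=> Lu Lv; apply: L2cD => //; exact: L2cN. Qed.

Definition ipL2 u v : R := \int[mu]_x dotc (u x) (v x).

Lemma ipC u v : ipL2 u v = ipL2 v u.
Proof. by apply: eq_Rintegral => x _; rewrite dotcC. Qed.

Lemma ipDl u v w : sq_integrable u -> sq_integrable v -> sq_integrable w -> ipL2 (u + v) w = ipL2 u w + ipL2 v w.
Proof.
move=> Lu Lv Lw; rewrite /ipL2.
under eq_Rintegral do rewrite [(u + v) _]/(_ + _) dotcDl.
by rewrite RintegralD//; exact: integrable_dot.
Qed.

Lemma ipM c u v : ipL2 (cst c \* u) v = ipL2 u (cst (conjc c) \* v).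
Proof. by apply: eq_Rintegral => x _ /=; rewrite dotcM. Qed.

Lemma ipZl (a : R) u v : sq_integrable u -> sq_integrable v ->
  ipL2 (cst (a%:C)%C \* u) v = a * ipL2 u v.
Proof.
move=> Lu Lv; rewrite /ipL2.
transitivity (\int[mu]_x (a * dotc (u x) (v x))); last first.
  by rewrite RintegralZl//; exact: integrable_dot.
apply: eq_Rintegral => x _ /=; rewrite /dotc cReM cImM /=; ring.
Qed.

Lemma ipZr (a : R) u v : sq_integrable u -> sq_integrable v ->
  ipL2 u (cst (a%:C)%C \* v) = a * ipL2 u v.
Proof. by move=> Lu Lv; rewrite ipC ipZl// ipC. Qed.

Lemma ipNl u v : sq_integrable u -> sq_integrable v -> ipL2 (- u) v = - ipL2 u v.
Proof.
move=> Lu Lv; rewrite (_ : - u = cst ((-1)%:C)%C \* u) ?ipZl ?mulN1r//.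
apply/funext => x /=; apply: complex_ext; rewrite ?cReM ?cImM ?cReN ?cImN /=; ring.
Qed.

Lemma ipBl u v w : sq_integrable u -> sq_integrable v -> sq_integrable w -> ipL2 (u - v) w = ipL2 u w - ipL2 v w.
Proof.
by move=> Lu Lv Lw; rewrite ipDl ?ipNl//; exact: L2cN.
Qed.

Lemma ipDr u v w : sq_integrable u -> sq_integrable v -> sq_integrable w -> ipL2 w (u + v) = ipL2 w u + ipL2 w v.
Proof. by move=> *; rewrite !(ipC w) ipDl. Qed.
Lemma ipNr u v : sq_integrable u -> sq_integrable v -> ipL2 u (- v) = - ipL2 u v.
Proof. by move=> *; rewrite !(ipC u) ipNl. Qed.
Lemma ipBr u v w : sq_integrable u -> sq_integrable v -> sq_integrable w -> ipL2 w (u - v) = ipL2 w u - ipL2 w v.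
Proof. by move=> *; rewrite !(ipC w) ipBl. Qed.

Lemma ip0l u : ipL2 0 u = 0.
Proof.
rewrite /ipL2 (_ : (fun x => _) = cst 0) ?Rintegral_cst ?mul0r//.
by apply/funext => x; rewrite /dotc !mul0r addr0.
Qed.

Lemma ip0r u : ipL2 u 0 = 0. Proof. by rewrite ipC ip0l. Qed.

Lemma ip_ge0 u : 0 <= ipL2 u u.
Proof. by apply: Rintegral_ge0 => x _; exact: dotcc_ge0. Qed.

Definition normL2 u := Num.sqrt (ipL2 u u).

Lemma N_ge0 u : 0 <= normL2 u. Proof. exact: sqrtr_ge0. Qed.
Lemma sqrN u : normL2 u ^+ 2 = ipL2 u u. Proof. by rewrite sqr_sqrtr ?ip_ge0. Qed.
Lemma N0 : normL2 0 = 0. Proof. by rewrite /normL2 ip0l sqrtr0. Qed.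
Hint Resolve N_ge0 : core.

Lemma ip_CauchySchwarz u v : sq_integrable u -> sq_integrable v -> `|ipL2 u v| <= normL2 u * normL2 v.
Proof.
move=> Lu Lv; rewrite -(@ler_pXn2r _ 2) ?nnegrE ?mulr_ge0//.
rewrite exprMn !sqrN real_normK ?num_real//.
have key (a b : R) : 0 <= a ^+ 2 * ipL2 u u + a * b * ipL2 u v *+ 2 + b ^+ 2 * ipL2 v v.
  have La := L2cZ (a%:C)%C Lu; have Lb := L2cZ (b%:C)%C Lv.
  have := ip_ge0 (cst (a%:C)%C \* u + cst (b%:C)%C \* v).
  rewrite ipDl ?ipDr//; last exact: L2cD.
  rewrite !(ipZl, ipZr)// [ipL2 v u]ipC => h; apply: le_trans h _.
  by rewrite le_eqVlt; apply/orP; left; apply/eqP; ring.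
have [v0|v0] := eqVneq (ipL2 v v) 0.
  have [->|uv0] := eqVneq (ipL2 u v) 0; first by rewrite expr0n mulr_ge0 ?ip_ge0.
  (* For [ipL2 v v = 0] the form is affine in b; this b gives it the value - [ipL2 u u] - 2 < 0. *)
  have := key 1 (- (ipL2 u u + 1) / ipL2 u v); rewrite v0 mulr0 addr0 mul1r divfK//.
  by have := ip_ge0 u; lra.
have {v0} : 0 < ipL2 v v by rewrite lt0r v0 ip_ge0.
have := key (ipL2 v v) (- ipL2 u v).
move: (ipL2 u u) (ipL2 u v) (ipL2 v v) => a b c h c0.
have : 0 <= c * (a * c - b ^+ 2) by apply: le_trans h _; rewrite le_eqVlt; apply/orP; left; apply/eqP; ring.
by rewrite pmulr_rge0// subr_ge0.
Qed.

Lemma ip_le u v : sq_integrable u -> sq_integrable v -> ipL2 u v <= normL2 u * normL2 v.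
Proof. move=> Lu Lv; apply: le_trans (ip_CauchySchwarz Lu Lv); exact: ler_norm. Qed.

Lemma N_triangle u v : sq_integrable u -> sq_integrable v -> normL2 (u + v) <= normL2 u + normL2 v.
Proof.
move=> Lu Lv; rewrite -(@ler_pXn2r _ 2) ?nnegrE ?addr_ge0// sqrrD !sqrN.
rewrite ipDl ?ipDr//; last exact: L2cD.
rewrite [ipL2 v u]ipC; have := ip_le Lu Lv; move: (normL2 u * normL2 v) => c; lra.
Qed.

Lemma NN u : normL2 (- u) = normL2 u.
Proof.
congr Num.sqrt; apply: eq_Rintegral => x _.
by rewrite [(- u) x]/(- u x) dotcNl dotcC dotcNl opprK.
Qed.

Lemma N_triangleB u v : sq_integrable u -> sq_integrable v -> normL2 (u - v) <= normL2 u + normL2 v.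
Proof. by move=> Lu Lv; rewrite -(NN v); apply: N_triangle => //; exact: L2cN. Qed.

Lemma N_distC u v : normL2 (u - v) = normL2 (v - u).
Proof. by rewrite -NN opprB. Qed.

Lemma N_tri_dist u v w : sq_integrable u -> sq_integrable v -> sq_integrable w ->
  normL2 (u - w) <= normL2 (u - v) + normL2 (v - w).
Proof.
move=> Lu Lv Lw.
have -> : u - w = (u - v) + (v - w) by rewrite addrA subrK.
by apply: N_triangle; apply: L2cB.
Qed.

Lemma N_le_dot u v (B : R) : 0 <= B -> sq_integrable u -> sq_integrable v ->
  (forall x, dotc (v x) (v x) <= B ^+ 2 * dotc (u x) (u x)) -> normL2 v <= B * normL2 u.
Proof.
move=> B0 Lu Lv h; rewrite -(@ler_pXn2r _ 2) ?nnegrE ?mulr_ge0//.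
rewrite exprMn !sqrN /ipL2 -RintegralZl//; last exact: integrable_dot.
apply: le_Rintegral => //; first exact: integrable_dot.
by apply: integrable_Rscale; exact: integrable_dot.
Qed.

Lemma N_M (q : T -> R[i]) (B : R) u : meas_c q -> (forall x, normc (q x) <= B) ->
  sq_integrable u -> normL2 (q \* u) <= B * normL2 u.
Proof.
move=> mq qB Lu.
(* That B >= 0 follows from the bound at a point; on an empty T both sides are 0. *)
have [[x0]|e] := pselect (exists x : T, True); last first.
  suff -> : q \* u = 0.
    rewrite N0.
    have -> : u = 0 by apply/funext => x; exfalso; apply: e; exists x.
    by rewrite N0 mulr0.
  by apply/funext => x; exfalso; apply: e; exists x.
move=> _; have B0 : 0 <= B by apply: le_trans (qB x0); exact: normc_ge0.
apply: N_le_dot => //; first exact: (L2cM mq qB).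
move=> x /=; rewrite normcM_dot ler_wpM2r ?dotcc_ge0//.
by rewrite lerXn2r ?nnegrE ?normc_ge0.
Qed.

Lemma NZ c u : sq_integrable u -> normL2 (cst c \* u) = normc c * normL2 u.
Proof.
move=> Lu; rewrite /normL2 -[X in X * _](@ger0_norm _ (normc c)) ?normc_ge0//.
rewrite -sqrtr_sqr -sqrtrM ?sqr_ge0//; congr Num.sqrt.
rewrite /ipL2 -RintegralZl//; last exact: integrable_dot.
by apply: eq_Rintegral => x _ /=; rewrite normcM_dot.
Qed.

Lemma ae_ip_eq0 u : sq_integrable u -> normL2 u = 0 -> {ae mu, forall x, u x = 0}.
Proof.
move=> [[mr mi] iu] /eqP; rewrite sqrtr_eq0 => h.
have : ipL2 u u = 0 by apply/eqP; rewrite eq_le h ip_ge0.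
rewrite /ipL2 /Rintegral.
have fu := integrable_fin_num measurableT iu.
move=> {h} h.
have {h} : (\int[mu]_x `|(dotc (u x) (u x))%:E| = 0)%E.
  under eq_integral do rewrite gee0_abs ?lee_fin ?dotcc_ge0//.
  by rewrite -(fineK fu) h.
have mu1 := @measurable_int _ _ _ _ _ _ iu.
move/(ae_eq_integral_abs mu measurableT mu1).1 => h.
apply: filterS h => x /(_ I) [] /eqP.
rewrite /dotc -!expr2 paddr_eq0 ?sqr_ge0// !sqrf_eq0 => /andP[/eqP a /eqP b].
exact: complex_ext.
Qed.

Lemma ae_eq_ip u u' v v' : sq_integrable u -> sq_integrable u' -> sq_integrable v -> sq_integrable v' ->
  {ae mu, forall x, u x = u' x} -> {ae mu, forall x, v x = v' x} ->
  ipL2 u v = ipL2 u' v'.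
Proof.
move=> Lu Lu' Lv Lv' uu' vv'; congr fine; apply: ae_eq_integral => //.
- exact: (@measurable_int _ _ _ _ _ _ (integrable_dot Lu Lv)).
- exact: (@measurable_int _ _ _ _ _ _ (integrable_dot Lu' Lv')).
by near=> x; move=> _; congr (EFin (dotc _ _)); near: x.
Unshelve. all: by end_near. Qed.

Lemma ae_eq_N u u' : sq_integrable u -> sq_integrable u' ->
  {ae mu, forall x, u x = u' x} -> normL2 u = normL2 u'.
Proof. by move=> Lu Lu' h; rewrite /normL2 (ae_eq_ip Lu Lu' Lu Lu'). Qed.

Lemma Lnorm2E u : Lnorm mu 2%:E (fun x => (normc (u x))%:E) =
  ((\int[mu]_x (dotc (u x) (u x))%:E) `^ 2^-1)%E.
Proof.
rewrite unlock; congr (_ `^ _)%E; apply: eq_integral => x _.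
by rewrite abse_EFin ger0_norm ?normc_ge0// poweR_EFin powR_mulrn ?normc_ge0// normc_sqr.
Qed.

Lemma Lnorm2_fin u : sq_integrable u -> Lnorm mu 2%:E (fun x => (normc (u x))%:E) = (normL2 u)%:E.
Proof.
move=> [_ iu]; rewrite Lnorm2E -[X in (X `^ _)%E]fineK; last exact: integrable_fin_num.
by rewrite poweR_EFin powR12_sqrt//; exact: ip_ge0.
Qed.

Lemma L2cP u : meas_c u -> (Lnorm mu 2%:E (fun x => (normc (u x))%:E) < +oo)%E ->
  sq_integrable u.
Proof.
move=> mu1; rewrite Lnorm2E => h; split=> //; apply/integrableP; split.
  by apply/measurable_EFinP; exact: meas_dot.
under eq_integral do rewrite /= ger0_norm ?dotcc_ge0//.
exact: (lty_poweRy _ h).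
Qed.

Lemma limn_einf_le (v : nat -> \bar R) (c : \bar R) n0 :
  (forall n, (n0 <= n)%N -> v n <= c)%E -> (limn_einf v <= c)%E.
Proof.
move=> h; rewrite limn_einf_lim; apply: lime_le; first exact: is_cvg_einfs.
apply: nearW => n /=; apply: le_trans (h (maxn n0 n) (leq_maxl _ _)).
by apply: ereal_inf_lbound; exists (maxn n0 n) => //=; exact: leq_maxr.
Qed.

(** Fatou's lemma: bounds on the integrals pass to an almost everywhere limit, which thereby becomes
    integrable. The bounds are asked from [n0] on, so that tails of a Cauchy sequence can be
    inserted. *)
Lemma integral_liminf_le (f : nat -> T -> R) (F : T -> R) (c : R) n0 :
  (forall n, mu.-integrable setT (EFin \o f n)) -> (forall n x, 0 <= f n x) ->
  measurable_fun setT F ->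
  {ae mu, forall x, f ^~ x @ \oo --> F x} ->
  (forall n, (n0 <= n)%N -> \int[mu]_x f n x <= c) ->
  mu.-integrable setT (EFin \o F) /\ \int[mu]_x F x <= c.
Proof.
move=> fi f0 mF fF fc.
have aeF : {ae mu, forall x, (F x)%:E = limn_einf (fun n => (f n x)%:E)}.
  apply: filterS fF => x fx.
  have fx' : (fun n => (f n x)%:E) @ \oo --> (F x)%:E.
    by apply/fine_cvgP; split=> //; exact: nearW.
  by rewrite is_cvg_limn_einfE ?(cvg_lim _ fx')//; apply/cvg_ex; eexists; exact: fx'.
have F0 : {ae mu, forall x, 0 <= F x}.
  apply: filterS fF => x fx; apply: (cvgr_to_ge fx).
    by apply: nearW.
have absF : (\int[mu]_x `|(F x)%:E| <= c%:E)%E.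
  rewrite (_ : \int[mu]_x `|(F x)%:E| = \int[mu]_x limn_einf (fun n => (f n x)%:E))%E.
    apply: le_trans (fatou mu measurableT _ _) _.
    - by move=> n; exact: (@measurable_int _ _ _ _ _ _ (fi n)).
    - by move=> n x _; rewrite lee_fin.
    apply: (@limn_einf_le _ _ n0) => n nn0.
    rewrite -[X in (X <= _)%E]fineK ?lee_fin; first exact: fc.
    exact: (integrable_fin_num measurableT (fi n)).
  apply: ge0_ae_eq_integral => //.
  - by apply: measurableT_comp => //; exact/measurable_EFinP.
  - rewrite (_ : (fun x => _) = (fun x => - limn_esup (fun n => - (f n x)%:E)))%E//.
    apply: measurableT_comp => //; apply: measurable_fun_limn_esup => n.
    by apply: measurableT_comp => //; exact: (@measurable_int _ _ _ _ _ _ (fi n)).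
  - move=> x _; rewrite limn_einf_lim; apply: lime_ge; first exact: is_cvg_einfs.
    by apply: nearW => n; apply: le_ereal_inf_tmp => _ [k _ <-]; rewrite lee_fin.
  - near=> x; move=> _.
    rewrite gee0_abs ?lee_fin; near: x => //.
have iF : mu.-integrable setT (EFin \o F).
  apply/integrableP; split; first exact/measurable_EFinP.
  by apply: le_lt_trans absF _; rewrite ltry.
split=> //; rewrite -lee_fin /Rintegral fineK; last exact: integrable_fin_num.
apply: le_trans absF; apply: le_integral => //; first exact: integrable_abse.
by move=> x _; exact: lee_abs.
Unshelve. all: by end_near. Qed.

(** Riesz-Fischer with a rate. The sums of |u_(k+1) - u_k| are bounded in L^2 by the geometric
    series, so they are finite almost everywhere and u_n converges there; Fatou's lemma for u_m -
    u_n, with m tending to infinity, gives the distance to the limit. *)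
Lemma L2_complete (u : nat -> T -> R[i]) (A r : R) : 0 <= r -> r < 1 ->
  (forall n, sq_integrable (u n)) -> (forall n, normL2 (u n.+1 - u n) <= A * r ^+ n) ->
  exists2 v, sq_integrable v & forall n, normL2 (v - u n) <= A * r ^+ n / (1 - r).
Proof.
move=> r0 r1 Lu uA.
have r1' : 0 < 1 - r by rewrite subr_gt0.
have A0 : 0 <= A by have := uA 0%N; rewrite expr0 mulr1; exact: le_trans.
pose g n x := normc (u n.+1 x - u n x).
pose G k x := \sum_(n < k) g n x.
pose h k x : R[i] := ((G k x)%:C)%C.
have g0 n x : 0 <= g n x by exact: normc_ge0.
have Lg n : sq_integrable (fun x => ((g n x)%:C)%C) /\ normL2 (fun x => ((g n x)%:C)%C) <= A * r ^+ n.
  have LB : sq_integrable (u n.+1 - u n) by exact: L2cB.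
  have dg x : dotc ((g n x)%:C)%C ((g n x)%:C)%C = dotc ((u n.+1 - u n) x) ((u n.+1 - u n) x).
    by rewrite -normc_sqr normcR real_normK ?num_real// normc_sqr.
  have Lg : sq_integrable (fun x => ((g n x)%:C)%C).
    apply: (L2c_dom (u := u n.+1 - u n) (B := 1)) => //; last first.
      by move=> x; rewrite mul1r dg.
    split; last exact: measurable_cst.
    rewrite (_ : (fun x => _) = fun x => (dotc ((u n.+1 - u n) x) ((u n.+1 - u n) x)) `^ 2^-1).
      apply: (measurableT_comp (measurable_powR _)).
      by have [m _] := LB; exact: meas_dot.
    by apply/funext => x /=; rewrite powR12_sqrt ?dotcc_ge0// -normcE.
  split=> //; apply: le_trans (uA n).
  by rewrite -[leRHS]mul1r; apply: N_le_dot => // x; rewrite dg expr1n mul1r.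
have hS k : h k.+1 = h k + (fun x => ((g k x)%:C)%C).
  apply/funext => x; rewrite /h /G big_ord_recr /=.
  by apply: complex_ext; rewrite ?cReD ?cImD //= addr0.
have Nh k : sq_integrable (h k) /\ normL2 (h k) <= A * (1 - r ^+ k) / (1 - r).
  elim: k => [|k [Lh IH]].
    have -> : h 0%N = 0 by apply/funext => x; rewrite /h /G big_ord0.
    by split; [exact: L2c0|rewrite N0 expr0 subrr mulr0 mul0r].
  have [Lgk Ngk] := Lg k; rewrite hS; split; first exact: L2cD.
  apply: le_trans (N_triangle Lh Lgk) _; apply: le_trans (lerD IH Ngk) _.
  rewrite le_eqVlt; apply/orP; left; apply/eqP; rewrite exprS; field.
  by rewrite gt_eqF.
have tailN n k : normL2 (u (n + k)%N - u n) <= A * r ^+ n * (1 - r ^+ k) / (1 - r).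
  elim: k => [|k IH]; first by rewrite addn0 subrr N0 expr0 subrr mulr0 mul0r.
  rewrite addnS; apply: le_trans (N_tri_dist (Lu _) (Lu (n + k)%N) (Lu _)) _.
  apply: le_trans (lerD (uA _) IH) _.
  rewrite le_eqVlt; apply/orP; left; apply/eqP; rewrite exprD exprS; field.
  by rewrite gt_eqF.
have tail n m : (n <= m)%N -> normL2 (u m - u n) <= A * r ^+ n / (1 - r).
  move=> /subnKC <-; apply: le_trans (tailN _ _) _.
  rewrite ler_pM2r ?invr_gt0// ler_piMr ?mulr_ge0 ?exprn_ge0//.
  by rewrite lerBlDr lerDl exprn_ge0.
pose B := A / (1 - r).
have G2 k : \int[mu]_x (G k x) ^+ 2 <= B ^+ 2.
  have -> : \int[mu]_x (G k x) ^+ 2 = normL2 (h k) ^+ 2.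
    by rewrite sqrN; apply: eq_Rintegral => x _; rewrite /dotc /h /= mul0r addr0.
  have [Lh Nhk] := Nh k; rewrite lerXn2r ?nnegrE ?N_ge0 ?divr_ge0//; first exact: ltW.
  apply: le_trans Nhk _; rewrite ler_pM2r ?invr_gt0// ler_piMr//.
  by rewrite lerBlDr lerDl exprn_ge0.
have iG k : mu.-integrable setT (EFin \o (fun x => G k x ^+ 2)).
  have [[_ i2] _] := Nh k; move: i2; congr integrable; apply/funext => x /=.
  by rewrite /dotc /h /= mul0r addr0.
have Gnd x : nondecreasing_seq (G ^~ x).
  by apply/nondecreasing_seqP => k; rewrite /G big_ord_recr /= lerDl.
have G0 k x : 0 <= G k x by apply: sumr_ge0.
have aeG : {ae mu, forall x, cvgn (G ^~ x)}.
  pose L x := limn_einf (fun k => (G k x ^+ 2)%:E).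
  have mL : measurable_fun setT L.
    rewrite (_ : L = (fun x => - limn_esup (fun n => - (G n x ^+ 2)%:E)))%E//.
    apply: measurableT_comp => //; apply: measurable_fun_limn_esup => n.
    by apply: measurableT_comp => //; exact: (@measurable_int _ _ _ _ _ _ (iG n)).
  have L0 x : (0 <= L x)%E.
    rewrite /L limn_einf_lim; apply: lime_ge; first exact: is_cvg_einfs.
    by apply: nearW => n; apply: le_ereal_inf_tmp => _ [k _ <-]; rewrite lee_fin sqr_ge0.
  have iL : mu.-integrable setT L.
    apply/integrableP; split=> //.
    under eq_integral do rewrite gee0_abs//.
    apply: (@le_lt_trans _ _ (B ^+ 2)%:E); last exact: ltry.
    apply: le_trans (fatou mu measurableT _ _) _.
    - by move=> n; exact: (@measurable_int _ _ _ _ _ _ (iG n)).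
    - by move=> n x _; rewrite lee_fin sqr_ge0.
    apply: (@limn_einf_le _ _ 0%N) => n _.
    have := G2 n; rewrite -lee_fin /Rintegral fineK//.
    exact: integrable_fin_num (iG n).
  apply: filterS (integrable_ae measurableT iL) => x /(_ I) Lx.
  have nd2 : nondecreasing_seq (fun k => (G k x ^+ 2)%:E).
    by move=> a b ab; rewrite lee_fin lerXn2r ?nnegrE//; exact: Gnd.
  have c2 := ereal_nondecreasing_cvgn nd2.
  have LE : L x = ereal_sup (range (fun k => (G k x ^+ 2)%:E)).
    by rewrite /L is_cvg_limn_einfE ?(cvg_lim _ c2)//; apply/cvg_ex; eexists; exact: c2.
  apply: nondecreasing_is_cvgn; first exact: Gnd.
  (* G <= 1 + G^2 turns the bound on the squares into one on G. *)
  exists (1 + fine (L x)) => _ [k _ <-].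
  have : (G k x) ^+ 2 <= fine (L x).
    by rewrite -lee_fin fineK// LE; apply: ereal_sup_ubound; exists k.
  have := G0 k x; move: (G k x) (fine _) => a b; nra.
(* A limsup is measurable without any exceptional set; off the null set it is the limit. *)
pose vr x := fine (limn_esup (fun n => (Re (u n x))%:E)).
pose vi x := fine (limn_esup (fun n => (Im (u n x))%:E)).
pose v x : R[i] := (vr x +i* vi x)%C.
have mv : meas_c v.
  by split; apply: (measurableT_comp (fine_measurable _)) => //;
    apply: measurable_fun_limn_esup => n; apply/measurable_EFinP; have [[]] := Lu n.
have cvgpart (a : nat -> R) x : (forall n, `|a n.+1 - a n| <= g n x) ->
    cvgn (G ^~ x) -> a @ \oo --> fine (limn_esup (fun n => (a n)%:E)).
  move=> ag cG.
  have : cvgn a.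
    have -> : a = series (telescope a) + cst (a 0%N).
      by rewrite telescopeK; apply/funext => n; exact: (esym (subrK _ _)).
    apply: is_cvgD; last exact: is_cvg_cst.
    apply: normed_cvg; apply: (series_le_cvg _ (fun n => g0 n x)) => //.
      by move=> n; exact: normr_ge0.
    rewrite (_ : series (g^~ x) = G^~ x)//.
    by apply/funext => k; rewrite /series /= /G big_mkord.
  move=> ca; have /cvg_ex[l al] := ca.
  have al' : (fun n => (a n)%:E) @ \oo --> l%:E by apply/fine_cvgP; split=> //; exact: nearW.
  rewrite is_cvg_limn_esupE; last by apply/cvg_ex; eexists; exact: al'.
  by rewrite (cvg_lim _ al').
have key n : mu.-integrable setT (EFin \o (fun x => dotc ((v - u n) x) ((v - u n) x))) /\
    \int[mu]_x dotc ((v - u n) x) ((v - u n) x) <= (A * r ^+ n / (1 - r)) ^+ 2.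
  apply: (@integral_liminf_le (fun m x => dotc ((u m - u n) x) ((u m - u n) x)) _ _ n).
  - by move=> m; apply: integrable_dot; apply: L2cB.
  - by move=> m x; exact: dotcc_ge0.
  - by apply: meas_dot; apply: meas_cB => //; have [] := Lu n.
  - apply: filterS aeG => x cG.
    have c1 := cvgpart (fun n => Re (u n x)) x _ cG.
    have c2 := cvgpart (fun n => Im (u n x)) x _ cG.
    rewrite /dotc; under eq_fun do rewrite ![(u _ - u n) x]/(_ - _) !cReB !cImB.
    rewrite ![(v - u n) x]/(_ - _) !cReB !cImB.
    have c1' := cvgB (c1 _) (cvg_cst (Re (u n x))).
    have c2' := cvgB (c2 _) (cvg_cst (Im (u n x))).
    apply: cvgD; apply: cvgM; (apply: c1' || apply: c2') => m.
    + by rewrite -cReB; exact: ler_Re_normc.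
    + by rewrite -cReB; exact: ler_Re_normc.
    + by rewrite -cImB; exact: ler_Im_normc.
    + by rewrite -cImB; exact: ler_Im_normc.
  - move=> m nm; rewrite -/(ipL2 _ _) -sqrN lerXn2r ?nnegrE ?N_ge0//.
      by rewrite divr_ge0 ?mulr_ge0 ?exprn_ge0// ltW.
    exact: tail.
have Lvn n : sq_integrable (v - u n).
  by split; [apply: meas_cB => //; have [] := Lu n|have [] := key n].
exists v; first by rewrite -(subrK (u 0%N) v); exact: L2cD.
move=> n; rewrite -(@ler_pXn2r _ 2) ?nnegrE ?N_ge0//; last first.
  by rewrite divr_ge0 ?mulr_ge0 ?exprn_ge0// ltW.
by rewrite sqrN; have [] := key n.
Qed.

End L2.
#[global] Hint Resolve N_ge0 : core.

(** * Lebesgue measure on R^n *)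

Section lebesgue_rV_theory.
Context {R : realType}.
Local Notation mu n := (lebesgue_rV R n).

Lemma measurable_rV_shift n (a : 'rV[R]_n) :
  measurable_fun setT (fun x : 'rV[R]_n => x + a).
Proof.
apply: measurable_fun_rVP => i.
under eq_fun do rewrite mxE.
apply: measurable_funD; last exact: measurable_cst.
exact: measurable_coord.
Qed.

Lemma lebesgue_measure_shift (a : R) (A : set R) : measurable A ->
  lebesgue_measure ((fun t => t + a) @^-1` A) = lebesgue_measure A.
Proof.
move=> mA.
have ms : measurable_fun setT (fun t : measurableTypeR R => (t + a : measurableTypeR R)).
  by apply: measurable_funD; [exact: measurable_id|exact: measurable_cst].
apply/esym.
have := @lebesgue_measure_unique R
  (measure_function_pushforward__canonical__measure_function_Measure
     (@lebesgue_measure R) ms).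
apply=> // _ [[x y]] _ <-.
change (lebesgue_measure (`]x, y]%classic : set R) =
  lebesgue_measure ((fun t : R => t + a) @^-1` `]x, y]%classic)).
rewrite (_ : _ @^-1` _ = `]x - a, y - a]%classic); last first.
  by apply/seteqP; split=> z /=; rewrite !in_itv /= ltrBlDr lerBrDr.
rewrite !lebesgue_measure_itv /= !lte_fin ltrD2r; case: ifP => // _.
by congr EFin; rewrite opprB addrA subrK.
Qed.

(** By induction on the dimension: a translation acts separately on the first coordinate and on the
    others, and a product measure is determined by its values on rectangles. *)
Lemma lebesgue_rV_shift n (a : 'rV[R]_n) (A : set 'rV[R]_n) : measurable A ->
  mu n ((fun x => x + a) @^-1` A) = mu n A.
Proof.
elim: n a A => [|n IH] a A mA.
  suff -> : (fun x : 'rV[R]_0 => x + a) @^-1` A = A by [].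
  by apply/seteqP; split=> x /=; rewrite (thinmx0 (x + a)) (thinmx0 x).
pose a0 : R := a ord0 ord0.
pose a' : 'rV[R]_n := \row_j a ord0 (lift ord0 j).
pose s (z : measurableTypeR R * 'rV[R]_n) : measurableTypeR R * 'rV[R]_n :=
  (z.1 + a0, z.2 + a').
have ms : measurable_fun setT s.
  apply/measurable_fun_pairP; split => /=.
    apply: measurable_funD; last exact: measurable_cst.
    exact: measurable_fst.
  apply: (measurableT_comp (measurable_rV_shift a')).
  exact: measurable_snd.
pose nu := ((@lebesgue_measure R) \x (mu n))%E.
have consE z : cons_rV z + a = cons_rV (s z).
  apply/rowP => i; rewrite mxE /cons_rV.
  have [j ->|j ->] := @split_ordP 1 n i.
    rewrite !(row_mxEl (n1:=1)) !mxE /s /a0 /=; congr (_ + a _ _).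
    by apply/val_inj; rewrite /= (ord1 j).
  rewrite !(row_mxEr (n1:=1)) /s mxE; congr (_ + _).
  by rewrite mxE; congr (a _ _); apply/val_inj.
have mcA : measurable (@cons_rV R n @^-1` A).
  by rewrite -[X in measurable X]setTI; exact: measurable_cons_rV.
rewrite /= /lebesgue_step /pushforward.
rewrite (_ : _ @^-1` (_ @^-1` A) = s @^-1` (@cons_rV R n @^-1` A)); last first.
  by apply/seteqP; split=> z /=; rewrite consE.
rewrite -/(pushforward nu s (@cons_rV R n @^-1` A)).
apply/esym.
apply: (@product_measure_unique _ _ _ _ _ _ _
  (measure_function_pushforward__canonical__measure_function_Measure
     _ ms)) => //.
move=> B C mB mC; rewrite /= /pushforward.
rewrite (_ : s @^-1` (B `*` C) =
  ((fun t : R => t + a0) @^-1` B) `*` ((fun v => v + a') @^-1` C))//.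
have mB' : measurable ((fun t : R => t + a0) @^-1` B).
  rewrite -[X in measurable X]setTI.
  have : measurable_fun setT (fun t : measurableTypeR R => (t + a0 : measurableTypeR R)).
    by apply: measurable_funD; [exact: measurable_id|exact: measurable_cst].
  exact.
have mC' : measurable ((fun v => v + a') @^-1` C).
  by rewrite -[X in measurable X]setTI; exact: measurable_rV_shift.
apply: etrans; first exact: product_measure1E.
by rewrite -(lebesgue_measure_shift a0 mB) -(IH a' C mC).
Qed.

Definition box n (a b : 'I_n -> R) : set 'rV[R]_n :=
  [set x | forall i, a i < x ord0 i < b i].

Lemma measurable_box n (a b : 'I_n -> R) : measurable (box a b).
Proof.
have -> : box a b = \big[setI/setT]_(i < n)
    ((fun x : 'rV[R]_n => x ord0 i) @^-1` `]a i, b i[%classic).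
  rewrite -bigcap_seq; apply/seteqP; split=> x /=.
    by move=> h i _ /=; rewrite in_itv /= h.
  by move=> h i; have := h i (mem_index_enum i); rewrite /= in_itv.
apply: bigsetI_measurable => i _; rewrite -[X in measurable X]setTI.
by apply: measurable_coord => //; exact: measurable_itv.
Qed.

Lemma lebesgue_rV_box n (a b : 'I_n -> R) : (forall i, a i <= b i) ->
  mu n (box a b) = (\prod_i (b i - a i))%:E.
Proof.
elim: n a b => [|n IH] a b ab.
  rewrite big_ord0 /= diracE mem_set//.
  by case.
rewrite /= /lebesgue_step /pushforward.
pose a' i := a (lift ord0 i); pose b' i := b (lift ord0 i).
rewrite (_ : cons_rV (n:=n) @^-1` _ = (`]a ord0, b ord0[%classic : set (measurableTypeR R)) `*` box a' b').
  apply: etrans.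
    by apply: product_measure1E; [exact: measurable_itv|exact: measurable_box].
  rewrite [X in (_ * X)%E]IH; last by move=> i; exact: ab.
  set L := (X in (X * _)%E).
  have -> : L = if a ord0 < b ord0 then (b ord0 - a ord0)%:E else 0%:E.
    apply: etrans; first exact: (lebesgue_measure_itv `]a ord0, b ord0[).
    by rewrite /= lte_fin EFinB.
  rewrite big_ord_recl.
  case: ltP => h; first by rewrite -EFinM.
  by rewrite mul0e (_ : b ord0 = a ord0) ?subrr ?mul0r//; apply/eqP; rewrite eq_le h ab.
have c0 z : @cons_rV R n z ord0 ord0 = z.1.
  have -> : ord0 = lshift n (ord0 : 'I_1) by exact/val_inj.
  by rewrite /cons_rV (row_mxEl (n1:=1)) mxE.
have cS z i : @cons_rV R n z ord0 (lift ord0 i) = z.2 ord0 i.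
  have -> : lift ord0 i = rshift 1 i by exact/val_inj.
  by rewrite /cons_rV (row_mxEr (n1:=1)).
apply/seteqP; split=> z /=.
  move=> h; split; first by have := h ord0; rewrite c0 /= in_itv.
  by move=> i; have := h (lift ord0 i); rewrite cS.
move=> [h1 h2] i; have [j ->|->] := unliftP ord0 i.
  by rewrite cS; exact: h2.
by rewrite c0; move: h1; rewrite /= in_itv.
Qed.

(** The norm on row vectors is the maximum norm, so its balls are cubes. *)
Lemma rV_norm_lt n (x : 'rV[R]_n) e : 0 < e ->
  (forall i, `|x ord0 i| < e) -> `|x| < e.
Proof.
move=> e0 h.
have : ball (0 : 'rV[R]_n) e x.
  split=> // i j; rewrite (ord1 i) mxE -ball_normE /ball_ /= sub0r normrN; exact: h.
by rewrite mx_norm_ball /ball_ /= sub0r normrN.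
Qed.

Lemma rV_coord_lt n (x : 'rV[R]_n) e i : `|x| < e -> `|x ord0 i| < e.
Proof.
move=> h.
have : ball (0 : 'rV[R]_n) e x by rewrite mx_norm_ball /ball_ /= sub0r normrN.
by move=> [_ /(_ ord0 i)]; rewrite mxE -ball_normE /ball_ /= sub0r normrN.
Qed.

Lemma rV_coord_le n (x : 'rV[R]_n) i : `|x ord0 i| <= `|x|.
Proof.
by apply/ler_addgt0Pr => e e0; apply/ltW/rV_coord_lt; rewrite ltrDl.
Qed.

Lemma rV_rat_dense n (x : 'rV[R]_n) e : 0 < e ->
  exists q : 'rV[rat]_n, `|x - map_mx ratr q| < e.
Proof.
move=> e0.
have h i : exists q : rat, `|x ord0 i - ratr q| < e.
  have : x ord0 i - e < x ord0 i by rewrite ltrBlDr ltrDl.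
  move=> /rat_in_itvoo[q]; rewrite in_itv /= => /andP[a b]; exists q.
  by rewrite gtr0_norm ?subr_gt0// ltrBlDr addrC -ltrBlDr.
have [q hq] := choice h.
exists (\row_i q i); apply: rV_norm_lt => // i; rewrite !mxE; exact: hq.
Qed.

(** The sigma-algebra is generated by the coordinates and not by the topology. The link is that an
    open set is the countable union of the cubes with rational centre and radius 1/(k+1) that it
    contains. *)
Lemma open_rV_measurable n (U : set 'rV[R]_n) : open U -> measurable U.
Proof.
move=> oU.
pose cb (z : 'rV[rat]_n * nat) : set 'rV[R]_n :=
  box (fun i => ratr (z.1 ord0 i) - z.2.+1%:R^-1) (fun i => ratr (z.1 ord0 i) + z.2.+1%:R^-1).
pose F z := if `[< cb z `<=` U >] then cb z else set0.
have -> : U = \bigcup_z F z.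
  apply/seteqP; split=> x; last first.
    by move=> [z _]; rewrite /F; case: asboolP => // h; exact: h.
  move=> Ux.
  have [e /= e0 Ue] : exists2 e : R, 0 < e & ball x e `<=` U.
    by move: (oU); rewrite openE => /(_ x Ux)/nbhs_ballP.
  have [k hk] : exists k : nat, k.+1%:R^-1 < e / 2.
    have /ltr_add_invr[k hk] : 0 < e / 2 by rewrite divr_gt0.
    by exists k; rewrite add0r in hk.
  have [q hq] : exists q : 'rV[rat]_n, `|x - map_mx ratr q| < k.+1%:R^-1.
    by apply: rV_rat_dense; rewrite invr_gt0.
  exists (q, k) => //; rewrite /F.
  have qx i : `|x ord0 i - ratr (q ord0 i)| < k.+1%:R^-1.
    by have := rV_coord_lt i hq; rewrite !mxE.
  rewrite asboolT.
    move=> i /=; have := qx i; rewrite ltr_norml; move: (ratr _) k.+1%:R^-1 => r c.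
    by move=> /andP[? ?]; apply/andP; split; lra.
  move=> y yq; apply: Ue; rewrite mx_norm_ball /ball_ /=; apply: rV_norm_lt => // i.
  rewrite !mxE; have := yq i; have := qx i; rewrite /= !ltr_norml.
  move: (ratr _) k.+1%:R^-1 hk => r c.
  by move=> ? /andP[? ?] /andP[? ?]; apply/andP; split; lra.
apply: countable_bigcupT_measurable; first exact: countableP.
by move=> z; rewrite /F; case: asboolP => // _; exact: measurable_box.
Qed.

Lemma continuous_rV_measurable n (f : 'rV[R]_n -> R) : continuous f ->
  measurable_fun setT f.
Proof.
move=> /continuousP cf; apply: (measurability _ (RGenOpens.measurableE R)).
move=> _ [_ [a [b ->] <-]]; rewrite setTI; apply: open_rV_measurable.
by apply: cf; exact: interval_open.
Qed.

Lemma integral_rV_shift n (a : 'rV[R]_n) (f : 'rV[R]_n -> \bar R) :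
  measurable_fun setT f ->
  (\int[mu n]_x f (x + a)%R = \int[mu n]_x f x)%E.
Proof.
have ge0 (g : 'rV[R]_n -> \bar R) : measurable_fun setT g -> (forall x, 0 <= g x)%E ->
    (\int[mu n]_x g (x + a)%R = \int[mu n]_x g x)%E.
  move=> mg g0.
  have := @ge0_integral_pushforward _ _ _ _ R _ (measurable_rV_shift a) (mu n) setT g measurableT mg.
  move=> <-; last by move=> x _; exact: g0.
  apply: eq_measure_integral; first exact: measurable_rV_shift.
  move=> mS A mA _; exact: (lebesgue_rV_shift a mA).
move=> mf; rewrite integralE [RHS]integralE; congr (_ - _)%E.
  transitivity (\int[mu n]_x (f^\+ (x + a)%R))%E.
    by apply: eq_integral => x _; rewrite !funeposE.
  by apply: ge0; [exact: measurable_funepos|move=> x; exact: funepos_ge0].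
transitivity (\int[mu n]_x (f^\- (x + a)%R))%E.
  by apply: eq_integral => x _; rewrite !funenegE.
by apply: ge0; [exact: measurable_funeneg|move=> x; exact: funeneg_ge0].
Qed.

Lemma Rintegral_rV_shift n (a : 'rV[R]_n) (f : 'rV[R]_n -> R) :
  measurable_fun setT f ->
  \int[mu n]_x f (x + a) = \int[mu n]_x f x.
Proof.
move=> mf; congr fine; apply: (@integral_rV_shift n a (EFin \o f)).
exact/measurable_EFinP.
Qed.

End lebesgue_rV_theory.

(** * Smooth functions *)

Section smooth1.
Context {R : realType}.
Implicit Types f g : R -> R.

(** Each derivative is given as a witness, so closure under sums, products, inverses and affine
    substitution is an induction on k that never mentions [derive1]. *)
Fixpoint C1k (k : nat) (g : R -> R) : Prop :=
  if k is k'.+1 then exists2 g', (forall t, is_derive t (1 : R) g (g' t)) & C1k k' g'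
  else True.

Definition smooth1 g := forall k, C1k k g.

Lemma C1kS k g : C1k k.+1 g -> C1k k g.
Proof.
elim: k g => [//|k IH] g [g' dg] /IH Cg'.
by exists g'.
Qed.

Lemma C1k_cst k (c : R) : C1k k (cst c).
Proof.
elim: k c => [//|k IH] c; exists (cst 0) => // t; exact: is_derive_cst.
Qed.

Lemma C1kD k f g : C1k k f -> C1k k g -> C1k k (f \+ g).
Proof.
elim: k f g => [//|k IH] f g [f' df Cf] [g' dg Cg].
exists (f' \+ g'); last exact: IH.
by move=> t; apply: is_deriveD.
Qed.

Lemma C1kM k f g : C1k k f -> C1k k g -> C1k k (f \* g).
Proof.
elim: k f g => [//|k IH] f g Cf Cg.
have Cf1 := C1kS Cf; have Cg1 := C1kS Cg.
case: Cf => f' df Cf; case: Cg => g' dg Cg.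
exists ((f \* g') \+ (g \* f')); last by apply: C1kD; apply: IH.
by move=> t; apply: is_deriveM.
Qed.

Lemma C1kN k f : C1k k f -> C1k k (fun t => - f t).
Proof.
move=> Cf; rewrite (_ : (fun t => - f t) = cst (-1) \* f).
  by apply: C1kM => //; exact: C1k_cst.
by apply/funext => t /=; rewrite mulN1r.
Qed.

Lemma C1kV k f : (forall t, f t != 0) -> C1k k f -> C1k k (fun t => (f t)^-1).
Proof.
move=> f0; elim: k => [//|k IH] Cf.
have Cf1 := IH (C1kS Cf); case: Cf => f' df Cf.
exists (fun t => - (((f t)^-1 * (f t)^-1) * f' t)).
  move=> t; have := @is_deriveV R f t (f' t) 1 (f0 t) (df t).
  move=> h; apply: (is_derive_eq h); rewrite /GRing.scale /= expr2 invfM; ring.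
by apply: C1kN; apply: C1kM => //; apply: C1kM.
Qed.

Lemma C1k_affine k f (a b : R) : C1k k f -> C1k k (fun t => f (a * t + b)).
Proof.
elim: k f => [//|k IH] f [f' df Cf].
exists (fun t => f' (a * t + b) * a).
  move=> t.
  have da : is_derive t (1 : R) (fun t => a * t + b) a.
    apply: is_derive_eq; rewrite /GRing.scale /=; ring.
  exact: (is_derive1_comp (df _) da).
rewrite (_ : (fun t => _) = (fun t => f' (a * t + b)) \* cst a)//.
by apply: C1kM; [exact: IH|exact: C1k_cst].
Qed.

Lemma smooth1_derive f : smooth1 f -> smooth1 (derive1 f).
Proof.
move=> sf k; have [f' df Cf] := sf k.+1.
suff -> : derive1 f = f' by [].
by apply/funext => t; rewrite derive1E; exact: derive_val.
Qed.

Lemma smooth1_is_derive f t : smooth1 f -> is_derive t (1 : R) f (derive1 f t).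
Proof.
move=> /(_ 1%N)[f' df _]; rewrite derive1E; apply: derivableP.
by have [] := df t.
Qed.

Lemma smooth1_continuous f : smooth1 f -> continuous f.
Proof.
move=> /(_ 1%N)[f' df _] t; apply: differentiable_continuous.
by apply/derivable1_diffP; have [] := df t.
Qed.

Lemma smooth1_cos_sin (a b : R) : smooth1 (fun t => a * cos t + b * sin t).
Proof.
move=> k; elim: k a b => [//|k IH] a b.
exists (fun t => b * cos t + (- a) * sin t) => // t.
by apply: is_derive_eq; rewrite /GRing.scale /=; ring.
Qed.

(** The family P(1/t) exp(-1/t) is closed under differentiation: the derivative belongs to the
    polynomial X^2 (P - P'). Smoothness, also at 0, is then an induction over the family. *)
Definition flat (P : {poly R}) (t : R) : R :=
  if 0 < t then P.[t^-1] * expR (- t^-1) else 0.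

Lemma poly_bound (P : {poly R}) : exists C, forall s, 1 <= s ->
  `|P.[s]| <= C * s ^+ size P.
Proof.
exists (\sum_(i < size P) `|P`_i|) => s s1.
rewrite horner_coef mulr_suml; apply: le_trans (ler_norm_sum _ _ _) _.
apply: ler_sum => i _; rewrite normrM ler_wpM2l// normrX ger0_norm; last lra.
by apply: ler_weXn2l => //; exact: ltnW.
Qed.

Lemma flat_bound (P : {poly R}) : exists C, forall t, `|t| <= 1 ->
  `|flat P t| <= C * t ^+ 2.
Proof.
have [C hC] := poly_bound P.
(* exp(-1/t) <= m! t^m by one term of the exponential series; this m absorbs P(1/t) and leaves t^2,
   so the difference quotient at 0 tends to 0. *)
have [m mE] : exists m, m = (size P).+2 by eexists.
exists (`|C| * m`!%:R) => t t1; rewrite /flat; case: ltP => t0; last first.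
  by rewrite normr0 mulr_ge0 ?sqr_ge0// mulr_ge0.
have ti1 : 1 <= t^-1 by rewrite -invr1 lef_pV2 ?posrE// (le_trans (ler_norm _) t1).
have ti0 : 0 < t^-1 by rewrite invr_gt0.
have e1 : t^-1 ^+ m / m`!%:R <= expR t^-1.
  by rewrite mE; have := @expR_ge1Dxn _ _ (size P).+1 (ltW ti0); apply: le_trans; rewrite lerDr.
have e2 : expR (- t^-1) <= m`!%:R * t ^+ m.
  have f0 : 0 < (m`!%:R : R) by rewrite ltr0n fact_gt0.
  rewrite expRN -[leRHS]invrK lef_pV2 ?posrE ?expR_gt0 ?invr_gt0 ?mulr_gt0 ?exprn_gt0//.
  by rewrite invfM -exprVn mulrC.
rewrite normrM [`|expR _|]ger0_norm ?expR_ge0//.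
apply: le_trans (ler_pM (normr_ge0 _) (expR_ge0 _) (hC _ ti1) e2) _.
apply: (@le_trans _ _ (`|C| * t^-1 ^+ size P * (m`!%:R * t ^+ m))).
  apply: ler_wpM2r; first by rewrite mulr_ge0// exprn_ge0// ltW.
  by apply: ler_wpM2r; [rewrite exprn_ge0// ltW|exact: ler_norm].
rewrite le_eqVlt; apply/orP; left; apply/eqP.
rewrite mE -addn2 exprD exprVn; field.
by rewrite expf_neq0// gt_eqF.
Qed.

Lemma is_derive_flat (P : {poly R}) t :
  is_derive t (1 : R) (flat P) (flat ('X^2 * P - 'X^2 * P^`()) t).
Proof.
have [t0|t0|->] := ltgtP t 0.
- have -> : flat ('X^2 * P - 'X^2 * P^`()) t = 0 by rewrite /flat ltNge ltW.
  apply: (near_eq_is_derive _ (is_derive_cst (0 : R) t 1)).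
  near=> z; rewrite /flat ltNge.
  suff -> : z <= 0 by [].
  by apply/ltW; near: z; exact: lt_nbhsl.
- pose g (z : R) := P.[z^-1] * expR (- z^-1).
  have gf : \near t, g t = flat P t.
    near=> z; rewrite /flat /g.
    suff -> : 0 < z by [].
    by near: z; exact: lt_nbhsr.
  have tn0 : t != 0 by rewrite gt_eqF.
  have di : is_derive t (1 : R) (fun z : R => z^-1) (- (t^-1 ^+ 2)).
    have := @is_deriveV R id t 1 1 tn0 (is_derive_id _ _).
    by move=> h; apply: (is_derive_eq h); rewrite /GRing.scale /= mulr1 exprVn.
  have dP := is_derive1_comp (is_derive_poly P t^-1) di.
  have dN : is_derive t (1 : R) (fun z : R => - z^-1) (- - t^-1 ^+ 2) := is_deriveN di.
  have dE := is_derive1_comp (g := fun z : R => - z^-1) (is_derive_expR (- t^-1)) dN.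
  apply: (near_eq_is_derive gf).
  apply: (is_derive_eq (is_deriveM dP dE)).
  rewrite /flat t0 /= /GRing.scale /= !hornerE /=; ring.
- have -> : flat ('X^2 * P - 'X^2 * P^`()) 0 = 0 by rewrite /flat ltxx.
  apply/is_derive1_caratheodory; exists (fun z => flat P z / z); split.
  + move=> z; rewrite subr0 {2}/flat ltxx subr0.
    have [->|z0] := eqVneq z 0; first by rewrite mulr0 /flat ltxx.
    by rewrite divfK.
  + have [C hC] := flat_bound P.
    have f0 : flat P 0 = 0 by rewrite /flat ltxx.
    apply/cvgrPdist_lt => e e0; near=> z; rewrite /= f0 mul0r sub0r normrN.
    have [->|z0] := eqVneq z 0; first by rewrite invr0 mulr0 normr0.
    have z1 : `|z| <= 1.
      by near: z; exists 1 => //= z; rewrite /= sub0r normrN => /ltW.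
    have ze : `|z| < e / (`|C| + 1).
      near: z; exists (e / (`|C| + 1)); first by rewrite /= divr_gt0// ltr_wpDl.
      by move=> z; rewrite /= sub0r normrN.
    rewrite normrM normfV ltr_pdivrMr ?normr_gt0//.
    apply: le_lt_trans (hC z z1) _.
    apply: (@le_lt_trans _ _ (`|C| * `|z| * `|z|)).
      rewrite -mulrA -expr2 real_normK ?num_real// ler_wpM2r ?sqr_ge0//; exact: ler_norm.
    rewrite ltr_pM2r ?normr_gt0//.
    move: ze; rewrite ltr_pdivlMr ?ltr_wpDl// mulrDr mulr1 mulrC.
    by apply: le_lt_trans; rewrite lerDl.
  + by rewrite /flat ltxx mul0r.
Unshelve. all: by end_near. Qed.

Lemma smooth1_flat P : smooth1 (flat P).
Proof.
move=> k; elim: k P => [//|k IH] P.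
by exists (flat ('X^2 * P - 'X^2 * P^`())); [exact: is_derive_flat|exact: IH].
Qed.

Definition psi : R -> R := flat 1.

Lemma psi_ge0 t : 0 <= psi t.
Proof. by rewrite /psi /flat; case: ifP => // _; rewrite hornerC mul1r expR_ge0. Qed.

Lemma psi_gt0 t : 0 < t -> 0 < psi t.
Proof. by rewrite /psi /flat => ->; rewrite hornerC mul1r expR_gt0. Qed.

Lemma psi_le0 t : t <= 0 -> psi t = 0.
Proof. by move=> t0; rewrite /psi /flat ltNge t0. Qed.

Lemma psi_le1 t : psi t <= 1.
Proof.
rewrite /psi /flat; case: ifP => // t0; rewrite hornerC mul1r -expR0 ler_expR.
by rewrite oppr_le0 invr_ge0 ltW.
Qed.

Lemma smooth1_psi : smooth1 psi. Proof. exact: smooth1_flat. Qed.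

(** A smooth step from 0 (for t <= 0) to 1 (for t >= 1). Its derivative is the mollifier of Morrey's
    estimate. *)
Definition theta (t : R) := psi t / (psi t + psi (1 - t)).

Lemma theta_den_gt0 t : 0 < psi t + psi (1 - t).
Proof.
have [t0|t0] := ltP 0 t; first by rewrite ltr_pwDl ?psi_gt0 ?psi_ge0.
by rewrite ltr_wpDl ?psi_ge0// psi_gt0//; lra.
Qed.

Lemma smooth1_theta : smooth1 theta.
Proof.
move=> k; apply: C1kM; first exact: smooth1_psi.
apply: C1kV; first by move=> t; rewrite gt_eqF ?theta_den_gt0.
apply: C1kD; first exact: smooth1_psi.
rewrite (_ : (fun t => psi (1 - t)) = (fun t => psi (-1 * t + 1))).
  by apply: C1k_affine; exact: smooth1_psi.
by apply/funext => t; rewrite mulN1r addrC.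
Qed.

Lemma theta_le0 t : t <= 0 -> theta t = 0.
Proof. by move=> t0; rewrite /theta psi_le0// mul0r. Qed.

Lemma theta_ge1 t : 1 <= t -> theta t = 1.
Proof.
move=> t1; rewrite /theta (psi_le0 (t := 1 - t)) ?subr_le0// addr0 divff//.
by rewrite gt_eqF// psi_gt0//; lra.
Qed.

End smooth1.

(** * Smooth functions of several variables *)

Section smooth_rV.
Context {R : realType} {n : nat}.
Local Notation V := 'rV[R]_n.
Local Notation e_ i := (delta_mx ord0 i : 'rV[R]_n).
Implicit Types (f g : V -> R) (i j : 'I_n).

(** Continuity is demanded at every order, since it does not follow from the existence of partial
    derivatives. *)
Fixpoint Ck k f : Prop := continuous f /\
  if k is k'.+1 then forall i, (forall x, derivable f x (e_ i)) /\ Ck k' (partial i f)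
  else True.

Definition smooth f := forall k, Ck k f.

Lemma Ck_continuous k f : Ck k f -> continuous f.
Proof. by case: k => [|k] []. Qed.

Lemma Ck_S k f : Ck k.+1 f -> Ck k f.
Proof.
elim: k f => [|k IH] f [cf h]; first by split.
split=> // i; have [h1 h2] := h i; split=> //; exact: IH.
Qed.

Lemma Ck_intro k f (F : 'I_n -> V -> R) : continuous f ->
  (forall i x, is_derive x (e_ i) f (F i x)) -> (forall i, Ck k (F i)) -> Ck k.+1 f.
Proof.
move=> cf dF CF; split=> // i; split; first by move=> x; exact: ex_derive.
rewrite (_ : partial i f = F i); first exact: CF.
by apply/funext => x; exact: derive_val.
Qed.

Lemma Ck_elim k f : Ck k.+1 f -> [/\ continuous f,
  forall i x, is_derive x (e_ i) f (partial i f x) & forall i, Ck k (partial i f)].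
Proof.
move=> [cf h]; split=> // i; have [h1 h2] := h i; last by [].
by move=> x; exact: derivableP.
Qed.

Lemma smooth_continuous f : smooth f -> continuous f.
Proof. by move=> /(_ 0%N); exact: Ck_continuous. Qed.

Lemma smooth_is_derive f i x : smooth f -> is_derive x (e_ i) f (partial i f x).
Proof. by move=> /(_ 1%N) /Ck_elim[]. Qed.

Lemma smooth_partial f i : smooth f -> smooth (partial i f).
Proof. by move=> sf k; have /Ck_elim[_ _] := sf k.+1. Qed.

Lemma smooth_iter_partialP f : smooth f <->
  (forall s, continuous (iter_partial s f)) /\
  (forall s i x, derivable (iter_partial s f) x (e_ i)).
Proof.
split=> [sf|[h1 h2] k].
  have sfs s : smooth (iter_partial s f).
    by elim: s => [//|i s IH] /=; exact: smooth_partial.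
  split=> [s|s i x]; first exact: smooth_continuous.
  by have [] := smooth_is_derive i x (sfs s).
rewrite -[f]/(iter_partial [::] f).
elim: k [::] => [|k IH] s; split=> // i; split; first exact: h2.
exact: (IH (i :: s)).
Qed.

Lemma Ck_cst k (c : R) : Ck k (cst c).
Proof.
elim: k c => [|k IH] c; first by split=> //; exact: cst_continuous.
by apply: (@Ck_intro _ _ (fun=> cst 0)) => //; exact: cst_continuous.
Qed.

Lemma CkD k f g : Ck k f -> Ck k g -> Ck k (f + g).
Proof.
elim: k f g => [|k IH] f g.
  by move=> [cf _] [cg _]; split=> // x; apply: continuousD; [exact: cf|exact: cg].
move=> /Ck_elim[cf df Cf] /Ck_elim[cg dg Cg].
apply: (@Ck_intro _ _ (fun i => partial i f + partial i g)).
- by move=> x; apply: continuousD; [exact: cf|exact: cg].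
- by move=> i; exact: IH.
Qed.

Lemma CkM k f g : Ck k f -> Ck k g -> Ck k (f \* g).
Proof.
elim: k f g => [|k IH] f g.
  by move=> [cf _] [cg _]; split=> // x; apply: continuousM; [exact: cf|exact: cg].
move=> Cf Cg; have Cf1 := Ck_S Cf; have Cg1 := Ck_S Cg.
move: Cf Cg => /Ck_elim[cf df Cf] /Ck_elim[cg dg Cg].
apply: (@Ck_intro _ _ (fun i => f \* partial i g + g \* partial i f)).
- by move=> x; apply: continuousM; [exact: cf|exact: cg].
- by move=> i; apply: CkD; apply: IH.
Qed.

Lemma smooth_cst c : smooth (cst c). Proof. by move=> k; exact: Ck_cst. Qed.
Lemma smoothD f g : smooth f -> smooth g -> smooth (f + g).
Proof. by move=> sf sg k; exact: CkD. Qed.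
Lemma smoothM f g : smooth f -> smooth g -> smooth (f \* g).
Proof. by move=> sf sg k; exact: CkM. Qed.
Lemma smoothZ (a : R) f : smooth f -> smooth (cst a \* f).
Proof. by apply: smoothM; exact: smooth_cst. Qed.

Lemma smooth_prod (I : Type) (r : seq I) (f : I -> V -> R) :
  (forall k, smooth (f k)) -> smooth (fun x => \prod_(i <- r) f i x).
Proof.
move=> sf; elim: r => [|i r IH].
  rewrite (_ : (fun x => _) = cst 1); first exact: smooth_cst.
  by apply/funext => x; rewrite big_nil.
rewrite (_ : (fun x => _) = f i \* (fun x => \prod_(i <- r) f i x)).
  exact: smoothM.
by apply/funext => x; rewrite big_cons.
Qed.

(** A derivative depends on the difference quotients alone. This transports derivatives to lines and
    along translations without any chain rule. *)
Lemma derive_eq_quot (V1 V2 : normedModType R) (f : V1 -> R) (g : V2 -> R) x v y w :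
  (forall h : R, f (h *: v + x) - f x = g (h *: w + y) - g y) ->
  'D_v f x = 'D_w g y /\ (derivable f x v -> derivable g y w).
Proof.
move=> h.
have E : (fun h : R => h^-1 *: ((f \o shift x) (h *: v) - f x)) =
    (fun h : R => h^-1 *: ((g \o shift y) (h *: w) - g y)).
  by apply/funext => t /=; rewrite h.
split; first exact: (congr1 (fun q : R -> R => lim (q @ 0^')) E).
by rewrite /derivable => df; exact: (eq_ind _ (fun q : R -> R => cvg (q @ 0^')) df _ E).
Qed.

Lemma line_quot f (x v : V) (t h : R) :
  f (h *: v + (t *: v + x)) - f (t *: v + x) =
  (fun s : R => f (s *: v + x)) (h *: 1 + t) - (fun s : R => f (s *: v + x)) t.
Proof. by rewrite [h *: 1]mulr1 scalerDl -!addrA. Qed.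

Lemma is_derive_line f (x v : V) (t D : R) : is_derive (t *: v + x) v f D ->
  is_derive t (1 : R) (fun s : R => f (s *: v + x)) D.
Proof.
move=> [df Df].
have [E1 E2] := derive_eq_quot (@line_quot f x v t).
by split; [exact: E2|rewrite -E1].
Qed.

Lemma is_derive_line0 f (x v : V) (D : R) :
  is_derive (0 : R) (1 : R) (fun s : R => f (s *: v + x)) D -> is_derive x v f D.
Proof.
move=> [df Df]; split; first exact/derivable1P.
have [E1 _] := derive_eq_quot (@line_quot f x v 0).
by rewrite -Df -E1 scale0r add0r.
Qed.

Lemma is_derive_coord (g : R -> R) (D : R) (x : V) i j :
  is_derive (x ord0 i) (1 : R) g D ->
  is_derive x (e_ j) (fun x : V => g (x ord0 i)) ((j == i)%:R * D).
Proof.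
move=> dg; apply: is_derive_line0.
have da : is_derive (0 : R) (1 : R) (fun s : R => s * (j == i)%:R + x ord0 i) (j == i)%:R.
  by apply: is_derive_eq; rewrite /GRing.scale /=; ring.
have dg' : is_derive (0 * (j == i)%:R + x ord0 i) (1 : R) g D by rewrite mul0r add0r.
have := is_derive1_comp (g := fun s : R => s * (j == i)%:R + x ord0 i) dg' da.
rewrite mulrC; congr (is_derive _ _ _ _); apply/funext => s /=.
by rewrite !mxE eqxx /= eq_sym.
Qed.

Lemma Ck_coord k (g : R -> R) i : C1k k.+1 g -> Ck k (fun x : V => g (x ord0 i)).
Proof.
have ct (g0 : R -> R) k0 : C1k k0.+1 g0 -> continuous (fun x : V => g0 (x ord0 i)).
  move=> [g' dg _] x; apply: (@continuous_comp _ _ _ (fun x : V => x ord0 i) g0).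
    exact: coord_continuous.
  by apply: differentiable_continuous; apply/derivable1_diffP; have [] := dg (x ord0 i).
elim: k g => [|k IH] g Cg; first by split=> //; exact: ct Cg.
have := Cg => -[g' dg Cg'].
apply: (@Ck_intro _ _ (fun j => cst (j == i)%:R \* (fun x => g' (x ord0 i)))).
- exact: ct Cg.
- by move=> j x; apply: is_derive_coord; exact: dg.
- by move=> j; apply: CkM; [exact: Ck_cst|exact: IH].
Qed.

Lemma smooth_coord (g : R -> R) i : smooth1 g -> smooth (fun x : V => g (x ord0 i)).
Proof. by move=> sg k; exact: Ck_coord. Qed.

Lemma is_derive_shift_rV f (a x v : V) :
  'D_v (fun y => f (y + a)) x = 'D_v f (x + a) /\
  (derivable f (x + a) v -> derivable (fun y => f (y + a)) x v).
Proof.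
have E h : f (h *: v + (x + a)) - f (x + a) =
  (fun y => f (y + a)) (h *: v + x) - (fun y => f (y + a)) x by rewrite addrA.
by have [-> ?] := derive_eq_quot (f := f) (g := fun y => f (y + a)) (x := x + a)
  (v := v) (y := x) (w := v) E.
Qed.

Lemma Ck_shift k f (a : V) : Ck k f -> Ck k (fun y => f (y + a)).
Proof.
have ct g : continuous g -> continuous (fun y : V => g (y + a)).
  move=> cg x; apply: (@continuous_comp _ _ _ (fun y : V => y + a) g); last exact: cg.
  by apply: continuousD; [exact: cvg_id|exact: cst_continuous].
elim: k f => [|k IH] f; first by move=> [cf _]; split=> //; exact: ct.
move=> /Ck_elim[cf df Cf].
apply: (@Ck_intro _ _ (fun i x => partial i f (x + a))); first exact: ct.
  move=> i x; have [d1 d2] := df i (x + a); have [E1 E2] := is_derive_shift_rV f a x (e_ i).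
  by split; [exact: E2|rewrite E1 d2].
by move=> i; exact: IH.
Qed.

Lemma smooth_shift f (a : V) : smooth f -> smooth (fun y => f (y + a)).
Proof. by move=> sf k; exact: Ck_shift. Qed.

Lemma partial_shift f (a : V) i :
  partial i (fun y => f (y + a)) = (fun x => partial i f (x + a)).
Proof. by apply/funext => x; have [] := is_derive_shift_rV f a x (e_ i). Qed.

Lemma partialD f g i : smooth f -> smooth g ->
  partial i (f + g) = partial i f + partial i g.
Proof.
move=> sf sg; apply/funext => x; apply: derive_val.
by apply: is_deriveD; exact: smooth_is_derive.
Qed.

Lemma partialM f g i : smooth f -> smooth g ->
  partial i (f \* g) = f \* partial i g + g \* partial i f.
Proof.
move=> sf sg; apply/funext => x; apply: derive_val.
by apply: is_deriveM; exact: smooth_is_derive.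
Qed.

Lemma partialZ (a : R) f i : smooth f -> partial i (cst a \* f) = cst a \* partial i f.
Proof.
move=> sf; rewrite partialM//; last exact: smooth_cst.
apply/funext => x; rewrite [LHS]/(_ + _) /= [partial i (cst a) x](derive_cst _ _ _).
by rewrite mulr0; exact: addr0.
Qed.

Lemma mean_value f i (x : V) (h : R) : smooth f ->
  exists2 c : R, `|c| <= `|h| & f (x + h *: e_ i) - f x = partial i f (x + c *: e_ i) * h.
Proof.
move=> sf.
pose F (t : R) := f (t *: e_ i + x).
have dF t : is_derive t (1 : R) F (partial i f (t *: e_ i + x)).
  by apply: is_derive_line; exact: smooth_is_derive.
have cF : continuous F.
  by move=> t; apply: differentiable_continuous; apply/derivable1_diffP; have [] := dF t.
have mvt a b : a < b -> exists2 c, a < c < b & F b - F a = partial i f (c *: e_ i + x) * (b - a).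
  move=> ab; have [|c] := MVT ab (fun t _ => dF t).
    by apply: continuous_subspaceT.
  by rewrite in_itv /= => ac ->; exists c.
have [h0|h0|->] := ltgtP h 0; last first.
- by exists 0; rewrite ?scale0r ?addr0 ?subrr ?mulr0.
- have [c /andP[c0 ch]] := mvt 0 h h0; rewrite /F scale0r add0r subr0 => E.
  exists c; first by rewrite !gtr0_norm// ltW.
  by rewrite [x + c *: _]addrC -E [x + _]addrC.
- have [c /andP[c0 ch]] := mvt h 0 h0; rewrite /F scale0r add0r sub0r => E.
  exists c; first by rewrite !ltr0_norm// lerN2 ltW.
  rewrite [x + c *: _]addrC -[LHS]opprK opprB [x + h *: _]addrC E; ring.
Qed.

End smooth_rV.

(** * Test functions *)

Lemma integrable_indic_lty d (T : measurableType d) (R : realType)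
    (mu : {measure set T -> \bar R}) (A : set T) :
  measurable A -> (mu A < +oo)%E -> mu.-integrable setT (EFin \o \1_A).
Proof.
move=> mA Aoo; apply/integrableP; split.
  by apply/measurable_EFinP; exact: measurable_indic.
rewrite (eq_integral (fun x => (\1_A x)%:E)); last first.
  by move=> t _; rewrite gee0_abs// lee_fin.
by rewrite integral_indic// setIT.
Qed.

Section tests.
Context {R : realType} {n : nat}.
Local Notation V := 'rV[R]_n.
Local Notation e_ i := (delta_mx ord0 i : 'rV[R]_n).
Local Notation mu := (lebesgue_rV R n).
Implicit Types (f g : V -> R) (i j : 'I_n).

(** [test_function] with vanishing outside a ball in place of compact support; the two agree by
    Heine-Borel ([tstP]). *)
Definition tst f := smooth f /\ exists L : R, forall x, L < `|x| -> f x = 0.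

Lemma rV_norm_open (L : R) : open [set x : V | L < `|x|].
Proof.
have -> : [set x : V | L < `|x|] = (fun x : V => `|x|) @^-1` `]L, +oo[%classic.
  by apply/seteqP; split=> x /=; rewrite in_itv /= andbT.
apply: open_comp; last exact: interval_open.
by move=> x _; exact: norm_continuous.
Qed.

Lemma tstP f : test_function f <-> tst f.
Proof.
split=> [[h1 h2 cf]|[sf [L fL]]].
  split; first by apply/smooth_iter_partialP; split.
  have [M [_ hM]] := compact_bounded cf.
  exists (M + 1) => x Mx; apply/eqP/negPn/negP => fx.
  have := hM (M + 1) (ltr_pwDr ltr01 (lexx _)) x.
  by move=> /(_ (@subset_closure _ [set x | f x != 0] x fx)) /=; rewrite leNgt Mx.
have [h1 h2] := (smooth_iter_partialP f).1 sf.
split=> //; apply: bounded_closed_compact; last exact: closed_closure.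
have sub : closure [set x | f x != 0] `<=` [set x : V | `|x| <= L].
  rewrite closureE => x; apply; split; last first.
    by move=> y /= fy; rewrite leNgt; apply/negP => /fL /eqP; exact/negP.
  rewrite (_ : [set x : V | `|x| <= L] = ~` [set x : V | L < `|x|]).
    by apply: open_closedC; exact: rV_norm_open.
  by apply/seteqP; split=> y /=; rewrite leNgt => /negP.
exists L; split; first exact: num_real.
by move=> M LM x /sub /= h; rewrite (le_trans h)// ltW.
Qed.

Lemma tst_smooth f : tst f -> smooth f. Proof. by case. Qed.

Lemma tst_partial f i : tst f -> tst (partial i f).
Proof.
move=> [sf [L fL]]; split; first exact: smooth_partial.
exists L => x Lx; apply: derive_val.
apply: (near_eq_is_derive _ (is_derive_cst (0 : R) x (e_ i))).
have := @rV_norm_open L; rewrite openE => /(_ x Lx).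
by apply: filterS => y /= /fL ->.
Qed.

Lemma tstD f g : tst f -> tst g -> tst (f + g).
Proof.
move=> [sf [L fL]] [sg [L' gL]]; split; first exact: smoothD.
exists (Num.max L L') => x; rewrite gt_max => /andP[Lx L'x].
by change (f x + g x = 0); rewrite (fL x Lx) (gL x L'x) addr0.
Qed.

Lemma tstMs f g : smooth g -> tst f -> tst (g \* f).
Proof.
move=> sg [sf [L fL]]; split; first exact: smoothM.
by exists L => x Lx /=; rewrite fL// mulr0.
Qed.

Lemma tstZ (a : R) f : tst f -> tst (cst a \* f).
Proof. by apply: tstMs; exact: smooth_cst. Qed.

Lemma tst0 : tst 0.
Proof. by split; [exact: (smooth_cst 0)|exists 0]. Qed.

Lemma tst_shift f (a : V) : tst f -> tst (fun x => f (x + a)).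
Proof.
move=> [sf [L fL]]; split; first exact: smooth_shift.
exists (L + `|a|) => x Lx; apply: fL.
have := ler_normB (x + a) a; rewrite addrK => h.
by rewrite -(ltrD2r `|a|); apply: lt_le_trans h.
Qed.

Lemma tst_bounded f : tst f -> exists2 B : R, 0 <= B & forall x, `|f x| <= B.
Proof.
move=> [sf [L fL]].
have L0 : 0 <= Num.max L 0 by rewrite le_max lexx orbT.
pose A := [set x : V | `|x| <= Num.max L 0].
have cA : compact A.
  apply: bounded_closed_compact.
    exists (Num.max L 0); split; first exact: num_real.
    by move=> M LM x /= h; rewrite (le_trans h)// ltW.
  rewrite (_ : A = ~` [set x : V | Num.max L 0 < `|x|]).
    by apply: open_closedC; exact: rV_norm_open.
  by apply/seteqP; split=> y /=; rewrite /A /= leNgt => /negP.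
have A0 : A !=set0 by exists 0; rewrite /A /= normr0.
have cf : {within A, continuous (fun x => `|f x|)}.
  apply: continuous_subspaceT => x; apply: continuous_comp.
    exact: smooth_continuous sf x.
  exact: norm_continuous.
have [c _ hc] := EVT_max_rV A0 cA cf.
exists `|f c| => // x; have [Lx|Lx] := leP `|x| (Num.max L 0).
  by apply: hc; rewrite inE.
by rewrite fL ?normr0//; apply: le_lt_trans Lx; rewrite le_max lexx.
Qed.

Definition dq i (h : R) f x := h^-1 * (f (x + h *: e_ i) - f x).

Lemma dqE i h f : dq i h f = cst h^-1 \* ((fun x => f (x + h *: e_ i)) + cst (-1) \* f).
Proof. by apply/funext => x; rewrite /dq /=; congr (_ * _); rewrite [RHS]/(_ + _) /= mulN1r. Qed.

Lemma tst_dq i h f : tst f -> tst (dq i h f).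
Proof.
by move=> tf; rewrite dqE; apply: tstZ; apply: tstD; [exact: tst_shift|exact: tstZ].
Qed.

Lemma smooth_dq i h f : smooth f -> smooth (dq i h f).
Proof.
by move=> tf; rewrite dqE; apply: smoothZ; apply: smoothD; [exact: smooth_shift|exact: smoothZ].
Qed.

Lemma partial_dq i j h f : smooth f -> partial j (dq i h f) = dq i h (partial j f).
Proof.
move=> sf; rewrite (dqE i h f) (dqE i h (partial j f)) partialZ; last first.
  by apply: smoothD; [exact: smooth_shift|exact: smoothZ].
rewrite partialD; [|exact: smooth_shift|exact: smoothZ].
by rewrite (partialZ _ _ sf) partial_shift.
Qed.

Lemma dqC i j h k f : dq i h (dq j k f) = dq j k (dq i h f).
Proof.
apply/funext => x; rewrite /dq -!addrA [k *: _ + _]addrC; ring.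
Qed.

Lemma dq_mean i (h : R) f (x : V) : h != 0 -> smooth f ->
  exists2 c : R, `|c| <= `|h| & dq i h f x = partial i f (x + c *: e_ i).
Proof.
move=> h0 sf; have [c ch E] := mean_value i x h sf; exists c => //.
by rewrite /dq E mulrC mulfK.
Qed.

Lemma lip_coord f i (B : R) (x : V) (c : R) : smooth f -> (forall y, `|partial i f y| <= B) ->
  `|f (x + c *: e_ i) - f x| <= B * `|c|.
Proof.
move=> sf fB; have [c' _ ->] := mean_value i x c sf.
by rewrite normrM ler_wpM2r.
Qed.

(** The mean value theorem twice: the error is of first order uniformly in x because the second
    derivatives of a test function are bounded. *)
Lemma dq_close i f : tst f -> exists2 B : R, 0 <= B &
  forall (h : R) (x : V), h != 0 -> `|dq i h f x - partial i f x| <= B * `|h|.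
Proof.
move=> tf; have tp := tst_partial i tf.
have [B B0 hB] := tst_bounded (tst_partial i tp).
exists B => // h x h0; have [c ch ->] := dq_mean i x h0 (tst_smooth tf).
apply: le_trans (lip_coord x c (tst_smooth tp) hB) _.
by rewrite ler_wpM2l.
Qed.

Lemma dq2_close i j f : tst f -> exists2 B : R, 0 <= B &
  forall (h k : R) (x : V), h != 0 -> k != 0 ->
  `|dq j k (dq i h f) x - partial i (partial j f) x| <= B * (`|h| + `|k|).
Proof.
move=> tf; have tp := tst_partial i (tst_partial j tf).
have [B1 B10 hB1] := tst_bounded (tst_partial i tp).
have [B2 B20 hB2] := tst_bounded (tst_partial j tp).
exists (B1 + B2); first exact: addr_ge0.
move=> h k x h0 k0; have sf := tst_smooth tf.
have [c ck ->] := dq_mean j x k0 (smooth_dq i h sf).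
rewrite partial_dq//.
have [c' ch ->] := dq_mean i (x + c *: e_ j) h0 (smooth_partial j sf).
have h1 := lip_coord (x + c *: e_ j) c' (tst_smooth tp) hB1.
have h2 := lip_coord x c (tst_smooth tp) hB2.
set F := partial i (partial j f) in h1 h2 *.
have -> : F (x + c *: e_ j + c' *: e_ i) - F x =
  (F (x + c *: e_ j + c' *: e_ i) - F (x + c *: e_ j)) + (F (x + c *: e_ j) - F x).
  by rewrite addrA subrK.
apply: le_trans (ler_normD _ _) _; apply: le_trans (lerD h1 h2) _.
by rewrite mulrDl lerD// ler_wpM2l//; [apply: ler_wpDr|apply: ler_wpDl].
Qed.

Lemma small_eq0 (a B : R) : (forall h : R, 0 < h -> `|a| <= B * h) -> a = 0.
Proof.
move=> h; apply/eqP; rewrite -normr_le0; apply/ler_addgt0Pr => e e0.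
have B1 : 0 < `|B| + 1 by rewrite ltr_wpDl.
apply: le_trans (h (e / (`|B| + 1)) (divr_gt0 e0 B1)) _.
rewrite add0r mulrCA ger_pMr// ler_pdivrMr// mul1r.
by apply: le_trans (ler_norm _) _; rewrite lerDl.
Qed.

(** Difference quotients in two directions commute exactly, and each mixed derivative is within O(h)
    of the common second quotient. *)
Lemma schwarz i j f : tst f -> partial i (partial j f) = partial j (partial i f).
Proof.
move=> tf; have [B1 _ h1] := dq2_close i j tf; have [B2 _ h2] := dq2_close j i tf.
apply/funext => x; apply/eqP; rewrite -subr_eq0; apply/eqP.
apply: (@small_eq0 _ ((B1 + B2) * 2)) => h h0; have hn : h != 0 by rewrite gt_eqF.
have := h1 h h x hn hn; have := h2 h h x hn hn; rewrite (dqC i j) (gtr0_norm h0).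
move: (dq _ _ _ _) (partial i _ x) (partial j _ x) => u a b.
rewrite !ler_norml => /andP[? ?] /andP[? ?]; apply/andP; split; nra.
Qed.

Lemma tst_measurable f : tst f -> measurable_fun setT f.
Proof. by move=> [sf _]; apply: continuous_rV_measurable; exact: smooth_continuous. Qed.

Definition cube (L : R) : set V := box (fun=> - L) (fun=> L).

Lemma cubeP L x : 0 < L -> cube L x <-> `|x| < L.
Proof.
move=> L0; split=> h; last by move=> i; rewrite -ltr_norml; exact: rV_coord_lt.
by apply: rV_norm_lt => // i; rewrite ltr_norml.
Qed.

Lemma mu_cube L : 0 <= L -> mu (cube L) = ((2 * L) ^+ n)%:E.
Proof.
move=> L0; rewrite lebesgue_rV_box; last by move=> i; lra.
by rewrite prodr_const card_ord opprK; congr (_ ^+ _)%:E; ring.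
Qed.

Lemma int_bound f (c L : R) : measurable_fun setT f -> 0 <= c -> 0 <= L ->
  (forall x, `|f x| <= c) -> (forall x, ~ cube L x -> f x = 0) ->
  mu.-integrable setT (EFin \o f) /\ `|\int[mu]_x f x| <= c * (2 * L) ^+ n.
Proof.
move=> mf c0 L0 fc fL.
have mC : measurable (cube L) by exact: measurable_box.
have iC : mu.-integrable setT (EFin \o (fun x => c * \1_(cube L) x)).
  apply: integrable_Rscale; apply: integrable_indic_lty => //.
  by rewrite [X in (X < _)%E]mu_cube// ltry.
have le x : `|f x| <= c * \1_(cube L) x.
  rewrite indicE; have [xC|xC] := boolP (x \in cube L).
    by rewrite mulr1.
  by rewrite fL ?normr0 ?mulr0//; move: xC; rewrite notin_setE.
have if_ : mu.-integrable setT (EFin \o f).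
  by apply: (integrable_dom mf iC) => x; exact: le.
split=> //; apply: le_trans (le_normr_Rintegral measurableT if_) _.
apply: (@le_trans _ _ (\int[mu]_x (c * \1_(cube L) x))).
  apply: le_Rintegral => //; first exact: integrable_norm.
rewrite RintegralZl//; last first.
  by apply: integrable_indic_lty => //; rewrite [X in (X < _)%E]mu_cube// ltry.
rewrite /Rintegral integral_indic// setIT [X in fine X]mu_cube//.
Qed.

Lemma tst_supp f : tst f -> exists2 L, 0 < L & forall x, ~ cube L x -> f x = 0.
Proof.
move=> [_ [L fL]]; exists (Num.max L 0 + 1).
  by rewrite ltr_wpDl// le_max lexx orbT.
have L0 : 0 < Num.max L 0 + 1 by rewrite ltr_wpDl// le_max lexx orbT.
move=> x /(cubeP x L0)/negP; rewrite -leNgt => h; apply: fL.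
apply: lt_le_trans h; rewrite ltr_pwDr//.
by rewrite le_max lexx.
Qed.

Lemma tst_integrable f : tst f -> mu.-integrable setT (EFin \o f).
Proof.
move=> tf; have [L L0 fL] := tst_supp tf; have [B B0 fB] := tst_bounded tf.
by have [] := int_bound (tst_measurable tf) B0 (ltW L0) fB fL.
Qed.

(* Translation invariance makes the integral of every difference quotient 0. *)
Lemma int_partial0 f i : tst f -> \int[mu]_x partial i f x = 0.
Proof.
move=> tf; have [B B0 hB] := dq_close i tf.
have [L1 L10 fL1] := tst_supp tf; have [L2 L20 fL2] := tst_supp (tst_partial i tf).
pose L := L1 + L2 + 1.
have L0 : 0 <= L by rewrite /L; lra.
apply: (@small_eq0 _ (B * (2 * L) ^+ n)) => h h0.
(* Steps of at most 1 keep the supports of all quotients inside one cube, of half-side L. *)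
pose h' := Num.min h 1.
have h'0 : 0 < h' by rewrite /h' lt_min h0 ltr01.
have h'1 : h' <= 1 by rewrite /h' ge_min lexx orbT.
have tq := tst_dq i h' tf.
have tp := tst_partial i tf.
have Iq : \int[mu]_x dq i h' f x = 0.
  rewrite /dq RintegralZl//; last first.
    have tm : tst ((fun x => f (x + h' *: e_ i)) + cst (-1) \* f).
      by apply: tstD; [exact: tst_shift|exact: tstZ].
    have := tst_integrable tm; congr integrable; apply/funext => x /=.
    by rewrite [X in X%:E]/(_ + _) /= mulN1r.
  rewrite RintegralB//; [|by apply: tst_integrable; exact: tst_shift|exact: tst_integrable].
  by rewrite (Rintegral_rV_shift _ (tst_measurable tf)) subrr mulr0.
have -> : \int[mu]_x partial i f x = - \int[mu]_x (dq i h' f x - partial i f x).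
  rewrite RintegralB//; [|exact: tst_integrable|exact: tst_integrable].
  by rewrite Iq sub0r opprK.
rewrite normrN.
have [|||||_] := @int_bound (fun x => dq i h' f x - partial i f x) (B * h') L.
- by apply: measurable_funB; exact: tst_measurable.
- by rewrite mulr_ge0// ltW.
- exact: L0.
- by move=> x; have := hB h' x (lt0r_neq0 h'0); rewrite (gtr0_norm h'0).
- move=> x xL.
  have LL : 0 < L by rewrite /L; lra.
  have {}xL : L <= `|x| by rewrite leNgt; apply/negP => /(cubeP x LL).
  have nL1 y : L1 <= `|y| -> f y = 0.
    by move=> h1; apply: fL1 => /(cubeP y L10); rewrite ltNge h1.
  rewrite fL2; last by move=> /(cubeP x L20); rewrite ltNge; apply/negP/negPn; rewrite /L in xL; lra.
  rewrite subr0 /dq !nL1 ?subrr ?mulr0//; first by rewrite /L in xL; lra.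
  have e1 : `|h' *: (e_ i : V)| <= 1.
    rewrite normrZ (gtr0_norm h'0).
    have ei : `|(e_ i : V)| <= 1.
      apply/ler_addgt0Pr => e e0; apply/ltW; apply: rV_norm_lt; first by rewrite ltr_wpDl.
      move=> j; rewrite mxE; case: (_ && _); rewrite ?normr1 ?normr0; lra.
    by apply: mulr_ile1 => //; exact: ltW.
  have := ler_normB (x + h' *: e_ i) (h' *: e_ i); rewrite addrK.
  by rewrite /L in xL; lra.
move=> /le_trans; apply.
by rewrite mulrAC ler_wpM2l ?mulr_ge0 ?exprn_ge0 ?mulr_ge0// /h' ge_min lexx.
Qed.

Lemma tstM f g : tst f -> tst g -> tst (f \* g).
Proof. by move=> tf tg; apply: tstMs => //; exact: tst_smooth. Qed.

Lemma integration_by_parts_rV f g i : tst f -> tst g ->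
  \int[mu]_x (partial i f x * g x) = - \int[mu]_x (f x * partial i g x).
Proof.
move=> tf tg; have := int_partial0 i (tstM tf tg).
rewrite partialM; [|exact: tst_smooth|exact: tst_smooth].
have tfg := tstM tf (tst_partial i tg); have tgf := tstM tg (tst_partial i tf).
change (\int[mu]_x (f x * partial i g x + g x * partial i f x) = 0 ->
  \int[mu]_x (partial i f x * g x) = - \int[mu]_x (f x * partial i g x)).
rewrite RintegralD//; [|exact: (tst_integrable tfg)|exact: (tst_integrable tgf)].
move=> h; apply/eqP; rewrite -addr_eq0; apply/eqP; rewrite -h addrC; congr (_ + _).
by apply: eq_Rintegral => x _; rewrite mulrC.
Qed.

End tests.

(** * Density of the test functions in L^2 *)

Section complex_tests.
Import HBNNSimple.
Context {R : realType} {n : nat}.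
Local Notation V := 'rV[R]_n.
Local Notation e_ i := (delta_mx ord0 i : 'rV[R]_n).
Local Notation mu := (lebesgue_rV R n).
Local Notation ip := (ipL2 mu).
Local Notation N := (normL2 mu).
Local Notation L2c := (sq_integrable mu).
Implicit Types (u v w phi : V -> R[i]) (i j : 'I_n).

Definition ctst phi := tst (fun x => Re (phi x)) /\ tst (fun x => Im (phi x)).

(* Locked, since unfolding nested derivatives makes unification diverge. *)
Fact cpart_key : unit. Proof. exact: tt. Qed.
Definition cpart i phi : V -> R[i] := locked_with cpart_key (fun x =>
  (partial i (fun x => Re (phi x)) x +i* partial i (fun x => Im (phi x)) x)%C).

Lemma cpartE i phi x : cpart i phi x =
  (partial i (fun x => Re (phi x)) x +i* partial i (fun x => Im (phi x)) x)%C.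
Proof. by rewrite /cpart locked_withE. Qed.

Lemma Re_cpart i phi : (fun x => Re (cpart i phi x)) = partial i (fun x => Re (phi x)).
Proof. by apply/funext => x; rewrite cpartE. Qed.

Lemma Im_cpart i phi : (fun x => Im (cpart i phi x)) = partial i (fun x => Im (phi x)).
Proof. by apply/funext => x; rewrite cpartE. Qed.

Lemma ctst_cpart i phi : ctst phi -> ctst (cpart i phi).
Proof.
by move=> [t1 t2]; split; rewrite (Re_cpart, Im_cpart); exact: tst_partial.
Qed.

Lemma ctst_meas phi : ctst phi -> meas_c phi.
Proof. by move=> [t1 t2]; split; exact: tst_measurable. Qed.

Lemma ctst_L2c phi : ctst phi -> L2c phi.
Proof.
move=> tp; split; first exact: ctst_meas.
have [t1 t2] := tp.
have := tst_integrable (tstD (tstM t1 t1) (tstM t2 t2)).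
by congr integrable; apply/funext.
Qed.

Lemma ctstD phi psi : ctst phi -> ctst psi -> ctst (phi + psi).
Proof.
move=> [a b] [a' b']; split.
  have := tstD a a'; congr tst; apply/funext => x; exact: esym (cReD _ _).
have := tstD b b'; congr tst; apply/funext => x; exact: esym (cImD _ _).
Qed.

Lemma ctstMs (q : V -> R[i]) phi : smooth (fun x => Re (q x)) -> smooth (fun x => Im (q x)) ->
  ctst phi -> ctst (q \* phi).
Proof.
move=> s1 s2 [t1 t2]; split.
  have := tstD (tstMs s1 t1) (tstZ (-1) (tstMs s2 t2)); congr tst; apply/funext => x.
  by rewrite addfE /= cReM mulN1r.
have := tstD (tstMs s1 t2) (tstMs s2 t1); congr tst; apply/funext => x.
by rewrite addfE /= cImM.
Qed.

Lemma ctstZ (c : R[i]) phi : ctst phi -> ctst (cst c \* phi).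
Proof. by apply: ctstMs; exact: smooth_cst. Qed.

Lemma ctstN phi : ctst phi -> ctst (- phi).
Proof.
move=> /(ctstZ (-1)); congr ctst; apply/funext => x /=; exact: mulN1r.
Qed.

Lemma ctstB phi psi : ctst phi -> ctst psi -> ctst (phi - psi).
Proof. by move=> tp tq; apply: ctstD => //; exact: ctstN. Qed.

Lemma ctst0 : ctst 0.
Proof. by split; exact: tst0. Qed.

Lemma ctst_shift (a : V) phi : ctst phi -> ctst (fun x => phi (x + a)).
Proof.
by move=> [t1 t2]; split; [exact: (tst_shift a t1)|exact: (tst_shift a t2)].
Qed.

Lemma ctst_real (f : V -> R) : tst f -> ctst (fun x => (f x)%:C%C).
Proof. by move=> tf; split => //; exact: tst0. Qed.

Lemma cpartD i phi psi : ctst phi -> ctst psi ->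
  cpart i (phi + psi) = cpart i phi + cpart i psi.
Proof.
move=> [a b] [a' b']; apply/funext => x; rewrite addfE !cpartE; apply: complex_ext => /=.
  rewrite (_ : (fun x => Re ((phi + psi) x)) = (fun x => Re (phi x)) + (fun x => Re (psi x))).
    by rewrite partialD//; exact: tst_smooth.
  by apply/funext => y; exact: cReD.
rewrite (_ : (fun x => Im ((phi + psi) x)) = (fun x => Im (phi x)) + (fun x => Im (psi x))).
  by rewrite partialD//; exact: tst_smooth.
by apply/funext => y; exact: cImD.
Qed.

Lemma cpartZ i (c : R[i]) phi : ctst phi -> cpart i (cst c \* phi) = cst c \* cpart i phi.
Proof.
move=> [a b]; have sa := tst_smooth a; have sb := tst_smooth b.
apply/funext => x; rewrite /= !cpartE; apply: complex_ext => /=.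
  rewrite cReM /= (_ : (fun x => Re (c * phi x)) =
    (cst (Re c) \* (fun x => Re (phi x))) + (cst (- Im c) \* (fun x => Im (phi x)))).
    rewrite partialD; [|exact: smoothZ|exact: smoothZ].
    by rewrite !partialZ// addfE /= mulNr.
  by apply/funext => y; rewrite addfE /= cReM mulNr.
rewrite cImM /= (_ : (fun x => Im (c * phi x)) =
  (cst (Re c) \* (fun x => Im (phi x))) + (cst (Im c) \* (fun x => Re (phi x)))).
  rewrite partialD; [|exact: smoothZ|exact: smoothZ].
  by rewrite !partialZ.
by apply/funext => y; rewrite addfE /= cImM.
Qed.

Lemma cpart_shift i (a : V) phi :
  cpart i (fun x => phi (x + a)) = (fun x => cpart i phi (x + a)).
Proof.
apply/funext => x; rewrite !cpartE.
by rewrite (partial_shift (fun x => Re (phi x))) (partial_shift (fun x => Im (phi x))).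
Qed.

Lemma cschwarz i j phi : ctst phi -> cpart i (cpart j phi) = cpart j (cpart i phi).
Proof.
move=> [a b]; apply/funext => x; rewrite (cpartE i (cpart j phi)) (cpartE j (cpart i phi)).
have H (u u' v v' : V -> R) : u = u' -> v = v' -> (u x +i* v x)%C = (u' x +i* v' x)%C by move=> -> ->.
apply: H.
  exact (etrans (congr1 (partial i) (Re_cpart j phi))
    (etrans (schwarz i j a) (esym (congr1 (partial j) (Re_cpart i phi))))).
exact (etrans (congr1 (partial i) (Im_cpart j phi))
  (etrans (schwarz i j b) (esym (congr1 (partial j) (Im_cpart i phi))))).
Qed.

Lemma ip_cpart i phi psi : ctst phi -> ctst psi ->
  ip (cpart i phi) psi = - ip phi (cpart i psi).
Proof.
move=> [a b] [a' b'].
transitivity (\int[mu]_x (partial i (fun x => Re (phi x)) x * Re (psi x)) +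
              \int[mu]_x (partial i (fun x => Im (phi x)) x * Im (psi x))).
  rewrite -RintegralD//.
  - by apply: eq_Rintegral => x _; rewrite /dotc cpartE.
  - exact: (tst_integrable (tstM (tst_partial i a) a')).
  - exact: (tst_integrable (tstM (tst_partial i b) b')).
rewrite (integration_by_parts_rV i a a') (integration_by_parts_rV i b b') -opprD; congr (- _).
rewrite -RintegralD//.
- by apply: eq_Rintegral => x _; rewrite /dotc cpartE.
- exact: (tst_integrable (tstM a (tst_partial i a'))).
- exact: (tst_integrable (tstM b (tst_partial i b'))).
Qed.

Lemma N_bound u (c L : R) : meas_c u -> 0 <= c -> 0 <= L ->
  (forall x, normc (u x) <= c) -> (forall x, ~ cube L x -> u x = 0) ->
  L2c u /\ N u <= c * Num.sqrt ((2 * L) ^+ n).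
Proof.
move=> mu1 c0 L0 uc uL.
have [|||||i1 i2] := @int_bound _ _ (fun x => dotc (u x) (u x)) (c ^+ 2) L.
- exact: meas_dot.
- exact: sqr_ge0.
- exact: L0.
- by move=> x; rewrite ger0_norm ?dotcc_ge0// -normc_sqr lerXn2r ?nnegrE ?normc_ge0.
- by move=> x /uL ->; rewrite /dotc mul0r addr0.
split=> //; rewrite /N -[c]ger0_norm// -sqrtr_sqr -sqrtrM ?sqr_ge0//.
rewrite ler_wsqrtr//; apply: le_trans i2; exact: ler_norm.
Qed.

Definition approx_tst u := L2c u /\
  forall e : R, 0 < e -> exists2 phi, ctst phi & N (u - phi) < e.

Lemma approx_tst_lim u : L2c u ->
  (forall e : R, 0 < e -> exists2 v, approx_tst v & N (u - v) < e) -> approx_tst u.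
Proof.
move=> Lu h; split=> // e e0; have e20 : 0 < e / 2 by rewrite divr_gt0.
have [v [Lv hv] uv] := h _ e20; have [phi tphi vphi] := hv _ e20.
exists phi => //; apply: le_lt_trans (N_tri_dist Lu Lv (ctst_L2c tphi)) _.
lra.
Qed.

Lemma approx_tst_ctst phi : ctst phi -> approx_tst phi.
Proof.
move=> tp; split; first exact: ctst_L2c.
by move=> e e0; exists phi; rewrite ?subrr ?N0.
Qed.

Lemma approx_tstD u v : approx_tst u -> approx_tst v -> approx_tst (u + v).
Proof.
move=> [Lu hu] [Lv hv]; split; first exact: L2cD.
move=> e e0; have e20 : 0 < e / 2 by rewrite divr_gt0.
have [phi tp up] := hu _ e20; have [psi tq vq] := hv _ e20.
exists (phi + psi); first exact: ctstD.
have -> : u + v - (phi + psi) = (u - phi) + (v - psi) by rewrite opprD addrACA.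
apply: le_lt_trans (N_triangle (L2cB Lu (ctst_L2c tp)) (L2cB Lv (ctst_L2c tq))) _.
lra.
Qed.

Lemma approx_tstZ (c : R[i]) u : approx_tst u -> approx_tst (cst c \* u).
Proof.
move=> [Lu hu]; split; first exact: L2cZ.
move=> e e0; have c1 : 0 < normc c + 1 by rewrite ltr_wpDl ?normc_ge0.
have [phi tp up] := hu _ (divr_gt0 e0 c1).
exists (cst c \* phi); first exact: ctstZ.
have -> : cst c \* u - cst c \* phi = cst c \* (u - phi).
  by apply/funext => x; rewrite addfE oppfE /= -mulrBr.
rewrite NZ; last by apply: L2cB => //; exact: ctst_L2c.
apply: (@le_lt_trans _ _ ((normc c + 1) * N (u - phi))).
  by rewrite ler_wpM2r// lerDl.
by rewrite mulrC -ltr_pdivlMr.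
Qed.

Lemma approx_tst0 : approx_tst 0.
Proof. exact: approx_tst_ctst ctst0. Qed.

(** Dominated convergence applied to |v - u_k|^2 <= 4 h^2. *)
Lemma L2_dominated (u : nat -> V -> R[i]) v (h : V -> R) :
  (forall k, meas_c (u k)) -> meas_c v -> L2c (fun x => (h x)%:C%C) ->
  (forall k x, normc (u k x) <= h x) ->
  (forall x, (fun k => normc (u k x - v x)) @ \oo --> (0 : R)) ->
  [/\ forall k, L2c (u k), L2c v & forall e : R, 0 < e ->
     exists k, N (v - u k) < e].
Proof.
move=> mu1 mv Lh uh cu.
have h0 x : 0 <= h x by apply: le_trans (uh 0%N x); exact: normc_ge0.
have vh x : normc (v x) <= h x.
  apply/ler_addgt0Pr => e e0.
  have /cvgrPdist_lt/(_ e e0)[k _ hk] := cu x.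
  have := hk k (leqnn k); rewrite /= sub0r normrN ger0_norm ?normc_ge0// => hk'.
  have -> : v x = u k x + (v x - u k x) by rewrite addrC subrK.
  apply: le_trans (normc_triangle _ _) _; rewrite lerD// normc_distC; exact: ltW.
have dom w : meas_c w -> (forall x, normc (w x) <= h x) -> L2c w.
  move=> mw wh; apply: (L2c_dom (u := fun x => (h x)%:C%C) (B := 1)) => // x.
  by rewrite mul1r -!normc_sqr normcR ger0_norm// lerXn2r ?nnegrE ?normc_ge0.
have Lu k : L2c (u k) by apply: dom.
have Lv : L2c v by apply: dom.
split=> // e e0.
pose F k x := dotc ((v - u k) x) ((v - u k) x).
have Lvu k : L2c (v - u k) by apply: L2cB.
have iF k := (Lvu k).2.
pose g x := 4 * dotc (h x)%:C%C (h x)%:C%C.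
have ig : mu.-integrable setT (EFin \o g) by apply: integrable_Rscale; exact: Lh.2.
have Fg k x : F k x <= g x.
  rewrite /F /g -!normc_sqr normcR ger0_norm//.
  have -> : 4 * h x ^+ 2 = (h x + h x) ^+ 2 by ring.
  rewrite lerXn2r ?nnegrE ?normc_ge0 ?addr_ge0//.
  apply: le_trans (normc_triangle _ _) _; rewrite normcN; exact: lerD.
have cF x : (fun k => (F k x)%:E) @ \oo --> 0%E.
  apply/fine_cvgP; split; first exact: nearW.
  rewrite (_ : _ \o _ = fun k => normc (u k x - v x) * normc (u k x - v x)).
    by rewrite -[X in _ --> X](mulr0 (0 : R)); exact: cvgM (cu x) (cu x).
  by apply/funext => k /=; rewrite /F -normc_sqr expr2 normc_distC.
have : (fun k => \int[mu]_x (F k x)%:E)%E @ \oo --> (\int[mu]_x (cst 0 x))%E.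
  have [] := @dominated_convergence _ _ R mu setT measurableT
    (fun k x => (F k x)%:E) (cst 0%E) (EFin \o g) => //.
  - by move=> k; exact: (@measurable_int _ _ _ _ _ _ (iF k)).
  - by apply: aeW => x _; exact: cF.
  - by apply: aeW => x k _ /=; rewrite lee_fin ger0_norm ?dotcc_ge0 ?Fg.
rewrite integral0 => /fine_cvgP[_ /cvgrPdist_lt/(_ (e ^+ 2))].
move=> /(_ (exprn_gt0 _ e0))[k _ hk]; exists k.
have := hk k (leqnn k); rewrite /= sub0r normrN -/(Rintegral _ _ _) -/(ip _ _).
rewrite ger0_norm ?ip_ge0// -sqrN => hk'.
by rewrite -(@ltr_pXn2r _ 2) ?nnegrE ?N_ge0// ltW.
Qed.

Definition cind (A : set V) : V -> R[i] := fun x => (\1_A x)%:C%C.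

(** For t > 0 the value is exp(-1/((k+1) t)). Products of such factors in the coordinates are smooth
    approximations to the indicators of boxes. *)
Lemma cvg_psi (t : R) : (fun k => psi (k.+1%:R * t)) @ \oo --> (if 0 < t then 1 else 0 : R).
Proof.
have [t0|t0] := ltP 0 t; last first.
  rewrite (_ : (fun k => _) = cst 0); first exact: cvg_cst.
  by apply/funext => k; rewrite psi_le0// mulr_ge0_le0.
rewrite (_ : (fun k => _) = fun k => expR (- (t^-1 * harmonic k))); last first.
  by apply/funext => k; rewrite /psi /flat pmulr_rgt0// t0 hornerC mul1r invfM mulrC.
rewrite -expR0; apply: continuous_cvg; first exact: continuous_expR.
rewrite -[X in _ --> X]oppr0; apply: cvgN; rewrite -[X in _ --> X](mulr0 t^-1).
by apply: cvgMr; exact: cvg_harmonic.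
Qed.

Lemma cvg_prod1 (I : Type) (r : seq I) (g : I -> nat -> R) :
  (forall l, g l @ \oo --> (1 : R)) ->
  (fun k => \prod_(i <- r) g i k) @ \oo --> (1 : R).
Proof.
move=> hg; elim: r => [|i r IH].
  rewrite (_ : (fun k => _) = cst 1); first exact: cvg_cst.
  by apply/funext => k; rewrite big_nil.
rewrite (_ : (fun k => _) = fun k => g i k * \prod_(i <- r) g i k).
  by rewrite -[X in _ --> X](mulr1 (1 : R)); exact: cvgM.
by apply/funext => k; rewrite big_cons.
Qed.

Lemma smooth1_psi_affine (a b : R) : smooth1 (fun t => psi (a * t + b)).
Proof. by move=> k; apply: C1k_affine; exact: smooth1_psi. Qed.

Lemma approx_box (K : R) (c : 'I_n -> R) : 0 < K -> (forall i, c i <= K) ->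
  approx_tst (cind (box (fun=> - K) c)).
Proof.
move=> K0 cK.
pose f k (x : V) : R := \prod_i (psi (k.+1%:R * (x ord0 i + K)) * psi (k.+1%:R * (c i - x ord0 i))).
have fbox k x : ~ box (fun=> - K) c x -> f k x = 0.
  move=> nb.
  have [i hi] : exists i, ~~ (- K < x ord0 i < c i).
    by apply: contra_notP nb => nb i; apply/negPn/negP => h; apply: nb; exists i.
  rewrite /f (bigD1 i)//= negb_and -!leNgt in hi *.
  case/orP: hi => h; first by rewrite psi_le0 ?mul0r// mulr_ge0_le0//; lra.
  by rewrite [X in _ * X * _]psi_le0 ?mulr0 ?mul0r// mulr_ge0_le0// subr_le0.
have subc x : box (fun=> - K) c x -> cube K x.
  by move=> h i; have := h i; have := cK i => ? /andP[-> /=] ?; lra.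
have tf k : tst (f k).
  split; last first.
    exists K => x Kx; apply: fbox => /subc/(cubeP x K0); rewrite ltNge.
    by move/negP; apply; exact: ltW.
  apply: smooth_prod => i.
  rewrite (_ : (fun x => _) = (fun x : V => psi (k.+1%:R * x ord0 i + k.+1%:R * K)) \*
     (fun x : V => psi (- k.+1%:R * x ord0 i + k.+1%:R * c i))).
    by apply: smoothM; apply: (smooth_coord i (smooth1_psi_affine _ _)).
  by apply/funext => x /=; congr (psi _ * psi _); ring.
have f01 k x : 0 <= f k x <= 1.
  rewrite /f; elim/big_ind: _ => [|a b /andP[a0 a1] /andP[b0 b1]|i _]; first by rewrite ler01 lexx.
    by rewrite mulr_ge0//= mulr_ile1.
  by rewrite mulr_ge0 ?psi_ge0//= mulr_ile1 ?psi_ge0 ?psi_le1.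
have mb : measurable (box (fun=> - K) c) by exact: measurable_box.
have mC : measurable (cube (n := n) K) by exact: measurable_box.
have mcind A : measurable A -> meas_c (cind A).
  by move=> mA; split => /=; [exact: measurable_indic|exact: measurable_cst].
have [||||| Lf Lb hf] := @L2_dominated (fun k x => (f k x)%:C%C) (cind (box (fun=> - K) c))
    (\1_(cube K)).
- by move=> k; apply: ctst_meas; exact: ctst_real.
- exact: mcind.
- have [|||||//] := @N_bound (fun x => (\1_(cube K) x)%:C%C) 1 K.
  + exact: mcind.
  + exact: ler01.
  + exact: ltW.
  + by move=> x; rewrite normcR ger0_norm// indicE lern1 leq_b1.
  + by move=> x xC; rewrite indicE memNset.
- move=> k x; rewrite normcR ger0_norm; last by case/andP: (f01 k x).
  rewrite indicE; have [xC|xC] := boolP (x \in cube K).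
    by case/andP: (f01 k x).
  by rewrite fbox// => /subc; move: xC; rewrite notin_setE.
- move=> x; rewrite (_ : (fun k => _) = fun k => `|f k x - \1_(box (fun=> - K) c) x|).
    have cf : (fun k => f k x) @ \oo --> (\1_(box (fun=> - K) c) x : R).
      have [xb|xb] := pselect (box (fun=> - K) c x); last first.
        rewrite indicE memNset// (_ : (fun k => _) = cst 0); first exact: cvg_cst.
        by apply/funext => k; rewrite fbox.
      rewrite indicE mem_set//; apply: cvg_prod1 => i.
      have /andP[h1 h2] := xb i.
      have p1 : 0 < x ord0 i + K by lra.
      have p2 : 0 < c i - x ord0 i by lra.
      have := @cvg_psi (x ord0 i + K); have := @cvg_psi (c i - x ord0 i).
      rewrite p1 p2 => c2 c1.
      by rewrite -[X in _ --> X](mulr1 (1 : R)); exact: cvgM c1 c2.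
    rewrite -[X in _ --> X](@normr0 _ R); apply: cvg_norm.
    rewrite -[X in _ --> X](subrr (\1_(box (fun=> - K) c) x : R)).
    by apply: cvgB => //; exact: cvg_cst.
  by apply/funext => k; rewrite /cind -normcR; congr normc; apply: complex_ext; rewrite ?cReB ?cImB //= subrr.
apply: approx_tst_lim => // e e0; have [k hk] := hf e e0.
by exists (fun x => (f k x)%:C%C) => //; apply: approx_tst_ctst; exact: ctst_real.
Qed.

(** A generating family closed under intersections, as Dynkin's theorem requires. *)
Definition orthants : set (set V) := [set A | exists b : 'I_n -> R, A = [set x : V | forall i, x ord0 i < b i]].

Lemma measurable_orthantsE : @measurable _ V = <<s orthants >>.
Proof.
rewrite eqEsubset; split=> A.
  apply: smallest_sub; first exact: smallest_sigma_algebra.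
  rewrite -bigcup_seq => B [i _ [C mC <-]].
  have : measurable_fun (setT : set (g_sigma_algebraType orthants))
      (fun x : g_sigma_algebraType orthants => ((x : V) ord0 i : measurableTypeR R)).
    apply: (measurability _ (RGenInftyO.measurableE R)) => //.
    move=> _ [_ [b ->] <-]; rewrite setTI.
    (* A half-space is the union over k of the orthants whose other bounds are k. *)
    rewrite (_ : _ @^-1` _ = \bigcup_k [set x : V | forall j, x ord0 j < if j == i then b else k%:R]).
      apply: bigcup_measurable => k _; apply: sub_sigma_algebra.
      by exists (fun j => if j == i then b else k%:R).
    apply/seteqP; split=> x /=; rewrite in_itv /=; last first.
      by move=> [k _ /(_ i)]; rewrite eqxx.
    move=> xb; exists (Num.truncn `|x|).+1 => // j; case: eqP => [->//|_].
    apply: le_lt_trans (ler_norm _) _; apply: le_lt_trans (rV_coord_le _ _) _.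
    exact: truncnS_gt.
  by apply.
apply: smallest_sub; first exact: sigma_algebra_measurable.
move=> B [b ->].
have -> : [set x : V | forall i, x ord0 i < b i] = \big[setI/setT]_(i < n)
    ((fun x : V => x ord0 i) @^-1` `]-oo, b i[%classic).
  rewrite -bigcap_seq; apply/seteqP; split=> x /=.
    by move=> h i _ /=; rewrite in_itv /= h.
  by move=> h i; have := h i (mem_index_enum i); rewrite /= in_itv.
apply: bigsetI_measurable => i _; rewrite -[X in measurable X]setTI.
by apply: measurable_coord => //; exact: measurable_itv.
Qed.

Lemma meas_cind A : measurable A -> meas_c (cind A).
Proof. by move=> mA; split => /=; [exact: measurable_indic|exact: measurable_cst]. Qed.

Lemma L2c_cind_cube A (K : R) : 0 < K -> measurable A -> L2c (cind (A `&` cube K)).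
Proof.
move=> K0 mA.
have [|||||//] := @N_bound (cind (A `&` cube K)) 1 K.
+ by apply: meas_cind; apply: measurableI => //; exact: measurable_box.
+ exact: ler01.
+ exact: ltW.
+ by move=> x; rewrite normcR ger0_norm// indicE lern1 leq_b1.
+ by move=> x xC; rewrite /cind indicE memNset// => -[].
Qed.

(** Dynkin's theorem, starting from boxes. Intersecting with a fixed cube keeps complements and
    countable unions in L^2. *)
Lemma approx_cind A (K : R) : 0 < K -> measurable A -> approx_tst (cind (A `&` cube K)).
Proof.
move=> K0 mA.
have mC : measurable (cube (n := n) K) by exact: measurable_box.
have boxI (b : 'I_n -> R) : [set x : V | forall i, x ord0 i < b i] `&` cube K =
    box (fun=> - K) (fun i => Num.min (b i) K).
  apply/seteqP; split=> x /=.
    by move=> [h1 h2] i; rewrite lt_min h1 /=; exact: h2.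
  move=> h; split=> i; have := h i; rewrite lt_min => /and3P[] //.
  by move=> -> _ ->.
apply: (@dynkin_induction _ V orthants (fun A => approx_tst (cind (A `&` cube K)))).
- exact: measurable_orthantsE.
- move=> B C [b ->] [c ->]; exists (fun i => Num.min (b i) (c i)).
  apply/seteqP; split=> x /=; first by move=> [h1 h2] i; rewrite lt_min h1 h2.
  by move=> h; split=> i; have := h i; rewrite lt_min => /andP[].
- rewrite setTI; exact: approx_box.
- by move=> B [b ->] /=; rewrite boxI; apply: approx_box => // i; rewrite ge_min lexx orbT.
- move=> B mB hB.
  have -> : cind (~` B `&` cube K) = cind (cube K) + cst (-1) \* cind (B `&` cube K).
    apply/funext => x; rewrite addfE /= /cind !indicE.
    apply: complex_ext; rewrite ?cReD ?cImD ?cReM ?cImM /=; last by ring.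
    rewrite !in_setI in_setC; case: (x \in B); case: (x \in cube K) => /=; ring.
  by apply: approx_tstD; [exact: approx_box|exact: approx_tstZ].
- move=> F mF tF hF.
  pose G k := \big[setU/set0]_(i < k) F i.
  have mG k : measurable (G k) by apply: bigsetU_measurable.
  have hG k : approx_tst (cind (G k `&` cube K)).
    elim: k => [|k IH].
      rewrite /G big_ord0 set0I (_ : cind set0 = 0); first exact: approx_tst0.
      by apply/funext => x; rewrite /cind indicE in_set0.
    have -> : cind (G k.+1 `&` cube K) = cind (G k `&` cube K) + cind (F k `&` cube K).
      apply/funext => x; rewrite addfE /cind !indicE.
      apply: complex_ext; rewrite ?cReD ?cImD /=; last by rewrite addr0.
      rewrite !in_setI /G big_ord_recr /= -/(G k) in_setU.
      have [xG|_] := boolP (x \in G k); have [xF|_] := boolP (x \in F k);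
        case: (x \in cube K) => /=; rewrite ?addr0 ?add0r//.
      exfalso; move: xG xF; rewrite !inE /G -bigcup_mkord => -[i /= ik Fi] Fk.
      have := tF i k I I; have ne : F i `&` F k !=set0 by exists x.
      by move=> /(_ ne) E; rewrite E ltnn in ik.
    exact: approx_tstD.
  have mU : measurable (\bigcup_k F k) by apply: bigcup_measurable.
  have [||||| _ Lb hf] := @L2_dominated (fun k => cind (G k `&` cube K))
    (cind (\bigcup_k F k `&` cube K)) (\1_(cube K)).
  + by move=> k; apply: meas_cind; exact: measurableI.
  + by apply: meas_cind; exact: measurableI.
  + by have := L2c_cind_cube K0 (@measurableT _ V); rewrite setTI.
  + move=> k x; rewrite normcR ger0_norm// !indicE in_setI ler_nat.
    by case: (x \in cube K); rewrite ?andbF ?andbT ?leq_b1.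
  + move=> x; rewrite (_ : (fun k => _) =
      fun k => `|\1_(G k `&` cube K) x - \1_(\bigcup_k F k `&` cube K) x|); last first.
      by apply/funext => k; rewrite /cind -normcR; congr normc; apply: complex_ext; rewrite ?cReB ?cImB //= subrr.
    apply: cvg_near_cst.
    have [[i _ Fi]|nF] := pselect ((\bigcup_k F k) x).
      exists i.+1 => // k /= ik; rewrite !indicE !in_setI.
      have xG : x \in G k by rewrite inE /G -bigcup_mkord; exists i.
      have xU : x \in \bigcup_k F k by rewrite inE; exists i.
      by rewrite xG xU subrr normr0.
    apply: nearW => k; rewrite !indicE !in_setI.
    have xU : x \in \bigcup_k F k = false by apply: memNset.
    have xG : x \in G k = false.
      apply: memNset => xG; apply: nF; move: xG.
      by rewrite /G -bigcup_mkord => -[i _ Fi]; exists i.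
    by rewrite xG xU subrr normr0.
  apply: approx_tst_lim => // e e0; have [k hk] := hf e e0.
  by exists (cind (G k `&` cube K)).
- by rewrite -measurable_orthantsE.
Qed.

Lemma approx_sum (s : seq R) (B : R -> set V) (K : R) : 0 < K ->
  (forall y, measurable (B y)) ->
  approx_tst (fun x => ((\sum_(y <- s) y * \1_(B y) x) * \1_(cube K) x)%:C%C).
Proof.
move=> K0 mB; elim: s => [|y s IH].
  rewrite (_ : (fun x => _) = 0); first exact: approx_tst0.
  by apply/funext => x; rewrite big_nil mul0r.
rewrite (_ : (fun x => _) = cst (y%:C)%C \* cind (B y `&` cube K) +
   (fun x => ((\sum_(y <- s) y * \1_(B y) x) * \1_(cube K) x)%:C%C)).
  by apply: approx_tstD => //; apply: approx_tstZ; exact: approx_cind.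
apply/funext => x; rewrite big_cons addfE /= /cind !indicE in_setI.
apply: complex_ext; rewrite ?cReD ?cImD ?cReM ?cImM /=; last by ring.
by case: (x \in cube K); rewrite ?andbT ?andbF /=; ring.
Qed.

(** Simple functions from below, cut off to growing cubes; f itself dominates them. *)
Lemma approx_ge0 (f : V -> R) : (forall x, 0 <= f x) ->
  L2c (fun x => (f x)%:C%C) -> approx_tst (fun x => (f x)%:C%C).
Proof.
move=> f0 Lf; have [[mf _] _] := Lf.
have mEf : measurable_fun setT (EFin \o f) by exact/measurable_EFinP.
have [g [ndg cg]] := approximation measurableT mEf (fun x _ => f0 x).
have cg' x : (fun k => g k x) @ \oo --> f x.
  by have /fine_cvgP[_] := cg x I; apply.
have gf k x : g k x <= f x.
  apply: (cvgr_to_ge (cg' x)); exists k => // m /= km.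
  by have /lefP := ndg _ _ km; apply.
have g0 k x : 0 <= g k x by exact: fun_ge0.
pose v k (x : V) : R[i] := (g k x * \1_(cube k.+1%:R) x)%:C%C.
have av k : approx_tst (v k).
  have := @approx_sum (finmap.enum_fset (fset_set (range (g k)))) (fun y => g k @^-1` [set y]) k.+1%:R (ltr0Sn _ _).
  move=> /(_ (fun y => measurable_funPTI (g k) (measurable_set1 y))).
  congr approx_tst; apply/funext => x; rewrite /v; congr ((_ * _)%:C)%C.
  by rewrite (fimfunE (g k)) fsbig_finite.
have [||||| _ Lf1 hf] := @L2_dominated v (fun x => (f x)%:C%C) f.
- by move=> k; have [[]] := av k.
- by have [] := Lf.
- exact: Lf.
- move=> k x; rewrite normcR ger0_norm ?mulr_ge0//.
  by apply: le_trans (gf k x); rewrite ler_piMr.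
- move=> x; rewrite (_ : (fun k => _) = fun k => `|g k x * \1_(cube k.+1%:R) x - f x|); last first.
    by apply/funext => k; rewrite /v -normcR; congr normc; apply: complex_ext; rewrite ?cReB ?cImB //= subrr.
  rewrite -[X in _ --> X](@normr0 _ R); apply: cvg_norm.
  rewrite -[X in _ --> X](subrr (f x)); apply: cvgB; last exact: cvg_cst.
  rewrite -[X in _ --> X]mulr1; apply: cvgM; first exact: cg'.
  apply: cvg_near_cst; exists (Num.truncn `|x|) => // k /= xk.
  rewrite indicE mem_set//; apply/cubeP => //.
  apply: lt_le_trans (truncnS_gt _) _; by rewrite ler_nat ltnS.
by apply: approx_tst_lim => // e e0; have [k hk] := hf e e0; exists (v k).
Qed.

Lemma approx_real (f : V -> R) :
  L2c (fun x => (f x)%:C%C) -> approx_tst (fun x => (f x)%:C%C).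
Proof.
move=> Lf; have [[mf _] _] := Lf.
have Ln : L2c (fun x => (`|f x|)%:C%C).
  apply: (L2c_dom (u := fun x => (f x)%:C%C) (B := 1)) => //.
    by split; [exact: measurableT_comp|exact: measurable_cst].
  by move=> x; rewrite mul1r -!normc_sqr !normcR normr_id.
have -> : (fun x => (f x)%:C%C) = (fun x => (`|f x|)%:C%C) +
    cst (-1) \* (fun x => (`|f x| - f x)%:C%C).
  apply/funext => x; rewrite addfE /=.
  by apply: complex_ext; rewrite ?cReD ?cImD ?cReM ?cImM /=; ring.
apply: approx_tstD; first exact: approx_ge0.
apply: approx_tstZ; apply: approx_ge0; first by move=> x; rewrite subr_ge0 ler_norm.
have := L2cB Ln Lf; congr sq_integrable; apply/funext => x; rewrite addfE oppfE.
by apply: complex_ext; rewrite ?cReB ?cImB //= subrr.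
Qed.

Lemma approx_all u : L2c u -> approx_tst u.
Proof.
move=> Lu; have [[mr mi] _] := Lu.
have dom (f : V -> R) : measurable_fun setT f -> (forall x, `|f x| <= normc (u x)) ->
    L2c (fun x => (f x)%:C%C).
  move=> mf fu; apply: (L2c_dom (u := u) (B := 1)) => //.
  by move=> x; rewrite mul1r -!normc_sqr normcR lerXn2r ?nnegrE ?normc_ge0.
have -> : u = (fun x => (Re (u x))%:C%C) + cst ('i%C) \* (fun x => (Im (u x))%:C%C).
  apply/funext => x; rewrite addfE /=.
  by apply: complex_ext; rewrite ?cReD ?cImD ?cReM ?cImM /=; ring.
apply: approx_tstD; last apply: approx_tstZ; apply: approx_real; apply: dom => // x.
  exact: ler_Re_normc.
exact: ler_Im_normc.
Qed.

End complex_tests.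

(** * Solving H_0 u + z u = g *)

Section laplacian.
Context {R : realType} {n : nat}.
Local Notation V := 'rV[R]_n.
Local Notation e_ i := (delta_mx ord0 i : 'rV[R]_n).
Local Notation mu := (lebesgue_rV R n).
Local Notation ip := (ipL2 mu).
Local Notation N := (normL2 mu).
Local Notation L2c := (sq_integrable mu).
Implicit Types (u v w phi : V -> R[i]) (i j : 'I_n) (z c : R[i]).

Definition shiftc (a : V) u : V -> R[i] := fun x => u (x + a).

Lemma meas_shift a u : meas_c u -> meas_c (shiftc a u).
Proof.
move=> [m1 m2]; split.
  exact: (measurableT_comp (f := fun x => Re (u x)) m1 (measurable_rV_shift a)).
exact: (measurableT_comp (f := fun x => Im (u x)) m2 (measurable_rV_shift a)).
Qed.

Lemma ip_shift a u v : meas_c u -> meas_c v -> ip (shiftc a u) (shiftc a v) = ip u v.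
Proof.
by move=> mu1 mv; exact: (Rintegral_rV_shift a (meas_dot mu1 mv)).
Qed.

Lemma L2c_shift a u : L2c u -> L2c (shiftc a u).
Proof.
move=> [mu1 iu]; split; first exact: meas_shift.
have mf : measurable_fun setT (fun x => dotc (u x) (u x)) by exact: meas_dot.
have mEf : measurable_fun setT (EFin \o (fun x => dotc (u x) (u x))).
  exact/measurable_EFinP.
have /integrableP[m1 i1] := iu; apply/integrableP; split.
  exact: (measurableT_comp (f := EFin \o (fun x => dotc (u x) (u x))) mEf (measurable_rV_shift a)).
apply: le_lt_trans i1; rewrite -(integral_rV_shift a (f := fun x => `|(dotc (u x) (u x))%:E|%E))//.
exact: measurableT_comp.
Qed.

Lemma N_shift a u : L2c u -> N (shiftc a u) = N u.
Proof. by move=> [mu1 _]; rewrite /normL2 ip_shift. Qed.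

Lemma ctst_shiftc a u : ctst u -> ctst (shiftc a u).
Proof. exact: ctst_shift. Qed.

Lemma L2c_sum (I : Type) (r : seq I) (F : I -> V -> R[i]) :
  (forall k, L2c (F k)) -> L2c (\sum_(k <- r) F k).
Proof. by move=> h; elim/big_ind: _ => //; [exact: L2c0|move=> *; exact: L2cD]. Qed.

Lemma ctst_sum (I : Type) (r : seq I) (F : I -> V -> R[i]) :
  (forall k, ctst (F k)) -> ctst (\sum_(k <- r) F k).
Proof. by move=> h; elim/big_ind: _ => //; [exact: ctst0|move=> *; exact: ctstD]. Qed.

Lemma ip_sumr (I : Type) (r : seq I) (F : I -> V -> R[i]) u :
  L2c u -> (forall k, L2c (F k)) -> ip u (\sum_(k <- r) F k) = \sum_(k <- r) ip u (F k).
Proof.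
move=> Lu h; elim: r => [|k r IH]; first by rewrite !big_nil ip0r.
by rewrite !big_cons ipDr ?IH//; exact: L2c_sum.
Qed.

Lemma ip_suml (I : Type) (r : seq I) (F : I -> V -> R[i]) u :
  L2c u -> (forall k, L2c (F k)) -> ip (\sum_(k <- r) F k) u = \sum_(k <- r) ip (F k) u.
Proof.
by move=> Lu h; rewrite ipC ip_sumr//; apply: eq_bigr => k _; rewrite ipC.
Qed.

Lemma N_sum (I : Type) (r : seq I) (F : I -> V -> R[i]) : (forall k, L2c (F k)) ->
  N (\sum_(k <- r) F k) <= \sum_(k <- r) N (F k).
Proof.
move=> h; elim: r => [|k r IH]; first by rewrite !big_nil N0.
rewrite !big_cons; apply: le_trans (N_triangle _ _) _ => //; first exact: L2c_sum.
by rewrite lerD2l.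
Qed.

Lemma sumfE (I : Type) (r : seq I) (F : I -> V -> R[i]) x :
  (\sum_(k <- r) F k) x = \sum_(k <- r) F k x.
Proof. by elim: r => [|k r IH]; rewrite ?big_nil// !big_cons addfE IH. Qed.

Definition clap phi : V -> R[i] := \sum_i cpart i (cpart i phi).

Lemma clapE phi x : clap phi x = \sum_i cpart i (cpart i phi) x.
Proof. exact: sumfE. Qed.

Lemma ctst_clap phi : ctst phi -> ctst (clap phi).
Proof. by move=> tp; apply: ctst_sum => i; do 2!apply: ctst_cpart. Qed.

Lemma clapD phi psi : ctst phi -> ctst psi -> clap (phi + psi) = clap phi + clap psi.
Proof.
move=> tp tq; rewrite /clap -big_split /=; apply: eq_bigr => i _.
by rewrite !cpartD//; exact: ctst_cpart.
Qed.

Lemma clapZ c phi : ctst phi -> clap (cst c \* phi) = cst c \* clap phi.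
Proof.
move=> tp; apply/funext => x; rewrite /= !clapE mulr_sumr; apply: eq_bigr => i _.
by rewrite !cpartZ//; exact: ctst_cpart.
Qed.

Lemma clap_shift a phi : clap (shiftc a phi) = shiftc a (clap phi).
Proof.
apply/funext => x; rewrite clapE /shiftc clapE; apply: eq_bigr => i _.
by rewrite (cpart_shift i a phi) (cpart_shift i a (cpart i phi)).
Qed.

Lemma clap_sum (I : Type) (r : seq I) (F : I -> V -> R[i]) :
  (forall k, ctst (F k)) -> clap (\sum_(k <- r) F k) = \sum_(k <- r) clap (F k).
Proof.
move=> h; elim: r => [|k r IH].
  rewrite !big_nil; have -> : (0 : V -> R[i]) = cst 0 \* 0.
    by apply/funext => x /=; rewrite mul0r.
  rewrite clapZ; last exact: ctst0.
  by apply/funext => x /=; rewrite !mul0r.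
by rewrite !big_cons clapD ?IH//; exact: ctst_sum.
Qed.

Lemma ip_conj_scale z u v : L2c u -> L2c v ->
  ip (cst z \* u) v + ip (cst (conjc z) \* u) v = 2 * Re z * ip u v.
Proof.
move=> Lu Lv; rewrite -ipDl//; try exact: L2cZ.
rewrite -ipZl//; congr ip; apply/funext => x; rewrite addfE /=.
by apply: complex_ext; rewrite ?cReD ?cImD ?cReM ?cImM ?cRe_conj ?cIm_conj /=; ring.
Qed.

Lemma ip_scale_self z u : L2c u -> ip (cst z \* u) u = Re z * N u ^+ 2.
Proof.
move=> Lu; rewrite sqrN -ipZl// /ipL2; apply: eq_Rintegral => x _ /=.
rewrite /dotc !cReM !cImM /=; ring.
Qed.

(** The absence of cancellation behind the lower bounds, both for test functions and on the
    lattice. *)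
Lemma N_sum_ge u v : L2c u -> L2c v -> 0 <= ip u v -> N u <= N (u + v) /\ N v <= N (u + v).
Proof.
move=> Lu Lv uv.
have E : N (u + v) ^+ 2 = N u ^+ 2 + N v ^+ 2 + 2 * ip u v.
  rewrite !sqrN ipDl ?ipDr//; try exact: L2cD.
  by rewrite [ip v u]ipC; ring.
split; rewrite -(@ler_pXn2r _ 2) ?nnegrE ?N_ge0// E.
  by have := sqr_ge0 (N v); lra.
by have := sqr_ge0 (N u); lra.
Qed.

Lemma ip_clap z phi : ctst phi -> 0 <= Re z -> 0 <= ip (cst z \* phi) (- clap phi).
Proof.
move=> tp z0; have Lp := ctst_L2c tp.
rewrite ipNr; [|exact: L2cZ|exact/ctst_L2c/ctst_clap].
rewrite oppr_ge0 ip_sumr; [|exact: L2cZ|by move=> i; apply: ctst_L2c; do 2!apply: ctst_cpart].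
rewrite -oppr_ge0 -sumrN; apply: sumr_ge0 => i _.
rewrite ipC ip_cpart; [|exact: ctst_cpart|exact: ctstZ].
rewrite opprK cpartZ// ipC ip_scale_self; last exact/ctst_L2c/ctst_cpart.
by rewrite mulr_ge0// sqr_ge0.
Qed.

Definition helm z phi : V -> R[i] := cst z \* phi - clap phi.

Lemma ctst_helm z phi : ctst phi -> ctst (helm z phi).
Proof. by move=> tp; apply: ctstB; [exact: ctstZ|exact: ctst_clap]. Qed.

Lemma helm_lower z phi : ctst phi -> 0 <= Re z ->
  normc z * N phi <= N (helm z phi) /\ N (clap phi) <= N (helm z phi).
Proof.
move=> tp z0; have Lp := ctst_L2c tp.
have Lc : L2c (- clap phi) by apply: L2cN; exact/ctst_L2c/ctst_clap.
have [h1 h2] := N_sum_ge (L2cZ z Lp) Lc (ip_clap tp z0).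
by rewrite -NZ// -[N (clap phi)]NN.
Qed.

Lemma ler_sum2 (F : 'I_n -> 'I_n -> R) i j : (forall k l, 0 <= F k l) ->
  F i j <= \sum_k \sum_l F k l.
Proof.
move=> F0; rewrite (bigD1 i)//= (bigD1 j)//= -addrA lerDl addr_ge0//.
  exact: sumr_ge0.
by apply: sumr_ge0 => *; exact: sumr_ge0.
Qed.

(** Two integrations by parts and the symmetry of second derivatives show that the squared norm of
    the Laplacian is the sum of the squared norms of all second derivatives. It takes the place of
    the multiplier bound |xi_i xi_j| <= |xi|^2. *)
Lemma N_cpart2 i j phi : ctst phi -> N (cpart i (cpart j phi)) <= N (clap phi).
Proof.
move=> tp.
have t2 k l : ctst (cpart k (cpart l phi)) by do 2!apply: ctst_cpart.
have E k l : ip (cpart k (cpart k phi)) (cpart l (cpart l phi)) = N (cpart k (cpart l phi)) ^+ 2.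
  have tk := ctst_cpart k tp; have tl := ctst_cpart l tp.
  have E1 := ip_cpart k tk (ctst_cpart l tl).
  have E2 := congr1 (fun w => - ip (cpart k phi) w) (cschwarz k l tl).
  have E3 := ip_cpart l tk (t2 k l).
  have E4 := congr1 (fun w => ip w (cpart k (cpart l phi))) (cschwarz k l tp).
  exact: etrans (etrans E1 E2) (etrans (esym E3) (etrans (esym E4) (esym (sqrN _ _)))).
rewrite -(@ler_pXn2r _ 2) ?nnegrE ?N_ge0//.
have -> : N (clap phi) ^+ 2 = \sum_k \sum_l N (cpart k (cpart l phi)) ^+ 2.
  rewrite sqrN ip_suml//; last by move=> k; exact: ctst_L2c.
    apply: eq_bigr => k _; rewrite ip_sumr//; last by move=> l; exact: ctst_L2c.
      by apply: eq_bigr => l _; exact: E.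
    exact: ctst_L2c.
  exact/ctst_L2c/ctst_clap.
exact: (ler_sum2 (F := fun k l => N (cpart k (cpart l phi)) ^+ 2) i j (fun k l => sqr_ge0 _)).
Qed.

(** Interpolation: one integration by parts and Cauchy-Schwarz. *)
Lemma N_cpart1 i phi : ctst phi -> N (cpart i phi) ^+ 2 <= N phi * N (clap phi).
Proof.
move=> tp; have t1 := ctst_cpart i tp.
rewrite sqrN ip_cpart//; have := ip_CauchySchwarz (ctst_L2c tp) (ctst_L2c (ctst_cpart i t1)).
move=> h; apply: le_trans (ler_norm _) _; rewrite normrN; apply: le_trans h _.
exact: (ler_wpM2l (N_ge0 mu phi) (N_cpart2 i i tp)).
Qed.

(** * The lattice Laplacian and its Neumann series *)

Section dense_range.
Variables (z : R[i]) (h : R).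
Hypotheses (z0 : 0 <= Re z) (zn0 : z != 0) (h0 : 0 < h).

Let h2 : R[i] := ((h ^- 2)%:C)%C.
(** The diagonal coefficient of z minus the lattice Laplacian of mesh h; dividing it out writes this
    operator as c (1 - avg). *)
Let c : R[i] := (((2 * n%:R) * h ^- 2)%:C)%C + z.

Let cn0 : c != 0.
Proof.
apply: contra_neq zn0 => c0.
have : Re c = 0 by rewrite c0.
have : Im c = 0 by rewrite c0.
rewrite /c cReD cImD /= add0r => Iz.
have : 0 <= (2 * n%:R) * h ^- 2 by rewrite mulr_ge0 ?mulr_ge0// invr_ge0 exprn_ge0// ltW.
move=> a b; apply: complex_ext => //.
by apply/eqP; rewrite eq_le z0 andbT -[leRHS]b lerDr.
Qed.

(* [nbr phi] sums [phi] over the [2 n] lattice neighbours, so that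
   [disc phi = z phi - (discrete Laplacian) phi]. *)
Definition nbr phi : V -> R[i] :=
  \sum_i (shiftc (h *: e_ i) phi + shiftc (- (h *: e_ i)) phi).
Definition avg phi := cst (c^-1 * h2) \* nbr phi.
Definition disc phi := cst c \* (phi - avg phi).

Lemma ctst_nbr phi : ctst phi -> ctst (nbr phi).
Proof. by move=> tp; apply: ctst_sum => i; apply: ctstD; exact: ctst_shiftc. Qed.

Lemma ctst_avg phi : ctst phi -> ctst (avg phi).
Proof. by move=> tp; apply: ctstZ; exact: ctst_nbr. Qed.

Lemma L2c_nbr phi : L2c phi -> L2c (nbr phi).
Proof. by move=> tp; apply: L2c_sum => i; apply: L2cD; exact: L2c_shift. Qed.

Lemma N_nbr phi : L2c phi -> N (nbr phi) <= 2 * n%:R * N phi.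
Proof.
move=> Lp; apply: le_trans (N_sum _ _) _.
  by move=> i; apply: L2cD; exact: L2c_shift.
apply: (@le_trans _ _ (\sum_(i < n) 2 * N phi)).
  apply: ler_sum => i _; apply: le_trans (N_triangle _ _) _; try exact: L2c_shift.
  by rewrite !N_shift// mulr2n mulrDl mul1r.
by rewrite sumr_const card_ord -mulr_natr; lra.
Qed.

Definition theta_avg : R := normc (c^-1 * h2) * (2 * n%:R).

Lemma theta_avg_ge0 : 0 <= theta_avg.
Proof. by rewrite mulr_ge0 ?normc_ge0 ?mulr_ge0. Qed.

(** [avg] is a contraction because |c| > 2 n / h^2 as soon as Re z >= 0 and z != 0. The imaginary
    axis is included, and [spectrum_nonreal] relies on it. *)
Lemma theta_avg_lt1 : theta_avg < 1.
Proof.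
have h20 : 0 < h ^- 2 by rewrite invr_gt0 exprn_gt0.
have nh : normc h2 = h ^- 2 by rewrite /h2 normcR gtr0_norm.
have nc : 0 < normc c.
  by rewrite lt_neqAle normc_ge0 eq_sym andbT; apply: contra_neq cn0 => /Normc.eq0_normc.
rewrite /theta_avg Normc.normcM Normc.normcV nh -mulrA [X in _ * X]mulrC.
rewrite ltr_pdivrMl// mulr1.
have A0 : 0 <= (2 * n%:R) * h ^- 2 by rewrite mulr_ge0 ?mulr_ge0// ltW.
rewrite -(@ltr_pXn2r _ 2) ?nnegrE ?normc_ge0// normc_sqr /dotc /c cReD cImD /= add0r.
move: A0; set A := _ * h ^- 2 => A0.
have := zn0; rewrite eq_complex negb_and /= => /orP[|] zz.
  have : 0 < Re z by rewrite lt_neqAle eq_sym zz.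
  by have := sqr_ge0 (Im z); nra.
have : 0 < Im z ^+ 2 by rewrite lt_neqAle sqr_ge0 eq_sym andbT sqrf_eq0.
have := mulr_ge0 A0 z0; have := sqr_ge0 (Re z); rewrite !expr2.
move: (Re z) (Im z) => a b *; nra.
Qed.

Lemma avg_iter_bound k phi : L2c phi ->
  L2c (iter k avg phi) /\ N (iter k avg phi) <= theta_avg ^+ k * N phi.
Proof.
move=> Lp; elim: k => [|k [L1 IH]]; first by rewrite expr0 mul1r.
split; first by apply: L2cZ; exact: L2c_nbr.
rewrite iterS /avg NZ; last exact: L2c_nbr.
apply: (@le_trans _ _ (theta_avg * N (iter k avg phi))).
  by rewrite /theta_avg -mulrA ler_wpM2l ?normc_ge0// N_nbr.
by rewrite exprS -mulrA ler_wpM2l// theta_avg_ge0.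
Qed.

Lemma nbrD phi psi : nbr (phi + psi) = nbr phi + nbr psi.
Proof.
rewrite /nbr -big_split; apply: eq_bigr => i _ /=.
by apply/funext => x; rewrite !addfE /shiftc !addfE addrACA.
Qed.

Lemma nbrZ (b : R[i]) phi : nbr (cst b \* phi) = cst b \* nbr phi.
Proof.
apply/funext => x; rewrite /= /nbr !sumfE mulr_sumr; apply: eq_bigr => i _.
by rewrite !addfE /shiftc /= mulrDr.
Qed.

Lemma clap_nbr phi : ctst phi -> clap (nbr phi) = nbr (clap phi).
Proof.
move=> tp; rewrite clap_sum; last by move=> i; apply: ctstD; exact: ctst_shiftc.
apply: eq_bigr => i _; rewrite clapD; [|exact: ctst_shiftc|exact: ctst_shiftc].
by rewrite !clap_shift.
Qed.

Lemma avgD phi psi : avg (phi + psi) = avg phi + avg psi.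
Proof. by rewrite /avg nbrD; apply/funext => x; rewrite addfE /= addfE mulrDr. Qed.

Lemma avgZ (b : R[i]) phi : avg (cst b \* phi) = cst b \* avg phi.
Proof. by rewrite /avg nbrZ; apply/funext => x /=; rewrite mulrCA. Qed.

Lemma clap_avg phi : ctst phi -> clap (avg phi) = avg (clap phi).
Proof. by move=> tp; rewrite /avg clapZ ?clap_nbr//; exact: ctst_nbr. Qed.

(** Partial sums of the Neumann series for the inverse of c (1 - avg), by Horner's scheme. Being
    finite combinations of translates, they preserve test functions and commute with the
    Laplacian. *)
Fixpoint neu k phi : V -> R[i] :=
  if k is k'.+1 then cst c^-1 \* phi + avg (neu k' phi) else 0.

Lemma avg0 : avg 0 = 0.
Proof.
have -> : (0 : V -> R[i]) = cst 0 \* 0 by apply/funext => x /=; rewrite mul0r.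
by rewrite avgZ; apply/funext => x /=; rewrite !mul0r.
Qed.

Lemma ctst_neu k phi : ctst phi -> ctst (neu k phi).
Proof.
move=> tp; elim: k => [|k IH] /=; first exact: ctst0.
by apply: ctstD; [exact: ctstZ|exact: ctst_avg].
Qed.

Lemma L2c_neu k phi : L2c phi -> L2c (neu k phi).
Proof.
move=> tp; elim: k => [|k IH] /=; first exact: L2c0.
by apply: L2cD; [exact: L2cZ|apply: L2cZ; exact: L2c_nbr].
Qed.

Lemma clap_neu k phi : ctst phi -> clap (neu k phi) = neu k (clap phi).
Proof.
move=> tp; elim: k => [|k IH] /=.
  have -> : (0 : V -> R[i]) = cst 0 \* 0 by apply/funext => x /=; rewrite mul0r.
  by rewrite clapZ; [apply/funext => x /=; rewrite !mul0r|exact: ctst0].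
rewrite clapD; [|exact: ctstZ|exact/ctst_avg/ctst_neu].
by rewrite clapZ// clap_avg ?IH//; exact: ctst_neu.
Qed.

Lemma neuD k phi psi : neu k (phi + psi) = neu k phi + neu k psi.
Proof.
elim: k => [|k IH] /=; first by rewrite addr0.
rewrite IH avgD addrACA; congr (_ + _).
by apply/funext => x; rewrite addfE /= mulrDr.
Qed.

Lemma neuZ k (b : R[i]) phi : neu k (cst b \* phi) = cst b \* neu k phi.
Proof.
elim: k => [|k IH] /=; first by apply/funext => x /=; rewrite mulr0.
by rewrite IH avgZ; apply/funext => x; rewrite /= !addfE /= mulrDr mulrCA.
Qed.

Lemma avg_neu k phi : avg (neu k phi) = neu k (avg phi).
Proof.
elim: k => [|k IH] /=; first exact: avg0.
by rewrite avgD IH avgZ.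
Qed.

Lemma neu_telescope k phi : neu k (disc phi) = phi - iter k avg phi.
Proof.
elim: k => [|k IH] /=; first by rewrite subrr.
rewrite IH /disc avgD.
have -> : cst c^-1 \* (cst c \* (phi - avg phi)) = phi - avg phi.
  by apply/funext => x; exact: mulKf cn0 _.
have -> : avg (- iter k avg phi) = - avg (iter k avg phi).
  have NE (psi : V -> R[i]) : - psi = cst (-1) \* psi by apply/funext => x; rewrite oppfE /= mulN1r.
  by rewrite (NE (iter k avg phi)) avgZ -NE.
by rewrite addrA subrK.
Qed.

Lemma disc_neu k phi : disc (neu k phi) = phi - iter k avg phi.
Proof.
rewrite -neu_telescope /disc neuZ neuD avg_neu; congr (_ \* _); congr (_ + _).
have NE (psi : V -> R[i]) : - psi = cst (-1) \* psi by apply/funext => x; rewrite oppfE /= mulN1r.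
exact: etrans (NE _) (etrans (esym (neuZ k (-1) (avg phi))) (congr1 (neu k) (esym (NE _)))).
Qed.

Definition discE phi i : V -> R[i] :=
  (phi - shiftc (h *: e_ i) phi) + (phi - shiftc (- (h *: e_ i)) phi).

Let cE : c = (2 * n)%:R * h2 + z.
Proof.
rewrite /c /h2; congr (_ + _); rewrite rmorphM /=; congr (_ * _).
by rewrite natrM rmorphM /= !rmorph_nat.
Qed.

Lemma disc_split phi : disc phi = cst z \* phi + cst h2 \* \sum_i discE phi i.
Proof.
apply/funext => x; rewrite /disc /avg addfE /= addfE oppfE /= mulrBr.
have -> : c * (c^-1 * h2 * nbr phi x) = h2 * nbr phi x by rewrite -mulrA mulVKf.
have -> : (\sum_i discE phi i) x = (2 * n)%:R * phi x - nbr phi x.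
  rewrite /nbr !sumfE natrM [2 * _]mulrC -mulrA -[n in n%:R]card_ord mulr_natl -sumr_const -sumrB.
  by apply: eq_bigr => i _; rewrite /discE !addfE !oppfE; ring.
rewrite cE; ring.
Qed.

(** The bound of [helm_lower] on the lattice, with no dependence on h: translations are isometries,
    so Re z (|phi|^2 - <phi, shift phi>) >= 0 by Cauchy-Schwarz. *)
Lemma disc_lower phi : L2c phi -> normc z * N phi <= N (disc phi).
Proof.
move=> Lp.
have Ls a : L2c (shiftc a phi) by exact: L2c_shift.
have LE i : L2c (discE phi i) by apply: L2cD; exact: L2cB.
have LS : L2c (\sum_i discE phi i) by exact: L2c_sum.
rewrite disc_split -NZ//.
apply: (N_sum_ge (L2cZ z Lp) (L2cZ h2 LS) _).1.
rewrite ipZr//; last exact: L2cZ.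
rewrite mulr_ge0//; first by rewrite invr_ge0 exprn_ge0// ltW.
rewrite ip_sumr//; last exact: L2cZ.
apply: sumr_ge0 => i _; have Lz := L2cZ z Lp.
rewrite /discE ipDr//; try exact: L2cB.
rewrite !ipBr// ip_scale_self//.
(* The backward shift is the adjoint of the forward one, so the two cross terms add up to 2 Re z
   <phi, shift phi>. *)
have E : ip (cst z \* phi) (shiftc (- (h *: e_ i)) phi) =
    ip (cst (conjc z) \* phi) (shiftc (h *: e_ i) phi).
  have E1 := ip_shift (h *: e_ i) Lz.1 (Ls (- (h *: e_ i))).1.
  have E2 : shiftc (h *: e_ i) (shiftc (- (h *: e_ i)) phi) = phi.
    by apply/funext => x; rewrite /shiftc addrK.
  by rewrite -E1 E2 (ipM mu z (shiftc (h *: e_ i) phi) phi) ipC.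
have E3 := ip_conj_scale z Lp (Ls (h *: e_ i)).
have := ip_le Lp (Ls (h *: e_ i)); rewrite N_shift// => E4.
rewrite E; have E5 := ler_wpM2l z0 E4; move: E3 E5; rewrite expr2 -mulrA.
move: (ip _ _) (ip _ _) => a b; lra.
Qed.

End dense_range.

Lemma delta_norm_le1 i : `|(e_ i : V)| <= 1.
Proof.
apply/ler_addgt0Pr => e e0; apply/ltW; apply: rV_norm_lt; first by rewrite ltr_wpDl.
move=> j; rewrite mxE; case: (_ && _); rewrite ?normr1 ?normr0; lra.
Qed.

(** This is - [dq i (- h) (dq i h f)], the symmetric second difference with the sign of minus the
    second derivative. *)
Definition d2 (h : R) i (f : V -> R) x : R :=
  h ^- 2 * ((f x - f (x + h *: e_ i)) + (f x - f (x + - (h *: e_ i)))).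

Lemma d2_close i f : tst f -> exists B L : R, [/\ 0 <= B, 0 < L &
  forall h : R, 0 < h <= 1 ->
  (forall x, `|d2 h i f x + partial i (partial i f) x| <= B * h) /\
  (forall x, ~ cube L x -> d2 h i f x + partial i (partial i f) x = 0)].
Proof.
move=> tf; have [B B0 hB] := dq2_close i i tf.
have [L1 L10 fL1] := tst_supp tf.
have [L2 L20 fL2] := tst_supp (tst_partial i (tst_partial i tf)).
have LL : 0 < L1 + L2 + 1 by lra.
exists (B * 2), (L1 + L2 + 1); split => //; first by rewrite mulr_ge0.
move=> h /andP[h0 h1]; split=> x.
  have hn : h != 0 by rewrite gt_eqF.
  have nn : - h != 0 by rewrite oppr_eq0.
  have := hB h (- h) x hn nn; rewrite normrN (gtr0_norm h0).
  have -> : dq i (- h) (dq i h f) x = - d2 h i f x.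
    rewrite /dq /d2 scaleNr -addrA addNr addr0 invrN.
    by move: (f (x + _)) (f (x + _)) => a b; field.
  by rewrite -normrN opprD !opprK -mulrA mulr2n mulrDl mul1r => /le_trans; apply.
move=> xL; have {}xL : L1 + L2 + 1 <= `|x| by rewrite leNgt; apply/negP => /(cubeP x LL).
have nL1 y : L1 <= `|y| -> f y = 0.
  by move=> a; apply: fL1 => /(cubeP y L10); rewrite ltNge a.
rewrite fL2 ?addr0; last by move=> /(cubeP x L20); rewrite ltNge; apply/negP/negPn; lra.
have e1 : `|h *: (e_ i : V)| <= 1.
  rewrite normrZ (gtr0_norm h0); apply: mulr_ile1 => //; [exact: ltW|exact: delta_norm_le1].
have a1 := ler_normB (x + h *: e_ i) (h *: e_ i); rewrite addrK in a1.
have a2 := ler_normB (x + - (h *: e_ i)) (- (h *: e_ i)); rewrite opprK subrK normrN in a2.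
rewrite /d2 !nL1; [by rewrite subrr addr0 mulr0|lra|lra|lra].
Qed.

Lemma disc_clap i w : ctst w -> exists2 B : R, 0 <= B & forall h : R, 0 < h <= 1 ->
  N (cst (h ^- 2)%:C%C \* discE h w i + cpart i (cpart i w)) <= B * h.
Proof.
move=> tw; have [t1 t2] := tw.
have [B1 [L1 [B10 L10 h1]]] := d2_close i t1; have [B2 [L2 [B20 L20 h2]]] := d2_close i t2.
pose L := L1 + L2; have L0 : 0 < L by rewrite /L; lra.
exists ((B1 + B2) * Num.sqrt ((2 * L) ^+ n)); first by rewrite mulr_ge0 ?addr_ge0 ?sqrtr_ge0.
move=> h hh; have [b1 c1] := h1 h hh; have [b2 c2] := h2 h hh.
have h0 : 0 < h by case/andP: hh.
set u := (X in N X).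
have Lu : L2c u.
  apply: L2cD; last by apply: ctst_L2c; do 2!apply: ctst_cpart.
  by apply: L2cZ; apply: L2cD; apply: L2cB; (exact: ctst_L2c) || (apply: L2c_shift; exact: ctst_L2c).
have E1 x : Re (u x) = d2 h i (fun x => Re (w x)) x + partial i (partial i (fun x => Re (w x))) x.
  rewrite /u addfE cReD cpartE /= Re_cpart; congr (_ + _).
  rewrite cReM /= mul0r subr0 /discE /d2 !addfE !oppfE !cReD !cReN //.
have E2 x : Im (u x) = d2 h i (fun x => Im (w x)) x + partial i (partial i (fun x => Im (w x))) x.
  rewrite /u addfE cImD cpartE /= Im_cpart; congr (_ + _).
  rewrite cImM /= mul0r addr0 /discE /d2 !addfE !oppfE !cImD !cImN //.
have [||||_ hN] := @N_bound _ _ u ((B1 + B2) * h) L Lu.1.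
- by rewrite mulr_ge0 ?addr_ge0// ltW.
- exact: ltW.
- move=> x; apply: le_trans (normc_le_ReIm _) _; rewrite E1 E2 mulrDl; exact: lerD.
- move=> x xL; have {}xL : L <= `|x| by rewrite leNgt; apply/negP => /(cubeP x L0).
  apply: complex_ext; rewrite ?E1 ?E2.
    by apply: c1 => /(cubeP x L10); rewrite ltNge; apply/negP/negPn; rewrite /L in xL; lra.
  by apply: c2 => /(cubeP x L20); rewrite ltNge; apply/negP/negPn; rewrite /L in xL; lra.
by rewrite mulrAC.
Qed.

Lemma disc_consistent z w : ctst w -> exists2 B : R, 0 <= B & forall h : R, 0 < h <= 1 ->
  0 <= Re z -> z != 0 -> N (disc z h w - helm z w) <= B * h.
Proof.
move=> tw; have /choice[B hB] : forall i, exists b : R, 0 <= b /\ forall h : R, 0 < h <= 1 ->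
    N (cst (h ^- 2)%:C%C \* discE h w i + cpart i (cpart i w)) <= b * h.
  by move=> i; have [b ? ?] := disc_clap i tw; exists b.
exists (\sum_i B i); first by apply: sumr_ge0 => i _; exact: (hB i).1.
move=> h hh z0 zn0; have h0 : 0 < h by case/andP: hh.
have -> : disc z h w - helm z w = \sum_i (cst (h ^- 2)%:C%C \* discE h w i + cpart i (cpart i w)).
  apply/funext => x; rewrite disc_split// /helm addfE oppfE !addfE oppfE /= clapE !sumfE mulr_sumr.
  have -> (a b c : R[i]) : a + b - (a - c) = b + c by ring.
  by rewrite -big_split /=; apply: eq_bigr.
apply: le_trans (N_sum _ _) _.
  move=> i; apply: L2cD; last by apply: ctst_L2c; do 2!apply: ctst_cpart.
  by apply: L2cZ; apply: L2cD; apply: L2cB; (exact: ctst_L2c) || (apply: L2c_shift; exact: ctst_L2c).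
by rewrite mulr_suml; apply: ler_sum => i _; exact: (hB i).2.
Qed.

(** Stability and consistency give convergence. For phi = neu w, which commutes with the Laplacian,
    helm phi - w = - neu (disc w - helm w) - avg^k w. The first term is small with h, uniformly in k
    by [disc_lower]; with h fixed, the second is small for large k. *)
Lemma dense_range z w (e : R) : ctst w -> 0 <= Re z -> z != 0 -> 0 < e ->
  exists2 phi, ctst phi & N (helm z phi - w) < e.
Proof.
move=> tw z0 zn0 e0.
have nz : 0 < normc z.
  by rewrite lt_neqAle normc_ge0 eq_sym andbT; apply: contra_neq zn0 => /Normc.eq0_normc.
have [B B0 hB] := disc_consistent z tw.
(* For |y| <= e' the norm of [disc (neu y)] is at most 2 e', and dividing by |z| leaves e / 4. *)
pose e' := e * normc z / 8.
have e'0 : 0 < e' by rewrite /e' divr_gt0// mulr_gt0.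
have B1 : 0 < B + 1 by rewrite ltr_wpDl.
pose h := Num.min 1 (e' / (B + 1)).
have h0 : 0 < h by rewrite lt_min ltr01 divr_gt0.
have h1 : 0 < h <= 1 by rewrite h0 ge_min lexx.
have hBe : B * h <= e'.
  apply: (@le_trans _ _ ((B + 1) * (e' / (B + 1)))); last by rewrite mulrCA divff ?mulr1 ?gt_eqF.
  by apply: ler_pM => //; [exact: ltW|rewrite lerDl|rewrite ge_min lexx orbT].
pose y : V -> R[i] := disc z h w - helm z w.
have ty : ctst y.
  apply: ctstB; last exact: ctst_helm.
  by apply: ctstZ; apply: ctstB => //; exact: ctst_avg.
have Ny : N y <= e' by apply: le_trans (hB h h1 z0 zn0) hBe.
have t0 := theta_avg_ge0 z h; have t1 := theta_avg_lt1 z0 zn0 h0.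
have Nw1 : 0 < N w + 1 by rewrite ltr_wpDl.
have [k hk] : exists k, theta_avg z h ^+ k * (N w + 1) < e / 4.
  have /cvgrPdist_lt /(_ (e / 4 / (N w + 1))) : (fun k => theta_avg z h ^+ k) @ \oo --> (0 : R).
    by apply: cvg_expr; rewrite ger0_norm.
  have ee : 0 < e / 4 / (N w + 1) by rewrite !divr_gt0.
  move=> /(_ ee) [k _ /(_ k (leqnn k))]; rewrite sub0r normrN ger0_norm ?exprn_ge0//.
  by rewrite ltr_pdivlMr// => hk; exists k.
exists (neu z h k w); first exact: ctst_neu.
have E : helm z (neu z h k w) - w = - neu z h k y - iter k (avg z h) w.
  have NE (psi : V -> R[i]) : - psi = cst (-1) \* psi by apply/funext => x; rewrite oppfE /= mulN1r.
  have E1 : helm z (neu z h k w) = neu z h k (helm z w).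
    rewrite /helm clap_neu// neuD neuZ; congr (_ + _).
    exact: etrans (NE _) (etrans (esym (neuZ z h k (-1) (clap w))) (congr1 (neu z h k) (esym (NE _)))).
  have E2 : neu z h k (disc z h w) = neu z h k y + neu z h k (helm z w).
    by rewrite -neuD /y subrK.
  rewrite (neu_telescope z0 zn0 h0) in E2.
  have -> : helm z (neu z h k w) = w - iter k (avg z h) w - neu z h k y.
    by rewrite E1 E2 addrC addKr.
  by rewrite addrC !addrA addNr add0r addrC.
have Lw := ctst_L2c tw; have Ly := ctst_L2c ty.
have Ln : L2c (neu z h k y) by exact: L2c_neu.
have [Li Ni] := avg_iter_bound z h k Lw.
have [Liy Niy] := avg_iter_bound z h k Ly.
rewrite E; apply: le_lt_trans (N_triangleB _ _) _ => //; first exact: L2cN.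
rewrite NN.
have g1 : N (iter k (avg z h) w) < e / 4.
  apply: le_lt_trans Ni _; apply: le_lt_trans hk; rewrite ler_wpM2l ?exprn_ge0//; lra.
have g2 : normc z * N (neu z h k y) <= 2 * e'.
  apply: le_trans (disc_lower z0 zn0 h0 Ln) _.
  rewrite (disc_neu z0 zn0 h0); apply: le_trans (N_triangleB Ly Liy) _.
  have : theta_avg z h ^+ k * N y <= 1 * N y.
    exact: (ler_wpM2r (N_ge0 mu y) (exprn_ile1 k t0 (ltW t1))).
  lra.
have g3 : N (neu z h k y) <= e / 4.
  rewrite -(ler_pM2l nz); apply: le_trans g2 _; rewrite /e'; lra.
lra.
Qed.

End laplacian.

Opaque normL2 ipL2.

Lemma geo_small (R : realType) (X C : R) : (forall k : nat, `|X| <= C * 2^-1 ^+ k) -> X = 0.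
Proof.
move=> h; apply/eqP; rewrite -normr_le0.
have c0 : (fun k => C * 2^-1 ^+ k) @ \oo --> (0 : R).
  by rewrite -[X in _ --> X](mulr0 C); apply: cvgMr; apply: cvg_expr; rewrite ger0_norm; lra.
rewrite -(cvg_lim (@Rhausdorff R) c0); apply: limr_ge; first by apply/cvg_ex; exists 0.
exact: nearW.
Qed.

Lemma normc_conj (R : realType) (z : R[i]) : normc (conjc z) = normc z.
Proof. by case: z => a b /=; rewrite sqrrN. Qed.

(** * Weak solutions in H^2 and perturbation of the potential *)

Section solvability.
Context {R : realType} {n : nat}.
Local Notation V := 'rV[R]_n.
Local Notation e_ i := (delta_mx ord0 i : 'rV[R]_n).
Local Notation mu := (lebesgue_rV R n).
Local Notation ip := (ipL2 mu).
Local Notation N := (normL2 mu).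
Local Notation L2c := (sq_integrable mu).
Implicit Types (u v w phi g q : V -> R[i]) (i j : 'I_n) (z c : R[i]).

Lemma L2P u : L2 u <-> L2c u.
Proof.
split=> [[m1 m2 h]|Lu]; first exact: L2cP (conj m1 m2) h.
have [[m1 m2] _] := Lu; split=> //.
by rewrite /L2norm (Lnorm2_fin Lu) ltry.
Qed.

Definition wder i u v := forall phi, ctst phi -> ip u (cpart i phi) = - ip v phi.

(** Real and purely imaginary test functions separate the two parts; conversely the two real
    identities are added. *)
Lemma wderP i u v : L2c u -> L2c v -> weak_partialC i u v <-> wder i u v.
Proof.
move=> Lu Lv.
have Ire w (f : V -> R) x : Re (w x) * f x = dotc (w x) (f x)%:C%C.
  by rewrite /dotc /= mulr0 addr0.
have Iim w (f : V -> R) x : Im (w x) * f x = dotc (w x) (0 +i* f x)%C.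
  by rewrite /dotc /= mulr0 add0r.
have ci (f : V -> R) : tst f -> ctst (fun x => (0 +i* f x)%C).
  by move=> tf; split => //=; exact: tst0.
have cR (f : V -> R) : tst f -> cpart i (fun x => (f x)%:C%C) = (fun x => (partial i f x)%:C%C).
  move=> tf; apply/funext => x; rewrite cpartE; congr (_ +i* _)%C.
  by rewrite /partial derive_cst.
have cI (f : V -> R) : tst f -> cpart i (fun x => (0 +i* f x)%C) = (fun x => (0 +i* partial i f x)%C).
  move=> tf; apply/funext => x; rewrite cpartE; congr (_ +i* _)%C.
  by rewrite /partial derive_cst.
split=> [[h1 h2] phi tp|h].
  have [t1 t2] := tp.
  have ir w (f : V -> R) : L2c w -> tst f -> mu.-integrable setT (EFin \o (fun x => Re (w x) * f x)).
    move=> Lw tf; have := integrable_dot Lw (ctst_L2c (ctst_real tf)).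
    by congr integrable; apply/funext => x /=; rewrite -Ire.
  have ii w (f : V -> R) : L2c w -> tst f -> mu.-integrable setT (EFin \o (fun x => Im (w x) * f x)).
    move=> Lw tf; have := integrable_dot Lw (ctst_L2c (ci _ tf)).
    by congr integrable; apply/funext => x /=; rewrite -Iim.
  have S w (f1 f2 : V -> R) : L2c w -> tst f1 -> tst f2 ->
    \int[mu]_x (Re (w x) * f1 x + Im (w x) * f2 x) =
    \int[mu]_x (Re (w x) * f1 x) + \int[mu]_x (Im (w x) * f2 x).
    by move=> Lw tf1 tf2; rewrite RintegralD//; [exact: ir|exact: ii].
  have E1 := S v _ _ Lv t1 t2.
  have E2 := S u _ _ Lu (tst_partial i t1) (tst_partial i t2).
  rewrite (h1 _ ((tstP _).2 t1)) (h2 _ ((tstP _).2 t2)) -opprD -E1 in E2.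
  rewrite -[RHS]/(- \int[mu]_x (Re (v x) * Re (phi x) + Im (v x) * Im (phi x))) -E2.
  by apply: eq_Rintegral => x _; rewrite cpartE.
split=> f /tstP tf.
  have := h _ (ctst_real tf); rewrite (cR _ tf) => E.
  have {}E : \int[mu]_x dotc (u x) (partial i f x)%:C%C = - \int[mu]_x dotc (v x) (f x)%:C%C := E.
  under eq_Rintegral do rewrite Ire.
  by rewrite E; congr (- _); apply: eq_Rintegral => x _; rewrite Ire.
have := h _ (ci _ tf); rewrite (cI _ tf) => E.
have {}E : \int[mu]_x dotc (u x) (0 +i* partial i f x)%C = - \int[mu]_x dotc (v x) (0 +i* f x)%C := E.
under eq_Rintegral do rewrite Iim.
by rewrite E; congr (- _); apply: eq_Rintegral => x _; rewrite Iim.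
Qed.

Lemma wderB i u u' v v' : L2c u -> L2c u' -> L2c v -> L2c v' ->
  wder i u v -> wder i u' v' -> wder i (u - u') (v - v').
Proof.
move=> Lu Lu' Lv Lv' h h' phi tp.
rewrite !ipBl//; try exact: ctst_L2c; last exact/ctst_L2c/ctst_cpart.
by rewrite h// h'//; ring.
Qed.

Lemma wder_ctst i phi : ctst phi -> wder i phi (cpart i phi).
Proof. by move=> tp psi tq; rewrite ip_cpart// opprK. Qed.

(** Weak differentiation has a closed graph in L^2; this places the limits of test functions in
    H^2. *)
Lemma wder_lim i (u v : nat -> V -> R[i]) u0 v0 (A B : R) :
  (forall k, L2c (u k)) -> (forall k, L2c (v k)) -> L2c u0 -> L2c v0 ->
  (forall k, N (u0 - u k) <= A * 2^-1 ^+ k) -> (forall k, N (v0 - v k) <= B * 2^-1 ^+ k) ->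
  (forall k, wder i (u k) (v k)) -> wder i u0 v0.
Proof.
move=> Lu Lv Lu0 Lv0 hu hv h phi tp.
have Lp := ctst_L2c tp; have Ld := ctst_L2c (ctst_cpart i tp).
apply/eqP; rewrite -subr_eq0 opprK; apply/eqP.
set X := ip u0 _ + _.
pose C := A * N (cpart i phi) + B * N phi.
have hX k : `|X| <= C * 2^-1 ^+ k.
  have -> : X = ip (u0 - u k) (cpart i phi) + ip (v0 - v k) phi.
    by rewrite !ipBl// (h k phi tp) /X; ring.
  apply: le_trans (ler_normD _ _) _; rewrite /C mulrDl; apply: lerD.
    apply: le_trans (ip_CauchySchwarz _ _) _ => //; first exact: L2cB.
    by rewrite mulrAC; apply: ler_wpM2r => //; exact: N_ge0.
  apply: le_trans (ip_CauchySchwarz _ _) _ => //; first exact: L2cB.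
  by rewrite mulrAC; apply: ler_wpM2r => //; exact: N_ge0.
exact: geo_small hX.
Qed.

(** The graph of - Laplacian + q on H^2. A general q allows the potentials [qpot] to be compared
    with each other and with constants. *)
Definition Hop q u g := exists Du : 'I_n -> V -> R[i], exists D2u : 'I_n -> 'I_n -> V -> R[i],
  [/\ L2c u, forall i, L2c (Du i) /\ wder i u (Du i),
      forall i j, L2c (D2u i j) /\ wder j (Du i) (D2u i j)
    & {ae mu, forall x, g x = - (\sum_i D2u i i x) + q x * u x}].

Definition qpot (m : R) (f : V -> R) z : V -> R[i] :=
  fun x => ((m ^+ 2)%:C - ((f x)%:C - z) ^+ 2)%C.

Lemma TV_graphP (m : R) (f : V -> R) z u g :
  TV_graph m f z u g <-> Hop (qpot m f z) u g.
Proof.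
split.
  move=> [h [[Du [D2u [[/L2P Lu h1 h2] ae1]]] ae2]].
  have LD i : L2c (Du i) by apply/L2P; exact: (h1 i).1.
  have LD2 i j : L2c (D2u i j) by apply/L2P; exact: (h2 i j).1.
  exists Du, D2u; split=> //.
  - by move=> i; split=> //; apply/wderP => //; exact: (h1 i).2.
  - by move=> i j; split=> //; apply/wderP => //; exact: (h2 i j).2.
  - move: ae1; apply: filterS2 ae2 => x -> ->; rewrite /qpot; ring.
move=> [Du [D2u [Lu h1 h2 ae1]]].
have LD i := (h1 i).1; have LD2 i j := (h2 i j).1.
exists (fun x => - (\sum_i D2u i i x) + (m ^+ 2)%:C%C * u x); split.
  exists Du, D2u; split; last by apply: aeW.
  split; first exact/L2P.
    by move=> i; split; [exact/L2P|apply/wderP => //; exact: (h1 i).2].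
  by move=> i j; split; [exact/L2P|apply/wderP => //; exact: (h2 i j).2].
by apply: filterS ae1 => x ->; rewrite /qpot; ring.
Qed.

Lemma Hop_L2c q u g : Hop q u g -> L2c u.
Proof. by case=> Du [D2u []]. Qed.

Lemma HopB q u u' g g' : Hop q u g -> Hop q u' g' -> Hop q (u - u') (g - g').
Proof.
move=> [Du [D2u [Lu h1 h2 ae1]]] [Du' [D2u' [Lu' h1' h2' ae1']]].
exists (fun i => Du i - Du' i), (fun i j => D2u i j - D2u' i j); split.
- exact: L2cB.
- move=> i; have [L w] := h1 i; have [L' w'] := h1' i.
  by split; [exact: L2cB|exact: wderB].
- move=> i j; have [L w] := h2 i j; have [L' w'] := h2' i j.
  by split; [exact: L2cB|apply: wderB => //; [exact: (h1 _).1|exact: (h1' _).1]].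
- apply: filterS2 ae1 ae1' => x; rewrite !addfE !oppfE => -> ->.
  have -> : \sum_i (D2u i i - D2u' i i) x = \sum_i D2u i i x - \sum_i D2u' i i x.
    by rewrite -sumrB.
  ring.
Qed.

Lemma Hop_ae q u g g' : Hop q u g -> {ae mu, forall x, g' x = g x} -> Hop q u g'.
Proof.
move=> [Du [D2u [Lu h1 h2 ae1]]] h; exists Du, D2u; split=> //.
by apply: filterS2 ae1 h => x -> ->.
Qed.

Lemma Hop_pert q q' u g : Hop q u g -> Hop q' u (g + (q' - q) \* u).
Proof.
move=> [Du [D2u [Lu h1 h2 ae1]]]; exists Du, D2u; split=> //.
apply: filterS ae1 => x; rewrite addfE /= addfE oppfE => ->; ring.
Qed.

Lemma Hop_test z u g phi : Hop (cst z) u g -> L2c g -> ctst phi ->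
  ip g phi = ip u (helm (conjc z) phi).
Proof.
move=> [Du [D2u [Lu h1 h2 ae1]]] Lg tp; have Lp := ctst_L2c tp.
have LD2 i j := (h2 i j).1.
have LS : L2c (\sum_i D2u i i) by apply: L2c_sum => i.
have Lr : L2c (- (\sum_i D2u i i) + cst z \* u) by apply: L2cD; [exact: L2cN|exact: L2cZ].
rewrite (ae_eq_ip Lg Lr Lp Lp); [|by apply: filterS ae1 => x ->; rewrite addfE oppfE sumfE|exact: aeW].
rewrite ipDl//; [|exact: L2cN|exact: L2cZ].
rewrite ipNl// ip_suml//.
rewrite /helm ipBr//; [|exact/L2cZ|exact/ctst_L2c/ctst_clap].
rewrite ipM addrC; congr (_ - _).
rewrite /clap ip_sumr//; last by move=> i; apply: ctst_L2c; do 2!apply: ctst_cpart.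
apply: eq_bigr => i _.
have E1 := (h1 i).2 _ (ctst_cpart i tp); have E2 := (h2 i i).2 _ tp.
by rewrite E1 E2 opprK.
Qed.

(** By duality, so that no density of test functions in H^2 is involved: v is approximated by
    (conj(z) - Laplacian) phi, hence |v|^2 is close to <g, phi>, while |z| |phi| is at most about
    |v|. *)
Lemma Hop_lower z v g : 0 <= Re z -> z != 0 -> Hop (cst z) v g -> L2c g ->
  normc z * N v <= N g.
Proof.
move=> z0 zn0 Hv Lg; have Lv := Hop_L2c Hv.
have nv := N_ge0 mu v; have ng := N_ge0 mu g.
have [->|v0] := eqVneq (N v) 0; first by rewrite mulr0.
have {}v0 : 0 < N v by rewrite lt_neqAle eq_sym v0.
rewrite -(ler_pM2r v0); apply/ler_addgt0Pr => e e0.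
have nz := normc_ge0 z.
(* K dominates the factor |z| |v| + |g| that e' acquires in the final estimate. *)
pose K := normc z * N v + N g + 1; have K0 : 0 < K by rewrite /K ltr_wpDl// addr_ge0// mulr_ge0.
pose e' := e / K; have e'0 : 0 < e' by rewrite divr_gt0.
have [w tw hw] := (approx_all Lv).2 (e' / 2) (divr_gt0 e'0 (ltr0Sn _ _)).
have zc0 : 0 <= Re (conjc z) by rewrite cRe_conj.
have zcn0 : conjc z != 0 by rewrite conjc_eq0.
have [phi tp hp] := dense_range tw zc0 zcn0 (divr_gt0 e'0 (ltr0Sn _ 1)).
have Lw := ctst_L2c tw; have Lp := ctst_L2c tp; have Lh := ctst_L2c (ctst_helm (conjc z) tp).
have hd : N (v - helm (conjc z) phi) < e'.
  apply: le_lt_trans (N_tri_dist Lv Lw Lh) _; rewrite [N (w - _)]N_distC; lra.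
have E := Hop_test Hv Lg tp.
have h1 : N v * N v <= N v * e' + N g * N phi.
  rewrite -expr2 sqrN -{2}[v](subrK (helm (conjc z) phi)) ipDr//; last exact: L2cB.
  apply: lerD; last by rewrite -E; exact: ip_le.
  apply: le_trans (ip_le _ _) _ => //; first exact: L2cB.
  by apply: ler_wpM2l => //; exact: ltW.
have h2 : normc z * N phi <= N v + e'.
    rewrite -(normc_conj z); apply: le_trans (helm_lower tp zc0).1 _.
  rewrite -[helm _ _](subrK v); apply: le_trans (N_triangle _ _) _ => //; first exact: L2cB.
  by rewrite addrC N_distC lerD2l ltW.
have h3 := ler_wpM2l nz h1; have h4 := ler_wpM2l ng h2.
have h5 : e' * K = e by rewrite /e' divfK// gt_eqF.
rewrite /K in h5; have ne := mulr_ge0 (ltW e'0) nv.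
move: h3 h4 h5 ne; move: (N v) (N g) (N phi) (normc z) => a b c d0 *; nra.
Qed.

Lemma mulr_sqr_le (a x y A : R) : 0 <= x -> x <= A -> 0 <= y -> y <= A ->
  0 <= a -> a ^+ 2 <= x * y -> a <= A.
Proof.
move=> x0 xA y0 yA a0 h; rewrite -(@ler_pXn2r _ 2) ?nnegrE//; last exact: le_trans xA.
by apply: le_trans h _; rewrite expr2; exact: ler_pM.
Qed.

(** Test functions with (z - Laplacian) phi_k within 2^-k of g are Cauchy together with all first
    and second derivatives, by [helm_lower], [N_cpart1] and [N_cpart2]; the limit solves the
    equation. *)
Lemma Hop_solve z g : 0 <= Re z -> z != 0 -> L2c g -> exists u, Hop (cst z) u g.
Proof.
move=> z0 zn0 Lg.
have nz : 0 < normc z.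
  by rewrite lt_neqAle normc_ge0 eq_sym andbT; apply: contra_neq zn0 => /Normc.eq0_normc.
have /choice[phi hphi] : forall k : nat, exists phi, ctst phi /\ N (helm z phi - g) <= 2^-1 ^+ k.
  move=> k; have e0 : 0 < 2^-1 ^+ k / 2 :> R by rewrite divr_gt0 ?exprn_gt0 ?invr_gt0.
  have [w tw hw] := (approx_all Lg).2 _ e0.
  have [phi tp hp] := dense_range tw z0 zn0 e0.
  exists phi; split=> //.
  apply: le_trans (N_tri_dist (ctst_L2c (ctst_helm z tp)) (ctst_L2c tw) Lg) _.
  rewrite [N (w - _)]N_distC; move: (N _) (N _) (2^-1 ^+ k) hw hp => a b c; lra.
have tp k := (hphi k).1.
have Lp k := ctst_L2c (tp k).
have Lh k := ctst_L2c (ctst_helm z (tp k)).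
(* One constant for all orders: 2 / |z| serves the functions, 2 their second derivatives, and the
   geometric mean the first derivatives. *)
pose A : R := Num.max 1 (normc z)^-1 * 2.
have A1 : 1 <= Num.max 1 (normc z)^-1 by rewrite le_max lexx.
have A2 : (normc z)^-1 <= Num.max 1 (normc z)^-1 by rewrite le_max lexx orbT.
have A0 : 0 <= A by rewrite /A; lra.
pose dp k : V -> R[i] := phi k.+1 - phi k.
have td k : ctst (dp k) by exact: ctstB.
have dB i w w' : ctst w -> ctst w' -> cpart i (w - w') = cpart i w - cpart i w'.
  move=> tw tw'; have NE (psi : V -> R[i]) : - psi = cst (-1) \* psi.
    by apply/funext => x; rewrite oppfE /= mulN1r.
  by rewrite cpartD//; [rewrite {1}(NE w') cpartZ// -NE|exact: ctstN].
have hd k : N (helm z (dp k)) <= 2 * 2^-1 ^+ k.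
  have -> : helm z (dp k) = helm z (phi k.+1) - helm z (phi k).
    have cE : clap (dp k) = clap (phi k.+1) - clap (phi k).
      rewrite /clap -sumrB; apply: eq_bigr => i _.
      by rewrite dB// dB//; exact: ctst_cpart.
    rewrite /helm cE; apply/funext => x; rewrite !addfE !oppfE /= !addfE !oppfE /=.
    have -> : dp k x = phi k.+1 x - phi k x by [].
    move: (phi _ x) (phi k x) (clap _ x) (clap _ x) => a b c d; ring.
  apply: le_trans (N_tri_dist (Lh k.+1) Lg (Lh k)) _; rewrite [N (g - _)]N_distC.
  have := (hphi k).2; have := (hphi k.+1).2; rewrite exprS.
  have : 0 <= 2^-1 ^+ k :> R by rewrite exprn_ge0.
  have ar (a b c : R) : 0 <= c -> a <= 2^-1 * c -> b <= c -> a + b <= 2 * c by lra.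
  exact: ar.
have g0 k : 0 <= 2^-1 ^+ k :> R by rewrite exprn_ge0.
have h0 k : N (dp k) <= A * 2^-1 ^+ k.
  apply: (@le_trans _ _ ((normc z)^-1 * (2 * 2^-1 ^+ k))).
    rewrite ler_pdivlMl//; exact: le_trans (helm_lower (td k) z0).1 (hd k).
  by rewrite /A -mulrA; apply: ler_wpM2r => //; rewrite mulr_ge0.
have hc k : N (clap (dp k)) <= A * 2^-1 ^+ k.
  apply: le_trans (le_trans (helm_lower (td k) z0).2 (hd k)) _.
  by apply: ler_wpM2r => //; rewrite /A; lra.
have h2 i j k : N (cpart i (cpart j (dp k))) <= A * 2^-1 ^+ k.
  exact: le_trans (N_cpart2 i j (td k)) (hc k).
have h1 i k : N (cpart i (dp k)) <= A * 2^-1 ^+ k.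
  exact: mulr_sqr_le (N_ge0 mu _) (h0 k) (N_ge0 mu _) (hc k) (N_ge0 mu _) (N_cpart1 i (td k)).
have r0 : 0 <= 2^-1 :> R by lra.
have r1 : 2^-1 < 1 :> R by lra.
have [u Lu hu] := L2_complete r0 r1 Lp h0.
have /choice[Du hDu] : forall i, exists v, L2c v /\ forall k, N (v - cpart i (phi k)) <= A * 2^-1 ^+ k / (1 - 2^-1).
  move=> i; have [|v Lv hv] := L2_complete r0 r1 (fun k => ctst_L2c (ctst_cpart i (tp k))) (A := A).
    move=> k; have E1 := dB i _ _ (tp k.+1) (tp k).
    by rewrite -E1; exact: h1.
  by exists v.
have t2 i j k : ctst (cpart j (cpart i (phi k))) by do 2!apply: ctst_cpart.
have /choice[D2u hD2u] : forall ij : 'I_n * 'I_n, exists v, L2c v /\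
    forall k, N (v - cpart ij.2 (cpart ij.1 (phi k))) <= A * 2^-1 ^+ k / (1 - 2^-1).
  move=> [i j] /=; have [|v Lv hv] := L2_complete r0 r1 (fun k => ctst_L2c (t2 i j k)) (A := A).
    move=> k; have E1 := congr1 (cpart j) (dB i _ _ (tp k.+1) (tp k)).
    have E2 := dB j _ _ (ctst_cpart i (tp k.+1)) (ctst_cpart i (tp k)).
    by rewrite -E2 -E1; exact: h2.
  by exists v.
have AE k : A * 2^-1 ^+ k / (1 - 2^-1) = (A / (1 - 2^-1)) * 2^-1 ^+ k by rewrite mulrAC.
exists u, Du, (fun i j => D2u (i, j)); split=> //.
- move=> i; split; first exact: (hDu i).1.
  apply: (@wder_lim i phi (fun k => cpart i (phi k)) u (Du i) (A / (1 - 2^-1)) (A / (1 - 2^-1))) => //.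
  + by move=> k; exact/ctst_L2c/ctst_cpart.
  + exact: (hDu i).1.
  + by move=> k; rewrite -AE.
  + by move=> k; rewrite -AE; exact: (hDu i).2.
  + by move=> k; exact: wder_ctst.
- move=> i j; split; first exact: (hD2u (i, j)).1.
  apply: (@wder_lim j (fun k => cpart i (phi k)) (fun k => cpart j (cpart i (phi k))) (Du i) (D2u (i, j))
    (A / (1 - 2^-1)) (A / (1 - 2^-1))) => //.
  + by move=> k; exact/ctst_L2c/ctst_cpart.
  + by move=> k; exact: ctst_L2c.
  + exact: (hDu i).1.
  + exact: (hD2u (i, j)).1.
  + by move=> k; rewrite -AE; exact: (hDu i).2.
  + by move=> k; rewrite -AE; exact: (hD2u (i, j)).2.
  + by move=> k; apply: wder_ctst; exact: ctst_cpart.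
pose S : V -> R[i] := \sum_i D2u (i, i).
have LS : L2c S by apply: L2c_sum => i; exact: (hD2u (i, i)).1.
pose y : V -> R[i] := g - (cst z \* u - S).
have Lzu : L2c (cst z \* u) by exact: L2cZ.
have Ly : L2c y by apply: L2cB => //; exact: L2cB.
have : N y = 0.
  pose B := A / (1 - 2^-1).
  apply: (@geo_small _ _ (1 + normc z * B + n%:R * B)) => k.
  rewrite ger0_norm; last exact: N_ge0.
  have -> : y = (g - helm z (phi k)) + ((S - clap (phi k)) - cst z \* (u - phi k)).
    apply/funext => x.
    change (g x - (z * u x - S x) = (g x - (z * phi k x - clap (phi k) x)) +
      ((S x - clap (phi k) x) - z * (u x - phi k x))).
    move: (clap _ x) => c; ring.
  have Lup : L2c (u - phi k) by exact: L2cB.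
  have LSc : L2c (S - clap (phi k)) by apply: L2cB => //; exact/ctst_L2c/ctst_clap.
  apply: le_trans (N_triangle _ _) _; [exact: L2cB|by apply: L2cB => //; exact: L2cZ|].
  apply: le_trans (lerD (lexx _) (N_triangleB LSc (L2cZ z Lup))) _.
  rewrite N_distC (NZ z Lup).
  have b1 := (hphi k).2.
  have b2 : normc z * N (u - phi k) <= normc z * B * 2^-1 ^+ k.
    by rewrite -mulrA; apply: ler_wpM2l; [exact: ltW|rewrite /B -AE].
  have b3 : N (S - clap (phi k)) <= n%:R * B * 2^-1 ^+ k.
    have -> : S - clap (phi k) = \sum_i (D2u (i, i) - cpart i (cpart i (phi k))) by rewrite /S /clap -sumrB.
    apply: le_trans (N_sum _ _) _.
      by move=> i; apply: L2cB; [exact: (hD2u (i, i)).1|exact: ctst_L2c].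
    apply: (@le_trans _ _ (\sum_(i < n) B * 2^-1 ^+ k)).
      by apply: ler_sum => i _; rewrite /B -AE; exact: (hD2u (i, i)).2.
    by rewrite sumr_const card_ord -mulrA mulr_natl.
  have ar (a b c p x t : R) : a <= p -> c <= x * p -> b <= t * p ->
    a + (b + c) <= (1 + x + t) * p by lra.
  exact: ar b1 b2 b3.
move=> /(ae_ip_eq0 Ly); apply: filterS => x.
have -> : y x = g x - (z * u x - S x) by [].
have -> : S x = \sum_i D2u (i, i) x by exact: sumfE.
move=> /eqP.
by rewrite subr_eq0 => /eqP ->; rewrite addrC.
Qed.

(** The bound concerns every solution and so contains uniqueness; the constant is recorded because
    it measures the admissible perturbation. *)
Definition solvable q (C : R) := [/\ 0 <= C,
  forall v g, L2c g -> Hop q v g -> N v <= C * N g &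
  forall g, L2c g -> exists u, Hop q u g].

Lemma solvable_cst z : 0 <= Re z -> z != 0 -> solvable (cst z) (normc z)^-1.
Proof.
move=> z0 zn0; have nz : 0 < normc z.
  by rewrite lt_neqAle normc_ge0 eq_sym andbT; apply: contra_neq zn0 => /Normc.eq0_normc.
split; first by rewrite invr_ge0 ltW.
- by move=> v g Lg Hv; rewrite ler_pdivlMl//; exact: Hop_lower Hv Lg.
- by move=> g; exact: Hop_solve.
Qed.

Lemma L2_complete0 (u : nat -> V -> R[i]) (A r : R) : 0 <= r -> r < 1 ->
  (forall k, L2c (u k)) -> (forall k, N (u k.+1 - u k) <= A * r ^+ k) ->
  exists2 v, L2c v & (fun k => N (v - u k)) @ \oo --> (0 : R).
Proof.
move=> r0 r1 Lu hu; have [v Lv hv] := L2_complete r0 r1 Lu hu.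
exists v => //; apply: (@squeeze_cvgr _ _ _ _ (cst 0) (fun k => A * r ^+ k / (1 - r))).
- by apply: nearW => k; rewrite (N_ge0 mu) hv.
- exact: cvg_cst.
- rewrite (_ : 0 = A * 0 / (1 - r)); last by rewrite mulr0 mul0r.
  by apply: cvgMl; apply: cvgMr; apply: cvg_expr; rewrite ger0_norm.
Qed.

Lemma cvg0_eq0 (f : nat -> R) (X : R) : f @ \oo --> (0 : R) -> 0 <= X ->
  (forall k, X <= f k) -> X = 0.
Proof.
move=> f0 X0 h; apply/eqP; rewrite eq_le X0 andbT.
rewrite -(cvg_lim (@Rhausdorff R) f0); apply: limr_ge; first by apply/cvg_ex; exists 0.
exact: nearW.
Qed.

(** Banach's fixed-point iteration for u = S (g - (q' - q) u). The solution map S is an arbitrary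
    choice of solutions: the contraction estimate only uses the bound for differences of
    solutions. *)
Lemma solvable_pert q q' (C delta : R) : meas_c q -> meas_c q' ->
  (forall x, normc (q' x - q x) <= delta) -> 0 <= delta -> C * delta < 1 ->
  solvable q C -> solvable q' (C / (1 - C * delta)).
Proof.
move=> mq mq' hd d0 Cd [C0 hlow hsol].
have Cd0 : 0 <= C * delta by rewrite mulr_ge0.
have Cd1 : 0 < 1 - C * delta by rewrite subr_gt0.
have md : meas_c (q' - q) by exact: meas_cB.
have Ld u : L2c u -> L2c ((q' - q) \* u) by exact: (L2cM md hd).
have Nd u : L2c u -> N ((q' - q) \* u) <= delta * N u by exact: (N_M md hd).
split; first by rewrite divr_ge0// ltW.
- move=> v g Lg Hv; have Lv := Hop_L2c Hv.
  have Hq : Hop q v (g - (q' - q) \* v).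
    apply: Hop_ae (Hop_pert q Hv) _; apply: aeW => x.
    rewrite !addfE oppfE /= !addfE !oppfE; ring.
  have h1 := hlow _ _ (L2cB Lg (Ld _ Lv)) Hq.
  have h2 : N v <= C * (N g + delta * N v).
    apply: le_trans h1 _; apply: ler_wpM2l => //.
    apply: le_trans (N_triangleB Lg (Ld _ Lv)) _.
    by rewrite lerD2l; exact: Nd.
  rewrite mulrAC ler_pdivlMr//; move: h2; rewrite mulrDr mulrBr mulr1 mulrA => h2.
  rewrite lerBlDr [N v * _]mulrC; exact: h2.
- move=> g Lg.
  have /choice[S hS] : forall f, exists u, L2c f -> Hop q u f.
    move=> f; have [Lf|nLf] := pselect (L2c f); last by exists 0.
    by have [u Hu] := hsol f Lf; exists u.
  pose T u := S (g - (q' - q) \* u).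
  have Lgu u : L2c u -> L2c (g - (q' - q) \* u) by move=> Lu; apply: L2cB => //; exact: Ld.
  have HT u : L2c u -> Hop q (T u) (g - (q' - q) \* u) by move=> Lu; apply: hS; exact: Lgu.
  have LT u : L2c u -> L2c (T u) by move=> Lu; exact: Hop_L2c (HT u Lu).
  have cT u w : L2c u -> L2c w -> N (T u - T w) <= (C * delta) * N (u - w).
    move=> Lu Lw; have Luw : L2c (u - w) by exact: L2cB.
    have H1 : Hop q (T u - T w) (- ((q' - q) \* (u - w))).
      apply: Hop_ae (HopB (HT u Lu) (HT w Lw)) _; apply: aeW => x.
      rewrite !addfE !oppfE /= !addfE !oppfE /= !addfE !oppfE; ring.
    have := hlow _ _ (L2cN (Ld _ Luw)) H1; rewrite NN => /le_trans; apply.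
    by rewrite -mulrA; apply: ler_wpM2l => //; exact: Nd.
  pose u k := iter k T 0.
  have Lu k : L2c (u k) by elim: k => [|k IH]; [exact: L2c0|exact: LT].
  have hu k : N (u k.+1 - u k) <= N (u 1%N - u 0%N) * (C * delta) ^+ k.
    elim: k => [|k IH]; first by rewrite mulr1.
    rewrite exprS mulrCA; apply: le_trans (cT _ _ (Lu k.+1) (Lu k)) _.
    exact: ler_wpM2l.
  have [v Lv hv] := L2_complete0 Cd0 Cd Lu hu.
  have LTv := LT v Lv.
  have LX : L2c (T v - v) by exact: L2cB.
  have X0 : N (T v - v) = 0.
    apply: (@cvg0_eq0 (fun k => C * delta * N (v - u k) + N (v - u k.+1))).
    - rewrite (_ : 0 = C * delta * 0 + 0); last by rewrite mulr0 addr0.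
      apply: cvgD; [exact: cvgMr|].
      pose f (k : nat) := N (v - u k); have : f @ \oo --> (0 : R) by [].
      by rewrite -cvg_shiftS.
    - exact: N_ge0.
    - move=> k; apply: le_trans (N_tri_dist LTv (Lu k.+1) Lv) _.
      by rewrite [N (u k.+1 - v)]N_distC lerD2r; exact: cT.
  have aeX := ae_ip_eq0 LX X0.
  (* The fixed-point equation holds only almost everywhere; [T v], unlike [v], is known to lie in
     the domain. *)
  exists (T v); apply: Hop_ae (Hop_pert q' (HT v Lv)) _.
  apply: filterS aeX => x; rewrite !addfE !oppfE /= !addfE !oppfE => /eqP.
  rewrite subr_eq0 => /eqP ->; ring.
Qed.

Lemma bi_solvable (m : R) (f : V -> R) z (B : R) :
  meas_c (qpot m f z) -> (forall x, normc (qpot m f z x) <= B) ->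
  boundedly_invertible (TV_graph m f z) <-> exists C, solvable (qpot m f z) C.
Proof.
move=> mq qB; split=> [[C hC]|[C [C0 hlow hsol]]].
  (* [boundedly_invertible] admits any real C, [solvable] only C >= 0. *)
  exists (Num.max 0 C); split.
  - by rewrite le_max lexx.
  - move=> v g Lg Hv; have [u [Hu hN hun]] := hC g ((L2P g).2 Lg).
    have Lu := Hop_L2c ((TV_graphP _ _ _ _ _).1 Hu); have Lv := Hop_L2c Hv.
    have E := hun v ((TV_graphP _ _ _ _ _).2 Hv).
    rewrite (ae_eq_N Lv Lu E).
    move: hN; rewrite /L2norm (Lnorm2_fin Lu) (Lnorm2_fin Lg) -EFinM lee_fin => /le_trans; apply.
    by apply: ler_wpM2r; [exact: N_ge0|rewrite le_max lexx orbT].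
  - move=> g Lg; have [u [Hu _ _]] := hC g ((L2P g).2 Lg).
    by exists u; apply/TV_graphP.
exists C => g /L2P Lg; have [u Hu] := hsol g Lg; have Lu := Hop_L2c Hu.
exists u; split; first exact/TV_graphP.
  by rewrite /L2norm (Lnorm2_fin Lu) (Lnorm2_fin Lg) -EFinM lee_fin; exact: hlow.
move=> v /TV_graphP Hv; have Lv := Hop_L2c Hv.
have Luv : L2c (v - u) by exact: L2cB.
have H0 : Hop (qpot m f z) (v - u) 0.
  by apply: Hop_ae (HopB Hv Hu) _; apply: aeW => x; rewrite addfE oppfE subrr.
have : N (v - u) = 0.
  apply/eqP; rewrite eq_le (N_ge0 mu) andbT.
  by have := hlow _ _ (L2c0 mu) H0; rewrite N0 mulr0.
move=> /(ae_ip_eq0 Luv); apply: filterS => x; rewrite addfE oppfE => /eqP.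
by rewrite subr_eq0 => /eqP.
Qed.

End solvability.

(** * The spectrum under perturbation *)

Section spectral.
Context {R : realType} {n : nat}.
Local Notation V := 'rV[R]_n.
Local Notation e_ i := (delta_mx ord0 i : 'rV[R]_n).
Local Notation mu := (lebesgue_rV R n).
Local Notation ip := (ipL2 mu).
Local Notation N := (normL2 mu).
Local Notation L2c := (sq_integrable mu).
Implicit Types (f g : V -> R) (u v phi q : V -> R[i]) (i j : 'I_n) (z w c : R[i]).
Variable m : R.

Lemma meas_qpot f z : continuous f -> meas_c (qpot m f z).
Proof.
move=> cf; have mf := continuous_rV_measurable cf.
have m1 : meas_c (fun x => ((f x)%:C - z)%C).
  by apply: (@meas_cB _ _ _ (fun x => (f x)%:C%C) (cst z)); [split => //=|exact: meas_c_cst].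
have := meas_cB (meas_c_cst ((m ^+ 2)%:C)%C) (meas_cM m1 m1).
congr meas_c; apply/funext => x; rewrite /qpot expr2 //.
Qed.

Lemma qpot_dist f g z w x (b e : R) : `|f x| <= b -> `|g x| <= b -> `|f x - g x| <= e ->
  normc (w - z) <= e -> normc (qpot m g w x - qpot m f z x) <= (2 * e) * (2 * b + normc z + normc w).
Proof.
move=> fb gb fg wz.
have -> : qpot m g w x - qpot m f z x =
    (((f x - g x)%:C)%C + (w - z)) * (((f x + g x)%:C)%C - (z + w)).
  by rewrite /qpot rmorphB rmorphD /=; ring.
rewrite Normc.normcM; apply: ler_pM; rewrite ?normc_ge0//.
  apply: le_trans (normc_triangle _ _) _; rewrite normcR; lra.
apply: le_trans (normc_triangle _ _) _; rewrite normcR normcN -addrA; apply: lerD.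
  by apply: le_trans (ler_normD _ _) _; lra.
exact: normc_triangle.
Qed.

Lemma qpot_bounded f z (b : R) x : `|f x| <= b -> normc (qpot m f z x) <= m ^+ 2 + (b + normc z) ^+ 2.
Proof.
move=> fb; rewrite /qpot; apply: le_trans (normc_triangle _ _) _.
rewrite normcN normcR ger0_norm ?sqr_ge0// lerD2l expr2 Normc.normcM -expr2.
rewrite lerXn2r ?nnegrE ?normc_ge0//; first by rewrite addr_ge0 ?normc_ge0//; exact: le_trans fb.
by apply: le_trans (normc_triangle _ _) _; rewrite normcN normcR lerD2r.
Qed.

Lemma spectrumNP f z (b : R) : continuous f -> (forall x, `|f x| <= b) ->
  ~ spectrum m f z <-> exists C, solvable (qpot m f z) C.
Proof.
move=> cf fb; rewrite -(bi_solvable (meas_qpot z cf) (fun x => qpot_bounded z (fb x))).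
by split=> [/contrapT//|h]; apply.
Qed.

Lemma spectrum_usc f z (b : R) : continuous f -> (forall x, `|f x| <= b) -> ~ spectrum m f z ->
  exists2 e : R, 0 < e & forall g, continuous g -> (forall x, `|g x| <= b) ->
    (forall x, `|f x - g x| <= e) -> forall w, normc (w - z) <= e -> ~ spectrum m g w.
Proof.
move=> cf fb /(spectrumNP _ cf fb)[C hC]; have [C0 _ _] := hC.
have b0 : 0 <= b by exact: le_trans (fb 0).
have z0 := normc_ge0 z.
(* By [qpot_dist] and |w| <= |z| + 1 the potential changes by at most e K; the choice of e makes C e
   K less than 1 / 2. *)
pose K := 2 * (2 * b + normc z + (normc z + 1)).
have K0 : 0 < K by rewrite /K; lra.
pose e := Num.min 1 ((C + 1)^-1 / K / 2).
have C1 : 0 < C + 1 by rewrite ltr_wpDl.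
have e0 : 0 < e by rewrite lt_min ltr01 !divr_gt0 ?invr_gt0.
exists e => // g cg gb fg w wz; apply/(spectrumNP _ cg gb).
have we : normc w <= normc z + 1.
  rewrite -[w](subrK z); apply: le_trans (normc_triangle _ _) _; rewrite addrC lerD2l.
  by apply: le_trans wz _; rewrite /e ge_min lexx.
eexists; apply: (solvable_pert (meas_qpot z cf) (meas_qpot w cg) (delta := e * K) _ _ _ hC).
- move=> x; apply: le_trans (qpot_dist (fb x) (gb x) (fg x) wz) _.
  by rewrite [2 * e]mulrC -mulrA; apply: (ler_wpM2l (ltW e0)); rewrite /K; move: we; clear; lra.
- by rewrite mulr_ge0 ?ltW.
- apply: (@le_lt_trans _ _ (C * ((C + 1)^-1 / K / 2 * K))).
    apply: (ler_wpM2l C0); apply: (ler_wpM2r (ltW K0)); rewrite /e ge_min lexx orbT //.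
  have -> : C * ((C + 1)^-1 / K / 2 * K) = (C / (C + 1)) / 2 by field; rewrite !gt_eqF.
  by rewrite ltr_pdivrMr// mul1r ltr_pdivrMr//; lra.
Qed.

(* For t large, [qpot m f z] takes its values in a disc around t w of radius less than t = |t w|. *)
Lemma spectrum_halfplane f z (b s K : R) w : continuous f -> (forall x, `|f x| <= b) ->
  0 <= Re w -> normc w = 1 -> 0 < s -> 0 < K ->
  (forall x, normc (qpot m f z x) <= K) -> (forall x, s <= dotc (qpot m f z x) w) ->
  ~ spectrum m f z.
Proof.
move=> cf fb w0 w1 s0 K0 hK hs; apply/(spectrumNP _ cf fb).
(* As |w| = 1, |q - t w|^2 <= K^2 - 2 t s + t^2, and t s > K^2 makes this less than t^2 - t s. *)
pose t := K ^+ 2 / s + 1.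
have t0 : 0 < t by rewrite /t ltr_wpDl// divr_ge0 ?sqr_ge0// ltW.
have tw0 : 0 <= Re (t%:C%C * w) by rewrite cReM /= mul0r subr0 mulr_ge0// ltW.
have tw1 : normc (t%:C%C * w) = t by rewrite Normc.normcM w1 mulr1 normcR gtr0_norm.
have twn : t%:C%C * w != 0.
  by apply: contra_eq_neq tw1 => ->; rewrite Normc.normc0 lt_eqF.
have := solvable_cst (n := n) tw0 twn; rewrite tw1 => hS.
have ts : t * s = K ^+ 2 + s by rewrite /t mulrDl mul1r divfK// gt_eqF.
have sK : s <= K.
  apply: le_trans (hs 0) _; apply: le_trans (ler_norm _) _.
  by apply: le_trans (ler_dotc _ _) _; rewrite w1 mulr1.
have st : s <= t.
  rewrite -(ler_pM2r s0) ts; nra.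
have d0 : 0 <= t ^+ 2 - t * s by rewrite expr2 -mulrBr; apply: mulr_ge0; [exact: ltW|rewrite subr_ge0].
have dt : Num.sqrt (t ^+ 2 - t * s) < t.
  rewrite -(@ltr_pXn2r _ 2) ?nnegrE ?sqrtr_ge0 ?(ltW t0)// sqr_sqrtr//.
  by rewrite gtrBl mulr_gt0.
eexists; apply: (solvable_pert (meas_c_cst _) (meas_qpot z cf) (delta := Num.sqrt (t ^+ 2 - t * s)) _ _ _ hS).
- move=> x; rewrite -(@ler_pXn2r _ 2) ?nnegrE ?sqrtr_ge0 ?normc_ge0// sqr_sqrtr// normc_sqr /=.
  have hx := hs x.
  have hK2 : dotc (qpot m f z x) (qpot m f z x) <= K ^+ 2.
    by rewrite -normc_sqr lerXn2r ?nnegrE ?normc_ge0// ltW.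
  have ww : dotc w w = 1 by rewrite -normc_sqr w1 expr1n.
  have := ler_wpM2l (ltW t0) hx.
  move: hK2 ww; rewrite /dotc !cReD !cImD !cReN !cImN !cReM !cImM /= ts.
  move: (qpot m f z x) => q; move: (Re q) (Im q) (Re w) (Im w) => a b' c d hK2 ww h.
  have : t ^+ 2 * (c * c + d * d) = t ^+ 2 by rewrite ww mulr1.
  nra.
- exact: sqrtr_ge0.
- by rewrite mulrC ltr_pdivrMr// mul1r.
Qed.

Lemma normc_i : normc (0 +i* 1)%C = 1 :> R.
Proof. by rewrite /= expr0n add0r expr1n sqrtr1. Qed.

(** If |Re z| > b, then Im q = 2 Im z (f - Re z) keeps one sign and stays away from 0, however small
    Im z is. Otherwise Im z is so large that Re q >= Im z^2 - 4 b^2 > 0. Either way q lies in a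
    half-plane away from 0. *)
Lemma spectrum_nonreal f z (b : R) : continuous f -> (forall x, `|f x| <= b) ->
  Im z != 0 -> 4 * b + m ^+ 2 < normc z -> ~ spectrum m f z.
Proof.
move=> cf fb zi zb.
have b0 : 0 <= b by exact: le_trans (fb 0).
have m0 := sqr_ge0 m.
pose K := m ^+ 2 + (b + normc z) ^+ 2 + 1.
have K0 : 0 < K by rewrite /K ltr_wpDl// addr_ge0 ?sqr_ge0.
have hK x : normc (qpot m f z x) <= K by apply: le_trans (qpot_bounded z (fb x)) _; rewrite /K lerDl.
have Rq x : Re (qpot m f z x) = m ^+ 2 + Im z ^+ 2 - (f x - Re z) ^+ 2.
  by rewrite /qpot expr2 cReD cReN cReM !cReD !cImD !cReN !cImN /=; ring.
have Iq x : Im (qpot m f z x) = 2 * Im z * (f x - Re z).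
  by rewrite /qpot expr2 cImD cImN cImM !cReD !cImD !cReN !cImN /=; ring.
have fx x : - b <= f x <= b by rewrite -ler_norml.
have [h|h] := ltP b `|Re z|.
  have [s [w [w0 w1 s0 hs]]] : exists s : R, exists w, [/\ 0 <= Re w, normc w = 1, 0 < s &
      forall x, s <= dotc (qpot m f z x) w].
    pose s := 2 * `|Im z| * (`|Re z| - b).
    have s0 : 0 < s by rewrite mulr_gt0 ?subr_gt0// mulr_gt0 ?normr_gt0.
    (* As |f| <= b < |Re z|, the sign of Im q is opposite to that of Re z Im z. *)
    pose sg : bool := (0 <= Im z) == (0 <= Re z).
    exists s, (if sg then - (0 +i* 1) else (0 +i* 1))%C; split => //.
    - by case: ifP => _ //; rewrite cReN oppr0.
    - by case: ifP => _; rewrite ?normcN normc_i.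
    - move=> x; rewrite /s /sg; have := Iq x; have := fx x; move: (qpot _ _ _ _) => q.
      move: h zi; rewrite /dotc; move: (Re z) (Im z) (f x) => a' b' c' h zi /andP[c1 c2] E.
      by case: (ger0P b') E => hb; case: (ger0P a') h => ha h E /=; rewrite ?cReN ?cImN /= E; nra.
  exact: spectrum_halfplane cf fb w0 w1 s0 K0 hK hs.
have zz : normc z ^+ 2 = Re z ^+ 2 + Im z ^+ 2 by rewrite normc_sqr /dotc -!expr2.
have I4 : 4 * b ^+ 2 < Im z ^+ 2.
  have : Re z ^+ 2 <= b ^+ 2 by rewrite -[Re z ^+ 2]real_normK ?num_real// lerXn2r ?nnegrE.
  have : (4 * b) ^+ 2 < normc z ^+ 2.
    by rewrite ltrXn2r ?nnegrE ?normc_ge0//; lra.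
  rewrite zz; move: (Re z) (Im z) => a' b'; nra.
apply: (@spectrum_halfplane f z b (Im z ^+ 2 - 4 * b ^+ 2) K 1) => //.
- by rewrite /= expr1n expr0n addr0 sqrtr1.
- by rewrite subr_gt0.
- move=> x; rewrite /dotc Rq /= mulr1 mulr0 addr0.
  have : - b <= Re z <= b by rewrite -ler_norml.
  have := fx x; move: (f x) (Re z) => c' a' /andP[? ?] /andP[? ?]; nra.
Qed.

End spectral.

(** * Calculus of one-variable factors and of their products *)

Section derive1_rules.
Context {R : realType}.
Implicit Types f g : R -> R.

Lemma smooth1M f g : smooth1 f -> smooth1 g -> smooth1 (f \* g).
Proof. by move=> sf sg k; exact: C1kM. Qed.

Lemma smooth1D f g : smooth1 f -> smooth1 g -> smooth1 (f \+ g).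
Proof. by move=> sf sg k; exact: C1kD. Qed.

Lemma smooth1_affine f (a b : R) : smooth1 f -> smooth1 (fun t => f (a * t + b)).
Proof. by move=> sf k; exact: C1k_affine. Qed.

Lemma derive1M f g : smooth1 f -> smooth1 g ->
  derive1 (f \* g) = (f \* derive1 g) \+ (g \* derive1 f).
Proof.
move=> sf sg; apply/funext => t; rewrite derive1E; apply: derive_val.
by have := is_deriveM (smooth1_is_derive t sf) (smooth1_is_derive t sg).
Qed.

Lemma derive1D f g : smooth1 f -> smooth1 g ->
  derive1 (f \+ g) = derive1 f \+ derive1 g.
Proof.
move=> sf sg; apply/funext => t; rewrite derive1E; apply: derive_val.
by have := is_deriveD (smooth1_is_derive t sf) (smooth1_is_derive t sg).
Qed.

Lemma derive1_affine f (a b : R) : smooth1 f ->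
  derive1 (fun t => f (a * t + b)) = (fun t => a * derive1 f (a * t + b)).
Proof.
move=> sf; apply/funext => t; rewrite derive1E; apply: derive_val.
have h : is_derive t (1 : R) (fun t => a * t + b) a.
  by apply: is_derive_eq; rewrite addr0 /GRing.scale /=; ring.
have := is_derive1_comp (g := fun t => a * t + b) (smooth1_is_derive (a * t + b) sf) h.
by rewrite mulrC.
Qed.

Lemma derive1_cos_sin (a b : R) :
  derive1 (fun t => a * cos t + b * sin t) = (fun t => b * cos t + (- a) * sin t).
Proof.
apply/funext => t; rewrite derive1E; apply: derive_val.
by apply: is_derive_eq; rewrite /GRing.scale /=; ring.
Qed.

End derive1_rules.

Section product_functions.
Context {R : realType} {n : nat}.
Local Notation V := 'rV[R]_n.
Local Notation e_ i := (delta_mx ord0 i : 'rV[R]_n).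
Implicit Types (g : 'I_n -> R -> R).

Definition prodc g : V -> R := fun x => \prod_j g j (x ord0 j).

Definition der i g : 'I_n -> R -> R := fun j => if j == i then derive1 (g j) else g j.

Lemma smooth1_der i g : (forall j, smooth1 (g j)) -> forall j, smooth1 (der i g j).
Proof. by move=> sg j; rewrite /der; case: eqP => // _; exact: smooth1_derive. Qed.

Lemma smooth_prodc g : (forall j, smooth1 (g j)) -> smooth (prodc g).
Proof. by move=> sg; apply: smooth_prod => j; exact: smooth_coord. Qed.

Lemma partial_prodc i g : (forall j, smooth1 (g j)) -> partial i (prodc g) = prodc (der i g).
Proof.
move=> sg; apply/funext => x; apply: derive_val; apply: is_derive_line0.
pose C := \prod_(j | j != i) g j (x ord0 j).
have -> : (fun s : R => prodc g (s *: e_ i + x)) = (fun s => C * g i (1 * s + x ord0 i)).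
  apply/funext => s; rewrite /prodc (bigD1 i)//= mulrC; congr (_ * g i _).
    by apply: eq_bigr => j ji; rewrite !mxE eqxx /= (negbTE ji) mulr0 add0r.
  by rewrite !mxE !eqxx /= mulr1 mul1r.
have E : prodc (der i g) x = C * derive1 (g i) (x ord0 i).
  rewrite /prodc (bigD1 i)//= mulrC /der eqxx; congr (_ * _).
  by apply: eq_bigr => j /negbTE ->.
rewrite E.
have sgi := smooth1_affine 1 (x ord0 i) (sg i).
have := is_deriveZ C (smooth1_is_derive (0 : R) sgi).
by rewrite derive1_affine// mulr0 add0r mul1r.
Qed.

Lemma prodc_supp g (L : R) x : 0 < L -> (forall j s, L <= `|s| -> g j s = 0) ->
  L <= `|x| -> prodc g x = 0.
Proof.
move=> L0 h xL; have [j hj] : exists j, L <= `|x ord0 j|.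
  apply: contrapT => nh; move: xL; rewrite leNgt => /negP; apply.
  apply: rV_norm_lt => // j; rewrite ltNge; apply/negP => ?; apply: nh; by exists j.
by rewrite /prodc (bigD1 j)//= h// mul0r.
Qed.

Lemma tst_prodc g (L : R) : 0 < L -> (forall j, smooth1 (g j)) ->
  (forall j s, L <= `|s| -> g j s = 0) -> tst (prodc g).
Proof.
move=> L0 sg h; split; first exact: smooth_prodc.
by exists L => x /ltW; exact: prodc_supp.
Qed.

Lemma prodc_le g (b : 'I_n -> R) x : (forall j s, `|g j s| <= b j) -> `|prodc g x| <= \prod_j b j.
Proof.
by move=> h; rewrite /prodc normr_prod; apply: ler_prod => j _; rewrite normr_ge0 h.
Qed.

End product_functions.

Section bump.
Context {R : realType}.

Lemma derive1_supp (g : R -> R) (L : R) : (forall s, L < `|s| -> g s = 0) ->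
  forall s, L < `|s| -> derive1 g s = 0.
Proof.
move=> h s Ls; rewrite derive1E; apply: derive_val.
apply: (@near_eq_is_derive _ _ _ (cst 0)); rewrite ?oner_eq0//.
have : open [set y : R | L < `|y|].
  have -> : [set y : R | L < `|y|] = (fun x : R => `|x|) @^-1` `]L, +oo[%classic.
    by apply/seteqP; split=> x /=; rewrite in_itv /= andbT.
  apply: open_comp; last exact: interval_open.
  by move=> x _; exact: norm_continuous.
move=> /(_ s Ls); apply: filterS => y /h ->//.
Qed.

Lemma continuous_supp_bounded (g : R -> R) (L : R) : continuous g ->
  (forall s, L < `|s| -> g s = 0) -> exists2 B : R, 0 <= B & forall s, `|g s| <= B.
Proof.
move=> cg h; pose M := Num.max L 0.
have M0 : - M <= M by rewrite ge0_cp// le_max lexx orbT.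
have cn : {within `[- M, M], continuous (fun s => `|g s|)}.
  by apply: continuous_subspaceT => x; apply: continuous_comp; [exact: cg|exact: norm_continuous].
have [c _ hc] := EVT_max M0 cn.
exists `|g c| => // s; have [Ms|Ms] := leP `|s| M.
  by apply: hc; rewrite in_itv /= -ler_norml.
by rewrite h ?normr0//; apply: le_lt_trans Ms; rewrite le_max lexx.
Qed.

(** A bump supported in [1, 2], away from 0: stretched by t it lives at distance t from the origin,
    where the potential has decayed. *)
Definition beta (s : R) : R := psi (1 * s + -1) * psi ((-1) * s + 2).

Lemma smooth1_beta : smooth1 beta.
Proof. by apply: smooth1M; exact: smooth1_psi_affine. Qed.

Lemma beta_supp s : ~~ (1 < s < 2) -> beta s = 0.
Proof.
rewrite negb_and -!leNgt /beta => /orP[h|h].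
  by rewrite psi_le0 ?mul0r//; lra.
by rewrite [X in _ * X]psi_le0 ?mulr0//; lra.
Qed.

Lemma beta_ge0 s : 0 <= beta s. Proof. by rewrite mulr_ge0 ?psi_ge0. Qed.

Lemma beta_le1 s : beta s <= 1. Proof. by rewrite mulr_ile1 ?psi_ge0 ?psi_le1. Qed.

Lemma beta_supp2 s : 2 < `|s| -> beta s = 0.
Proof.
move=> h; apply: beta_supp; apply/negP => /andP[a b].
by move: h; rewrite ger0_norm; lra.
Qed.

Lemma beta_mid : exists2 c : R, 0 < c & forall s, 5/4 <= s <= 7/4 -> c <= beta s.
Proof.
have pm (a b : R) : 0 < a -> a <= b -> psi a <= psi b.
  move=> a0 ab; rewrite /psi /flat a0 (lt_le_trans a0 ab) !hornerC !mul1r ler_expR lerN2.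
  by rewrite lef_pV2 ?posrE//; exact: lt_le_trans ab.
exists (psi 4^-1 * psi 4^-1); first by rewrite mulr_gt0// psi_gt0//; lra.
move=> s /andP[a b]; rewrite /beta; apply: ler_pM; rewrite ?psi_ge0//; apply: pm; lra.
Qed.

Lemma beta_bounds : exists2 B : R, 1 <= B &
  forall s, [/\ `|beta s| <= B, `|derive1 beta s| <= B & `|derive1 (derive1 beta) s| <= B].
Proof.
have s1 := smooth1_derive smooth1_beta; have s2 := smooth1_derive s1.
have [B1 B10 h1] := continuous_supp_bounded (smooth1_continuous s1) (derive1_supp beta_supp2).
have [B2 B20 h2] := continuous_supp_bounded (smooth1_continuous s2) (derive1_supp (derive1_supp beta_supp2)).
exists (1 + B1 + B2); first by lra.
move=> s; split; [|by apply: le_trans (h1 s) _; lra|by apply: le_trans (h2 s) _; lra].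
by rewrite ger0_norm ?beta_ge0//; apply: le_trans (beta_le1 s) _; lra.
Qed.

End bump.

(** * The real half-lines of the spectrum *)

Section weyl1.
Context {R : realType}.
Variables (kap t : R).
Hypothesis t1 : 1 <= t.

Let t0 : 0 < t. Proof. exact: lt_le_trans ltr01 t1. Qed.

Lemma derive1Z (c : R) (f : R -> R) : smooth1 f ->
  derive1 (fun s => c * f s) = (fun s => c * derive1 f s).
Proof.
move=> sf; apply/funext => s; rewrite derive1E; apply: derive_val.
by have := is_deriveZ c (smooth1_is_derive s sf).
Qed.

(** [trig 1 0] and [trig 0 1] are the real and imaginary parts of exp(i kap s). The summand 0 gives
    the argument the affine form of [derive1_affine]. *)
Definition trig (a b : R) : R -> R := fun s => a * cos (kap * s + 0) + b * sin (kap * s + 0).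

Lemma smooth1_trig a b : smooth1 (trig a b).
Proof. exact: (smooth1_affine kap 0 (smooth1_cos_sin a b)). Qed.

Lemma derive1_trig a b : derive1 (trig a b) = trig (kap * b) (- (kap * a)).
Proof.
rewrite (derive1_affine kap 0 (smooth1_cos_sin a b)) derive1_cos_sin.
by apply/funext => s; rewrite /trig; ring.
Qed.

Lemma trig_le a b s : `|trig a b s| <= `|a| + `|b|.
Proof.
rewrite /trig; apply: le_trans (ler_normD _ _) _; rewrite !normrM; apply: lerD.
  by rewrite ler_piMr// ler_norml cos_geN1 cos_le1.
by rewrite ler_piMr// ler_norml sin_geN1 sin_le1.
Qed.

Definition bt : R -> R := fun s => beta (t^-1 * s + 0).

Lemma smooth1_bt : smooth1 bt.
Proof. exact: smooth1_affine smooth1_beta. Qed.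

Lemma derive1_bt : derive1 bt = fun s => t^-1 * derive1 beta (t^-1 * s + 0).
Proof. exact: derive1_affine smooth1_beta. Qed.

Lemma derive2_bt : derive1 (derive1 bt) = fun s => t^-1 * (t^-1 * derive1 (derive1 beta) (t^-1 * s + 0)).
Proof.
have s1 := smooth1_derive (@smooth1_beta R).
rewrite derive1_bt derive1Z; last exact: smooth1_affine.
by rewrite (@derive1_affine R _ _ _ s1).
Qed.

Lemma bt_supp s : ~~ (t < s < 2 * t) -> bt s = 0.
Proof.
move=> h; apply: beta_supp; rewrite addr0 ltr_pdivlMl// mulr1.
by rewrite ltr_pdivrMl// mulrC.
Qed.

Lemma bt_ge0 s : 0 <= bt s. Proof. exact: beta_ge0. Qed.
Lemma bt_le1 s : bt s <= 1. Proof. exact: beta_le1. Qed.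

(** [trig] solves y'' = - kap^2 y, so each remaining term contains a derivative of the cutoff and
    with it a factor 1/t. *)
Lemma derive_trig_bt a b s :
  derive1 (derive1 (trig a b \* bt)) s + kap ^+ 2 * (trig a b \* bt) s =
  trig a b s * derive1 (derive1 bt) s + 2 * (trig (kap * b) (- (kap * a)) s * derive1 bt s).
Proof.
have sT := smooth1_trig; have sb := smooth1_bt; have sb1 := smooth1_derive sb.
rewrite derive1M// derive1_trig derive1D; [|exact: smooth1M|exact: smooth1M].
rewrite (derive1M (sT a b) sb1) (derive1M sb (sT _ _)) !derive1_trig /= /trig; ring.
Qed.

Lemma trig_bt_bound (B a b s : R) : 1 <= B ->
  (forall s, [/\ `|beta s| <= B, `|derive1 beta s| <= B & `|derive1 (derive1 beta) s| <= B]) ->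
  `|a| + `|b| <= 1 ->
  `|derive1 (derive1 (trig a b \* bt)) s + kap ^+ 2 * (trig a b \* bt) s| <=
   (B + 2 * `|kap| * B) / t.
Proof.
move=> B1 hB ab; have [_ h1 h2] := hB (t^-1 * s + 0).
have ti : 0 <= t^-1 by rewrite invr_ge0 ltW.
have ti1 : t^-1 <= 1 by rewrite invf_le1.
rewrite derive_trig_bt; apply: le_trans (ler_normD _ _) _; rewrite [leRHS]mulrDl; apply: lerD.
  rewrite normrM derive2_bt -[B / t]mul1r; apply: ler_pM => //; first exact: le_trans (trig_le _ _ _) ab.
  rewrite normrM (ger0_norm ti) mulrC; apply: ler_wpM2r => //.
  rewrite normrM (ger0_norm ti); apply: le_trans h2; exact: ler_piMl.
rewrite normrM ger0_norm// -!mulrA; apply: ler_wpM2l => //.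
rewrite normrM derive1_bt normrM (ger0_norm ti) [_ * `|derive1 _ _|]mulrC.
apply: ler_pM => //.
- by apply: mulr_ge0.
- apply: le_trans (trig_le _ _ _) _; rewrite normrN !normrM -mulrDr addrC.
  by rewrite -[leRHS]mulr1; apply: ler_wpM2l.
- by apply: ler_wpM2r.
Qed.

End weyl1.

Section weyl.
Context {R : realType} {n : nat}.
Local Notation V := 'rV[R]_n.
Local Notation e_ i := (delta_mx ord0 i : 'rV[R]_n).
Local Notation mu := (lebesgue_rV R n).
Local Notation ip := (ipL2 mu).
Local Notation N := (normL2 mu).
Local Notation L2c := (sq_integrable mu).
Variables (m : R) (i0 : 'I_n).

(** A plane wave in the direction [i0], cut off by [bt t] in every coordinate. The wave number will
    satisfy kap^2 = lambda^2 - m^2. *)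
Definition wfac (kap t a b : R) (j : 'I_n) : R -> R :=
  if j == i0 then trig kap a b \* bt t else bt t.
Definition wfun (kap t a b : R) : V -> R := prodc (wfac kap t a b).

Variables (kap t : R).
Hypothesis t1 : 1 <= t.

Let t0 : 0 < t. Proof. exact: lt_le_trans ltr01 t1. Qed.

Lemma smooth1_wfac a b j : smooth1 (wfac kap t a b j).
Proof.
rewrite /wfac; case: eqP => _; last exact: smooth1_bt.
by apply: smooth1M; [exact: smooth1_trig|exact: smooth1_bt].
Qed.

Lemma bt_supp2 s : 2 * t <= `|s| -> bt t s = 0.
Proof.
move=> h; apply: bt_supp => //; apply/negP => /andP[h1 h2].
by move: h; rewrite ger0_norm; lra.
Qed.

Lemma wfac_supp a b j s : 2 * t <= `|s| -> wfac kap t a b j s = 0.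
Proof.
by move=> h; rewrite /wfac; case: eqP => _ /=; rewrite bt_supp2 ?mulr0.
Qed.

Lemma tst_wfun a b : tst (wfun kap t a b).
Proof.
apply: (@tst_prodc _ _ _ (2 * t)); [by rewrite mulr_gt0|exact: smooth1_wfac|exact: wfac_supp].
Qed.

Lemma wfac_le a b j s : `|a| + `|b| <= 1 -> `|wfac kap t a b j s| <= 1.
Proof.
move=> ab; have h : `|bt t s| <= 1 by rewrite ger0_norm ?bt_ge0 ?bt_le1.
rewrite /wfac; case: eqP => _ //=; rewrite normrM; apply: mulr_ile1 => //.
exact: le_trans (trig_le _ _ _ _) ab.
Qed.

Lemma prodc_le1 (g : 'I_n -> R -> R) (i : 'I_n) (c : R) (x : V) : (forall j s, j != i -> `|g j s| <= 1) ->
  `|g i (x ord0 i)| <= c -> `|prodc g x| <= c.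
Proof.
move=> h hi; rewrite /prodc (bigD1 i)//= normrM -[c]mulr1; apply: ler_pM => //.
have /andP[//] : 0 <= `|\prod_(j | j != i) g j (x ord0 j)| <= 1.
rewrite normr_prod; elim/big_rec: _ => [|j y ji /andP[y0 y1]]; first by rewrite ler01 lexx.
by rewrite mulr_ge0//= mulr_ile1// h.
Qed.

Lemma wfun_lap (B a b : R) x : 1 <= B ->
  (forall s, [/\ `|beta s| <= B, `|derive1 beta s| <= B & `|derive1 (derive1 beta) s| <= B]) ->
  `|a| + `|b| <= 1 ->
  `|\sum_i partial i (partial i (wfun kap t a b)) x + kap ^+ 2 * wfun kap t a b x| <=
    (n.+1%:R * (B + 2 * `|kap| * B)) / t.
Proof.
move=> B1 hB ab; have sg := smooth1_wfac a b.
have K0 : 0 <= B + 2 * `|kap| * B by rewrite addr_ge0 ?mulr_ge0//; lra.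
have pp i : partial i (partial i (wfun kap t a b)) = prodc (der i (der i (wfac kap t a b))).
  by rewrite !partial_prodc//; exact: smooth1_der.
have bb i : i != i0 -> `|partial i (partial i (wfun kap t a b)) x| <= (B + 2 * `|kap| * B) / t.
  move=> ii; rewrite pp; apply: (@prodc_le1 _ i).
    by move=> j s ji; rewrite /der (negbTE ji); exact: wfac_le.
  rewrite /der eqxx /wfac (negbTE ii) derive2_bt.
  have [_ _ h2] := hB (t^-1 * x ord0 i + 0).
  have ti : 0 <= t^-1 by rewrite invr_ge0 ltW.
  have ti1 : t^-1 <= 1 by rewrite invf_le1.
  rewrite normrM (ger0_norm ti) mulrC; apply: ler_wpM2r => //.
  rewrite normrM (ger0_norm ti); apply: (@le_trans _ _ B); last by rewrite lerDl mulr_ge0// ?mulr_ge0//; lra.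
  by apply: le_trans h2; exact: ler_piMl.
have b0 : `|partial i0 (partial i0 (wfun kap t a b)) x + kap ^+ 2 * wfun kap t a b x| <= (B + 2 * `|kap| * B) / t.
  pose g j : R -> R := if j == i0 then fun s => derive1 (derive1 (trig kap a b \* bt t)) s + kap ^+ 2 * (trig kap a b \* bt t) s else bt t.
  have -> : partial i0 (partial i0 (wfun kap t a b)) x + kap ^+ 2 * wfun kap t a b x = prodc g x.
    pose P := \prod_(j | j != i0) bt t (x ord0 j).
    have E (h : 'I_n -> R -> R) : (forall j, j != i0 -> h j = bt t) -> prodc h x = h i0 (x ord0 i0) * P.
      by move=> hh; rewrite /prodc (bigD1 i0)//=; congr (_ * _); apply: eq_bigr => j /hh ->.
    rewrite pp /wfun (E (wfac kap t a b)); last by move=> j /negbTE; rewrite /wfac => ->.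
    rewrite (E g); last by move=> j /negbTE; rewrite /g => ->.
    rewrite (E (der _ _)); last by move=> j /negbTE ji; rewrite /der ji /wfac ji.
    have -> : der i0 (der i0 (wfac kap t a b)) i0 = derive1 (derive1 (trig kap a b \* bt t)).
      by rewrite /der !eqxx /wfac eqxx.
    by rewrite /wfac /g eqxx mulrA -mulrDl.
  apply: (@prodc_le1 _ i0).
    by move=> j s ji; rewrite /g (negbTE ji) ger0_norm ?bt_ge0 ?bt_le1.
  by rewrite /g eqxx; exact: trig_bt_bound.
rewrite (bigD1 i0)//= addrAC; apply: le_trans (ler_normD _ _) _.
rewrite -mulrA -natr1 mulrDl mul1r [leRHS]addrC; apply: lerD => //.
apply: le_trans (ler_norm_sum _ _ _) _.
rewrite mulr_natl -[n in leRHS]card_ord -sumr_const.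
rewrite [leRHS](bigD1 i0)//= -[leLHS]add0r; apply: lerD; first by rewrite divr_ge0// ltW.
by apply: ler_sum => i ii; exact: bb.
Qed.

Lemma wfun_supp (a b : R) (x : V) : ~~ (t < x ord0 i0 < 2 * t) -> wfun kap t a b x = 0.
Proof.
move=> h; rewrite /wfun /prodc (bigD1 i0)//= /wfac eqxx /=.
by rewrite (bt_supp t1 h) mulr0 mul0r.
Qed.

Lemma wfun_supp2 (a b : R) (x : V) : 2 * t < `|x| -> wfun kap t a b x = 0.
Proof.
by move=> /ltW; apply: prodc_supp; [rewrite mulr_gt0|exact: wfac_supp].
Qed.

Lemma wfun_le (a b : R) (x : V) : `|a| + `|b| <= 1 -> `|wfun kap t a b x| <= 1.
Proof.
move=> ab; apply: (@prodc_le1 _ i0) => [j s _|]; exact: wfac_le.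
Qed.

Lemma wfun_trig (a b : R) (x : V) : wfun kap t a b x = trig kap a b (x ord0 i0) * prodc (fun=> bt t) x.
Proof.
rewrite /wfun /prodc (bigD1 i0)//= [in RHS](bigD1 i0)//= /wfac eqxx /= -[LHS]mulrA; congr (_ * (_ * _)).
by apply: eq_bigr => j /negbTE ->.
Qed.

Definition wave : V -> R[i] := fun x => (wfun kap t 1 0 x +i* wfun kap t 0 1 x)%C.

Lemma ctst_wave : ctst wave.
Proof. by split; exact: tst_wfun. Qed.

Lemma dotc_wave x : dotc (wave x) (wave x) = prodc (fun=> bt t) x ^+ 2.
Proof.
rewrite /dotc /= !wfun_trig /trig !mul0r !mul1r addr0 add0r.
have := cos2Dsin2 (kap * x ord0 i0 + 0); set c := cos _; set s := sin _ => E.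
by rewrite -!expr2 !exprMn -mulrDl E mul1r.
Qed.

Lemma partial_supp (f : V -> R) i (L : R) : (forall x : V, L < `|x| -> f x = 0) ->
  forall x : V, L < `|x| -> partial i f x = 0.
Proof.
move=> fL x Lx; apply: derive_val.
apply: (near_eq_is_derive _ (is_derive_cst (0 : R) x (e_ i))).
have := @rV_norm_open R n L; rewrite openE => /(_ x Lx).
by apply: filterS => y /= /fL ->.
Qed.

Lemma decay_le (x : V) (s : R) i : 0 < s -> s <= `|x ord0 i| -> (1 + sqnorm2 x) `^ (- 2^-1) <= s^-1.
Proof.
move=> s0 sx.
have h : s ^+ 2 <= 1 + sqnorm2 x.
  apply: (@le_trans _ _ (sqnorm2 x)); last by rewrite lerDr.
  apply: (@le_trans _ _ (x ord0 i ^+ 2)).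
    by rewrite -[leRHS]real_normK ?num_real// lerXn2r ?nnegrE// ltW.
  by rewrite /sqnorm2 (bigD1 i)//= lerDl; apply: sumr_ge0 => *; exact: sqr_ge0.
have p0 : 0 < 1 + sqnorm2 x by apply: lt_le_trans h; exact: exprn_gt0.
rewrite powRN powR12_sqrt ?(ltW p0)// lef_pV2 ?posrE ?sqrtr_gt0//.
by rewrite -[s]ger0_norm ?(ltW s0)// -sqrtr_sqr ler_wsqrtr.
Qed.

Lemma sqnorm2_ge0 (x : V) : 0 <= sqnorm2 x.
Proof. by apply: sumr_ge0 => *; exact: sqr_ge0. Qed.

Lemma decay_le1 (x : V) : (1 + sqnorm2 x) `^ (- 2^-1) <= 1.
Proof.
have p0 : 1 <= 1 + sqnorm2 x by rewrite lerDl sqnorm2_ge0.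
rewrite powRN powR12_sqrt; last by apply: le_trans p0.
by rewrite invf_le1 ?sqrtr_gt0 ?(lt_le_trans ltr01 p0)// -[leLHS]sqrtr1 ler_wsqrtr.
Qed.

(** On the inner box of side t / 2 each of the n cutoff factors is at least c. *)
Lemma wave_lower (c : R) : 0 <= c -> (forall s : R, 5/4 <= s <= 7/4 -> c <= beta s) ->
  c ^+ n * Num.sqrt ((t / 2) ^+ n) <= N wave.
Proof.
move=> c0 hc; pose A := box (fun=> 5/4 * t) (fun=> 7/4 * t) : set V.
have mA : measurable A by exact: measurable_box.
have muA : mu A = ((t / 2) ^+ n)%:E.
  rewrite /A lebesgue_rV_box; last by move=> i; rewrite ler_wpM2r ?ltW//; lra.
  by rewrite prodr_const card_ord; congr (_ ^+ _)%:E; field.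
pose v : V -> R[i] := cst ((c ^+ n)%:C)%C \* cind A.
have mi : meas_c (cind A) by split => /=; [exact: measurable_indic|exact: measurable_cst].
have tn0 : 0 <= (t / 2) ^+ n by rewrite exprn_ge0// divr_ge0// ltW.
have iA : mu.-integrable setT (EFin \o \1_A).
  have muo : (mu A < +oo)%E by rewrite muA ltry.
  exact: (integrable_indic_lty mA muo).
have LA : L2c (cind A).
  split=> //; move: iA; congr integrable; apply/funext => x /=; congr (_%:E).
  by rewrite /dotc /= mulr0 addr0 indicE -natrM mulnb andbb.
have NA : N (cind A) = Num.sqrt ((t / 2) ^+ n).
  congr Num.sqrt; transitivity (\int[mu]_x (\1_A x : R)).
    by apply: eq_Rintegral => x _; rewrite /dotc /= mulr0 addr0 indicE -natrM mulnb andbb.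
  by rewrite /Rintegral integral_indic// setIT; exact: (congr1 fine muA).
have -> : c ^+ n * Num.sqrt ((t / 2) ^+ n) = N v.
  by rewrite /v NZ// NA normcR ger0_norm// exprn_ge0.
rewrite -[leRHS]mul1r; apply: N_le_dot => //; [exact/ctst_L2c/ctst_wave|exact: L2cZ|].
move=> x; rewrite expr1n mul1r dotc_wave /v /dotc /= /cind /=.
rewrite !mulr0 !mul0r subr0 !addr0 mulr0 addr0 -expr2 indicE.
have [xA|xA] := boolP (x \in A); last by rewrite mulr0 expr0n /= sqr_ge0.
rewrite mulr1 lerXn2r ?nnegrE ?exprn_ge0//; first by apply: prodr_ge0 => *; exact: bt_ge0.
rewrite -[n in _ ^+ n]card_ord -prodr_const; apply: ler_prod => j _; rewrite c0 /=; apply: hc.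
move: xA; rewrite inE => /(_ j) /andP[h1 h2]; rewrite addr0.
by rewrite ler_pdivlMl// ler_pdivrMl// mulrC ltW//= mulrC ltW.
Qed.

Lemma Re_clap (u : V -> R[i]) x :
  Re (clap u x) = \sum_i partial i (partial i (fun x => Re (u x))) x.
Proof.
rewrite clapE (big_morph (@complex.Re R) (@cReD R) (@cRe0 R)).
by apply: eq_bigr => i _; rewrite cpartE /= Re_cpart.
Qed.

Lemma Im_clap (u : V -> R[i]) x :
  Im (clap u x) = \sum_i partial i (partial i (fun x => Im (u x))) x.
Proof.
rewrite clapE (big_morph (@complex.Im R) (@cImD R) (@cIm0 R)).
by apply: eq_bigr => i _; rewrite cpartE /= Im_cpart.
Qed.

(** The image of the wave is (q + kap^2) wave - (Laplacian + kap^2) wave. On the support q + kap^2 =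
    f (2 lambda - f) is O(1/t) by the decay of f, and the second term is O(1/t) by [wfun_lap]; the
    square root comes from the volume of a cube of side 6 t. *)
Lemma wave_upper (B b lam : R) f : 1 <= B ->
  (forall s, [/\ `|beta s| <= B, `|derive1 beta s| <= B & `|derive1 (derive1 beta) s| <= B]) ->
  0 <= b -> kap ^+ 2 = lam ^+ 2 - m ^+ 2 ->
  continuous f -> (forall x, `|f x| <= b * (1 + sqnorm2 x) `^ (- 2^-1)) ->
  exists g, [/\ L2c g, Hop (qpot m f lam%:C%C) wave g &
    N g <= (2 * (n.+1%:R * (B + 2 * `|kap| * B)) + 2 * (b * (2 * `|lam| + b))) / t *
      Num.sqrt ((6 * t) ^+ n)].
Proof.
move=> B1 hB b0 hk cf hf.
have tw := ctst_wave; have Lw := ctst_L2c tw.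
have fb x : `|f x| <= b.
  by apply: le_trans (hf x) _; rewrite -[leRHS]mulr1; apply: ler_wpM2l => //; exact: decay_le1.
have mq := meas_qpot m lam%:C%C cf.
pose q := qpot m f lam%:C%C.
have Lq : L2c (q \* wave).
  by apply: (L2cM mq _ Lw) => x; exact: qpot_bounded (fb x).
have Lc : L2c (clap wave) by exact/ctst_L2c/ctst_clap.
pose g : V -> R[i] := q \* wave - clap wave.
have Lg : L2c g by exact: L2cB.
exists g; split=> //.
  exists (fun i => cpart i wave), (fun i j => cpart j (cpart i wave)); split=> //.
  - by move=> i; split; [exact/ctst_L2c/ctst_cpart|exact: wder_ctst].
  - move=> i j; split; [by apply: ctst_L2c; do 2!apply: ctst_cpart|].
    by apply: wder_ctst; exact: ctst_cpart.
  - by apply: aeW => x; rewrite /g addfE oppfE /= clapE addrC.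
set K1 := n.+1%:R * _; set K2 := b * (2 * _ + _).
have K10 : 0 <= K1 by rewrite mulr_ge0// addr_ge0 ?mulr_ge0//; lra.
have K20 : 0 <= K2 by rewrite mulr_ge0// addr_ge0// mulr_ge0.
have [||||_] := @N_bound _ _ g ((2 * K1 + 2 * K2) / t) (3 * t) Lg.1; last first.
- by congr (_ <= _ * Num.sqrt (_ ^+ _)); ring.
- move=> x xL.
  have {}xL : 3 * t <= `|x| by rewrite leNgt; apply/negP => /cubeP h; apply: xL; apply: h; rewrite mulr_gt0.
  have {}xL : 2 * t < `|x| by apply: lt_le_trans xL; rewrite ltr_pM2r//; lra.
  have u0 : wave x = 0 by apply: complex_ext => /=; exact: wfun_supp2.
  have c0 : clap wave x = 0.
    apply: complex_ext; rewrite ?Re_clap ?Im_clap /=; apply: big1 => i _.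
      by apply: (@partial_supp _ i (2 * t) _ x xL); apply: (@partial_supp _ i (2 * t)) => y; exact: wfun_supp2.
    by apply: (@partial_supp _ i (2 * t) _ x xL); apply: (@partial_supp _ i (2 * t)) => y; exact: wfun_supp2.
  by rewrite /g addfE oppfE c0 /= u0 mulr0 subrr.
- move=> x.
  have -> : g x = (q x + (kap ^+ 2)%:C%C) * wave x - (clap wave x + (kap ^+ 2)%:C%C * wave x).
    by rewrite /g addfE oppfE /=; ring.
  rewrite [2 * K1 + _]addrC [leRHS]mulrDl; apply: le_trans (normc_triangle _ _) _; rewrite normcN; apply: lerD.
    have [xt|xt] := boolP (t < x ord0 i0 < 2 * t); last first.
      have -> : wave x = 0 by apply: complex_ext => /=; exact: wfun_supp.
      by rewrite mulr0 Normc.normc0; apply: divr_ge0; [exact: mulr_ge0|exact: ltW].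
    rewrite Normc.normcM -mulrA mulrC; apply: ler_pM; rewrite ?normc_ge0//.
      apply: le_trans (normc_le_ReIm _) _; rewrite /=.
      by apply: lerD; apply: wfun_le; rewrite normr1 normr0 ?add0r ?addr0.
    have -> : q x + (kap ^+ 2)%:C%C = ((f x * (2 * lam - f x))%:C)%C.
      rewrite /q /qpot hk; apply: complex_ext; rewrite expr2 ?cReD ?cImD ?cReN ?cImN ?cReM ?cImM ?cReD ?cImD ?cReN ?cImN /=; ring.
    have fx : `|f x| <= b / t.
      apply: le_trans (hf x) _; apply: ler_wpM2l => //; apply: (@decay_le _ _ i0) => //.
      by case/andP: xt => h _; apply: le_trans (ltW h) (ler_norm _).
    rewrite normcR normrM /K2 mulrAC; apply: ler_pM => //.
    apply: le_trans (ler_normB _ _) _; rewrite normrM ger0_norm//.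
    by rewrite lerD2l.
  apply: le_trans (normc_le_ReIm _) _; rewrite cReD cImD Re_clap Im_clap !cReM !cImM /=.
  rewrite !mul0r subr0 addr0 -mulrA mulr2n mulrDl mul1r.
  by apply: lerD; apply: wfun_lap; rewrite ?normr1 ?normr0 ?add0r ?addr0.
- by rewrite mulr_ge0// ltW.
- by apply: divr_ge0; [apply: addr_ge0; exact: mulr_ge0|exact: ltW].
Qed.

End weyl.

(** Both norms grow like t^(n/2), but the image of the wave carries an additional factor 1/t. A
    resolvent bound C would therefore bound t. *)
Lemma spectrum_real (R : realType) (n : nat) (m b lam : R) (f : 'rV[R]_n -> R) :
  (0 < n)%N -> 0 <= b -> continuous f ->
  (forall x, `|f x| <= b * (1 + sqnorm2 x) `^ (- 2^-1)) ->
  m ^+ 2 <= lam ^+ 2 -> spectrum m f lam%:C%C.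
Proof.
move=> n0 b0 cf hf ml.
have fb x : `|f x| <= b.
  apply: le_trans (hf x) _; rewrite -[leRHS]mulr1; apply: ler_wpM2l => //; exact: decay_le1.
have i0 : 'I_n by exact: Ordinal n0.
apply: contrapT => /(spectrumNP m lam%:C%C cf fb)[C [C0 hlow _]].
pose kap := Num.sqrt (lam ^+ 2 - m ^+ 2).
have hk : kap ^+ 2 = lam ^+ 2 - m ^+ 2 by rewrite sqr_sqrtr// subr_ge0.
have [B B1 hB] := @beta_bounds R; have [c c0 hc] := @beta_mid R.
pose K := 2 * (n.+1%:R * (B + 2 * `|kap| * B)) + 2 * (b * (2 * `|lam| + b)).
have key t : 1 <= t -> c ^+ n * t <= C * K * Num.sqrt (12 ^+ n).
  move=> t1; have t0 : 0 < t by exact: lt_le_trans t1.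
  have [g [Lg Hg Ng]] := wave_upper i0 t1 B1 hB b0 hk cf hf.
  have h1 := wave_lower i0 kap t1 (ltW c0) hc.
  have h2 := le_trans h1 (le_trans (hlow _ _ Lg Hg) (ler_wpM2l C0 Ng)).
  have E : (6 * t) ^+ n = 12 ^+ n * (t / 2) ^+ n by rewrite -exprMn; congr (_ ^+ _); field.
  have s0 : 0 < Num.sqrt ((t / 2) ^+ n) by rewrite sqrtr_gt0 exprn_gt0// divr_gt0.
  rewrite -/K E sqrtrM ?exprn_ge0// in h2.
  rewrite -(ler_pM2r s0) -(ler_pM2r (_ : 0 < t^-1)) ?invr_gt0//.
  move: h2; congr (_ <= _); last by ring.
  by field; rewrite gt_eqF.
have cn0 : 0 < c ^+ n by rewrite exprn_gt0.
set Q := C * K * _ in key.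
have := key (`|Q| / c ^+ n + 1); rewrite lerDr divr_ge0 ?(ltW cn0)// => /(_ isT).
rewrite mulrDr mulrCA divff ?gt_eqF// !mulr1.
have := ler_norm Q; lra.
Qed.

(** * Uniform continuity in W^{1,p} *)

Section hoelder_box.
Context {d : measure_display} {T : measurableType d} {R : realType}.
Variable mu : {measure set T -> \bar R}.
Implicit Types (f g : T -> R).

Lemma Rintegral_le_norm f (B : R) : measurable_fun setT f ->
  (\int[mu]_x `|(f x)%:E| <= B%:E)%E -> `|\int[mu]_x f x| <= B.
Proof.
move=> mf h; have i1 : mu.-integrable setT (EFin \o f).
  by apply/integrableP; split; [exact/measurable_EFinP|apply: le_lt_trans h (ltry _)].
apply: le_trans (le_normr_Rintegral measurableT i1) _.
have i2 : mu.-integrable setT (EFin \o (fun x => `|f x|)) by exact: integrable_norm.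
by rewrite /Rintegral -lee_fin fineK//; exact: integrable_fin_num.
Qed.

(** Hoelder's inequality with 1/q = 1 - 1/p, where |g|^q is at most c^q on a set of measure v and 0
    elsewhere. *)
Lemma hoelder_supp f g (A : set T) (p M c v : R) :
  measurable_fun setT f -> measurable_fun setT g -> 1 < p -> 0 <= M -> 0 <= c ->
  measurable A -> mu A = v%:E -> 0 <= v ->
  (Lnorm mu p%:E (EFin \o f) <= M%:E)%E -> (forall x, `|g x| <= c) ->
  (forall x, ~ A x -> g x = 0) -> `|\int[mu]_x (f x * g x)| <= M * (c * v `^ (1 - p^-1)).
Proof.
move=> mf mg p1 M0 c0 mA mv v0 fM gc gA.
have p0 : 0 < p by exact: lt_trans p1.
have pi1 : p^-1 < 1 by rewrite invf_lt1.
pose q := (1 - p^-1)^-1.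
have q0 : 0 < q by rewrite invr_gt0 subr_gt0.
have pq : p^-1 + q^-1 = 1 by rewrite invrK; lra.
have qi : q^-1 = 1 - p^-1 by rewrite invrK.
have qn : q != 0 by rewrite gt_eqF.
apply: Rintegral_le_norm; first exact: measurable_funM.
have := hoelder mu mf mg p0 q0 pq; rewrite Lnorm1 => /le_trans; apply.
rewrite EFinM; apply: lee_pmul => //; [exact: Lnorm_ge0|exact: Lnorm_ge0|].
rewrite unlock /=.
have hI : (\int[mu]_x (`|(g x)%:E| `^ q) <= ((c `^ q) * v)%:E)%E.
  apply: (@le_trans _ _ (\int[mu]_x ((c `^ q) * \1_A x)%:E)%E).
    apply: ge0_le_integral => //.
    - by move=> x _; exact: poweR_ge0.
    - apply/measurable_EFinP; apply: (measurableT_comp (f := fun y : R => `|y| `^ q)) => //.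
      apply: (measurableT_comp (f := fun y : R => y `^ q)) => //.
    - by apply/measurable_EFinP; apply: measurable_funM => //; exact: measurable_indic.
    - move=> x _; rewrite abse_EFin poweR_EFin lee_fin indicE.
      have [xA|xA] := boolP (x \in A).
        by rewrite mulr1; apply: ge0_ler_powR; rewrite ?nnegrE// ltW.
      by rewrite gA ?normr0 ?powR0 ?mulr0//; move: xA; rewrite notin_setE.
  under eq_integral do rewrite EFinM.
  have m1 : measurable_fun setT (EFin \o (\1_A : T -> R)).
    by apply/measurable_EFinP; exact: measurable_indic.
  have p1' : forall x, setT x -> (0 <= (EFin \o (\1_A : T -> R)) x)%E by move=> x _; rewrite lee_fin.
  rewrite (ge0_integralZl_EFin mu measurableT p1' m1 (powR_ge0 c q)).
  by rewrite integral_indic// setIT [X in (_ * X)%E]mv EFinM.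
apply: (@le_trans _ _ ((((c `^ q) * v)%:E) `^ q^-1)%E).
  apply: gt0_ler_poweR => //; rewrite ?in_itv /= ?leey ?andbT.
  - by rewrite invr_ge0 ltW.
  - by apply: integral_ge0 => x _; rewrite lee_fin powR_ge0.
  - by rewrite lee_fin mulr_ge0// powR_ge0.
rewrite poweR_EFin lee_fin powRM ?powR_ge0// -powRrM mulfV// powRr1// qi.
exact: lexx.
Qed.

End hoelder_box.

Section sobolev_norm.
Context {R : realType} {n : nat}.
Local Notation V := 'rV[R]_n.
Local Notation mu := (lebesgue_rV R n).

Lemma W1p_norm_partial (p M : R) (f : V -> R) (Df : 'I_n -> V -> R) i : 0 < p -> 0 <= M ->
  (W1p_norm p f Df <= M%:E)%E -> (Lnorm mu p%:E (EFin \o Df i) <= M%:E)%E.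
Proof.
move=> p0 M0; rewrite /W1p_norm => h; apply: le_trans h.
rewrite -[leLHS]poweRe1; last exact: Lnorm_ge0.
rewrite -(mulfV (lt0r_neq0 p0)) poweRrM; apply: gt0_ler_poweR; rewrite ?in_itv /= ?leey ?andbT.
- by rewrite invr_ge0 ltW.
- exact: poweR_ge0.
- by apply: adde_ge0; [exact: poweR_ge0|apply: sume_ge0 => j _; exact: poweR_ge0].
- rewrite (bigD1 i)//= addeCA leeDl//; apply: adde_ge0; first exact: poweR_ge0.
  by apply: sume_ge0 => j _; exact: poweR_ge0.
Qed.

End sobolev_norm.

Section theta_more.
Context {R : realType}.

Definition dtheta : R -> R := derive1 theta.

Lemma smooth1_dtheta : smooth1 dtheta.
Proof. exact: smooth1_derive smooth1_theta. Qed.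

Lemma derive1_psi_ge0 t : 0 <= derive1 (@psi R) t.
Proof.
have [_] := @is_derive_flat R 1 t; rewrite -derive1E => ->.
rewrite /flat; case: ifP => // t0; rewrite derivC mulr0 subr0 mulr1 hornerXn.
by rewrite mulr_ge0 ?expR_ge0// sqr_ge0.
Qed.

Lemma dtheta_ge0 t : 0 <= dtheta t.
Proof.
have dn := @theta_den_gt0 R t.
have s2 : smooth1 (fun t : R => psi ((-1) * t + 1)) by exact: smooth1_psi_affine.
have d1 := smooth1_is_derive t (@smooth1_psi R).
have d2 := smooth1_is_derive t s2.
rewrite derive1_affine in d2; last exact: smooth1_psi.
have d3 := is_deriveD d1 d2.
have E : (psi : R -> R) + (fun t => psi (-1 * t + 1)) = (fun t => psi t + psi (1 - t)).
  by apply/funext => s; change (psi s + psi (-1 * s + 1) = psi s + psi (1 - s)); congr (_ + psi _); ring.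
rewrite E in d3.
have d4 := is_deriveV (f := fun t : R => psi t + psi (1 - t)) (lt0r_neq0 dn) d3.
have [_ d5] := is_deriveM d1 d4.
have -> : dtheta t = derive1 (psi \* (fun s : R => (psi s + psi (1 - s))^-1)) t by [].
have e1 : -1 * t + 1 = 1 - t by ring.
rewrite derive1E d5 /GRing.scale /= e1.
have h1 := derive1_psi_ge0 t; have h2 := derive1_psi_ge0 (1 - t).
have p1 := @psi_ge0 R t; have p2 := @psi_ge0 R (1 - t).
move: (derive1 (@psi R) t) (derive1 (@psi R) (1 - t)) (psi t) (psi (1 - t)) h1 h2 p1 p2 dn.
move=> {s2 d1 d2 E d3 d4 d5} a b c d0 h1 h2 p1 p2 dn.
have -> : c * (- (c + d0) ^- 2 * (a + -1 * b)) + (c + d0)^-1 * a = (a * d0 + c * b) / (c + d0) ^+ 2.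
  by field; rewrite gt_eqF.
by rewrite divr_ge0 ?sqr_ge0// addr_ge0// mulr_ge0.
Qed.

Lemma theta_ge0 (t : R) : 0 <= theta t.
Proof. by rewrite /theta divr_ge0 ?psi_ge0// ltW// theta_den_gt0. Qed.

Lemma theta_le1 (t : R) : theta t <= 1.
Proof. by rewrite /theta ler_pdivrMr ?theta_den_gt0// mul1r lerDl psi_ge0. Qed.

Lemma dtheta_supp t : 1 < `|t| -> dtheta t = 0.
Proof.
rewrite lter_normr => /orP[h|h]; rewrite /dtheta derive1E; apply: derive_val.
  apply: (near_eq_is_derive _ (is_derive_cst (1 : R) t (1 : R))).
  have := @open_gt R 1; rewrite openE => /(_ t h).
  by apply: filterS => y /= hy; rewrite theta_ge1// ltW.
apply: (near_eq_is_derive _ (is_derive_cst (0 : R) t (1 : R))).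
have t0 : t < 0 by lra.
have := @open_lt R 0; rewrite openE => /(_ t t0).
by apply: filterS => y /= hy; rewrite theta_le0// ltW.
Qed.

Lemma dtheta_pos : exists x : R, exists2 e : R, 0 < e & forall t, `|x - t| < e -> 2^-1 <= dtheta t.
Proof.
(* The step rises by 1 over the unit interval, so its slope is 1 somewhere. *)
have [x _ hx] : exists2 x : R, x \in `]0, 1[ & theta 1 - theta 0 = dtheta x * (1 - 0).
  apply: (MVT ltr01).
  - by move=> x _; rewrite /dtheta; apply: smooth1_is_derive; exact: smooth1_theta.
  - by apply: continuous_subspaceT; apply: smooth1_continuous; exact: smooth1_theta.
rewrite theta_ge1// theta_le0// !subr0 mulr1 in hx.
exists x; have := smooth1_continuous smooth1_dtheta (x := x).
have h2 : 0 < 2^-1 :> R by lra.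
move=> /cvgrPdist_lt /(_ 2^-1 h2) [e /= e0 he].
exists e => // t xt; have := he t xt; rewrite -hx => /ltr_normlW.
by move: (dtheta t) => u; clear; lra.
Qed.

Lemma dtheta_bound : exists2 B : R, 1 <= B & forall t, `|dtheta t| <= B.
Proof.
have [B B0 hB] := continuous_supp_bounded (smooth1_continuous smooth1_dtheta) dtheta_supp.
by exists (1 + B) => [|t]; [rewrite lerDl|apply: le_trans (hB t) _; rewrite lerDr].
Qed.

End theta_more.

(** * Mollifiers of product form at dyadic radii *)

Section kernels.
Context {R : realType} {n : nat}.
Local Notation V := 'rV[R]_n.
Local Notation e_ i := (delta_mx ord0 i : 'rV[R]_n).
Local Notation mu := (lebesgue_rV R n).

Definition th (a : R) : R -> R := fun t => theta (a^-1 * t + 0).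

Lemma smooth1_th a : smooth1 (th a).
Proof. by apply: smooth1_affine; exact: smooth1_theta. Qed.

Lemma derive1_th a t : derive1 (th a) t = a^-1 * dtheta (a^-1 * t + 0).
Proof. by rewrite derive1_affine//; exact: smooth1_theta. Qed.

Lemma smooth1_dth a : smooth1 (derive1 (th a)).
Proof. exact/smooth1_derive/smooth1_th. Qed.

Lemma derive1_th_supp a t : 0 < a -> a < `|t| -> derive1 (th a) t = 0.
Proof.
move=> a0 h; rewrite derive1_th addr0 dtheta_supp ?mulr0// normrM gtr0_norm ?invr_gt0//.
by rewrite ltr_pdivlMl// mulr1.
Qed.

Lemma derive1_th_le (B a t : R) : 0 < a -> (forall s, `|dtheta s| <= B) -> `|derive1 (th a) t| <= B / a.
Proof.
move=> a0 hB; rewrite derive1_th normrM gtr0_norm ?invr_gt0// mulrC.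
by rewrite ler_wpM2r// invr_ge0 ltW.
Qed.

(** Both steps equal 1 far to the right, so their difference has bounded support, while its
    derivative is the difference of the mollifiers of radii r and r / 2. *)
Definition om (r : R) : R -> R := th r \+ (fun t => -1 * th (r / 2) t).

Lemma smooth1_om r : smooth1 (om r).
Proof.
apply: smooth1D; first exact: smooth1_th.
rewrite (_ : (fun t => _) = (cst (-1) \* th (r / 2))) //.
by apply: smooth1M; [move=> k; exact: C1k_cst|exact: smooth1_th].
Qed.

Lemma derive1_om r t : derive1 (om r) t = derive1 (th r) t - derive1 (th (r / 2)) t.
Proof.
have s2 : smooth1 (fun t => -1 * th (r / 2) t).
  rewrite (_ : (fun t => _) = (cst (-1) \* th (r / 2))) //.
  by apply: smooth1M; [move=> k; exact: C1k_cst|exact: smooth1_th].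
rewrite derive1D//; last exact: smooth1_th.
by rewrite /= derive1Z ?mulN1r//; exact: smooth1_th.
Qed.

Lemma om_supp r t : 0 < r -> r < `|t| -> om r t = 0.
Proof.
move=> r0; rewrite /om /th /= !addr0 lter_normr => /orP[h|h].
  rewrite !theta_ge1 ?mulr1 ?subrr//; rewrite mulrC ler_pdivlMr ?divr_gt0// mul1r; lra.
have t0 : t <= 0 by lra.
rewrite !theta_le0 ?mulr0 ?addr0//; rewrite mulr_ge0_le0// invr_ge0; lra.
Qed.

Lemma om_le r t : `|om r t| <= 2.
Proof.
apply: le_trans (ler_normD _ _) _; rewrite mulN1r normrN.
by rewrite !ger0_norm ?theta_ge0// mulr2n lerD// theta_le1.
Qed.

(** Halving the radius is done one coordinate at a time: [hat r s] is r / 2 in the first s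
    coordinates and r in the others. Passing from s to s + 1 changes the kernel [rho] by a partial
    derivative of the test function [omf] ([rho_step]), which a weak derivative can absorb. *)
Definition hat (r : R) (s : nat) (j : 'I_n) : R := if (j < s)%N then r / 2 else r.
Definition rho (r : R) (s : nat) : V -> R := prodc (fun j => derive1 (th (hat r s j))).
Definition omf (r : R) (s : nat) (i : 'I_n) : V -> R :=
  prodc (fun j => if j == i then om r else derive1 (th (hat r s j))).

Lemma rho_half r : rho r n = rho (r / 2) 0.
Proof. by apply: (congr1 prodc); apply/funext => j; rewrite /hat ltn_ord; reflexivity. Qed.

Lemma half_double (r : R) : 0 < r -> r / 2 <= r /\ r < 2 * r.
Proof. by move=> r0; split; lra. Qed.

Section fixed_radius.
Variable r : R.
Hypothesis r0 : 0 < r.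

Lemma hat_gt0 s j : 0 < hat r s j.
Proof. by rewrite /hat; case: ifP => _; rewrite ?divr_gt0. Qed.

Lemma hat_le s j : r / 2 <= hat r s j <= r.
Proof. have [h _] := half_double r0.
by rewrite /hat; case: ifP => _; rewrite lexx ?andbT. Qed.

Let r20 : 0 < 2 * r. Proof. by rewrite mulr_gt0. Qed.

Let dth_supp s j t : 2 * r <= `|t| -> derive1 (th (hat r s j)) t = 0.
Proof.
move=> h; apply: derive1_th_supp; first exact: hat_gt0.
apply: lt_le_trans h; have /andP[_ h] := hat_le s j; apply: le_lt_trans h _.
by have [_] := half_double r0.
Qed.

Lemma tst_rho s : tst (rho r s).
Proof. by apply: (tst_prodc r20) => [j|j t]; [exact: smooth1_dth|exact: dth_supp]. Qed.

Lemma rho_supp s x : ~ cube (2 * r) x -> rho r s x = 0.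
Proof.
move=> xC; apply: (prodc_supp r20 (dth_supp s)).
by rewrite leNgt; apply/negP => /(cubeP x r20).
Qed.

Let omf_fac s (i j : 'I_n) : R -> R := if j == i then om r else derive1 (th (hat r s j)).

Let omf_fac_supp s i j t : 2 * r <= `|t| -> omf_fac s i j t = 0.
Proof.
move=> h; rewrite /omf_fac; case: eqP => _; last exact: dth_supp.
apply: om_supp => //; apply: lt_le_trans h.
by have [_] := half_double r0.
Qed.

Let smooth1_omf_fac s i j : smooth1 (omf_fac s i j).
Proof. by rewrite /omf_fac; case: eqP => _; [exact: smooth1_om|exact: smooth1_dth]. Qed.

Lemma tst_omf s i : tst (omf r s i).
Proof. by apply: (tst_prodc r20) => [j|j t]; [exact: smooth1_omf_fac|exact: omf_fac_supp]. Qed.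

Lemma omf_supp s i x : ~ cube (2 * r) x -> omf r s i x = 0.
Proof.
move=> xC; apply: (prodc_supp r20 (omf_fac_supp s i)).
by rewrite leNgt; apply/negP => /(cubeP x r20).
Qed.

Lemma rho_step (i : 'I_n) x : rho r i x - rho r i.+1 x = partial i (omf r i i) x.
Proof.
rewrite partial_prodc; last exact: smooth1_omf_fac.
pose P := \prod_(j | j != i) derive1 (th (hat r i j)) (x ord0 j).
have split_i (g : 'I_n -> R -> R) : (forall j, j != i -> g j (x ord0 j) = derive1 (th (hat r i j)) (x ord0 j)) ->
    prodc g x = g i (x ord0 i) * P.
  by move=> h; rewrite /prodc (bigD1 i)//=; congr (_ * _); exact: eq_bigr.
have E0 : rho r i x = derive1 (th (hat r i i)) (x ord0 i) * P.
  exact (split_i (fun j => derive1 (th (hat r i j))) (fun j _ => erefl)).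
have hatE (j : 'I_n) : j != i -> hat r i.+1 j = hat r i j.
  by move=> ji; rewrite /hat ltnS leq_eqVlt (negbTE (_ : (j != i :> nat))).
have E1 : rho r i.+1 x = derive1 (th (hat r i.+1 i)) (x ord0 i) * P.
  exact (split_i (fun j => derive1 (th (hat r i.+1 j)))
    (fun j ji => congr1 (fun a => derive1 (th a) (x ord0 j)) (hatE j ji))).
rewrite E0 E1 split_i; last by move=> j ji; rewrite /der !(negbTE ji).
rewrite -mulrBl; congr (_ * _).
by rewrite /der !eqxx derive1_om /hat ltnn ltnSn.
Qed.

Variable B : R.
Hypothesis hB : forall t, `|dtheta t| <= B.

Let B0 : 0 <= B. Proof. by apply: le_trans (hB 0). Qed.

Lemma omf_le s i x : `|omf r s i x| <= 2 * (2 * B / r) ^+ n.-1.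
Proof.
apply: le_trans (prodc_le (b := fun j => if j == i then 2 else 2 * B / r) _ _) _.
  move=> j t; case: eqP => _; first exact: om_le.
  apply: le_trans (derive1_th_le t (hat_gt0 s j) hB) _.
  have /andP[h _] := hat_le s j.
  have -> : 2 * B / r = B / (r / 2) by field; rewrite gt_eqF.
  by apply: ler_wpM2l => //; rewrite lef_pV2 ?posrE ?hat_gt0 ?divr_gt0.
rewrite (bigD1 i)//= eqxx (eq_bigr (fun=> 2 * B / r)); last by move=> j /negbTE ->.
by rewrite prodr_const cardC1 card_ord.
Qed.

Lemma rho_le x : `|rho r 0 x| <= (B / r) ^+ n.
Proof.
apply: le_trans (prodc_le (b := fun j => B / r) _ _) _.
  by move=> j t; exact: derive1_th_le.
by rewrite prodr_const card_ord.
Qed.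

End fixed_radius.

Opaque rho omf.

(** The kernels differ by a partial derivative of a test function, whose integral is 0. The mass
    enters the estimates only through its independence of the radius and its positivity. *)
Lemma int_rho_step r s : 0 < r -> (s <= n)%N -> \int[mu]_x rho r s x = \int[mu]_x rho r 0 x.
Proof.
move=> r0; elim: s => [|s IH] sn; [reflexivity|rewrite -(IH (ltnW sn))].
have := int_partial0 (Ordinal sn) (tst_omf r0 s (Ordinal sn)).
have -> : partial (Ordinal sn) (omf r s (Ordinal sn)) = (fun x => rho r s x - rho r s.+1 x).
  by apply/funext => x; rewrite -(rho_step r (Ordinal sn)).
rewrite (RintegralB measurableT (tst_integrable (tst_rho r0 s)) (tst_integrable (tst_rho r0 s.+1))).
by move=> h; exact (esym (subr0_eq h)).
Qed.

Lemma int_rho k : \int[mu]_x rho (2^-1 ^+ k) 0 x = \int[mu]_x rho 1 0 x.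
Proof.
elim: k => [|k <-]; [rewrite expr0; reflexivity|rewrite exprSr -rho_half].
by apply: int_rho_step; [rewrite exprn_gt0 ?invr_gt0|exact: leqnn].
Qed.

Lemma int_rho_gt0 : 0 < \int[mu]_x rho 1 0 x.
Proof.
have [t [e e0 he]] := @dtheta_pos R.
pose A : set V := box (fun=> t - e) (fun=> t + e).
have mA : measurable A by exact: measurable_box.
have muA : mu A = ((2 * e) ^+ n)%:E.
  rewrite /A lebesgue_rV_box; last by move=> i; lra.
  by rewrite prodr_const card_ord; congr (_ ^+ _)%:E; ring.
have muo : (mu A < +oo)%E by rewrite muA ltry.
have iA := integrable_indic_lty mA muo.
have iB : mu.-integrable setT (EFin \o (fun x => 2^-1 ^+ n * \1_A x)) by exact: integrable_Rscale.
Transparent rho.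
have ge0 x : 0 <= rho 1 0 x.
  by apply: prodr_ge0 => j _; rewrite derive1_th mulr_ge0 ?dtheta_ge0// invr_ge0 ltW// hat_gt0.
have := @le_Rintegral _ _ _ mu setT (fun x => 2^-1 ^+ n * \1_A x) (rho 1 0) measurableT iB
  (tst_integrable (tst_rho ltr01 0)).
rewrite RintegralZl// {1}/Rintegral integral_indic// setIT.
rewrite (congr1 fine muA) /= => h; apply: lt_le_trans (h _).
  by rewrite mulr_gt0 ?exprn_gt0 ?invr_gt0 ?mulr_gt0.
move=> x _; rewrite indicE; have [xA|xA] := boolP (x \in A); last by rewrite mulr0.
rewrite mulr1 -[n in _ ^+ n]card_ord -prodr_const; apply: ler_prod => j _.
rewrite invr_ge0 ler0n /= derive1_th /hat invr1 !mul1r addr0; apply: he.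
by move: xA; rewrite inE => /(_ j) /andP[h1 h2]; rewrite ltr_norml; apply/andP; split; lra.
Qed.

End kernels.

Opaque rho omf.

Section tst_lipschitz.
Context {R : realType} {n : nat}.
Local Notation V := 'rV[R]_n.
Local Notation e_ i := (delta_mx ord0 i : 'rV[R]_n).

(** The corners of a path from x to y along the axes; each edge is controlled by one partial
    derivative. *)
Definition mixed (x y : V) (s : nat) : V := \row_j (if (j < s)%N then y ord0 j else x ord0 j).

Lemma mixed_step x y (i : 'I_n) :
  mixed x y i.+1 = mixed x y i + (y ord0 i - x ord0 i) *: e_ i.
Proof.
apply/rowP => j; rewrite !mxE eqxx /= ltnS leq_eqVlt.
have [->|ji] := eqVneq j i; first by rewrite eqxx ltnn mulr1 addrC subrK.
by rewrite (negbTE (_ : (j != i :> nat)))//= mulr0 addr0.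
Qed.

Lemma tst_lip (f : V -> R) : tst f -> exists2 L : R, 0 <= L &
  forall x y, `|f x - f y| <= L * `|x - y|.
Proof.
move=> tf; have /choice[B hB] : forall i, exists b : R, 0 <= b /\ forall x, `|partial i f x| <= b.
  by move=> i; have [b ? ?] := tst_bounded (tst_partial i tf); exists b.
have B0 i : 0 <= B i := (hB i).1.
exists (\sum_i B i) => [|x y]; first by apply: sumr_ge0 => i _.
have key s : (s <= n)%N -> `|f (mixed x y s) - f (mixed x y 0)| <= \sum_(i < n | (i < s)%N) B i * `|x - y|.
  elim: s => [|s IH] sn; first by rewrite subrr normr0 big1.
  pose i := Ordinal sn.
  rewrite (bigD1 i) ?ltnSn//= addrC.
  have -> : f (mixed x y s.+1) - f (mixed x y 0) =
    (f (mixed x y s) - f (mixed x y 0)) + (f (mixed x y s.+1) - f (mixed x y s)) by ring.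
  apply: le_trans (ler_normD _ _) _; apply: lerD.
    apply: le_trans (IH (ltnW sn)) _; rewrite le_eqVlt; apply/orP; left; apply/eqP.
    by apply: eq_bigl => j; rewrite -(inj_eq val_inj) /= ltnS; case: ltngtP.
  rewrite (mixed_step x y i); apply: le_trans (lip_coord _ _ (tst_smooth tf) (hB i).2) _.
  apply: ler_wpM2l => //.
  by rewrite distrC; have := @rV_coord_le R n (x - y) i; rewrite !mxE.
have := key n (leqnn n).
have -> : mixed x y n = y by apply/rowP => j; rewrite mxE ltn_ord.
have -> : mixed x y 0 = x by apply/rowP => j; rewrite mxE.
rewrite distrC mulr_suml => /le_trans; apply.
by rewrite le_eqVlt; apply/orP; left; apply/eqP; apply: eq_bigl => j; rewrite ltn_ord.
Qed.

End tst_lipschitz.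

Lemma powR_exprn (R : realType) (a x : R) k : 0 <= a -> (a ^+ k) `^ x = (a `^ x) ^+ k.
Proof. by move=> a0; rewrite -(powR_mulrn k a0) -(powR_mulrn k (powR_ge0 a x)) -!powRrM mulrC. Qed.

(** * Morrey's estimate *)

Section morrey.
Context {R : realType} {n : nat}.
Local Notation V := 'rV[R]_n.
Local Notation e_ i := (delta_mx ord0 i : 'rV[R]_n).
Local Notation mu := (lebesgue_rV R n).
Variables (p M B : R).
Hypotheses (n0 : (0 < n)%N) (np : n%:R < p) (M0 : 0 <= M) (hB : forall t : R, `|dtheta t| <= B).

Let B0 : 0 <= B. Proof. by apply: le_trans (hB 0). Qed.
Let p1 : 1 < p.
Proof. by apply: le_lt_trans np; rewrite ler1n. Qed.

Section potential.
Variables (f : V -> R) (Df : 'I_n -> V -> R).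
Hypotheses (cf : continuous f) (fM : forall x, `|f x| <= M)
  (mD : forall i, measurable_fun setT (Df i)) (wD : forall i, weak_partial i f (Df i))
  (ND : forall i, (Lnorm mu p%:E (EFin \o Df i) <= M%:E)%E).

Let mf : measurable_fun setT f. Proof. exact: continuous_rV_measurable. Qed.

Lemma int_tst g : tst g -> mu.-integrable setT (EFin \o (fun x => f x * g x)).
Proof.
move=> tg; have ig : mu.-integrable setT (EFin \o (fun x => `|g x|)).
  exact: integrable_norm (tst_integrable tg).
apply: (integrable_dom (g := fun x => M * `|g x|)).
- by apply: measurable_funM => //; exact: tst_measurable.
- exact: integrable_Rscale.
- by move=> x; rewrite normrM ler_wpM2r.
Qed.

Definition avgV (r : R) (s : nat) (x : V) : R := \int[mu]_y (f y * rho r s (y - x)).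

(** The averages differ by the integral of f against a partial derivative of [omf], that is, of the
    weak derivative of f against [omf]; Hoelder's inequality bounds it by the L^p norm. *)
Lemma avgV_step (r : R) (i : 'I_n) x : 0 < r ->
  `|avgV r i x - avgV r i.+1 x| <=
  M * (2 * (2 * B / r) ^+ n.-1 * ((4 * r) ^+ n) `^ (1 - p^-1)).
Proof.
move=> r0; have to := tst_shift (- x) (tst_omf r0 i i).
have tr s := tst_shift (- x) (tst_rho r0 s).
have -> : avgV r i x - avgV r i.+1 x = - \int[mu]_y (Df i y * omf r i i (y - x)).
  rewrite -(wD i ((tstP _).2 to)) partial_shift /avgV -RintegralB//; [|exact: int_tst|exact: int_tst].
  by apply: eq_Rintegral => y _; rewrite -mulrBr rho_step.
rewrite normrN.
pose A : set V := box (fun j => x ord0 j - 2 * r) (fun j => x ord0 j + 2 * r).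
apply: (@hoelder_supp _ _ _ mu _ _ A) => //.
- exact: tst_measurable.
- by rewrite mulr_ge0// exprn_ge0// divr_ge0 ?mulr_ge0// ltW.
- exact: measurable_box.
- have h j : x ord0 j - 2 * r <= x ord0 j + 2 * r.
    have h2 : 0 <= 2 * r by rewrite mulr_ge0// ltW.
    by rewrite lerD2l (le_trans _ h2)// oppr_le0.
  have -> : (4 * r) ^+ n = \prod_(j < n) ((x ord0 j + 2 * r) - (x ord0 j - 2 * r)).
    by rewrite -[n in LHS]card_ord -prodr_const; apply: eq_bigr => j _; ring.
  exact: lebesgue_rV_box h.
- by rewrite exprn_ge0// mulr_ge0// ltW.
- by move=> y; exact: omf_le.
- move=> y yA; apply: omf_supp => // yC; apply: yA => j.
  by have := yC j; rewrite !mxE => /andP[h1 h2]; apply/andP; split; lra.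
Qed.

Lemma avgV_half (r : R) x : 0 < r ->
  `|avgV r 0 x - avgV (r / 2) 0 x| <=
  n%:R * (M * (2 * (2 * B / r) ^+ n.-1 * ((4 * r) ^+ n) `^ (1 - p^-1))).
Proof.
move=> r0; have -> : avgV (r / 2) 0 x = avgV r n x by rewrite /avgV rho_half.
set K := M * _.
have : forall s, (s <= n)%N -> `|avgV r 0 x - avgV r s x| <= s%:R * K.
  elim=> [|s IH] sn; first by rewrite subrr normr0 mul0r.
  apply: le_trans (ler_distD (avgV r s x) _ _) _; rewrite -natr1 mulrDl mul1r; apply: lerD; first exact: IH (ltnW sn).
  exact: (avgV_step (Ordinal sn)).
by apply.
Qed.

Lemma avgV_near (r e : R) x : 0 < r -> 0 <= e -> (forall y, `|y - x| < 2 * r -> `|f y - f x| <= e) ->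
  `|avgV r 0 x - (\int[mu]_y rho r 0 y) * f x| <= e * (4 * B) ^+ n.
Proof.
move=> r0 e0 h; have tr := tst_shift (- x) (tst_rho r0 0).
rewrite -(Rintegral_rV_shift (- x) (tst_measurable (tst_rho r0 0))) mulrC.
rewrite -RintegralZl//; last exact: tst_integrable.
rewrite /avgV -RintegralB//; [|exact: int_tst|by apply: integrable_Rscale; exact: tst_integrable].
pose g y := (f y - f x) * rho r 0 (y - x).
have mg : measurable_fun setT g.
  by apply: measurable_funM; [exact: measurable_funB|exact: tst_measurable].
have -> : \int[mu]_y (f y * rho r 0 (y - x) - f x * rho r 0 (y - x)) = \int[mu]_y g (y + x).
  rewrite (Rintegral_rV_shift x mg).
  by apply: eq_Rintegral => y _; rewrite /g mulrBl.
have [|||||_] := @int_bound _ _ (fun y => g (y + x)) (e * (B / r) ^+ n) (2 * r).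
- exact: (measurableT_comp mg (measurable_rV_shift x)).
- by rewrite mulr_ge0// exprn_ge0// divr_ge0// ltW.
- by rewrite mulr_ge0// ltW.
- move=> y; rewrite /g addrK normrM.
  have [yC|yC] := pselect (cube (2 * r) y).
    apply: ler_pM => //; last exact: rho_le.
    by apply: h; rewrite addrK; apply/cubeP => //; rewrite mulr_gt0.
  by rewrite rho_supp// normr0 mulr0 mulr_ge0// exprn_ge0// divr_ge0// ltW.
- by move=> y yC; rewrite /g addrK rho_supp// mulr0.
move=> /le_trans; apply; rewrite -mulrA -exprMn.
have -> : B / r * (2 * (2 * r)) = 4 * B by field; rewrite gt_eqF.
exact: lexx.
Qed.

(** At a fixed radius the Lipschitz constant comes from the kernel, and f contributes only its bound
    M. Both kernels live within distance 2 r + 1 <= 3 of x, whence 6^n. *)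
Lemma avgV_lip (r L : R) x y : 0 < r <= 1 -> 0 <= L ->
  (forall u v : V, `|rho r 0 u - rho r 0 v| <= L * `|u - v|) -> `|x - y| <= 1 ->
  `|avgV r 0 x - avgV r 0 y| <= M * L * 6 ^+ n * `|x - y|.
Proof.
move=> /andP[r0 r1] L0 hL xy.
have h2 : 0 < 2 * r by rewrite mulr_gt0.
have r2 : 2 * r <= 2 by rewrite ler_piMr.
have tx := tst_shift (- x) (tst_rho r0 0); have ty := tst_shift (- y) (tst_rho r0 0).
have E0 : avgV r 0 x - avgV r 0 y = \int[mu]_z (f z * rho r 0 (z - x) - f z * rho r 0 (z - y)).
  exact: esym (RintegralB measurableT (int_tst tx) (int_tst ty)).
pose g z := f z * (rho r 0 (z - x) - rho r 0 (z - y)).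
have mg : measurable_fun setT g.
  exact: (measurable_funM mf (measurable_funB (tst_measurable tx) (tst_measurable ty))).
have -> : avgV r 0 x - avgV r 0 y = \int[mu]_z g (z + x).
  rewrite E0.
  rewrite (Rintegral_rV_shift x mg).
  by apply: eq_Rintegral => z _; rewrite /g mulrBr.
have [|||||_] := @int_bound _ _ (fun z => g (z + x)) (M * (L * `|x - y|)) 3.
- exact: (measurableT_comp mg (measurable_rV_shift x)).
- by rewrite !mulr_ge0.
- by [].
- move=> z; rewrite /g normrM; apply: ler_pM => //.
  apply: le_trans (hL _ _) _; apply: ler_wpM2l => //.
  by rewrite opprB addrC addrA subrK distrC.
- move=> z zC; rewrite /g !rho_supp// ?subrr ?mulr0//.
    move=> /(cubeP _ h2) h; apply: zC; apply/cubeP => //.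
    have := ler_normB (z + (x - y)) (x - y); rewrite addrK => tri.
    rewrite -addrA in h; apply: le_lt_trans tri _; apply: lt_le_trans (ltr_leD h xy) _.
    by apply: le_trans (lerD r2 (lexx 1)) _; have -> : 3 = 2 + 1 :> R by ring.
  rewrite addrK => /(cubeP _ h2) h; apply: zC; apply/cubeP => //.
  by apply: lt_le_trans h _; apply: le_trans r2 _; rewrite ler_nat.
move=> /le_trans; apply; have -> : 2 * 3 = 6 :> R by ring.
by rewrite !mulrA [M * L * _ * _]mulrAC.
Qed.

(* [K0] and [lam] are such that [avgV_half] at radius [2^-k] gives [K0 lam^k]. *)
Definition lam : R := 2^-1 * ((2^-1 ^+ n) `^ (- p^-1)).
Definition K0 : R := n%:R * (M * (2 * (2 * B) ^+ n.-1 * (4 ^+ n) `^ (1 - p^-1))).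

Lemma lam_ge0 : 0 <= lam.
Proof. by rewrite mulr_ge0 ?powR_ge0// invr_ge0. Qed.

(** [lam] is 2^(n/p - 1), so this is where p > n enters. *)
Lemma lam_lt1 : lam < 1.
Proof.
have p0 : 0 < p by exact: lt_trans p1.
have l2 : ln (2^-1 : R) < 0 by apply: ln_lt0; apply/andP; split; rewrite ?invr_gt0 ?invf_lt1 ?ltr1n.
rewrite /lam powRN -powR_mulrn ?invr_ge0// -powRrM.
rewrite ltr_pdivrMr ?powR_gt0 ?invr_gt0// mul1r /powR gt_eqF ?invr_gt0//.
rewrite -[X in X < _](@lnK R) ?posrE ?invr_gt0// ltr_expR.
by rewrite -[X in X < _]mul1r ltr_nM2r// ltr_pdivrMr// mul1r.
Qed.

Lemma radius_pow k : (2 * (2 * B / (2^-1 ^+ k)) ^+ n.-1 * ((4 * 2^-1 ^+ k) ^+ n) `^ (1 - p^-1)) =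
  2 * (2 * B) ^+ n.-1 * (4 ^+ n) `^ (1 - p^-1) * lam ^+ k.
Proof.
set r := 2^-1 ^+ k.
have r0 : 0 < r by rewrite exprn_gt0// invr_gt0.
have -> : lam ^+ k = r * (r ^+ n) `^ (- p^-1).
  rewrite /lam exprMn; congr (_ * _).
  have h20 : 0 <= 2^-1 :> R by rewrite invr_ge0.
  by rewrite /r exprAC (powR_exprn _ _ (exprn_ge0 n h20)).
rewrite !exprMn powRM ?exprn_ge0// ?(ltW r0)//.
have rn0 : r ^+ n != 0 by rewrite gt_eqF// exprn_gt0.
rewrite (@powRD _ (r ^+ n) 1 (- p^-1)); last by rewrite rn0 implybT.
rewrite powRr1 ?exprn_ge0 ?(ltW r0)//.
have -> : r ^+ n = r * r ^+ n.-1 by rewrite -exprS prednK.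
rewrite exprVn; set X := _ `^ (- p^-1).
have : r ^+ n.-1 != 0 by rewrite gt_eqF// exprn_gt0.
move: (r ^+ n.-1) X (_ `^ _) (2 ^+ _) (B ^+ _) => a b c d0 e0 a0.
field => //.
Qed.

Lemma avgV_geo k x : `|avgV (2^-1 ^+ k) 0 x - avgV (2^-1 ^+ k.+1) 0 x| <= K0 * lam ^+ k.
Proof.
have r0 : 0 < 2^-1 ^+ k :> R by rewrite exprn_gt0// invr_gt0.
rewrite exprSr; apply: le_trans (avgV_half x r0) _.
by rewrite radius_pow /K0 -!mulrA.
Qed.

Let l0 := lam_ge0.
Let l1 : 0 < 1 - lam. Proof. by rewrite subr_gt0 lam_lt1. Qed.

Lemma K0_ge0 : 0 <= K0.
Proof. by rewrite !mulr_ge0 ?powR_ge0 ?exprn_ge0 ?mulr_ge0. Qed.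

Lemma avgV_tail k j x : `|avgV (2^-1 ^+ k) 0 x - avgV (2^-1 ^+ (k + j)) 0 x| <= K0 * lam ^+ k / (1 - lam).
Proof.
have : `|avgV (2^-1 ^+ k) 0 x - avgV (2^-1 ^+ (k + j)) 0 x| <= K0 * lam ^+ k * ((1 - lam ^+ j) / (1 - lam)).
  elim: j => [|j IH]; first by rewrite addn0 subrr normr0 expr0 subrr mul0r mulr0.
  apply: le_trans (ler_distD (avgV (2^-1 ^+ (k + j)) 0 x) _ _) _.
  apply: le_trans (lerD IH _) _; first by rewrite addnS; exact: avgV_geo.
  rewrite exprD exprS le_eqVlt; apply/orP; left; apply/eqP; field.
  by rewrite gt_eqF.
move=> /le_trans; apply; rewrite mulrA ler_wpM2r ?invr_ge0 ?(ltW l1)//.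
rewrite -[leRHS]mulr1; apply: ler_wpM2l; first by rewrite mulr_ge0 ?K0_ge0 ?exprn_ge0.
by rewrite gerBl exprn_ge0.
Qed.

(** Continuity of f at x identifies the limit of the averages; the geometric tail gives a rate that
    is the same for all f. *)
Lemma avgV_lim k x :
  `|avgV (2^-1 ^+ k) 0 x - (\int[mu]_y rho 1 0 y) * f x| <= K0 * lam ^+ k / (1 - lam).
Proof.
apply/ler_addgt0Pr => e e0.
have B4 : 0 < (4 * B) ^+ n + 1 by rewrite ltr_wpDl// exprn_ge0// mulr_ge0.
have cfx : f y @[y --> x] --> f x by exact: cf.
move/cvgrPdist_lt : cfx => /(_ _ (divr_gt0 e0 B4)).
rewrite -filter_from_ballE => -[r /= r0 hr].
have /cvgrPdist_lt /(_ (r / 2)) : (fun j : nat => 2^-1 ^+ j : R) @ \oo --> 0.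
  by apply: cvg_expr; rewrite ger0_norm ?invr_ge0// invf_lt1// ltr1n.
rewrite divr_gt0// => /(_ isT) [j _ hj].
have rj : 2 * 2^-1 ^+ (k + j) < r :> R.
  have := hj (k + j)%N (leq_addl _ _); rewrite sub0r normrN ger0_norm ?exprn_ge0 ?invr_ge0//.
  by rewrite ltr_pdivlMr// mulrC.
have r'0 : 0 < 2^-1 ^+ (k + j) :> R by rewrite exprn_gt0// invr_gt0.
apply: le_trans (ler_distD (avgV (2^-1 ^+ (k + j)) 0 x) _ _) _.
apply: lerD; first exact: avgV_tail.
rewrite -(int_rho (k + j)).
apply: le_trans (avgV_near (e := e / ((4 * B) ^+ n + 1)) r'0 _ _) _.
- by rewrite divr_ge0// ltW.
- move=> y hy; rewrite distrC; apply/ltW/hr; rewrite -ball_normE /= distrC.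
  exact: lt_trans rj.
- by rewrite mulrAC ler_pdivrMr// ler_wpM2l ?(ltW e0)// lerDl.
Qed.

End potential.

(** The radius 2^-k is fixed first, so that the averages are within e of c0 f for every f; at that
    radius they are uniformly Lipschitz. The three errors add up to 3 e, and 4 e = c0 / (i + 1). *)
Lemma morrey_equicontinuity : exists gam : nat -> R, (forall i, 0 < gam i) /\
  forall (f : V -> R) (Df : 'I_n -> V -> R), continuous f -> (forall x, `|f x| <= M) ->
  (forall i, measurable_fun setT (Df i)) -> (forall i, weak_partial i f (Df i)) ->
  (forall i, (Lnorm mu p%:E (EFin \o Df i) <= M%:E)%E) ->
  forall i x y, `|x - y| < gam i -> `|f x - f y| <= i.+1%:R^-1.
Proof.
pose c0 : R := \int[mu]_y rho 1 0 y; have c00 : 0 < c0 := int_rho_gt0.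
have l1 : 0 < 1 - lam by rewrite subr_gt0 lam_lt1.
have l0 := lam_ge0.
have K0' := K0_ge0.
suff /choice[gam hg] : forall i : nat, exists g : R, 0 < g /\
  forall (f : V -> R) (Df : 'I_n -> V -> R), continuous f -> (forall x, `|f x| <= M) ->
  (forall i, measurable_fun setT (Df i)) -> (forall i, weak_partial i f (Df i)) ->
  (forall i, (Lnorm mu p%:E (EFin \o Df i) <= M%:E)%E) ->
  forall x y, `|x - y| < g -> `|f x - f y| <= i.+1%:R^-1.
  exists gam; split=> [i|f Df cf fM mD wD ND i x y]; first exact: (hg i).1.
  exact: (hg i).2 f Df cf fM mD wD ND x y.
move=> i; pose e : R := c0 / i.+1%:R / 4.
have e0 : 0 < e by rewrite !divr_gt0.
have [k hk] : exists k : nat, K0 * lam ^+ k / (1 - lam) <= e.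
  have c1 : (fun k : nat => lam ^+ k) @ \oo --> (0 : R).
    by apply: cvg_expr; rewrite ger0_norm// lam_lt1.
  have K1 : 0 < K0 + 1 by rewrite ltr_wpDl.
  have e1 : 0 < e * (1 - lam) / (K0 + 1) by rewrite divr_gt0// mulr_gt0.
  move/cvgrPdist_lt : c1 => /(_ _ e1) [k _ /(_ k (leqnn k))].
  rewrite sub0r normrN ger0_norm ?exprn_ge0// ltr_pdivlMr// => hk.
  exists k; rewrite ler_pdivrMr//; apply: le_trans (ltW hk); rewrite mulrC.
  by apply: ler_wpM2l; rewrite ?exprn_ge0// lerDl.
have r0 : 0 < 2^-1 ^+ k :> R by rewrite exprn_gt0// invr_gt0.
have r01 : 0 < (2^-1 ^+ k : R) <= 1.
  by rewrite r0 exprn_ile1 ?invr_ge0// invf_le1// ler1n.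
have [L L0 hL] := tst_lip (tst_rho (n := n) r0 0).
pose D := M * L * 6 ^+ n.
have D0 : 0 <= D by rewrite !mulr_ge0 ?exprn_ge0.
have D1 : 0 < D + 1 by rewrite ltr_wpDl.
exists (Num.min 1 (e / (D + 1))); split; first by rewrite lt_min ltr01 divr_gt0.
move=> f Df cf fM mD wD ND x y; rewrite lt_min => /andP[xy1 xy2].
have h1 := avgV_lim cf fM mD wD ND k x.
have h2 := avgV_lim cf fM mD wD ND k y.
have h3 := avgV_lip cf fM r01 L0 hL (ltW xy1).
have h3' : `|avgV f (2^-1 ^+ k) 0 x - avgV f (2^-1 ^+ k) 0 y| <= e.
  apply: le_trans h3 _; rewrite -/D; apply: (@le_trans _ _ (D * (e / (D + 1)))).
    by apply: ler_wpM2l => //; exact: ltW.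
  by rewrite mulrCA ger_pMr// ler_pdivrMr// mul1r lerDl.
have h4 : c0 * `|f x - f y| <= e + e + e.
  rewrite -[c0]gtr0_norm// -normrM mulrBr.
  apply: le_trans (ler_distD (avgV f (2^-1 ^+ k) 0 x) _ _) _.
  rewrite -addrA; apply: lerD; first by rewrite distrC; exact: le_trans h1 hk.
  apply: le_trans (ler_distD (avgV f (2^-1 ^+ k) 0 y) _ _) _.
  by apply: lerD => //; exact: le_trans h2 hk.
have ei : e * 4 = c0 / i.+1%:R by rewrite /e divfK.
rewrite -(ler_pM2l c00) -ei; apply: le_trans h4 _.
have ar (t : R) : 0 < t -> t + t + t <= t * 4 by move=> t0; lra.
exact: ar.
Qed.

End morrey.

(** Decay and a modulus of continuity, with no derivative left: membership is a condition on pairs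
    of values, hence stable under limits of samples. [gam i] is a radius within which the
    oscillation is at most 1 / (i + 1). *)
Definition potentials (R : realType) (n : nat) (b : R) (gam : nat -> R) : set ('rV[R]_n -> R) :=
  [set f | (forall x, `|f x| <= b * (1 + sqnorm2 x) `^ (- 2^-1)) /\
           forall i x y, `|x - y| < gam i -> `|f x - f y| <= i.+1%:R^-1].

Lemma Omega_pM_potentials (R : realType) (n : nat) (p M : R) : (0 < n)%N -> n%:R < p -> 0 <= M ->
  exists gam : nat -> R, (forall i, 0 < gam i) /\ Omega_pM (d := n) p M `<=` potentials M gam.
Proof.
move=> n0 np M0; have [B B1 hB] := @dtheta_bound R.
have p0 : 0 < p by apply: le_lt_trans np.
have [gam [g0 hg]] := morrey_equicontinuity n0 np M0 hB.
exists gam; split=> // f [cf [Df [hD hN]] fM]; split=> //.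
apply: (hg f Df) => //.
- move=> x; apply: le_trans (fM x) _; rewrite -[leRHS]mulr1; apply: ler_wpM2l => //.
  exact: decay_le1.
- by move=> i; exact: (hD i).1.
- by move=> i; exact: (hD i).2.
- by move=> i; exact: W1p_norm_partial hN.
Qed.

(** * A machine reading a table *)

Section digit_expansion.
Context {R : realType}.
Variable D : nat -> nat.
Hypothesis D3 : forall p, (D p <= 3)%N.

Let S (p k : nat) : R := \sum_(q < k) (D (p + q))%:R * 10^-1 ^+ q.+1.

Let S_S p k : S p k.+1 = ((D p)%:R + S p.+1 k) / 10.
Proof.
rewrite /S big_ord_recl addn0 expr1 [RHS]mulrDl; congr (_ + _).
rewrite mulr_suml; apply: eq_bigr => q _; by rewrite lift0 addnS addSn exprSr mulrA.
Qed.

Let S_bound p k : 0 <= S p k <= 3^-1.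
Proof.
elim: k p => [|k IH] p; first by rewrite /S big_ord0 lexx invr_ge0 ler0n.
rewrite S_S; have /andP[h1 h2] := IH p.+1.
have : (D p)%:R <= 3 :> R by rewrite ler_nat.
have : 0 <= (D p)%:R :> R by [].
by move: (D p)%:R (S p.+1 k) h1 h2 => a b h1 h2 h3 h4; apply/andP; split; lra.
Qed.

Let S_cvg p : cvgn (S p).
Proof.
apply: nondecreasing_is_cvgn.
  apply/nondecreasing_seqP => k; rewrite /S big_ord_recr /= lerDl.
  by rewrite mulr_ge0// exprn_ge0.
by exists 3^-1 => _ [k _ <-]; case/andP: (S_bound p k).
Qed.

(** The decimal fraction 0.D(p)D(p+1)... Digits of at most 3 keep every tail at most 1/3, so
    comparisons with 1 read off the leading digit exactly, without the ambiguity of repeating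
    nines. *)
Definition dexp (p : nat) : R := limn (S p).

Lemma dexp_bound p : 0 <= dexp p <= 3^-1.
Proof.
apply/andP; split.
  by apply: limr_ge; [exact: S_cvg|apply: nearW => k; case/andP: (S_bound p k)].
by apply: limr_le; [exact: S_cvg|apply: nearW => k; case/andP: (S_bound p k)].
Qed.

Lemma dexp_rec p : 10 * dexp p = (D p)%:R + dexp p.+1.
Proof.
suff -> : dexp p = ((D p)%:R + dexp p.+1) / 10 by rewrite mulrC divfK.
apply: cvg_lim => //; rewrite -cvg_shiftS.
have -> : (fun k => S p k.+1) = (fun k => ((D p)%:R + S p.+1 k) / 10).
  by apply/funext => k; exact: S_S.
by apply: cvgMl; apply: cvgD; [exact: cvg_cst|exact: S_cvg].
Qed.

End digit_expansion.

(** An injection rather than a bijection, chosen because the machine evaluates it with two additions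
    and one multiplication. *)
Definition npair (s c : nat) : nat := ((s + c) ^ 2 + s)%N.

Lemma npair_inj s c s' c' : npair s c = npair s' c' -> s = s' /\ c = c'.
Proof.
rewrite /npair => E.
have h (u v a b : nat) : (u < v)%N -> (a <= u)%N -> (u ^ 2 + a < v ^ 2 + b)%N.
  move=> uv au; apply: leq_trans (leq_addr _ _).
  apply: (@leq_trans (u.+1 ^ 2)%N); last by rewrite leq_exp2r.
  rewrite -!mulnn; nia.
have uv : (s + c = s' + c')%N.
  case: (ltngtP (s + c) (s' + c'))%N => // uv.
    by have := h _ _ s s' uv (leq_addr _ _); rewrite E ltnn.
  by have := h _ _ s' s uv (leq_addr _ _); rewrite E ltnn.
rewrite uv in E; have ss : s = s' by lia.
by split=> //; lia.
Qed.

Section commands.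

(* The commands read off the table; 3, which stops the machine, does not occur here. *)
Definition cstep (st : int * seq int) (c : nat) : int * seq int :=
  match c with
  | 0%N => (st.1 + 1, st.2)
  | 1%N => (st.1 - 1, st.2)
  | _ => (st.1, st.1 :: st.2)
  end.

Lemma cstep_inc k st : foldl cstep st (nseq k 0%N) = (st.1 + k%:Z, st.2).
Proof.
elim: k st => [|k IH] st /=; first by rewrite addr0; case: st.
by rewrite IH /= -addrA; congr (_ + _, _); lia.
Qed.

Lemma cstep_dec k st : foldl cstep st (nseq k 1%N) = (st.1 - k%:Z, st.2).
Proof.
elim: k st => [|k IH] st /=; first by rewrite subr0; case: st.
by rewrite IH /= -addrA; congr (_ + _, _); lia.
Qed.

(** The list is produced from its last entry to its first, since command 2 pushes in front, as
    [ShiftR] does on the tape. *)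
Lemma cstep_compile (l : seq int) : exists cs : seq nat,
  all (fun c => (c <= 2)%N) cs /\ (foldl cstep (0, [::]) cs).2 = l.
Proof.
elim: l => [|a l [cs [h1 h2]]]; first by exists [::].
pose z := (foldl cstep (0, [::]) cs).1.
have E : foldl cstep (0, [::]) cs = (z, l) by rewrite -h2 /z; case: foldl.
exists (cs ++ (nseq (absz (a - z)) (if (0 <= a - z)%R then 0%N else 1%N) ++ [:: 2%N])); split.
  by rewrite !all_cat h1 all_nseq /= andbT; case: ifP => _; rewrite orbT.
rewrite !foldl_cat E; case: ifP => az.
  by rewrite cstep_inc /=; congr (_ :: _); lia.
by rewrite cstep_dec /=; congr (_ :: _); lia.
Qed.

End commands.

Section machine.
Context {R : realType}.
Variables (D : nat -> nat) (O : nat -> R[i]).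
Hypothesis D3 : forall p, (D p <= 3)%N.

(** [Negz k] is the cell of index -(k+1), so [rIm] follows [rRe], as [Query] demands. [rCur] holds
    the current entry in steps of 1/n. [rCnt] grows by 1/2 with each cell pushed, because the output
    announces the number of complex entries. *)
Local Notation rN := (Negz 0).
Local Notation rK := (Negz 1).
Local Notation rS := (Negz 2).
Local Notation rY := (Negz 3).
Local Notation rC := (Negz 4).
Local Notation rIm := (Negz 5).
Local Notation rRe := (Negz 6).
Local Notation rOne := (Negz 7).
Local Notation rCur := (Negz 8).
Local Notation rCnt := (Negz 9).
Local Notation rInv := (Negz 10).
Local Notation rT := (Negz 11).

(* The cells of negative index are registers, which 59-76 protect from [ShiftR].
   6-24 fold the codes of the n samples into rS by [npair]; from 31 on, the digit of
   index [npair N j] of the constant [dexp D 0] is the j-th command to be executed. *)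
Definition program : seq (instr (R := R)) :=
  [:: Const rOne 1; Const rT 0; Op Defs.Add rN (Posz 0) rT; Op Defs.Div rInv rOne rN; Op Defs.Add rS (Posz 0) rT; Const rK 0;
  (* 6 *) Op Defs.Sub rT rN rK; Op Defs.Sub rT rT rOne; Branch rT 10; Branch rOne 25;
  (* 10 *) Query rK rRe; Op Defs.Mul rY rN rRe; Op Defs.Mul rT rN rN; Op Defs.Add rY rY rT; Const rC 0;
  (* 15 *) Branch rY 17; Branch rOne 20; Op Defs.Sub rY rY rOne; Op Defs.Add rC rC rOne; Branch rOne 15;
  (* 20 *) Op Defs.Add rT rS rC; Op Defs.Mul rT rT rT; Op Defs.Add rS rS rT; Op Defs.Add rK rK rOne; Branch rOne 6;
  (* 25 *) Op Defs.Add rT rS rN; Op Defs.Mul rT rT rT; Op Defs.Add rS rS rT; Const rK 0; Const rCur 0; Const rCnt 0;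
  (* 31 *) Op Defs.Add rC rS rK; Op Defs.Mul rC rC rC; Op Defs.Add rC rC rS; Const rY (dexp D 0);
  (* 35 *) Op Defs.Sub rT rC rOne; Branch rT 38; Branch rOne 46;
  (* 38 *) Op Defs.Sub rC rC rOne; Const rT 10; Op Defs.Mul rY rY rT;
  (* 41 *) Op Defs.Sub rT rY rOne; Branch rT 44; Branch rOne 35; Op Defs.Sub rY rY rOne; Branch rOne 41;
  (* 46 *) Const rT 10; Op Defs.Mul rY rY rT; Op Defs.Add rK rK rOne; Op Defs.Sub rY rY rOne; Branch rY 53;
  (* 51 *) Op Defs.Add rCur rCur rInv; Branch rOne 31;
  (* 53 *) Op Defs.Sub rY rY rOne; Branch rY 57; Op Defs.Sub rCur rCur rInv; Branch rOne 31;
  (* 57 *) Op Defs.Sub rY rY rOne; Branch rY 77; ShiftR;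
  (* 60 *) Const rInv 0; Op Defs.Add rInv rCnt rInv; Const rCnt 0; Op Defs.Add rCnt rCur rCnt; Const rCur 0; Op Defs.Add rCur rOne rCur;
  (* 66 *) Const rOne 0; Op Defs.Add rOne rRe rOne; Const rS 0; Op Defs.Add rS rK rS; Const rK 0; Op Defs.Add rK rN rK;
  (* 72 *) Const (Posz 1) 0; Op Defs.Add (Posz 1) rCur (Posz 1); Const rT 2^-1; Op Defs.Add rCnt rCnt rT; Branch rOne 31;
  (* 77 *) Const (Posz 0) 0; Op Defs.Add (Posz 0) (Posz 0) rCnt; Halt].

Definition reach (c c' : config) := exists t, iter t (obind (step O program)) (Some c) = Some c'.

Lemma reach_refl c : reach c c. Proof. by exists 0%N. Qed.

Lemma reach_trans c1 c2 c3 : reach c1 c2 -> reach c2 c3 -> reach c1 c3.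
Proof. by move=> [t1 h1] [t2 h2]; exists (t2 + t1)%N; rewrite iterD h1. Qed.

Lemma reach_step c c1 c2 : step O program c = Some c1 -> reach c1 c2 -> reach c c2.
Proof. by move=> h1 [t h2]; exists t.+1; rewrite iterSr /= h1. Qed.

Lemma reach_yes pc i l (x : tape) c : nth Halt program pc = Branch i l -> 0 <= x i ->
  reach (l, x) c -> reach (pc, x) c.
Proof. by move=> E xi; apply: reach_step; rewrite /step E xi. Qed.

Lemma reach_no pc i l (x : tape) c : nth Halt program pc = Branch i l -> x i < 0 ->
  reach (pc.+1, x) c -> reach (pc, x) c.
Proof. by move=> E xi; apply: reach_step; rewrite /step E leNgt xi. Qed.

Lemma reach_div pc i j k (x : tape) c : nth Halt program pc = Op Defs.Div i j k -> x k != 0 ->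
  reach (pc.+1, set_cell x i (x j / x k)) c -> reach (pc, x) c.
Proof. by move=> E xk; apply: reach_step; rewrite /step E (negbTE xk). Qed.

Lemma reach_query pc i j k (x : tape) c : nth Halt program pc = Query i j -> x i = k%:R ->
  reach (pc.+1, set_cell (set_cell x j (Re (O k))) (j + 1) (Im (O k))) c -> reach (pc, x) c.
Proof. by move=> E xk; apply: reach_step; rewrite /step E xk natr_nat natrK. Qed.

Ltac b_yes := (eapply reach_yes; [reflexivity| |]).
Ltac b_no := (eapply reach_no; [reflexivity| |]).
Ltac b_div := (eapply reach_div; [reflexivity| |]).
Ltac go := (eapply reach_step; [reflexivity|]).

Implicit Types (x : @tape R) (n k c : nat).

Definition base x n := [/\ x rN = n%:R, x rOne = 1 & x rInv = n%:R^-1].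

Lemma start n : (0 < n)%N -> exists x, [/\ reach (init n) (6%N, x),
  base x n, x rK = 0%:R & x rS = n%:R].
Proof.
move=> n0; eexists; split.
  do 3!go.
  b_div; first by rewrite /set_cell /= addr0 pnatr_eq0 gt_eqF.
  do 2!go; exact: reach_refl.
all: rewrite /base /set_cell /= ?addr0 ?div1r; by [].
Qed.

(* [c] is the number of iterations of [y := y - 1] performed while [0 <= y]. *)
Definition counts (y : R) c := y < c%:R /\ ((0 < c)%N -> c%:R - 1 <= y).

Lemma count_loop c x : x rOne = 1 -> counts (x rY) c ->
  exists x', [/\ reach (15%N, x) (20%N, x'), x' rC = x rC + c%:R &
    forall i, i != rY -> i != rC -> x' i = x i].
Proof.
elim: c x => [|c IH] x x1 [h1 h2].
  exists x; rewrite addr0; split=> //.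
  b_no => //; b_yes; first by rewrite x1.
  exact: reach_refl.
have y0 : 0 <= x rY by apply: le_trans (h2 isT); rewrite -natr1 addrK.
pose x1' : tape := set_cell (set_cell x rY (x rY - x rOne)) rC (x rC + x rOne).
have [||x' [r1 r2 r3]] := IH x1'.
- by rewrite /x1' /set_cell /=.
- rewrite /x1' /set_cell /= x1; split; first by rewrite ltrBlDr natr1.
  by move=> c0; rewrite lerB// -[c%:R](addrK 1) natr1; exact: h2.
exists x'; split.
- b_yes => //; do 2!go.
  by b_yes; first by rewrite /set_cell /= x1.
- by rewrite r2 /x1' /set_cell /= x1 -natr1; ring.
- by move=> i i1 i2; rewrite r3// /x1' /set_cell (negbTE i1) (negbTE i2).
Qed.

Lemma query_step n k s c x : base x n -> x rK = k%:R -> x rS = s%:R -> (k < n)%N ->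
  counts (n%:R * Re (O k) + n%:R * n%:R) c ->
  exists x', [/\ reach (6%N, x) (6%N, x'), base x' n, x' rK = k.+1%:R & x' rS = (npair s c)%:R].
Proof.
move=> [bN b1 bI] hk hs kn hc.
pose x1 : tape := set_cell (set_cell x rT (x rN - x rK)) rT (x rN - x rK - x rOne).
pose x2 : tape := set_cell (set_cell x1 rRe (Re (O k))) rIm (Im (O k)).
pose x3 : tape := set_cell (set_cell (set_cell (set_cell x2 rY (x rN * Re (O k))) rT (x rN * x rN)) rY
  (x rN * Re (O k) + x rN * x rN)) rC 0.
have [||x4 [r1 r2 r3]] := @count_loop c x3.
- by rewrite /x3 /x2 /x1 /set_cell /=.
- by rewrite /x3 /x2 /x1 /set_cell /= bN.
have r4 i : i != rY -> i != rC -> i != rT -> i != rRe -> i != rIm -> x4 i = x i.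
  move=> i1 i2 i3 i4 i5; rewrite r3// /x3 /x2 /x1 /set_cell.
  by rewrite (negbTE i1) (negbTE i2) (negbTE i3) (negbTE i4) (negbTE i5).
have r5 : reach (6%N, x) (20%N, x4).
  apply: reach_trans r1; do 2!go; b_yes.
    by rewrite /set_cell /= bN b1 hk subr_ge0 -natrB ?(ltnW kn)// ler1n subn_gt0.
  (eapply (reach_query (k := k)); [reflexivity| |]); first by rewrite /set_cell /=.
  by do 4!go; exact: reach_refl.
eexists; split.
- apply: reach_trans r5 _; do 4!go.
  by b_yes; [rewrite /set_cell /= r4// b1|exact: reach_refl].
- by rewrite /base /set_cell /= !r4.
- by rewrite /set_cell /= !r4// hk b1 natr1.
- rewrite /set_cell /= r2 !r4// hs /x3 /set_cell /= add0r.
  by rewrite /npair natrD natrX natrD expr2 addrC.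
Qed.

Lemma query_loop n (cs : seq nat) s k x : base x n -> x rK = k%:R -> x rS = s%:R ->
  (k + size cs)%N = n -> (forall i, (i < size cs)%N ->
    counts (n%:R * Re (O (k + i)%N) + n%:R * n%:R) (nth 0%N cs i)) ->
  exists x', [/\ reach (6%N, x) (25%N, x'), base x' n & x' rS = (foldl npair s cs)%:R].
Proof.
elim: cs s k x => [|c cs IH] s k x bx hk hs /= kn hc.
  have [bN b1 bI] := bx.
  eexists; split.
  - do 2!go; b_no.
      by rewrite /set_cell /= bN b1 hk -kn addn0 subrr sub0r oppr_lt0.
    b_yes; first by rewrite /set_cell /= b1.
    exact: reach_refl.
  - by rewrite /base /set_cell /=.
  - by rewrite /set_cell /=.
have kn' : (k < n)%N by rewrite -kn addnS ltnS leq_addr.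
have := hc 0%N isT; rewrite addn0 => /(query_step bx hk hs kn')[x1 [r1 b1 hk1 hs1]].
have [||x2 [r2 b2 hs2]] := IH (npair s c) k.+1 x1 b1 hk1 hs1.
- by rewrite addSnnS.
- by move=> i ic; rewrite addSnnS; exact: hc i.+1 ic.
by exists x2; split=> //; exact: reach_trans r2.
Qed.

Lemma phase2 n s x : base x n -> x rS = s%:R ->
  exists x', [/\ reach (25%N, x) (31%N, x'), base x' n, x' rS = (npair s n)%:R, x' rK = 0%:R &
    x' rCur = 0 /\ x' rCnt = 0].
Proof.
move=> [bN b1 bI] hs; eexists; split.
- by do 6!go; exact: reach_refl.
- by rewrite /base /set_cell /=.
- by rewrite /set_cell /= hs bN /npair natrD natrX natrD expr2 addrC.
- by rewrite /set_cell /=.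
- by rewrite /set_cell /=.
Qed.

(** With r in [0, 1) the subtraction of 1 can be repeated exactly dg times. *)
Lemma digit_loop (dg : nat) (r : R) x : x rOne = 1 -> x rY = dg%:R + r -> 0 <= r < 1 ->
  exists x', [/\ reach (41%N, x) (35%N, x'), x' rY = r & forall i, i != rY -> i != rT -> x' i = x i].
Proof.
move=> + + /andP[r0 r1]; elim: dg x => [|dg IH] x x1 hy.
  eexists; split.
  - go; b_no; first by rewrite /set_cell /= x1 hy add0r subr_lt0.
    b_yes; first by rewrite /set_cell /= x1.
    exact: reach_refl.
  - by rewrite /set_cell /= hy add0r.
  - by move=> i i1 i2; rewrite /set_cell (negbTE i2).
pose x' : tape := set_cell (set_cell x rT (x rY - x rOne)) rY (x rY - x rOne).
have [||x2 [r2 h2 h3]] := IH x'.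
- by rewrite /x' /set_cell /=.
- by rewrite /x' /set_cell /= x1 hy -natr1; ring.
exists x2; split=> //.
- go; b_yes.
    by rewrite /set_cell /= x1 hy -natr1 addrAC addrK addr_ge0.
  go; b_yes; first by rewrite /set_cell /= x1.
  exact: r2.
- by move=> i i1 i2; rewrite h3// /x' /set_cell (negbTE i1) (negbTE i2).
Qed.

Lemma skip_loop (q p : nat) x : x rOne = 1 -> x rC = p%:R -> x rY = dexp D q ->
  exists x', [/\ reach (35%N, x) (46%N, x'), x' rY = dexp D (q + p) &
    forall i, i != rY -> i != rC -> i != rT -> x' i = x i].
Proof.
elim: p q x => [|p IH] q x x1 hc hy.
  eexists; split.
  - go; b_no; first by rewrite /set_cell /= x1 hc sub0r oppr_lt0.
    b_yes; first by rewrite /set_cell /= x1.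
    exact: reach_refl.
  - by rewrite /set_cell /= hy addn0.
  - by move=> i i1 i2 i3; rewrite /set_cell (negbTE i3).
pose x' : tape := set_cell (set_cell (set_cell (set_cell x rT (x rC - x rOne)) rC (x rC - x rOne)) rT 10)
  rY (x rY * 10).
have [|||x2 [r2 h2 h3]] := @digit_loop (D q) (dexp D q.+1) x'.
- by rewrite /x' /set_cell /=.
- by rewrite /x' /set_cell /= hy mulrC dexp_rec.
- by have /andP[a b] := @dexp_bound R D D3 q.+1; rewrite a /=; apply: le_lt_trans b _; lra.
have [|||x3 [r3 h4 h5]] := IH q.+1 x2.
- by rewrite h3// /x' /set_cell /=.
- by rewrite h3// /x' /set_cell /= hc x1 -natr1 addrK.
- exact: h2.
exists x3; split.
- go; b_yes.
    by rewrite /set_cell /= x1 hc -natr1 addrK.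
  do 3!go; apply: reach_trans r3; exact: r2.
- by rewrite h4 addSnnS.
- by move=> i i1 i2 i3; rewrite h5// h3// /x' /set_cell (negbTE i1) (negbTE i2) (negbTE i3).
Qed.

Lemma read_digit (N j : nat) x : x rOne = 1 -> x rS = N%:R -> x rK = j%:R ->
  exists x', [/\ reach (31%N, x) (49%N, x'),
    x' rY = (D (npair N j))%:R + dexp D (npair N j).+1, x' rK = j.+1%:R &
    forall i, i != rY -> i != rC -> i != rT -> i != rK -> x' i = x i].
Proof.
move=> x1 hs hk.
pose x' : tape := set_cell (set_cell (set_cell (set_cell x rC (x rS + x rK)) rC ((x rS + x rK) * (x rS + x rK)))
  rC ((x rS + x rK) * (x rS + x rK) + x rS)) rY (dexp D 0).
have [|||x2 [r2 h2 h3]] := @skip_loop 0 (npair N j) x'.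
- by rewrite /x' /set_cell /=.
- by rewrite /x' /set_cell /= hs hk /npair natrD natrX natrD expr2.
- by rewrite /x' /set_cell /=.
eexists; split.
- do 4!go; apply: reach_trans; first exact: r2.
  by do 3!go; exact: reach_refl.
- by rewrite /set_cell /= h2 add0n mulrC dexp_rec.
- by rewrite /set_cell /= !h3// /x' /set_cell /= hk x1 natr1.
- move=> i i1 i2 i3 i4; rewrite /set_cell (negbTE i1) (negbTE i3) (negbTE i4).
  by rewrite h3// /x' /set_cell (negbTE i1) (negbTE i2).
Qed.

(** What remains of [base] once a push has displaced [rN]. *)
Definition base2 x n := x rOne = 1 /\ x rInv = n%:R^-1.

Definition output_inv n x (st : int * seq int) :=
  [/\ x rCur = st.1%:~R * n%:R^-1, x rCnt = (size st.2)%:R / 2 &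
      forall k, (k < size st.2)%N -> x (Posz k.+1) = (nth 0 st.2 k)%:~R * n%:R^-1].

(** A copy is made of two instructions: clear the target, then add the source to it. *)
Lemma reach_copy pc i j v x (c : config) : nth Halt program pc = Const i 0 ->
  nth Halt program pc.+1 = Op Defs.Add i j i -> j != i -> x j = v ->
  reach (pc.+2, set_cell x i v) c -> reach (pc, x) c.
Proof.
move=> E1 E2 ji <- h; apply: reach_step; first by rewrite /step E1.
apply: reach_step h; rewrite /step E2; congr (Some (_, _)); apply/funext => l.
by rewrite /set_cell eqxx (negbTE ji) addr0; case: eqP.
Qed.

Ltac cp v := (eapply (reach_copy (v := v)); [reflexivity|reflexivity|by []|by []|]).

(** After [ShiftR] each register is found in its right neighbour; restoring from the left end
    upwards never overwrites a value still to be read. The old [rN] leaves the registers for cell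
    0. *)
Lemma push_step x : x rOne = 1 -> exists x', [/\ reach (59%N, x) (31%N, x'),
  x' rCnt = x rCnt + 2^-1, x' (Posz 1) = x rCur, forall k, x' (Posz k.+2) = x (Posz k.+1) &
  forall i, i \in [:: rK; rS; rOne; rCur; rInv] -> x' i = x i].
Proof.
move=> b1; pose z : tape := fun j => x (j - 1).
pose x1 : tape := set_cell (set_cell (set_cell (set_cell (set_cell (set_cell z
  rInv (x rInv)) rCnt (x rCnt)) rCur (x rCur)) rOne (x rOne)) rS (x rS)) rK (x rK).
have h1 : reach (59%N, x) (72%N, x1).
  go; cp (x rInv); cp (x rCnt); cp (x rCur); cp (x rOne); cp (x rS); cp (x rK).
  exact: reach_refl.
have e1 : x1 rOne = 1 by rewrite -b1.
have e2 : x1 rCur = x rCur by [].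
have e3 : x1 rCnt = x rCnt by [].
have e4 i : i \in [:: rK; rS; rOne; rCur; rInv] -> x1 i = x i.
  by rewrite !inE => /orP[|/orP[|/orP[|/orP[]]]] /eqP ->.
have e5 k : x1 (Posz k.+2) = x (Posz k.+1).
  have -> : x1 (Posz k.+2) = x (Posz k.+2 - 1)%R by [].
  by congr x; lia.
move: x1 h1 e1 e2 e3 e4 e5 => x1 h1 e1 e2 e3 e4 e5.
eexists; split.
- apply: reach_trans h1 _; cp (x rCur).
  do 2!go; b_yes; first by rewrite /set_cell /= e1.
  exact: reach_refl.
- by rewrite /set_cell /= e3.
- by rewrite /set_cell /=.
- by move=> k; rewrite /set_cell /=; exact: e5.
- move=> i hi; have ei := e4 i hi; move: hi ei.
  by rewrite /set_cell !inE => /orP[|/orP[|/orP[|/orP[]]]] /eqP ->.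
Qed.

Lemma command_step n (N j : nat) st x : base2 x n -> x rS = N%:R -> x rK = j%:R ->
  output_inv n x st -> (D (npair N j) <= 2)%N ->
  exists x', [/\ reach (31%N, x) (31%N, x'), base2 x' n, x' rS = N%:R, x' rK = j.+1%:R &
    output_inv n x' (cstep st (D (npair N j)))].
Proof.
move=> [b1 bI] hs hk [u1 u2 u3] d2.
have [x1 [r1 h1 h2 h3]] := read_digit b1 hs hk.
have /andP[e0 e1] := @dexp_bound R D D3 (npair N j).+1.
have e2 : dexp D (npair N j).+1 < 1 :> R by apply: le_lt_trans e1 _; lra.
move: {e1} (D (npair N j)) (dexp D (npair N j).+1) d2 h1 e0 e2 => dg e.
case: dg => [|[|[|//]]] _ h1 e0 e1.
- eexists; split.
  + apply: reach_trans r1 _; go; b_no.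
      by rewrite /set_cell /= h1 h3// b1 add0r subr_lt0.
    go; b_yes; first by rewrite /set_cell /= h3// b1.
    exact: reach_refl.
  + by rewrite /base2 /set_cell /= !h3.
  + by rewrite /set_cell /= h3.
  + by rewrite /set_cell /=.
  + split.
    * by rewrite /set_cell /= !h3// u1 bI rmorphD /= mulrDl mul1r.
    * by rewrite /set_cell /= h3.
    * by move=> k hk'; rewrite /set_cell /= h3// u3.
- eexists; split.
  + apply: reach_trans r1 _; go; b_yes.
      by rewrite /set_cell /= h1 h3// b1 addrAC subrr add0r.
    go; b_no.
      by rewrite /set_cell /= h1 !h3// b1; lra.
    go; b_yes; first by rewrite /set_cell /= h3// b1.
    exact: reach_refl.
  + by rewrite /base2 /set_cell /= !h3.
  + by rewrite /set_cell /= h3.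
  + by rewrite /set_cell /=.
  + split.
    * by rewrite /set_cell /= !h3// u1 bI rmorphB /= mulrBl mul1r.
    * by rewrite /set_cell /= h3.
    * by move=> k hk'; rewrite /set_cell /= h3// u3.
- pose y : tape := set_cell x1 rY (x1 rY - 3).
  have r2 : reach (49%N, x1) (59%N, y).
    go; b_yes; first by rewrite /set_cell /= h1 h3// b1; lra.
    go; b_yes; first by rewrite /set_cell /= h1 !h3// b1; lra.
    go; b_no; first by rewrite /set_cell /= h1 !h3// b1; lra.
    have -> : y = set_cell (set_cell (set_cell x1 rY (x1 rY - x1 rOne)) rY (x1 rY - x1 rOne - x1 rOne)) rY
       (x1 rY - x1 rOne - x1 rOne - x1 rOne).
      have hx : x1 rOne = 1 by rewrite h3.
      apply/funext => i; rewrite /y /set_cell hx; case: eqP => // _; ring.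
    exact: reach_refl.
  have y3 i : i != rY -> i != rC -> i != rT -> i != rK -> y i = x i.
    by move=> i1 *; rewrite /y /set_cell (negbTE i1) h3.
  have yK : y rK = j.+1%:R by rewrite /y /set_cell /=.
  have y1 : y rOne = 1 by rewrite y3.
  have [x2 [r3 c1 c2 c3 c4]] := push_step y1.
  exists x2; split.
  + exact: reach_trans r1 (reach_trans r2 r3).
  + by split; rewrite c4 ?y3.
  + by rewrite c4// y3.
  + by rewrite c4.
  + split.
    * by rewrite c4// y3.
    * by rewrite c1 y3// u2 /= -[in RHS]natr1 [RHS]mulrDl mul1r.
    * case=> [|k] hk'; first by rewrite c2 y3.
      by rewrite c3 y3// u3.
Qed.

Lemma command_loop n (N : nat) (cs : seq nat) j st x : base2 x n -> x rS = N%:R -> x rK = j%:R ->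
  output_inv n x st -> (forall i, (i < size cs)%N -> D (npair N (j + i)%N) = nth 0%N cs i) ->
  all (fun c => (c <= 2)%N) cs ->
  exists x', [/\ reach (31%N, x) (31%N, x'), base2 x' n, x' rS = N%:R, x' rK = (j + size cs)%:R &
    output_inv n x' (foldl cstep st cs)].
Proof.
elim: cs j st x => [|c cs IH] j st x bx hs hk ho hD /=.
  by move=> _; exists x; rewrite addn0; split=> //; exact: reach_refl.
move=> /andP[c2 hcs]; have := hD 0%N isT; rewrite addn0 /= => Dc.
have [|x1 [r1 b1 s1 k1 ou1]] := command_step bx hs hk ho; first by rewrite Dc.
rewrite Dc in ou1.
have [|//|x2 [r2 b2 s2 k2 ou2]] := IH j.+1 _ x1 b1 s1 k1 ou1.
  by move=> i ic; rewrite addSnnS; exact: hD i.+1 ic.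
exists x2; rewrite addnS -addSn; split=> //; exact: reach_trans r2.
Qed.

Lemma halt_step n (N j : nat) st x : base2 x n -> x rS = N%:R -> x rK = j%:R ->
  output_inv n x st -> D (npair N j) = 3%N ->
  exists x', [/\ reach (31%N, x) (79%N, x'), x' 0 = (size st.2)%:R / 2 &
    forall k, (k < size st.2)%N -> x' (Posz k.+1) = (nth 0 st.2 k)%:~R * n%:R^-1].
Proof.
move=> [b1 bI] hs hk [u1 u2 u3] d3.
have [x1 [r1 h1 h2 h3]] := read_digit b1 hs hk.
have /andP[e0 e1] := @dexp_bound R D D3 (npair N j).+1.
rewrite d3 in h1; move: (dexp D (npair N j).+1) h1 e0 e1 => e h1 e0 e1.
eexists; split.
- apply: reach_trans r1 _; go; b_yes.
    by rewrite /set_cell /= h1 h3// b1; lra.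
  go; b_yes.
    by rewrite /set_cell /= h1 !h3// b1; lra.
  go; b_yes.
    by rewrite /set_cell /= h1 !h3// b1; lra.
  by do 2!go; exact: reach_refl.
- by rewrite /set_cell /= h3// add0r u2.
- by move=> k hk'; rewrite /set_cell /= h3// u3.
Qed.

Fixpoint decode_string (l : seq int) (n : nat) : seq R[i] :=
  match l with
  | a :: b :: l' => (a%:~R / n%:R +i* (b%:~R / n%:R))%C :: decode_string l' n
  | _ => [::]
  end.

Lemma decode_spec (l : seq int) n s : size l = s.*2 -> size (decode_string l n) = s /\
  forall k, (k < s)%N -> nth 0 (decode_string l n) k =
    ((nth 0 l k.*2)%:~R / n%:R +i* ((nth 0 l k.*2.+1)%:~R / n%:R))%C.
Proof.
elim: s l => [|s IH] [|a [|b l]]//= [sl].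
have [h1 h2] := IH _ sl; rewrite h1; split=> // -[|k]//= ks.
by rewrite h2.
Qed.

(** Past the end of the commands the table must read 3, the stop command, which is therefore the
    default of [nth]. *)
Lemma program_correct n (cs0 : seq nat) (cs : seq nat) (l : seq int) s :
  (0 < n)%N -> size cs0 = n ->
  (forall i, (i < n)%N -> counts (n%:R * Re (O i) + n%:R * n%:R) (nth 0%N cs0 i)) ->
  all (fun c => (c <= 2)%N) cs -> (foldl cstep (0, [::]) cs).2 = l -> size l = s.*2 ->
  (forall j, D (npair (npair (foldl npair n cs0) n) j) = nth 3%N cs j) ->
  bss_outputs program O n (decode_string l n).
Proof.
move=> n0 sz hc hcs hl sl hD.
have [x1 [r1 b1 k1 s1]] := start n0.
have [||x2 [r2 b2 s2]] := query_loop b1 k1 s1 _ _ (cs := cs0).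
- by rewrite add0n.
- by move=> i; rewrite sz add0n; exact: hc.
have [x3 [r3 b3 s3 k3 [c3 t3]]] := phase2 b2 s2.
set N := npair (foldl npair n cs0) n in s3 hD.
have o3 : output_inv n x3 (0, [::]) by split=> //=; rewrite ?c3 ?t3 ?mul0r.
have b3' : base2 x3 n by case: b3.
have [|x4 [r4 b4 s4 k4 o4]] := command_loop b3' s3 k3 o3 _ hcs.
  by move=> i ic; rewrite add0n hD; exact: set_nth_default.
have [|x5 [[t ht] h1 h2]] := halt_step b4 s4 k4 o4.
  by rewrite add0n hD nth_default.
have [t' ht'] := reach_trans r1 (reach_trans r2 (reach_trans r3 (reach_trans r4 (ex_intro _ t ht)))).
exists t', 79%N, x5; split=> //.
have [d1 d2] := decode_spec n sl; rewrite hl in h1 h2.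
split; first by rewrite h1 d1 sl -muln2 natrM mulfK.
move=> k; rewrite d1 => ks; rewrite d2// !h2 ?sl ?ltn_Sdouble ?ltn_double//.
Qed.

End machine.

(** * Closed sets and output strings *)

Section closed_sets.
Context {R : realType}.
Implicit Types (A B : set R[i]) (z a : R[i]).

Lemma normc_eq0 z : (forall e : R, 0 < e -> normc z < e) -> z = 0.
Proof.
move=> h; apply: Normc.eq0_normc; apply/eqP; rewrite eq_le normc_ge0 andbT.
by apply/ler_addgt0Pr => e e0; rewrite add0r ltW// h.
Qed.

Lemma closedCP A : Defs.closedC A <->
  forall z, (forall e : R, 0 < e -> exists2 a, A a & normc (z - a) < e) -> A z.
Proof.
split=> [cA z h|h z cz].
  apply: cA => B /nbhs_ballP[e /= e0 zB].
  (* Radii of balls in R[i] are themselves complex; a positive one is real. *)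
  have eE : e = (Re e)%:C%C by move: e0; rewrite ltcE /= => /andP[/eqP h0 _]; apply: complex_ext.
  have e0' : 0 < Re e by move: e0; rewrite ltcE => /andP[].
  have [a Aa za] := h _ e0'; exists a; split=> //; apply: zB.
  by rewrite -ball_normE /= eE ltcR.
apply: h => e e0.
have e0' : 0 < (e%:C)%C :> (R[i])^o by rewrite ltcR.
have [a [Aa]] := cz _ (nbhsx_ballx (z : (R[i])^o) _ e0').
by rewrite -ball_normE /= ltcR => ?; exists a.
Qed.

Lemma closedCU A B : Defs.closedC A -> Defs.closedC B -> Defs.closedC (A `|` B).
Proof. exact: closedU. Qed.

Lemma closedC1 a : Defs.closedC [set a].
Proof.
apply/closedCP => z h; apply/eqP; rewrite -subr_eq0; apply/eqP; apply: normc_eq0 => e /h[b -> //].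
Qed.

(** The signs s = 1 and s = -1 give the two half-lines of an output. *)
Lemma closedC_ray (r s : R) : Defs.closedC [set z | Im z = 0 /\ 0 <= s * (Re z - r)].
Proof.
apply/closedCP => z h; split.
  apply/eqP; rewrite -normr_le0; apply/ler_addgt0Pr => e /h[a [a0 _] za].
  rewrite add0r; apply: le_trans (ltW za); apply: le_trans (ler_Im_normc _).
  by rewrite cImB a0 subr0.
apply/ler_addgt0Pr => e e0.
have s1 : 0 < `|s| + 1 by rewrite ltr_wpDl.
have [a [_ a0] za] := h _ (divr_gt0 e0 s1).
have h1 : `|Re z - Re a| <= e / (`|s| + 1).
  by apply: le_trans (ltW za); apply: le_trans (ler_Re_normc _); rewrite cReB.
have h2 : `|s * (Re z - Re a)| <= e.
  rewrite normrM; apply: (@le_trans _ _ (`|s| * (e / (`|s| + 1)))); first exact: ler_wpM2l.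
  by rewrite mulrCA ger_pMr// ler_pdivrMr// mul1r lerDl.
have := ler_norm (- (s * (Re z - Re a))); rewrite normrN => h3.
have -> : s * (Re z - r) + e = s * (Re a - r) + (s * (Re z - Re a) + e) by ring.
by rewrite addr_ge0// -lerBlDr sub0r lerNl; exact: (le_trans h3 h2).
Qed.

Lemma dH_le A B (e : R) : 0 <= e ->
  (forall a, A a -> exists2 b, B b & normc (a - b) <= e) ->
  (forall b, B b -> exists2 a, A a & normc (b - a) <= e) -> (dH A B <= e%:E)%E.
Proof.
move=> e0 hA hB; apply: ge_ereal_sup => _ [[->|[a Aa <-]]|[b Bb <-]].
- by rewrite lee_fin.
- have [b Bb ab] := hA a Aa; apply: (@le_trans _ _ (normc (a - b))%:E); last by rewrite lee_fin.
  by apply: ereal_inf_lbound; exists b.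
- have [a Aa ab] := hB b Bb; apply: (@le_trans _ _ (normc (b - a))%:E); last by rewrite lee_fin.
  by apply: ereal_inf_lbound; exists a.
Qed.

Lemma dH_ge0 A B : (0 <= dH A B)%E.
Proof. by apply: ereal_sup_ubound; left; left. Qed.

Lemma dH_cvg0 (A : nat -> set R[i]) B :
  (forall e : R, 0 < e -> \forall n \near \oo, (dH (A n) B <= e%:E)%E) ->
  (fun n => dH (A n) B) @ \oo --> 0%E.
Proof.
move=> h; apply/fine_cvgP; split.
  apply: filterS (h 1 ltr01) => n h1; rewrite ge0_fin_numE ?dH_ge0//.
  exact: le_lt_trans h1 (ltry _).
apply/cvgrPdist_le => e e0; apply: filterS (h e e0) => n h1 /=.
have fn : dH (A n) B \is a fin_num.
  by rewrite ge0_fin_numE ?dH_ge0//; exact: le_lt_trans h1 (ltry _).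
by rewrite sub0r normrN ger0_norm ?fine_ge0 ?dH_ge0// -lee_fin fineK.
Qed.

Definition gridpt (n : nat) (p : int * int) : R[i] := (p.1%:~R / n%:R +i* (p.2%:~R / n%:R))%C.

(* Scaled by n: points of the form (a, 0), and the half-lines issued from r and -r,
   in the pairing used by [closed_set_of]. *)
Definition outstring (n r : nat) (pts : seq (int * int)) : seq int :=
  flatten [seq [:: p.1; p.2; 0; 0] | p <- pts] ++
  [:: (n * r)%:Z; 0; n%:Z; 0; - (n * r)%:Z; 0; - n%:Z; 0].

Lemma size_outstring n r pts : size (outstring n r pts) = (((size pts) + 2).*2).*2.
Proof.
rewrite /outstring size_cat; elim: pts => //= p pts IH.
by move: IH; lia.
Qed.

Lemma closed_set_of_outstring n r pts : (0 < n)%N ->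
  closed_set_of (decode_string (R := R) (outstring n r pts) n) =
  [set z | (exists2 p, p \in pts & z = gridpt n p) \/
     (Im z = 0 /\ 0 <= 1 * (Re z - r%:R)) \/ (Im z = 0 /\ 0 <= (-1) * (Re z - - r%:R))].
Proof.
move=> n0; have nn : n%:R != 0 :> R by rewrite pnatr_eq0 -lt0n.
have c1 : (n%:Z)%:~R / n%:R = 1 :> R by rewrite -pmulrn divff.
have cr : ((n * r)%:Z)%:~R / n%:R = r%:R :> R by rewrite -pmulrn natrM mulrAC divff// mul1r.
elim: pts => [|p pts IH]; last first.
  rewrite /outstring /= -/(outstring n r pts) IH; apply/seteqP; split=> z /=.
    move=> [[t t0 ->]|[[p' hp' ->]|h]].
    - by left; exists p; [rewrite inE eqxx|rewrite !mul0r -/(gridpt n p); apply: complex_ext; rewrite ?cReD ?cImD ?cReM ?cImM /=; ring].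
    - by left; exists p' => //; rewrite inE hp' orbT.
    - by right.
  move=> [[p']|h]; last by right; right.
  rewrite inE => /orP[/eqP -> ->|hp' ->]; last by right; left; exists p'.
  left; exists 0 => //.
  by rewrite !mul0r; apply: complex_ext; rewrite ?cReD ?cImD ?cReM ?cImM /=; ring.
rewrite /outstring /= !mul0r; apply/seteqP; split=> z /=.
  move=> [[t t0 ->]|[[t t0 ->]|//]]; right; [left|right]; rewrite ?cReD ?cImD ?cReM ?cImM /=.
    by rewrite cr c1; split; [ring|]; have -> : 1 * (r%:R + (t * 1 - 0 * 0) - r%:R) = t by ring.
  rewrite !rmorphN /= !mulNr cr c1; split; first by ring.
  by rewrite mul1r; have -> : - (- r%:R + (t * - (1) - 0 * 0) - - r%:R) = t by ring.
move=> [[p]//|[[i0 h]|[i0 h]]]; [left|right; left].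
  exists (1 * (Re z - r%:R)) => //.
  by apply: complex_ext; rewrite ?cReD ?cImD ?cReM ?cImM /= ?cr ?c1 ?i0; ring.
exists ((-1) * (Re z - - r%:R)) => //.
by apply: complex_ext; rewrite ?cReD ?cImD ?cReM ?cImM /= ?rmorphN /= ?mulNr ?cr ?c1 ?i0; ring.
Qed.

Lemma closedC_outstring n r pts : (0 < n)%N ->
  Defs.closedC (closed_set_of (decode_string (R := R) (outstring n r pts) n)).
Proof.
move=> n0; rewrite closed_set_of_outstring//.
set A := [set z | _] ; have -> : A = [set z | exists2 p, p \in pts & z = gridpt n p] `|`
   ([set z | Im z = 0 /\ 0 <= 1 * (Re z - r%:R)] `|` [set z | Im z = 0 /\ 0 <= (-1) * (Re z - - r%:R)]).
  by [].
apply: closedCU; last by apply: closedCU; exact: closedC_ray.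
elim: pts {A} => [|p pts IH].
  have -> : [set z | exists2 p, p \in [::] & z = gridpt n p] = set0 by apply/seteqP; split=> z // [].
  exact: closed0.
have -> : [set z | exists2 p0, p0 \in p :: pts & z = gridpt n p0] =
    [set gridpt n p] `|` [set z | exists2 p, p \in pts & z = gridpt n p].
  apply/seteqP; split=> z /=.
    by move=> [p']; rewrite inE => /orP[/eqP -> ->|h ->]; [left|right; exists p'].
  by move=> [->|[p' h ->]]; [exists p; rewrite ?inE ?eqxx|exists p'; rewrite ?inE ?h ?orbT].
by apply: closedCU => //; exact: closedC1.
Qed.

End closed_sets.

(** * Spectra from finitely many samples *)

Section approximation.
Context {R : realType}.
Implicit Types (A B C : set R[i]) (z a : R[i]).

Definition hclose (e : R) A B := (forall a, A a -> exists2 b, B b & normc (a - b) <= e) /\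
  (forall b, B b -> exists2 a, A a & normc (b - a) <= e).

Lemma hclose_sym e A B : hclose e A B -> hclose e B A.
Proof. by case. Qed.

Lemma hclose_trans e e' A B C : hclose e A B -> hclose e' B C -> hclose (e + e') A C.
Proof.
move=> [h1 h2] [h3 h4]; split=> [a /h1[b /h3[c Cc bc] ab]|c /h4[b /h2[a Aa ba] cb]].
  by exists c => //; apply: le_trans (normc_tri_dist _ b _) _; exact: lerD.
by exists a => //; apply: le_trans (normc_tri_dist _ b _) _; rewrite addrC; exact: lerD.
Qed.

Lemma hclose_le e e' A B : e <= e' -> hclose e A B -> hclose e' A B.
Proof.
move=> ee [h1 h2]; split=> [a /h1[b Bb ab]|b /h2[a Aa ba]]; [exists b|exists a] => //.
  exact: le_trans ab ee.
exact: le_trans ba ee.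
Qed.

Lemma hclose_dH e A B : 0 <= e -> hclose e A B -> (dH A B <= e%:E)%E.
Proof. by move=> e0 [h1 h2]; exact: dH_le. Qed.

Lemma nearest_int (n : nat) (x : R) (r : nat) : (0 < n)%N -> `|x| <= r%:R ->
  exists2 p : int, `|x - p%:~R / n%:R| <= 2^-1 / n%:R & (absz p <= n * r + 1)%N.
Proof.
move=> n0 xr; have nn : 0 < n%:R :> R by rewrite ltr0n.
pose p := Num.floor (n%:R * x + 2^-1).
have /andP[h1 h2] := floor_itv (n%:R * x + 2^-1); rewrite -/p intrD in h1 h2.
have h3 : `|n%:R * x - p%:~R| <= 2^-1 by rewrite ler_norml; apply/andP; split; lra.
exists p.
  have -> : x - p%:~R / n%:R = (n%:R * x - p%:~R) / n%:R by field; rewrite gt_eqF.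
  by rewrite normrM [`|n%:R^-1|]gtr0_norm ?invr_gt0// ler_pM2r ?invr_gt0.
have h4 : `|n%:R * x| <= (n * r)%:R by rewrite normrM natrM gtr0_norm// ler_pM2l.
have h5 : `|p%:~R : R| <= (n * r + 1)%:R.
  rewrite natrD; move: h3 h4; rewrite !ler_norml => /andP[? ?] /andP[? ?]; apply/andP; split; lra.
by move: h5; rewrite -intr_norm -abszE -pmulrn ler_nat.
Qed.

Lemma gridpt_near (n : nat) z (r : nat) : (0 < n)%N -> `|Re z| <= r%:R -> `|Im z| <= r%:R ->
  exists p : int * int, [/\ (absz p.1 <= n * r + 1)%N, (absz p.2 <= n * r + 1)%N &
    normc (z - gridpt n p) <= n%:R^-1].
Proof.
move=> n0 h1 h2; have [p p1 p2] := nearest_int n0 h1; have [q q1 q2] := nearest_int n0 h2.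
exists (p, q); split=> //; apply: le_trans (normc_le_ReIm _) _; rewrite cReB cImB /=.
apply: le_trans (lerD p1 q1) _; rewrite -mulrDl.
have -> : 2^-1 + 2^-1 = 1 :> R by lra.
by rewrite mul1r.
Qed.

(** The points are the grid points within 1/n of X. Away from the half-lines X stays in the square
    of half-side r, where rounding costs 1/(2n) per coordinate. *)
Lemma outstring_exists (n r : nat) (X : set R[i]) : (0 < n)%N ->
  (forall a : R, r%:R <= `|a| -> X a%:C%C) ->
  (forall z, X z -> Im z = 0 \/ normc z <= r%:R) ->
  exists pts, hclose n%:R^-1 X (closed_set_of (decode_string (outstring n r pts) n)).
Proof.
move=> n0 X1 X2.
have n1 : 0 <= n%:R^-1 :> R by rewrite invr_ge0.
(* Rounding may move a coordinate one mesh beyond n r. *)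
pose B := (n * r + 1)%N.
pose box := [seq (Posz i - Posz B, Posz j - Posz B)%R | i <- iota 0 (B + B).+1, j <- iota 0 (B + B).+1].
pose pts := [seq p <- box | `[< exists2 x, X x & normc (gridpt n p - x) <= n%:R^-1 >]].
have box_mem (p : int * int) : (absz p.1 <= B)%N -> (absz p.2 <= B)%N -> p \in box.
  case: p => p q /= hp hq; apply/allpairsP; exists (absz (p + B), absz (q + B)); split.
  - by rewrite mem_iota /=; lia.
  - by rewrite mem_iota /=; lia.
  - by congr pair; rewrite /=; lia.
exists pts; rewrite closed_set_of_outstring//; split=> z /=.
  move=> Xz.
  have [rz|] := boolP ((Im z == 0) && (r%:R <= `|Re z|)).
    move/andP: rz => [/eqP i0 rz]; exists z; last by rewrite subrr Normc.normc0.
    right; move: rz; rewrite ler_normr => /orP[rz|rz]; [left|right]; split=> //; rewrite ?mul1r ?mulN1r.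
      by rewrite subr_ge0.
    by rewrite opprB subr_ge0 lerNr.
  rewrite negb_and => hz.
  have [h1 h2] : `|Re z| <= r%:R /\ `|Im z| <= r%:R.
    case: (X2 z Xz) => [i0|zr]; last by split; apply: le_trans zr; [exact: ler_Re_normc|exact: ler_Im_normc].
    by move: hz; rewrite i0 eqxx normr0 /= -ltNge => /ltW.
  have [p [p1 p2 pz]] := gridpt_near n0 h1 h2.
  exists (gridpt n p) => //; left; exists p => //; rewrite mem_filter box_mem// andbT.
  by apply/asboolP; exists z => //; rewrite normc_distC.
move=> [[p]|h].
  by rewrite mem_filter => /andP[/asboolP[x Xx px] _] ->; exists x.
have [i0 rz] : Im z = 0 /\ r%:R <= `|Re z|.
  case: h => -[i0 h]; split=> //; rewrite ler_normr; apply/orP; [left|right].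
    by move: h; rewrite mul1r subr_ge0.
  by move: h; rewrite mulN1r opprB subr_ge0 lerNr.
exists z; last by rewrite subrr Normc.normc0.
have -> : z = (Re z)%:C%C by exact: complex_ext.
exact: X1.
Qed.

End approximation.

(** * Rounded samples as information *)

Section information.
Context {R : realType} {d : nat}.
Local Notation V := 'rV[R]_d.
Implicit Types (f g : V -> R) (x y : V) (n k i : nat).

Lemma rV_ballE x y (r : R) : ball x r y = (`|x - y| < r).
Proof. by rewrite mx_norm_ball. Qed.

Lemma continuous_rVP f x : {for x, continuous f} <->
  forall e : R, 0 < e -> exists2 r : R, 0 < r & forall y, `|x - y| < r -> `|f x - f y| <= e.
Proof.
have FF : Filter (nbhs x) by exact: nbhs_filter.
split=> [/(@cvgrPdist_le R R V (nbhs x) FF f (f x)) h e /h /nbhs_ballP[r r0 hr]|h].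
  by exists r => // y xy; apply: hr; rewrite rV_ballE.
apply/(@cvgrPdist_le R R V (nbhs x) FF f (f x)) => e /h[r r0 hr].
by apply/nbhs_ballP; exists r => // y; rewrite rV_ballE; exact: hr.
Qed.

(** The rational points through their codes; a number that codes no point yields 0, a harmless
    repetition in the enumeration. *)
Definition pt k : V := map_mx ratr (odflt 0 (unpickle k) : 'rV[rat]_d).

Lemma pt_dense x (e : R) : 0 < e -> exists k, `|x - pt k| < e.
Proof.
move=> /(rV_rat_dense x)[q hq]; exists (pickle q).
by rewrite /pt pickleK.
Qed.

(* The cell of [t] in the mesh of size 1/n starting at -n; 0 to the left of -n. *)
Definition code n (t : R) : nat :=
  if 0 <= n%:R * t + n%:R * n%:R then (Num.truncn (n%:R * t + n%:R * n%:R)).+1 else 0%N.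

Lemma code_counts n (t : R) : counts (n%:R * t + n%:R * n%:R) (code n t).
Proof.
rewrite /code; case: ifPn => h; last by split=> //; rewrite ltNge.
have /andP[h1 h2] := truncn_itv h; split=> // _.
by rewrite -natr1 addrK.
Qed.

Lemma code_close n (s t : R) : (0 < n)%N -> - n%:R <= t -> code n s = code n t ->
  `|s - t| <= n%:R^-1.
Proof.
move=> n0 nt; have nn : 0 < n%:R :> R by rewrite ltr0n.
have t0 : 0 <= n%:R * t + n%:R * n%:R by rewrite -mulrDr mulr_ge0 ?(ltW nn)// -lerBlDr sub0r.
rewrite /code t0; case: ifP => // s0 [E].
have /andP[h1 h2] := truncn_itv t0; have /andP[] := truncn_itv s0; rewrite E => h3 h4.
rewrite -natr1 in h2 h4.
have -> : s - t = ((n%:R * s + n%:R * n%:R) - (n%:R * t + n%:R * n%:R)) / n%:R.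
  by field; rewrite gt_eqF.
rewrite normrM [`|n%:R^-1|]gtr0_norm ?invr_gt0// ler_piMl ?invr_ge0 ?ler0n//.
by rewrite ler_norml; apply/andP; split; lra.
Qed.

Definition codes n f : seq nat := [seq code n (f (pt k)) | k <- iota 0 n].

Lemma codes_nth n f g k : codes n f = codes n g -> (k < n)%N ->
  code n (f (pt k)) = code n (g (pt k)).
Proof.
move=> + kn.
have E (u : V -> R) : nth 0%N (codes n u) k = code n (u (pt k)).
  rewrite /codes (nth_map 0%N) ?size_iota; last exact: kn.
  by congr (code n (u (pt _))); exact: nth_iota.
by rewrite -!E => ->.
Qed.

Lemma codes_close n f g k (b : R) : codes n f = codes n g -> (k < n)%N -> `|g (pt k)| <= b ->
  b <= n%:R -> `|f (pt k) - g (pt k)| <= n%:R^-1.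
Proof.
move=> /codes_nth h kn gb bn; apply: code_close; [exact: leq_ltn_trans kn| |exact: h].
by rewrite lerNl; apply: le_trans bn; apply: le_trans gb; rewrite -normrN ler_norm.
Qed.

Lemma near_natr (b : R) : \forall n \near \oo, b <= n%:R.
Proof.
exists (Num.truncn `|b|).+1 => // n /= hn; apply: le_trans (ler_norm b) _.
by apply: ltW; apply: lt_le_trans (truncnS_gt _) _; rewrite ler_nat.
Qed.

Lemma near_natV (e : R) : 0 < e -> \forall n \near \oo, (0 < n)%N /\ n%:R^-1 <= e.
Proof.
move=> e0; near=> n.
have n0 : (0 < n)%N by near: n; exists 1%N.
split=> //; rewrite invf_ple ?posrE ?ltr0n//; near: n; exact: near_natr.
Unshelve. all: by end_near. Qed.

Variables (b : R) (gam : nat -> R).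
Hypotheses (b0 : 0 <= b) (gam0 : forall i, 0 < gam i).
Local Notation K := (potentials b gam).

Lemma pot_bound f x : K f -> `|f x| <= b.
Proof.
move=> [h _]; apply: le_trans (h x) _; rewrite -[leRHS]mulr1.
exact: ler_wpM2l (decay_le1 _).
Qed.

Lemma small_inv (e : R) : 0 < e -> exists i, i.+1%:R^-1 <= e.
Proof.
move=> /near_natV[N _ h]; exists N; exact: (h N.+1 (leqnSn N)).2.
Qed.

Lemma pot_continuous f : K f -> continuous f.
Proof.
move=> [_ h] x; apply/continuous_rVP => e /small_inv[i hi].
by exists (gam i) => // y /h /le_trans; apply.
Qed.

Lemma codes_close_pt f g n k : codes n f = codes n g -> K g -> (k < n)%N -> b <= n%:R ->
  `|f (pt k) - g (pt k)| <= n%:R^-1.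
Proof. by move=> h Kg kn bn; apply: codes_close h kn (pot_bound _ Kg) bn. Qed.

(* Two functions with the same codes are close near [pt k], hence, by density
   and decay, everywhere. *)
Lemma codes_unif f (e : R) : K f -> 0 < e ->
  \forall n \near \oo, forall g, K g -> codes n f = codes n g -> forall x, `|f x - g x| <= e.
Proof.
(* Outside the cube of half-side s the decay bounds both functions by e / 2. *)
move=> Kf e0; pose s : R := 2 * b / e + 1.
have s0 : 0 < s by rewrite ltr_wpDl// !mulr_ge0// invr_ge0 ltW.
pose A := [set x : V | `|x| <= s].
have cA : compact A.
  apply: bounded_closed_compact.
    by exists s; split; [exact: num_real|move=> M LM x /= h; rewrite (le_trans h)// ltW].
  rewrite (_ : A = ~` [set x : V | s < `|x|]); first by apply: open_closedC; exact: rV_norm_open.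
  by apply/seteqP; split=> y /=; rewrite /A /= leNgt => /negP.
have [i hi] := small_inv (divr_gt0 e0 (ltr0n _ 3)).
(* Compactness of the cube makes the number of samples uniform in x. *)
have H : \forall n \near \oo, A `<=` (fun x => forall g, K g -> codes n f = codes n g -> `|f x - g x| <= e).
  move: cA => /compact_near_coveringP cA; apply: cA => x _.
  have gi : 0 < gam i / 2 by rewrite divr_gt0.
  have [k hk] := pt_dense x gi.
  have n1 := near_natr b; have n2 := near_natV (divr_gt0 e0 (ltr0n _ 3)).
  exists (ball x (gam i / 2), [set n | [/\ (k < n)%N, b <= n%:R & n%:R^-1 <= e / 3]]).
    split; first exact: nbhsx_ballx.
    near=> n; split; [by near: n; exact: nbhs_infty_gt|by near: n; exact: n1|].
    by have [] : (0 < n)%N /\ n%:R^-1 <= e / 3 by near: n; exact: n2.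
  move=> [x' n] [/= xx' [kn bn ne]] g Kg fg.
  have hx : `|x' - pt k| < gam i.
    rewrite (splitr (gam i)); apply: le_lt_trans (ler_distD x _ _) (ltrD _ hk).
    by move: xx'; rewrite rV_ballE distrC.
  have h1 := Kf.2 i _ _ hx; have h2 := Kg.2 i _ _ hx; have h3 := codes_close_pt fg Kg kn bn.
  move: h1 h2 h3 (le_trans h3 ne); rewrite !ler_norml.
  move: (f x') (g x') (f (pt k)) (g (pt k)) i.+1%:R^-1 hi => p q p' q' r hr.
  by move=> /andP[? ?] /andP[? ?] _ /andP[? ?]; apply/andP; split; lra.
apply: filterS H => n H g Kg fg x.
have [xs|xs] := leP `|x| s; first exact: (H x xs g Kg fg).
have [j hj] : exists j, s <= `|x ord0 j|.
  apply: contrapT => hn; move: xs; rewrite ltNge => /negP; apply; apply: ltW.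
  apply: rV_norm_lt => // j; rewrite ltNge; apply/negP => h; apply: hn; by exists j.
have hd := decay_le s0 hj.
have bs : b * s^-1 <= e / 2.
  rewrite ler_pdivrMr// /s mulrDr mulr1.
  have -> : e / 2 * (2 * b / e) = b by field; rewrite gt_eqF.
  by rewrite lerDl divr_ge0// ltW.
have h1 : `|f x| <= e / 2 by apply: le_trans bs; apply: le_trans (Kf.1 x) (ler_wpM2l b0 hd).
have h2 : `|g x| <= e / 2 by apply: le_trans bs; apply: le_trans (Kg.1 x) (ler_wpM2l b0 hd).
by apply: le_trans (ler_normB _ _) _; rewrite [leRHS]splitr; exact: lerD.
Unshelve. all: by end_near. Qed.

(** As f is only continuous, its own modulus selects a sample near each point, and the modulus of
    the class transfers the values of g. Two points are treated with one g because a modulus of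
    continuity concerns pairs. *)
Lemma codes_approx f x y (e : R) : continuous f -> 0 < e ->
  (forall N, exists2 n, (N <= n)%N & exists2 g, K g & codes n f = codes n g) ->
  exists g, [/\ K g, `|f x - g x| <= e & `|f y - g y| <= e].
Proof.
move=> cf e0 hf; have e3 := divr_gt0 e0 (ltr0n R 3).
have [i hi] := small_inv e3.
have near_pt (w : V) : exists k, `|f w - f (pt k)| <= e / 3 /\ `|w - pt k| < gam i.
  have [r r0 hr] := (continuous_rVP f w).1 (cf w) _ e3.
  have [|k] := @pt_dense w (Num.min r (gam i)); first by rewrite lt_min r0 gam0.
  move=> hk; exists k.
  have aux (a : R) : a < Num.min r (gam i) -> a < r /\ a < gam i by rewrite lt_min => /andP.
  have h := aux _ hk; split; last exact: h.2.
  exact: hr (pt k) h.1.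
have [k [k1 k2]] := near_pt x; have [l [l1 l2]] := near_pt y.
have [N _ hN] : \forall n \near \oo, [/\ (k < n)%N, (l < n)%N, b <= n%:R & n%:R^-1 <= e / 3].
  near=> n; split; [near: n; exact: nbhs_infty_gt|near: n; exact: nbhs_infty_gt|near: n; exact: near_natr|].
  by have [] : (0 < n)%N /\ n%:R^-1 <= e / 3 by near: n; exact: near_natV.
have [n Nn [g Kg fg]] := hf N; have [kn ln bn ne] := hN n Nn.
have h3 := le_trans (codes_close_pt fg Kg kn bn) ne.
have h4 := le_trans (codes_close_pt fg Kg ln bn) ne.
have h5 := le_trans (Kg.2 i _ _ k2) hi; have h6 := le_trans (Kg.2 i _ _ l2) hi.
have aux (p q r s : R) : `|p - q| <= e / 3 -> `|q - r| <= e / 3 -> `|s - r| <= e / 3 -> `|p - s| <= e.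
  by clear; rewrite !ler_norml => /andP[? ?] /andP[? ?] /andP[? ?]; apply/andP; split; lra.
by exists g; split=> //; [exact: aux k1 h3 h5|exact: aux l1 h4 h6].
Unshelve. all: by end_near. Qed.

(** The conditions defining the class concern at most two values, which are limits of values of
    members. The contrapositive excludes, from some n on, a class that does not contain f. *)
Lemma codes_limit f : continuous f ->
  (forall N, exists2 n, (N <= n)%N & exists2 g, K g & codes n f = codes n g) -> K f.
Proof.
move=> cf hf; split=> [x|i x y xy].
  apply/ler_addgt0Pr => e e0; have [g [Kg h _]] := codes_approx x x cf e0 hf.
  rewrite -[f x](subrK (g x)) addrC; apply: le_trans (ler_normD _ _) _.
  exact: lerD (Kg.1 x) h.
apply/ler_addgt0Pr => e e0; have e2 : 0 < e / 2 by rewrite divr_gt0.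
have [g [Kg hx hy]] := codes_approx x y cf e2 hf.
have := Kg.2 i x y xy; move: hx hy; rewrite !ler_norml.
move: (f x) (g x) (f y) (g y) i.+1%:R^-1 => p q p' q' r.
by move=> /andP[? ?] /andP[? ?] /andP[? ?]; apply/andP; split; lra.
Qed.

Variable m : R.
Hypothesis d0 : (0 < d)%N.
Local Notation sigma := (spectrum m).

Lemma spectrum_closed f : K f -> Defs.closedC (sigma f).
Proof.
move=> Kf; apply/closedCP => z h; apply: contrapT => nz.
have cf := pot_continuous Kf.
have [e e0 he] := spectrum_usc cf (fun x => pot_bound x Kf) nz.
have [a sa za] := h e e0.
apply: (he f cf (fun x => pot_bound x Kf) _ a) => //; last by rewrite normc_distC ltW.
by move=> x; rewrite subrr normr0 ltW.
Qed.

(** Above 4 b + m^2, beyond which the spectrum is real, and above |m|, beyond which every real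
    number is spectral. *)
Definition cutoff : nat := ((Num.truncn (4 * b + m ^+ 2)).+1 + (Num.truncn `|m|).+1)%N.

Lemma cutoff_real f (a : R) : K f -> cutoff%:R <= `|a| -> sigma f a%:C%C.
Proof.
move=> Kf ra; apply: (spectrum_real d0 b0 (pot_continuous Kf) Kf.1).
rewrite -[leLHS]real_normK ?num_real// -[leRHS]real_normK ?num_real// lerXn2r ?nnegrE//.
apply: le_trans ra; apply: (@le_trans _ _ (Num.truncn `|m|).+1%:R); first exact: ltW (truncnS_gt _).
by rewrite ler_nat leq_addl.
Qed.

Lemma cutoff_spectrum f z : K f -> sigma f z -> Im z = 0 \/ normc z <= cutoff%:R.
Proof.
move=> Kf sz; have [->|zi] := eqVneq (Im z) 0; [by left|right].
rewrite leNgt; apply/negP => h; apply: (spectrum_nonreal (pot_continuous Kf) (fun x => pot_bound x Kf) zi _ sz).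
apply: le_lt_trans h; apply: (@le_trans _ _ (Num.truncn (4 * b + m ^+ 2)).+1%:R).
  exact: ltW (truncnS_gt _).
by rewrite ler_nat leq_addr.
Qed.

(** [spectrum_usc] at the points of a square outside sigma(f), made uniform by compactness. Beyond
    the cutoff all members of the class have the same spectrum, two real half-lines. *)
Lemma codes_spectrum f (e : R) : K f -> 0 < e ->
  \forall n \near \oo, forall g, K g -> codes n f = codes n g ->
    forall z, sigma g z -> exists2 a, sigma f a & normc (z - a) <= e.
Proof.
move=> Kf e0; pose I := `[- cutoff%:R, cutoff%:R]%classic : set R.
have cI : compact (I `*` I) by apply: compact_setX; exact: segment_compact.
have H : \forall n \near \oo, I `*` I `<=` (fun p => forall g, K g -> codes n f = codes n g ->
    sigma g (p.1 +i* p.2)%C -> exists2 a, sigma f a & normc ((p.1 +i* p.2)%C - a) <= e).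
  move: cI => /compact_near_coveringP cI; apply: cI => -[x y] _.
  have close (p : R * R) (r : R) : ball (x, y) (r / 2) p -> normc ((p.1 +i* p.2)%C - (x +i* y)%C) <= r.
    case: p => p q [h1 h2]; apply: le_trans (normc_le_ReIm _) _; rewrite cReB cImB /= (splitr r).
    by move: h1 h2; rewrite -!ball_normE /= => h1 h2; rewrite distrC [`|q - _|]distrC ltW// ltrD.
  have [sz|nz] := pselect (sigma f (x +i* y)%C).
    exists (ball (x, y) (e / 2), setT).
      by split; [apply: nbhsx_ballx; rewrite divr_gt0|exact: filterT].
    by move=> [p n] [/= pe _] g _ _ _; exists (x +i* y)%C => //; exact: close.
  have cf := pot_continuous Kf.
  have [r r0 hr] := spectrum_usc cf (fun x => pot_bound x Kf) nz.
  exists (ball (x, y) (r / 2), [set n | forall g, K g -> codes n f = codes n g -> forall x, `|f x - g x| <= r]).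
    by split; [apply: nbhsx_ballx; rewrite divr_gt0|exact: codes_unif].
  move=> [p n] [/= pr hn] g Kg fg sg; exfalso.
  by apply: (hr g (pot_continuous Kg) (fun x => pot_bound x Kg) (hn g Kg fg) _ (close _ _ pr) sg).
apply: filterS H => n H g Kg fg z sz.
have [/andP[/eqP i0 rz]|] := boolP ((Im z == 0) && (cutoff%:R <= `|Re z|)).
  exists z; last by rewrite subrr Normc.normc0 ltW.
  have -> : z = (Re z)%:C%C by exact: complex_ext.
  exact: cutoff_real.
rewrite negb_and => hz.
have [h1 h2] : `|Re z| <= cutoff%:R /\ `|Im z| <= cutoff%:R.
  case: (cutoff_spectrum Kg sz) => [i0|zr].
    by move: hz; rewrite i0 eqxx normr0 /= -ltNge => /ltW.
  by split; apply: le_trans zr; [exact: ler_Re_normc|exact: ler_Im_normc].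
have zE : z = ((Re z, Im z).1 +i* (Re z, Im z).2)%C by exact: complex_ext.
rewrite zE; apply: (H (Re z, Im z) _ g Kg fg); last by rewrite -zE.
by split; rewrite /I /= in_itv /= -ler_norml.
Qed.

End information.

(** * The algorithm *)

(** The fold does not record the length of the list; this is why the machine pairs the result with n
    once more. *)
Lemma foldl_npair_inj a (s s' : seq nat) : size s = size s' ->
  foldl npair a s = foldl npair a s' -> s = s'.
Proof.
elim/last_ind: s s' => [|s c IH] s'; first by case: s'.
case/lastP: s' => [|s' c']; first by rewrite size_rcons.
rewrite !size_rcons => -[ss]; rewrite !foldl_rcons => /npair_inj[h ->].
by rewrite (IH s').
Qed.

Section algorithm.
Context {R : realType} {d : nat}.
Local Notation V := 'rV[R]_d.
Variables (m : R) (b : nat -> R) (gam : nat -> nat -> R) (Om : set (V -> R)).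
Hypotheses (d0 : (0 < d)%N) (b0 : forall j, 0 <= b j) (gam0 : forall j i, 0 < gam j i).
Local Notation K j := (potentials (b j) (gam j)).
Hypothesis OmK : forall f, Om f -> exists j, K j f.
Implicit Types (f g : V -> R) (n k i j : nat) (cs : seq nat) (z a : R[i]).
Local Notation sigma := (spectrum m).

(** The class in use is determined by the codes and not by f, so that the algorithm uses no further
    information. *)
Definition least n cs j := (exists2 g : V -> R, K j g & codes n g = cs) /\
  forall i, (i < j)%N -> ~ exists2 g : V -> R, K i g & codes n g = cs.

Lemma least_uniq n cs i j : least n cs i -> least n cs j -> i = j.
Proof.
move=> [hi hi'] [hj hj']; case: (ltngtP i j) => // ij.
  by case: (hj' _ ij).
by case: (hi' _ ij).
Qed.

Lemma least_exists n cs j g : K j g -> codes n g = cs -> exists2 i, least n cs i & (i <= j)%N.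
Proof.
move=> Kg gc; pose P i := `[< exists2 g : V -> R, K i g & codes n g = cs >].
have exP : exists i, P i by exists j; apply/asboolP; exists g.
case: (ex_minnP exP) => i /asboolP Pi mini; exists i.
  split=> // i' i'i /asboolP h; by move: i'i; rewrite ltnNge mini.
by apply: mini; apply/asboolP; exists g.
Qed.

(** The quantification over e takes the closure of the union of the spectra. *)
Definition enclosure n cs : set R[i] :=
  [set z | exists2 j, least n cs j & forall e : R, 0 < e ->
     exists g : V -> R, [/\ K j g, codes n g = cs & exists2 a, sigma g a & normc (z - a) < e]].

Lemma enclosure_closed n cs : Defs.closedC (enclosure n cs).
Proof.
apply/closedCP => z h; have [_ [j lj _] _] := h 1 ltr01.
exists j => // e e0; have e2 : 0 < e / 2 by rewrite divr_gt0.
have [a [j' lj' ha] za] := h _ e2; rewrite (least_uniq lj' lj) in ha.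
have [g [Kg gc [a' sa' aa']]] := ha _ e2.
exists g; split=> //; exists a' => //.
by apply: le_lt_trans (normc_tri_dist _ a _) _; rewrite (splitr e) ltrD.
Qed.

Lemma enclosure_sub n f z : least n (codes n f) 0%N -> K 0%N f -> sigma f z -> enclosure n (codes n f) z.
Proof.
move=> l Kf sz; exists 0%N => // e e0; exists f; split=> //; exists z => //.
by rewrite subrr Normc.normc0.
Qed.

Lemma enclosure_output n cs : (0 < n)%N -> (exists j, least n cs j) -> exists (r : nat) pts,
  hclose n%:R^-1 (enclosure n cs) (closed_set_of (decode_string (R := R) (outstring n r pts) n)).
Proof.
move=> n0 [j lj]; exists (cutoff (b j) m); apply: outstring_exists => //.
  move=> a ra; exists j => // e e0; have [[g Kg gc] _] := lj; exists g; split=> //.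
  exists a%:C%C; last by rewrite subrr Normc.normc0.
  exact: (cutoff_real (b0 j) (gam0 j) d0 Kg ra).
move=> z [j' lj' h]; rewrite (least_uniq lj' lj) in h.
have [->|zi] := eqVneq (Im z) 0; [by left|right].
apply/ler_addgt0Pr => e e0.
(* An approximating point closer to z than |Im z| is not real, hence lies in the disc given by the
   cutoff. *)
have e1 : 0 < Num.min e `|Im z| by rewrite lt_min e0 normr_gt0.
have [g [Kg gc [a sa za]]] := h _ e1.
have [ze zI] : normc (z - a) < e /\ normc (z - a) < `|Im z| by apply/andP; rewrite -lt_min.
case: (cutoff_spectrum (b0 j) (gam0 j) Kg sa) => [a0|ar].
  by have := le_lt_trans (ler_Im_normc (z - a)) zI; rewrite cImB a0 subr0 ltxx.
rewrite -[z](subrK a) addrC; apply: le_trans (normc_triangle _ _) _.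
exact: lerD ar (ltW ze).
Qed.

Definition good n cs (l : seq int) := exists (r : nat) pts, l = outstring n r pts /\
  hclose n%:R^-1 (enclosure n cs) (closed_set_of (decode_string (R := R) l n)).

(** A choice that depends on n and the codes alone; this makes [Gam] a general algorithm and lets
    the machine look its strings up. *)
Definition output n cs : seq int := xget [::] (good n cs).

Lemma outputP n f : (0 < n)%N -> Om f -> good n (codes n f) (output n (codes n f)).
Proof.
move=> n0 Of; apply: xgetPex.
have [j Kf] := OmK Of; have [i li _] := least_exists Kf (erefl (codes n f)).
have [r [pts h]] := enclosure_output n0 (ex_intro _ i li).
by exists (outstring n r pts), r, pts.
Qed.

Definition Gam n f : set R[i] := closed_set_of (decode_string (R := R) (output n (codes n f)) n).

Lemma Gam_close n f : (0 < n)%N -> Om f -> hclose n%:R^-1 (enclosure n (codes n f)) (Gam n f).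
Proof. by move=> n0 Of; have [r [pts [_ h]]] := outputP n0 Of. Qed.

(** From some n on, the least class is the first one that contains f: the finitely many earlier ones
    are refuted by [codes_limit]. Then [codes_spectrum] applies to this class. *)
Lemma enclosure_limit f (e : R) : Om f -> 0 < e ->
  \forall n \near \oo, hclose e (enclosure n (codes n f)) (sigma f).
Proof.
move=> /OmK[j1 Kf1] e0; pose P i := `[< K i f >].
have exP : exists i, P i by exists j1; exact/asboolP.
case: (ex_minnP exP) => j /asboolP Kf minj {j1 Kf1 exP}.
have cf := pot_continuous (gam0 j) Kf.
have N1 i : (i < j)%N -> \forall n \near \oo, ~ exists2 g : V -> R, K i g & codes n g = codes n f.
  move=> ij; apply: contrapT => hN.
  have : K i f.
    apply: (codes_limit (b0 i) (gam0 i) cf) => N; apply: contrapT => hN'; apply: hN.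
    exists N => // n /= Nn [g Kg gc]; apply: hN'; by exists n => //; exists g.
  by move=> /asboolP /minj; rewrite leqNgt ij.
have N2 : \forall n \near \oo, forall i, (i < j)%N -> ~ exists2 g : V -> R, K i g & codes n g = codes n f.
  elim: j N1 {Kf minj} => [|j IH] N1; first by apply: nearW.
  have h := IH (fun i ij => N1 i (ltnW ij)); have h' := N1 j (ltnSn j).
  near=> n => i; rewrite ltnS leq_eqVlt => /orP[/eqP ->|ij]; first by near: n.
  by move: i ij; near: n.
have e2 : 0 < e / 2 by rewrite divr_gt0.
have N3 := codes_spectrum (b0 j) (gam0 j) m d0 Kf e2.
near=> n.
have hn2 : forall i, (i < j)%N -> ~ exists2 g : V -> R, K i g & codes n g = codes n f by near: n.
have hn3 : forall g, K j g -> codes n f = codes n g ->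
    forall z, sigma g z -> exists2 a, sigma f a & normc (z - a) <= e / 2 by near: n; exact: N3.
have lj : least n (codes n f) j by split=> //; exists f.
split=> [z [j' lj' h]|z sz].
  rewrite (least_uniq lj' lj) in h; have [g [Kg gc [a sa za]]] := h _ e2.
  have [a' sa' aa'] := hn3 g Kg (esym gc) a sa; exists a' => //.
  by apply: le_trans (normc_tri_dist _ a _) _; rewrite (splitr e) lerD// ltW.
exists z; last by rewrite subrr Normc.normc0 ltW.
exists j => // e' e'0; exists f; split=> //; exists z => //; by rewrite subrr Normc.normc0.
Unshelve. all: by end_near. Qed.

Definition compile (l : seq int) : seq nat := sval (cid (cstep_compile l)).

Definition entry p c := exists n f j, [/\ (0 < n)%N,
  p = npair (npair (foldl npair n (codes n f)) n) j & c = nth 3%N (compile (output n (codes n f))) j].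

(** An index that encodes no samples reads as the stop command 3; elsewhere [tableE] shows that the
    entry is unique. *)
Definition table p : nat := xget 3%N (entry p).

Lemma table3 p : (table p <= 3)%N.
Proof.
rewrite /table; case: xgetP => [_ _ [n [f [j [_ _ ->]]]]|//].
rewrite /compile; case: cid => cs [hcs _] /=.
have [h|h] := ltnP j (size cs); last by rewrite nth_default.
by move/all_nthP : hcs => /(_ 3%N _ h) /leqW.
Qed.

Lemma tableE n f j : (0 < n)%N ->
  table (npair (npair (foldl npair n (codes n f)) n) j) = nth 3%N (compile (output n (codes n f))) j.
Proof.
move=> n0; rewrite /table; case: xgetP => [c _ [n' [g [j' [n'0 E ->]]]]|h].
  have [/npair_inj[E1 nn] <-] := npair_inj E; subst n'.
  by rewrite (foldl_npair_inj _ E1)// !size_map.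
by exfalso; apply: (h (nth 3%N (compile (output n (codes n f))) j)); exists n, f, j.
Qed.

Definition ev k f : R[i] := (f (pt k))%:C%C.

Lemma range_ev : range ev = point_evaluations (R := R) (d := d).
Proof.
apply/seteqP; split=> [_ [k _ <-]|_ [q ->]]; first by exists (odflt 0 (unpickle k)).
by exists (pickle q) => //; apply/funext => f; rewrite /ev /pt pickleK.
Qed.

Lemma ev_codes n f g : (forall k, (k < n)%N -> ev k f = ev k g) -> codes n f = codes n g.
Proof.
move=> h; apply/eq_in_map => k; rewrite mem_iota add0n => /h [E]; by rewrite E.
Qed.

(** The first n evaluations are read whatever f is, so the information set is the same for all
    instances. *)
Lemma Gam_general n : (0 < n)%N -> @general_algorithm R (KG_problem m Om) (Gam n).
Proof.
move=> n0; exists (fun=> ev @` `I_n) => f Of; split.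
- rewrite /Gam; have [r [pts [-> _]]] := outputP n0 Of; exact: closedC_outstring.
- exact/finite_image/finite_II.
- by exists (ev 0%N), 0%N.
- by move=> _ [k _ <-]; rewrite /= -range_ev; exists k.
- move=> g Og h; split=> //; rewrite /Gam.
  by rewrite (@ev_codes n g f)// => k kn; apply: h; exists k.
Qed.

Lemma Gam_program n f : (0 < n)%N -> Om f ->
  bss_outputs (program (R := R) table) (fun k => ev k f) n (decode_string (output n (codes n f)) n).
Proof.
move=> n0 Of; have [r [pts [E _]]] := outputP n0 Of.
have cE : compile (output n (codes n f)) = compile (output n (codes n f)) by [].
move: cE; rewrite {1}/compile; case: cid => cs [h1 h2] /= cE.
apply: (program_correct table3 n0 (cs0 := codes n f) (cs := cs) _ _ h1 h2).
- by rewrite size_map size_iota.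
- move=> k kn; rewrite (nth_map 0%N) ?size_iota// nth_iota// add0n; exact: code_counts.
- by rewrite E; exact: size_outstring.
- by move=> j; rewrite tableE// cE.
Qed.

Lemma problem_closed : problem_wf (KG_problem m Om).
Proof.
by move=> f /OmK[j Kf]; exact: (spectrum_closed (b0 j) (gam0 j) Kf).
Qed.

Lemma Gam_tower : arithmetic_tower1 (P := KG_problem m Om) Gam.
Proof.
split; first exact: Gam_general.
- move=> f Of; apply: dH_cvg0 => e e0; have e2 : 0 < e / 2 by rewrite divr_gt0.
  have h1 := enclosure_limit Of e2; have h2 := near_natV e2; near=> n.
  have [n0 ne] : (0 < n)%N /\ n%:R^-1 <= e / 2 by near: n.
  apply: hclose_dH; first exact: ltW.
  rewrite (splitr e); apply: hclose_trans (hclose_sym (hclose_le ne (Gam_close n0 Of))) _.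
  by near: n.
- exists ev; first exact: range_ev.
  exists (program table) => f Of n n0; exists (decode_string (output n (codes n f)) n) => //.
  exact: Gam_program.
Unshelve. all: by end_near. Qed.

Lemma Delta2A_KG : Delta2A (KG_problem m Om).
Proof. by split; [exact: problem_closed|exists Gam; exact: Gam_tower]. Qed.

Lemma Pi1A_KG : (forall f, Om f -> K 0%N f) -> Pi1A (KG_problem m Om).
Proof.
move=> OK; split; first exact: Delta2A_KG.
exists Gam; first exact: Gam_tower.
move=> f Of; exists (fun n => enclosure n (codes n f)) => n n0; split.
- exact: enclosure_closed.
- move=> z sz; apply: enclosure_sub => //; last exact: OK.
  by split=> //; exists f => //; exact: OK.
- by apply: hclose_dH; [rewrite invr_ge0|exact: Gam_close].
Qed.

End algorithm.

Theorem corollary2p9 (R : realType) (d : nat) (m p M : R) :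
  (0 < d)%N -> 0 < m -> d%:R < p -> 0 < M ->
  Delta2A (KG_problem m (@Omega_p R d p)) /\
  Pi1A (KG_problem m (@Omega_pM R d p M)).
Proof.
move=> d0 _ dp M0; split; last first.
  have [gam [gam0 h]] := Omega_pM_potentials d0 dp (ltW M0).
  (* With M known all classes are taken equal, so the class in use always has index 0 and contains
     f. *)
  apply: (@Pi1A_KG R d m (fun=> M) (fun=> gam)) => // [_|f /h Kf]; first exact: ltW.
  by exists 0%N.
(* The classes of the bounds M = 0, 1, 2, ... exhaust [Omega_p]. *)
have [gam hgam] := choice (fun j : nat => Omega_pM_potentials d0 dp (ler0n R j)).
apply: (@Delta2A_KG R d m (fun j => j%:R) gam) => // [j i|f [M' /= M'0 [cf [DV [hDV hn] hb]]]].
  exact: (hgam j).1.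
exists (Num.truncn M').+1; apply: (hgam _).2.
have MM : M' <= (Num.truncn M').+1%:R by exact: ltW (truncnS_gt _).
split=> // [|x]; first by exists DV; split=> //; apply: le_trans hn _; rewrite lee_fin.
by apply: le_trans (hb x) _; apply: ler_wpM2r => //; exact: powR_ge0.
Qed.
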